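(* Let $\mathbb G$ be a locally compact quantum group and let $E(\mathbb G)=(\mathcal E(\mathbb G),\Phi_{\mathbb G},U_{\mathbb G},H_{\mathbb G})$ be the maximal unital embedded $C^*$-Eberlein algebra of $\mathbb G$, with inclusion $j:\mathcal E(\mathbb G)\to M(C_0^u(\mathbb G))$. Then $E(\mathbb G)$ is a compactification of $\mathbb G$ in the category of $C^*$-Eberlein algebras. That is, given any $C^*$-Eberlein algebra $\mathbb S=(B,\Phi_B,U_B,H_B)$ with $B$ unital, and any morphism $\mathbb G\to\mathbb S$, given by $\theta:B\to M(C_0^u(\mathbb G))$, there is a unique morphism $E(\mathbb G)\to\mathbb S$, given by a $*$-homomorphism $\theta_0:B\to\mathcal E(\mathbb G)$, making the diagram commute, i.e. such that $j\circ\theta_0=\theta$.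
   Context: $\mathbb G$ is a locally compact quantum group in the sense of Kustermans–Vaes, with universal $C^*$-algebra $C_0^u(\mathbb G)$ and coproduct $\Delta_u$; $C_0^u(\mathbb G)^*$ is a Banach algebra with product $\langle\mu\star\lambda,a\rangle=(\mu\otimes\lambda)\Delta_u(a)$. A unitary corepresentation of $C_0^u(\mathbb G)$ on $H$ is a unitary $U\in M(C_0^u(\mathbb G)\otimes\mathcal B_0(H))$ with $(\Delta_u\otimes\mathrm{id})(U)=U_{13}U_{23}$. A tilde denotes the normal extension of a map to the bidual. A $C^*$-Eberlein algebra is a quadruple $(A,\Phi,V,H)$ where: (1) $A$ is a $C^*$-algebra, $\Phi:A\to A^{**}\overline\otimes A^{**}$ is a unital $*$-homomorphism (if $A$ is non-unital, this means the normal extension is unital), $H$ is a Hilbert space and $V\in A^{**}\overline\otimes\mathcal B(H)$ is a contraction; (2) $A_V:=\{(\mathrm{id}\otimes\omega)(V):\omega\in\mathcal B(H)_*\}$ is a subset of $A\subseteq A^{**}$ and is norm dense in $A$; (3) the bilinear product on $A^*$ given by $\langle\mu\star\nu,a\rangle=\langle\Phi(a),\mu\otimes\nu\rangle$ is associative; (4) the map $A^*\to\mathcal B(H)$, $\mu\mapsto(\mu\otimes\mathrm{id})(V)$ is a homomorphism for $\star$. Morphisms: (a) a morphism $(A_1,\Phi_1,V_1,H_1)\to(A_2,\Phi_2,V_2,H_2)$ of $C^*$-Eberlein algebras is a non-degenerate $*$-homomorphism $\theta:A_2\to M(A_1)$ such that $\theta^*:A_1^*\to A_2^*$ is a homomorphism;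 (b) a morphism $\mathbb G\to(A,\Phi,V,H)$ is a non-degenerate $*$-homomorphism $\theta:A\to M(C_0^u(\mathbb G))$ such that $\theta^*:C_0^u(\mathbb G)^*\to A^*$ is a homomorphism and such that $U=(\tilde\theta\otimes\mathrm{id})(V)\in C_0^u(\mathbb G)^{**}\overline\otimes\mathcal B(H)$ satisfies $(\tilde\Delta_u\otimes\mathrm{id})(U)=U_{13}U_{23}$ and $U^*U=UU^*=1\otimes p$ for some orthogonal projection $p\in\mathcal B(H)$. Embedded $C^*$-Eberlein algebras of $\mathbb G$: let $U\in M(C_0^u(\mathbb G)\otimes\mathcal B_0(K))$ be a unitary corepresentation such that the norm closure $B$ of $\{(\mathrm{id}\otimes\omega)(U):\omega\in\mathcal B(K)_*\}$ is a $C^*$-subalgebra of $M(C_0^u(\mathbb G))$. Let $U'\in B^{**}\overline\otimes\mathcal B(K)$ be determined by $(\mathrm{id}\otimes\omega)(U')=(\mathrm{id}\otimes\omega)(U)\in B$ for all $\omega$. There is a unique $\Phi_B$ such that $(B,\Phi_B,U',K)$ is a $C^*$-Eberlein algebra with the inclusion $B\to M(C_0^u(\mathbb G))$ giving a morphism $\mathbb G\to(B,\Phi_B,U',K)$; the $C^*$-Eberlein algebras arising in this way are the embedded ones. $E(\mathbb G)$ denotes a unital embedded $C^*$-Eberlein algebra whose underlying algebra $\mathcal E(\mathbb G)\subseteq M(C_0^u(\mathbb G))$ contains the underlying algebra of every other unital embedded $C^*$-Eberlein algebra; it exists, and $\mathcal E(\mathbb G),\Phi_{\mathbb G}$ are unique.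 *)

(* Defs.v *)
(* The complex field is R[i], for an arbitrary R : realType.  Inner products are linear in the first variable.  Operators
   are plain functions, the predicate [bounded_op] being imposed where it
   matters; partial constructions (adjoints, slices, amplifications) are total
   functions which return 0 when the object they denote does not exist.
   The bidual A** of a C*-algebra is realised as the von Neumann algebra
   generated by A in a universal representation, and M(A) as the idealiser of A
   in A**. *)
From HB Require Import structures.
From mathcomp Require Import all_boot all_order all_algebra.
From mathcomp Require Import complex.
From mathcomp Require Import all_classical all_reals all_analysis.

Set Implicit Arguments.
Unset Strict Implicit.
Unset Printing Implicit Defensive.
Import Order.TTheory GRing.Theory Num.Theory numFieldNormedType.Exports.
Local Open Scope classical_set_scope.
Local Open Scope complex_scope.
Local Open Scope ring_scope.

Record hilbert (R : realType) := Hilbert {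
  hsp :> completeNormedModType R[i];
  ip : hsp -> hsp -> R[i];
  ip_linear : forall (c : R[i]) x y z, ip (c *: x + y) z = c * ip x z + ip y z;
  ip_conj : forall x y, ip y x = Num.conj (ip x y);
  ip_norm : forall x, `|x| ^+ 2 = ip x x
}.

Section Operators.
Context {R : realType}.
Local Notation C := R[i].

Definition bounded_op (V W : normedModType C) (f : V -> W) : Prop :=
  linear f /\ exists M : C, forall x, `|f x| <= M * `|x|.

Definition dual (V : normedModType C) : set (V -> C^o) :=
  [set f | bounded_op f].

Section OneSpace.
Variable H : hilbert R.
Implicit Types (S T X : H -> H) (D : set (H -> H)).

Definition adj S : H -> H :=
  fun y => xget 0 [set z | forall x, ip (S x) y = ip x z].

Definition unitary_op S : Prop :=
  [/\ bounded_op S, adj S \o S = id & S \o adj S = id].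

Definition projection_op S : Prop :=
  [/\ bounded_op S, S \o S = S & adj S = S].

Definition op_ge0 S : Prop := forall x, 0 <= ip (S x) x.

Definition op_le S T : Prop := op_ge0 (fun x => T x - S x).

Definition op_lspan D : set (H -> H) :=
  [set S | exists n (c : 'I_n -> C) (T : 'I_n -> H -> H),
     (forall k, D (T k)) /\ S = fun x => \sum_(k < n) c k *: T k x].

(* closure of D in B(H) for the operator norm *)
Definition op_closure D : set (H -> H) :=
  [set S | bounded_op S /\ forall e : C, 0 < e ->
     exists2 T, D T & forall x, `|S x - T x| <= e * `|x|].

Definition compact_op : set (H -> H) :=
  op_closure (op_lspan [set S | exists a b : H, S = fun x => ip x a *: b]).

Definition commutant D : set (H -> H) :=
  [set S | bounded_op S /\ forall T, D T -> S \o T = T \o S].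

Definition bicommutant D : set (H -> H) := commutant (commutant D).

Definition is_vN D : Prop :=
  [/\ D `<=` bounded_op (V:=H) (W:=H), forall S, D S -> D (adj S)
    & bicommutant D = D].

(* For D a C*-algebra acting nondegenerately on H this is M(D). *)
Definition idealizer D : set (H -> H) :=
  [set S | bounded_op S /\ forall T, D T -> D (S \o T) /\ D (T \o S)].

End OneSpace.

(* B(H)_*: a pair (x, y) of square-summable sequences stands for the normal
   functional  T |-> sum_n <T x_n, y_n>. *)

Definition sqsum (H : hilbert R) (x : nat -> H) : Prop :=
  exists M : C, forall n, \sum_(k < n) `|x k| ^+ 2 <= M.

Definition predual (H : hilbert R) : set ((nat -> H) * (nat -> H)) :=
  [set w | sqsum w.1 /\ sqsum w.2].

Definition eval_form (H : hilbert R) (w : (nat -> H) * (nat -> H))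
  (g : H -> H -> C) : C := limn (series (fun n => g (w.1 n) (w.2 n) : C^o)).

Definition pair_op (H : hilbert R) (w : (nat -> H) * (nat -> H)) (S : H -> H)
  : C := eval_form w (fun x y => ip (S x) y).

Definition vec_fun (H : hilbert R) (x y : H) : (nat -> H) * (nat -> H) :=
  (fun n => if n == 0%N then x else 0, fun n => if n == 0%N then y else 0).

End Operators.

Record htensor (R : realType) (H K : hilbert R) := HTensor {
  hten :> hilbert R;
  tens : H -> K -> hten;
  tens_linl : forall (c : R[i]) x x' y,
    tens (c *: x + x') y = c *: tens x y + tens x' y;
  tens_linr : forall (c : R[i]) x y y',
    tens x (c *: y + y') = c *: tens x y + tens x y';
  tens_ip : forall x x' y y',
    ip (tens x y) (tens x' y') = ip x x' * ip y y';
  tens_dense : forall (u : hten) (e : R[i]), 0 < e ->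
    exists n (x : 'I_n -> H) (y : 'I_n -> K),
      `|u - \sum_(k < n) tens (x k) (y k)| <= e
}.

(* A choice of the (unique up to unitary) Hilbert space tensor product of any
   two Hilbert spaces; nothing below depends on this choice. *)
Definition tensor_products (R : realType) : Type :=
  forall H K : hilbert R, htensor H K.

Section Tensors.
Context {R : realType} (tp : tensor_products R).
Local Notation C := R[i].

Definition op_tens (H K : hilbert R) (S : H -> H) (T : K -> K) :
    tp H K -> tp H K :=
  xget (fun=> 0) [set X | bounded_op X /\
    forall x y, X (tens (tp H K) x y) = tens (tp H K) (S x) (T y)].

Definition tens_ops (H K : hilbert R) (D : set (H -> H)) (E : set (K -> K)) :
    set (tp H K -> tp H K) :=
  [set X | exists2 S, D S & exists2 T, E T & X = op_tens S T].

(* the von Neumann algebra tensor product, for D and E von Neumann algebras *)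
Definition vN_tens (H K : hilbert R) (D : set (H -> H)) (E : set (K -> K)) :
    set (tp H K -> tp H K) := bicommutant (tens_ops D E).

(* the minimal tensor product of the C*-algebras D and E *)
Definition min_tens (H K : hilbert R) (D : set (H -> H)) (E : set (K -> K)) :
    set (tp H K -> tp H K) := op_closure (op_lspan (tens_ops D E)).

(* (w (x) id)(X) *)
Definition lslice (H K : hilbert R) (w : (nat -> H) * (nat -> H))
    (X : tp H K -> tp H K) : K -> K :=
  fun y => xget 0 [set z | forall y', ip z y' =
    eval_form w (fun x x' => ip (X (tens _ x y)) (tens _ x' y'))].

(* (id (x) w)(X) *)
Definition rslice (H K : hilbert R) (w : (nat -> K) * (nat -> K))
    (X : tp H K -> tp H K) : H -> H :=
  fun x => xget 0 [set z | forall x', ip z x' =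
    eval_form w (fun y y' => ip (X (tens _ x y)) (tens _ x' y'))].

(* <X, v (x) w> *)
Definition pair_tens (H K : hilbert R) (v : (nat -> H) * (nat -> H))
  (w : (nat -> K) * (nat -> K)) (X : tp H K -> tp H K) : C :=
  pair_op v (rslice w X).

(* X_13 and X_23 *)
Definition leg13 (H K : hilbert R) (X : tp H K -> tp H K) :
    tp (tp H H) K -> tp (tp H H) K :=
  xget (fun=> 0) [set Y | bounded_op Y /\ forall x1 x2 y x1' x2' y',
    ip (Y (tens _ (tens _ x1 x2) y)) (tens _ (tens _ x1' x2') y') =
    ip x2 x2' * ip (X (tens _ x1 y)) (tens _ x1' y')].

Definition leg23 (H K : hilbert R) (X : tp H K -> tp H K) :
    tp (tp H H) K -> tp (tp H H) K :=
  xget (fun=> 0) [set Y | bounded_op Y /\ forall x1 x2 y x1' x2' y',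
    ip (Y (tens _ (tens _ x1 x2) y)) (tens _ (tens _ x1' x2') y') =
    ip x1 x1' * ip (X (tens _ x2 y)) (tens _ x2' y')].

(* (f (x) id)(X) for a normal map f between von Neumann algebras on H and L,
   determined by (id (x) w)((f (x) id)(X)) = f((id (x) w)(X)) *)
Definition amplify (H L K : hilbert R) (f : (H -> H) -> L -> L)
    (X : tp H K -> tp H K) : tp L K -> tp L K :=
  xget (fun=> 0) [set Y | bounded_op Y /\
    forall w, predual w -> rslice w Y = f (rslice w X)].

End Tensors.

Record cstar (R : realType) := CStar {
  csp :> completeNormedModType R[i];
  cmul : csp -> csp -> csp;
  cinv : csp -> csp;
  cmulA : forall a b c, cmul a (cmul b c) = cmul (cmul a b) c;
  cmul_linl : forall (t : R[i]) a b c,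
    cmul (t *: a + b) c = t *: cmul a c + cmul b c;
  cmul_linr : forall (t : R[i]) a b c,
    cmul a (t *: b + c) = t *: cmul a b + cmul a c;
  cinv_lin : forall (t : R[i]) a b,
    cinv (t *: a + b) = Num.conj t *: cinv a + cinv b;
  cinvK : forall a, cinv (cinv a) = a;
  cinvM : forall a b, cinv (cmul a b) = cmul (cinv b) (cinv a);
  cmul_norm : forall a b, `|cmul a b| <= `|a| * `|b|;
  cstar_norm : forall a, `|cmul (cinv a) a| = `|a| ^+ 2
}.

Section CStarAlgebras.
Context {R : realType}.
Local Notation C := R[i].

Definition unital (A : cstar R) : Prop :=
  exists e : A, forall a, cmul e a = a /\ cmul a e = a.

Definition star_hom (A : cstar R) (H : hilbert R) (f : A -> H -> H) : Prop :=
  [/\ forall a, bounded_op (f a),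
      forall (c : C) a b, f (c *: a + b) = fun x => c *: f a x + f b x,
      forall a b, f (cmul a b) = f a \o f b
    & forall a, f (cinv a) = adj (f a)].

(* A universal representation: a nondegenerate representation in which A* is the
   predual of the generated von Neumann algebra, which is therefore A**. *)
Record univ_rep (A : cstar R) := UnivRep {
  usp : hilbert R;
  urep : A -> usp -> usp;
  urep_hom : star_hom urep;
  urep_nondeg : forall (x : usp) (e : C), 0 < e ->
    exists n (a : 'I_n -> A) (y : 'I_n -> usp),
      `|x - \sum_(k < n) urep (a k) (y k)| <= e;
  urep_univ : forall f, dual f ->
    exists2 w, predual w & forall a, f a = pair_op w (urep a)
}.
Arguments urep {A} u a _.

Variables (A : cstar R) (u : univ_rep A).

Definition bidual : set (usp u -> usp u) := bicommutant (range (urep u)).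

Definition multiplier : set (usp u -> usp u) :=
  [set x | bidual x /\ forall a, range (urep u) (x \o urep u a) /\
                                 range (urep u) (urep u a \o x)].

(* a normal functional on A** extending f in A* (unique on A** ) *)
Definition normal_fun (f : A -> C) : (nat -> usp u) * (nat -> usp u) :=
  xget (fun=> 0, fun=> 0)
    [set w | predual w /\ forall a, f a = pair_op w (urep u a)].

(* the normal extension to A** of a map f : A -> B(L) *)
Definition normal_ext (L : hilbert R) (f : A -> L -> L) (x : usp u -> usp u) :
    L -> L :=
  fun z => xget 0 [set t | forall z',
    ip t z' = pair_op (normal_fun (fun a => ip (f a z) z')) x].

(* f^* m, for f : B -> M(A) and m in A^* *)
Definition transpose (B : cstar R) (f : B -> usp u -> usp u) (m : A -> C) :
    B -> C := fun b => pair_op (normal_fun m) (f b).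

(* nondegenerate *-homomorphism B -> M(A) *)
Definition nondeg_hom (B : cstar R) (f : B -> usp u -> usp u) : Prop :=
  [/\ star_hom f, forall b, multiplier (f b)
    & forall a, op_closure (op_lspan
        [set S | exists b a', S = f b \o urep u a']) (urep u a)].

Variable tp : tensor_products R.

(* the product on A^* defined by Phi : A -> A** (x) A** *)
Definition conv (Phi : A -> tp (usp u) (usp u) -> tp (usp u) (usp u))
    (m n : A -> C) : A -> C :=
  fun a => pair_tens (normal_fun m) (normal_fun n) (Phi a).

End CStarAlgebras.

Arguments urep {R A} u a _.
Arguments bidual {R A} u _.
Arguments multiplier {R A} u _.
Arguments normal_fun {R A} u f.
Arguments normal_ext {R A} u {L} f x _.

(* [normal_ext Phi id = id] says that the normal extension of Phi is unital,
   the units of A** and of A** (x) A** being identity operators. *)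
Record eberlein (R : realType) (tp : tensor_products R) := Eberlein {
  ealg : cstar R;
  euniv : univ_rep ealg;
  eH : hilbert R;
  ePhi : ealg -> tp (usp euniv) (usp euniv) -> tp (usp euniv) (usp euniv);
  eV : tp (usp euniv) eH -> tp (usp euniv) eH;
  ePhi_hom : star_hom ePhi;
  ePhi_vN : forall a, vN_tens (bidual euniv) (bidual euniv) (ePhi a);
  ePhi_unital : normal_ext euniv ePhi id = id;
  eV_vN : vN_tens (bidual euniv) [set S : eH -> eH | bounded_op S] eV;
  eV_contr : forall x, `|eV x| <= `|x|;
  eV_slice : forall w, predual w -> range (urep euniv) (rslice w eV);
  eV_dense : forall (a : ealg) (e : R[i]), 0 < e ->
    exists2 w, predual w &
      exists2 b, rslice w eV = urep euniv b & `|a - b| <= e;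
  ePhi_assoc : forall l m n, dual l -> dual m -> dual n ->
    conv ePhi (conv ePhi l m) n = conv ePhi l (conv ePhi m n);
  eV_mult : forall m n, dual m -> dual n ->
    lslice (normal_fun euniv (conv ePhi m n)) eV =
    lslice (normal_fun euniv m) eV \o lslice (normal_fun euniv n) eV
}.

Arguments ePhi {R tp} _ _ _.
Arguments eV {R tp} _ _.

(* A morphism E1 -> E2 is a map from the algebra of E2 to the multiplier algebra
   of the algebra of E1. *)
Definition eberlein_morphism (R : realType) (tp : tensor_products R)
    (E1 E2 : eberlein tp)
    (f : ealg E2 -> usp (euniv E1) -> usp (euniv E1)) : Prop :=
  nondeg_hom f /\ forall m n, dual m -> dual n ->
    transpose f (conv (ePhi E1) m n) =
    conv (ePhi E2) (transpose f m) (transpose f n).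

Section Weights.
Context {R : realType} (H : hilbert R).
Local Open Scope ereal_scope.

Definition pos_part (M : set (H -> H)) : set (H -> H) :=
  [set x | M x /\ op_ge0 x].

Definition fin_part (M : set (H -> H)) (phi : (H -> H) -> \bar R) :
    set (H -> H) := [set x | pos_part M x /\ phi x < +oo].

Definition sqint (M : set (H -> H)) (phi : (H -> H) -> \bar R) :
    set (H -> H) := [set x | M x /\ phi (adj x \o x) < +oo].

Definition is_weight (M : set (H -> H)) (phi : (H -> H) -> \bar R) : Prop :=
  [/\ forall x, pos_part M x -> 0 <= phi x,
      forall x y, pos_part M x -> pos_part M y ->
        phi (fun z => (x z + y z)%R) = phi x + phi y
    & forall (t : R) x, (0 <= t)%R -> pos_part M x ->
        phi (fun z => t%:C *: x z)%R = t%:E * phi x].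

Definition normal_weight (M : set (H -> H)) (phi : (H -> H) -> \bar R) :=
  forall (D : set (H -> H)) x, D `<=` pos_part M -> D !=set0 ->
    (forall y z, D y -> D z -> exists2 t, D t & op_le y t /\ op_le z t) ->
    pos_part M x -> (forall y, D y -> op_le y x) ->
    (forall z, pos_part M z -> (forall y, D y -> op_le y z) -> op_le x z) ->
    phi x = ereal_sup (phi @` D).

(* sigma-weak density in M of the span of the positive elements of finite
   weight *)
Definition semifinite_weight (M : set (H -> H)) (phi : (H -> H) -> \bar R) :=
  forall x, M x -> forall n (w : 'I_n -> (nat -> H) * (nat -> H)),
    (forall k, predual (w k)) -> forall e : R[i], (0 < e)%R ->
    exists2 y, op_lspan (fin_part M phi) y &
      forall k, (`|pair_op (w k) x - pair_op (w k) y| <= e)%R.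

Definition faithful_weight (M : set (H -> H)) (phi : (H -> H) -> \bar R) :=
  forall x, pos_part M x -> phi x = 0 -> x = fun=> 0%R.

Definition nsf_weight (M : set (H -> H)) (phi : (H -> H) -> \bar R) : Prop :=
  [/\ is_weight M phi, normal_weight M phi, semifinite_weight M phi
    & faithful_weight M phi].

End Weights.

(* Kustermans--Vaes, von Neumann algebraic form: L^oo(G) = gM acts on the GNS
   space of the left Haar weight gphi, with GNS map gLam.  In the invariance
   axioms [w.1 = w.2] says that the functional w is positive. *)
Record lcqg (R : realType) (tp : tensor_products R) := LCQG {
  gL2 : hilbert R;
  gM : set (gL2 -> gL2);
  gDelta : (gL2 -> gL2) -> tp gL2 gL2 -> tp gL2 gL2;
  gphi : (gL2 -> gL2) -> \bar R;
  gpsi : (gL2 -> gL2) -> \bar R;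
  gLam : (gL2 -> gL2) -> gL2;
  gM_vN : is_vN gM;
  gDelta_vN : forall x, gM x -> vN_tens gM gM (gDelta x);
  gDelta_lin : forall (c : R[i]) x y, gM x -> gM y ->
    gDelta (fun z => c *: x z + y z) =
    fun z => c *: gDelta x z + gDelta y z;
  gDelta_mul : forall x y, gM x -> gM y ->
    gDelta (x \o y) = gDelta x \o gDelta y;
  gDelta_adj : forall x, gM x -> gDelta (adj x) = adj (gDelta x);
  gDelta_id : gDelta id = id;
  gDelta_normal : forall w, predual w -> exists2 w', predual w' &
    forall x, gM x -> pair_op w (gDelta x) = pair_op w' x;
  (* (Delta (x) id) Delta = (id (x) Delta) Delta, evaluated at
     w_{a,a'} (x) w_{b,b'} (x) w_{c,c'} *)
  gDelta_coassoc : forall x a b c a' b' c', gM x ->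
    ip (gDelta (rslice (vec_fun c c') (gDelta x)) (tens _ a b))
       (tens _ a' b') =
    ip (gDelta (lslice (vec_fun a a') (gDelta x)) (tens _ b c))
       (tens _ b' c');
  gphi_nsf : nsf_weight gM gphi;
  gpsi_nsf : nsf_weight gM gpsi;
  gphi_inv : forall w x, predual w -> w.1 = w.2 -> fin_part gM gphi x ->
    gphi (lslice w (gDelta x)) = ((complex.Re (pair_op w id))%:E * gphi x)%E;
  gpsi_inv : forall w x, predual w -> w.1 = w.2 -> fin_part gM gpsi x ->
    gpsi (rslice w (gDelta x)) = ((complex.Re (pair_op w id))%:E * gpsi x)%E;
  gLam_lin : forall (c : R[i]) x y, sqint gM gphi x -> sqint gM gphi y ->
    gLam (fun z => c *: x z + y z) = c *: gLam x + gLam y;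
  gLam_norm : forall x, sqint gM gphi x ->
    gphi (adj x \o x) = (complex.Re (ip (gLam x) (gLam x)))%:E;
  gLam_dense : forall (z : gL2) (e : R[i]), 0 < e ->
    exists2 x, sqint gM gphi x & `|z - gLam x| <= e;
  gLam_mul : forall x y, gM x -> sqint gM gphi y -> gLam (x \o y) = x (gLam y)
}.

Arguments gM {R tp} l _.
Arguments gDelta {R tp} l x _.
Arguments gphi {R tp} l x.
Arguments gpsi {R tp} l x.
Arguments gLam {R tp} l x.

Section Universal.
Context {R : realType} {tp : tensor_products R} (G : lcqg tp).
Local Notation L2 := (gL2 G).

(* The left regular corepresentation, W^* (Lam x (x) Lam y) =
   (Lam (x) Lam)(Delta(y)(x (x) 1)), in the sliced form
   (w (x) id)(W^* ) Lam(y) = Lam((w (x) id) Delta(y)). *)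
Definition left_regular (W : tp L2 L2 -> tp L2 L2) : Prop :=
  unitary_op W /\ forall w y, predual w -> sqint (gM G) (gphi G) y ->
    sqint (gM G) (gphi G) (lslice w (gDelta G y)) /\
    lslice w (adj W) (gLam G y) = gLam G (lslice w (gDelta G y)).

(* C_0 of the dual quantum group *)
Definition dual_C0 (W : tp L2 L2 -> tp L2 L2) : set (L2 -> L2) :=
  op_closure [set x | exists2 w, predual w & x = lslice w W].

(* The map w |-> (id (x) w)(W^* ) is an injective homomorphism of the Banach
   algebra L^1 of the dual into B(L2), and the *-algebra L^1_# consists of those
   w for which the adjoint of the image is in the image.  L^1_# is identified
   here with its image, with the operations of B(L2); passing to adjoints
   shows that W may be used instead of W^*. *)
Definition L1sharp (W : tp L2 L2 -> tp L2 L2) : set (L2 -> L2) :=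
  [set x | (exists2 w, predual w & x = rslice w W) /\
           (exists2 w, predual w & adj x = rslice w W)].

Definition L1sharp_rep (W : tp L2 L2 -> tp L2 L2) (K : hilbert R)
    (r : (L2 -> L2) -> K -> K) : Prop :=
  [/\ forall x, L1sharp W x -> bounded_op (r x),
      forall (c : R[i]) x y, L1sharp W x -> L1sharp W y ->
        r (fun z => c *: x z + y z) = fun z => c *: r x z + r y z,
      forall x y, L1sharp W x -> L1sharp W y -> r (x \o y) = r x \o r y
    & forall x, L1sharp W x -> r (adj x) = adj (r x)].

(* Kustermans' universal C*-algebra C_0^u(G): the enveloping C*-algebra of L^1_#
   of the dual, with the lift uW of W to M(C_0^u(G) (x) C_0(G^)) and the
   coproduct uDelta determined by (uDelta (x) id)(uW) = uW_13 uW_23. *)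
Record universal := Universal {
  uG_W : tp L2 L2 -> tp L2 L2;
  uG_W_regular : left_regular uG_W;
  uC0 : cstar R;
  uuniv : univ_rep uC0;
  ulam : (L2 -> L2) -> uC0;
  ulam_hom : L1sharp_rep uG_W (urep uuniv \o ulam);
  ulam_dense : forall (a : uC0) (e : R[i]), 0 < e ->
    exists2 x, L1sharp uG_W x & `|a - ulam x| <= e;
  ulam_univ : forall (K : hilbert R) (r : (L2 -> L2) -> K -> K),
    L1sharp_rep uG_W r -> exists2 s : uC0 -> K -> K, star_hom s &
      forall x, L1sharp uG_W x -> s (ulam x) = r x;
  uW : tp (usp uuniv) L2 -> tp (usp uuniv) L2;
  uW_unitary : unitary_op uW;
  uW_mult :
    idealizer (min_tens (range (urep uuniv)) (dual_C0 uG_W)) uW;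
  uW_slice : forall w, predual w -> L1sharp uG_W (rslice w uG_W) ->
    urep uuniv (ulam (rslice w uG_W)) = rslice w uW;
  uDelta : uC0 -> tp (usp uuniv) (usp uuniv) -> tp (usp uuniv) (usp uuniv);
  uDelta_hom : star_hom uDelta;
  uDelta_mult : forall a, idealizer (min_tens (range (urep uuniv))
    (range (urep uuniv))) (uDelta a);
  uDelta_nondeg : min_tens (range (urep uuniv))
      (range (urep uuniv)) `<=`
    op_closure (op_lspan [set S | exists a, exists2 T,
      min_tens (range (urep uuniv)) (range (urep uuniv)) T &
      S = uDelta a \o T]);
  uDelta_W :
    amplify (normal_ext uuniv uDelta) uW = leg13 uW \o leg23 uW
}.

Arguments uDelta u a _ : clear implicits.

Variable X : universal.
Local Notation Hu := (usp (uuniv X)).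

(* (Delta_u (x) id)(U) = U_13 U_23 *)
Definition corep_eq (K : hilbert R) (U : tp Hu K -> tp Hu K) : Prop :=
  amplify (normal_ext (uuniv X) (uDelta X)) U = leg13 U \o leg23 U.

Definition unitary_corep (K : hilbert R) (U : tp Hu K -> tp Hu K) : Prop :=
  [/\ idealizer (min_tens (range (urep (uuniv X))) (@compact_op R K)) U,
      unitary_op U & corep_eq U].

Definition qg_morphism (E : eberlein tp) (f : ealg E -> Hu -> Hu) : Prop :=
  [/\ nondeg_hom f,
      forall m n, dual m -> dual n ->
        transpose f (conv (uDelta X) m n) =
        conv (ePhi E) (transpose f m) (transpose f n)
    & let U := amplify (normal_ext (euniv E) f) (eV E) in
      corep_eq U /\
      exists p : eH E -> eH E, [/\ projection_op p,
        adj U \o U = op_tens id p & U \o adj U = op_tens id p]].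

Definition slice_closure (K : hilbert R) (U : tp Hu K -> tp Hu K) :
    set (Hu -> Hu) :=
  op_closure [set x | exists2 w, predual w & x = rslice w U].

Definition is_cstar_subalg (D : set (Hu -> Hu)) : Prop :=
  [/\ D `<=` multiplier (uuniv X), forall x y, D x -> D y -> D (x \o y)
    & forall x, D x -> D (adj x)].

(* E is an embedded C*-Eberlein algebra of G: its algebra is carried by j onto
   the norm closure of the slices of U, and eV E is the associated U'. *)
Definition embedded (E : eberlein tp) (j : ealg E -> Hu -> Hu) : Prop :=
  exists U : tp Hu (eH E) -> tp Hu (eH E),
    [/\ unitary_corep U, is_cstar_subalg (slice_closure U),
        star_hom j /\ injective j, range j = slice_closure U
      & (forall w, predual w -> exists2 b,
           rslice w (eV E) = urep (euniv E) b & j b = rslice w U)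
        /\ qg_morphism j].

Definition maximal_embedded (E : eberlein tp) (j : ealg E -> Hu -> Hu) : Prop :=
  [/\ embedded j, unital (ealg E)
    & forall (E' : eberlein tp) (j' : ealg E' -> Hu -> Hu),
        embedded j' -> unital (ealg E') -> range j' `<=` range j].

End Universal.
Arguments uDelta {R tp G} u a _.

(* Main.v *)
(* Since [j] is injective, everything reduces to [range theta `<=` range j], and for
   this it suffices, by maximality, to exhibit B = theta(S) as the algebra of an
   embedded Eberlein algebra.

   Unital *-homomorphisms have closed range and lift norms up to a factor 2, so B is
   a C*-algebra and the amplification U = (theta (x) id)(V) exists.  B** is the
   corner of S** complementary to the support of ker theta; compressing V by it and
   by the projection p with U^*U = UU^* = 1 (x) p, and the coproduct by it twice,
   gives the structure on B.  The coproduct passes to B because, for a unital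
   Eberlein algebra, (id (x) n) Phi(a) and (m (x) id) Phi(a) lie in the algebra
   itself: the product of functionals is separately weak-* continuous, so that
   identities need only be checked on the functionals of the form m o theta.

   The compression of U is a unitary corepresentation; that it is a multiplier of
   C_0^u(G) (x) K is a Dini argument, as its slices are multipliers of C_0^u(G).

   The same weak-* argument shows that [j^-1 o theta] is a morphism. *)
Require Import Defs.
From HB Require Import structures.
From mathcomp Require Import all_boot all_order all_algebra.
From mathcomp Require Import complex.
From mathcomp Require Import all_classical all_reals all_analysis.
From mathcomp Require Import ring lra.

Set Implicit Arguments.
Unset Strict Implicit.
Unset Printing Implicit Defensive.
Import Order.TTheory GRing.Theory Num.Theory numFieldNormedType.Exports.
Local Open Scope classical_set_scope.
Local Open Scope complex_scope.
Local Open Scope ring_scope.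

(** * Norms and bounded maps *)

(** A morphism constrains [Phi] only through the functionals m o theta, and [Phi] has values in a
    von Neumann tensor product, so nothing immediate forces it to respect ker theta. What helps is
    V: on a slice a = (id (x) w)(V) the product of m and n takes the value w(M_m M_n), where M_m =
    (m (x) id)(V), and moving one of the two operators into w yields another slice. Density of the
    slices then makes the algebra invariant under translation by functionals, once it is known to be
    norm closed in its universal representation.

    That closedness, the completeness of B and the existence of the amplification all rest on
    lifting elements with control of the norm. The lift is built from convergent iterations (a
    square root, a Neumann series) instead of a spectral theory, at the price of a factor 2; at the
    level of matrices this factor is removed by taking powers.

    The space carrying B** cannot be chosen freely: [univ_rep] wants every functional on B to be
    normal, so it is cut out of the universal representation of S. *)

Section Norms.
Context {R : realType}.
Local Notation C := R[i].

Definition cn (z : C) : R := complex.Re `|z|.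

Lemma RRe_ge0 (z : C) : 0 <= z -> z = (complex.Re z)%:C.
Proof. by move=> z0; rewrite RRe_real ?ger0_real. Qed.

Lemma cnE z : `|z| = (cn z)%:C. Proof. by rewrite {1}[`|z|]RRe_ge0. Qed.
Lemma cn_ge0 z : 0 <= cn z. Proof. by rewrite -ler0c -cnE. Qed.
Lemma cn0 : cn 0 = 0. Proof. by apply: complexI; rewrite -cnE normr0. Qed.
Lemma cnD z t : cn (z + t) <= cn z + cn t.
Proof. by rewrite -lecR rmorphD /= -!cnE ler_normD. Qed.
Lemma cnM z t : cn (z * t) = cn z * cn t.
Proof. by apply: complexI; rewrite rmorphM /= -!cnE normrM. Qed.
Lemma cnN z : cn (- z) = cn z.
Proof. by apply: complexI; rewrite -!cnE normrN. Qed.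
Lemma cnB z t : cn (z - t) = cn (t - z). Proof. by rewrite -opprB cnN. Qed.
Lemma cnJ z : cn (Num.conj z) = cn z.
Proof. by apply: complexI; rewrite -!cnE norm_conjC. Qed.
Lemma cn_eq0 z : cn z = 0 -> z = 0.
Proof. by move=> h; apply/eqP; rewrite -normr_eq0 cnE h. Qed.
Lemma cn_real (r : R) : cn r%:C = `|r|.
Proof. by rewrite /cn normc_def /= expr0n /= addr0 sqrtr_sqr. Qed.
Lemma cn_ge0r (r : R) : 0 <= r -> cn r%:C = r.
Proof. by move=> r0; rewrite cn_real ger0_norm. Qed.
Lemma cn1 : cn 1 = 1. Proof. by have := cn_ge0r (@ler01 R). Qed.
Lemma Re_le_cn z : `|complex.Re z| <= cn z.
Proof. by rewrite -lecR -cnE normc_ge_Re. Qed.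
Lemma cni : cn 'i%C = 1.
Proof. by rewrite /cn normc_def /= expr0n expr1n add0r sqrtr1. Qed.
Lemma Im_le_cn z : `|complex.Im z| <= cn z.
Proof.
have := Re_le_cn (- 'i%C * z); rewrite cnM cnN cni mul1r.
by case: z => a b /=; rewrite oppr0 mul0r !mulN1r opprK add0r.
Qed.
Lemma cn_ReIm z : cn z <= `|complex.Re z| + `|complex.Im z|.
Proof.
rewrite -!cn_real; have {1}-> : z = (complex.Re z)%:C + 'i%C * (complex.Im z)%:C by exact: complexE.
by apply: le_trans (cnD _ _) _; rewrite cnM cni mul1r.
Qed.
Lemma cn_sqr z : z * Num.conj z = (cn z ^+ 2)%:C.
Proof. by rewrite -normCK cnE rmorphXn. Qed.
Lemma cn_sum I (s : seq I) (F : I -> C) :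
  cn (\sum_(i <- s) F i) <= \sum_(i <- s) cn (F i).
Proof.
elim: s => [|i s IH]; first by rewrite !big_nil cn0.
by rewrite !big_cons (le_trans (cnD _ _))// lerD2l.
Qed.
Lemma ReM_real (r : R) z : complex.Re (r%:C * z) = r * complex.Re z.
Proof. by case: z => a b /=; rewrite mul0r subr0. Qed.
Lemma ReD (z t : C) : complex.Re (z + t) = complex.Re z + complex.Re t.
Proof. by case: z; case: t. Qed.
Lemma ReN (z : C) : complex.Re (- z) = - complex.Re z.
Proof. by case: z. Qed.
Lemma ReJ (z : C) : complex.Re (Num.conj z) = complex.Re z.
Proof. by case: z. Qed.
Lemma Re_le (z t : C) : z <= t -> complex.Re z <= complex.Re t.
Proof. by rewrite lecE => /andP[]. Qed.
Lemma conj_real (r : R) : Num.conj (r%:C : C) = r%:C.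
Proof. exact: conjc_real. Qed.

(** Norms over [R[i]] are complex numbers; [nr] and [cn] are their real versions, on which [lra] and
    [nra] can work. *)
Definition nr (V : normedModType C) (x : V) : R := complex.Re `|x|.

Section V.
Variable V : normedModType C.
Implicit Types x y z : V.

Lemma nrE x : `|x| = (nr x)%:C. Proof. by rewrite {1}[`|x|]RRe_ge0. Qed.
Lemma nr_ge0 x : 0 <= nr x. Proof. by rewrite -ler0c -nrE. Qed.
Lemma nr0 : nr (0 : V) = 0. Proof. by apply: complexI; rewrite -nrE normr0. Qed.
Lemma nrD x y : nr (x + y) <= nr x + nr y.
Proof. by rewrite -lecR rmorphD /= -!nrE ler_normD. Qed.
Lemma nrN x : nr (- x) = nr x.
Proof. by apply: complexI; rewrite -!nrE normrN. Qed.
Lemma nrB x y : nr (x - y) = nr (y - x). Proof. by rewrite -opprB nrN. Qed.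
Lemma nrZ c x : nr (c *: x) = cn c * nr x.
Proof. by apply: complexI; rewrite rmorphM /= -cnE -!nrE normrZ. Qed.
Lemma nr_eq0 x : nr x = 0 -> x = 0.
Proof. by move=> h; apply/eqP; rewrite -normr_eq0 nrE h. Qed.
Lemma nr_triang x y z : nr (x - z) <= nr (x - y) + nr (y - z).
Proof. by rewrite (_ : x - z = (x - y) + (y - z)) ?nrD// addrA subrK. Qed.
Lemma nr_le_sub x y : nr x <= nr (x - y) + nr y.
Proof. by have := nr_triang x y 0; rewrite !subr0. Qed.
Lemma nr_sum I (s : seq I) (F : I -> V) :
  nr (\sum_(i <- s) F i) <= \sum_(i <- s) nr (F i).
Proof.
elim: s => [|i s IH]; first by rewrite !big_nil nr0.
by rewrite !big_cons (le_trans (nrD _ _))// lerD2l.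
Qed.
Lemma nr_small x : (forall e : R, 0 < e -> nr x <= e) -> x = 0.
Proof.
move=> h; apply: nr_eq0; apply/eqP; rewrite eq_le nr_ge0 andbT.
by apply/ler_addgt0Pl => e e0; rewrite addr0 h.
Qed.
Lemma nr_le x y : (`|x| <= `|y|) = (nr x <= nr y).
Proof. by rewrite !nrE lecR. Qed.
End V.

Lemma cn_small (z : C) : (forall e : R, 0 < e -> cn z <= e) -> z = 0.
Proof. exact: (@nr_small C^o z). Qed.

Lemma epsC (e : C) : 0 < e -> exists2 r : R, 0 < r & e = r%:C.
Proof.
move=> e0; exists (complex.Re e); last by rewrite -RRe_ge0// ltW.
by rewrite -ltcR -RRe_ge0 // ltW.
Qed.

Definition seqlim (V : normedModType C) (u : nat -> V) (l : V) :=
  forall e : R, 0 < e -> exists N, forall n, (N <= n)%N -> nr (u n - l) <= e.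

Lemma seqlim_cvg (V : normedModType C) (u : nat -> V) l :
  seqlim u l -> u @ \oo --> l.
Proof.
move=> h; apply/cvgrPdist_le => e /epsC[r r0 ->].
have [N hN] := h r r0; near=> n.
rewrite nrE lecR nrB; apply: hN.
near: n; exact: nbhs_infty_ge.
Unshelve. all: by end_near. Qed.

Lemma cvg_seqlim (V : normedModType C) (u : nat -> V) l :
  u @ \oo --> l -> seqlim u l.
Proof.
move=> /cvgrPdist_le h e e0.
have [|N _ hN] := h e%:C; first by rewrite ltcR.
by exists N => n Nn; rewrite nrB -lecR -nrE; exact: hN.
Qed.

Lemma seqlim_lim (V : normedModType C) (u : nat -> V) l :
  seqlim u l -> limn u = l.
Proof. by move=> /seqlim_cvg; apply: cvg_lim; exact: norm_hausdorff. Qed.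

Lemma seqlim_uniq (V : normedModType C) (u : nat -> V) l l' :
  seqlim u l -> seqlim u l' -> l = l'.
Proof. by move=> /seqlim_lim <- /seqlim_lim <-. Qed.

Definition seqcauchy (V : normedModType C) (u : nat -> V) :=
  forall e : R, 0 < e -> exists N, forall m n, (N <= m)%N -> (N <= n)%N ->
    nr (u m - u n) <= e.

Lemma seqcauchy_lim (V : completeNormedModType C) (u : nat -> V) :
  seqcauchy u -> exists l, seqlim u l.
Proof.
move=> h; have : cvg (u @ \oo).
  apply/cauchy_cvgP; apply/cauchyP => e /epsC[r r0 ->].
  have r2 : 0 < r / 2 by lra.
  have [N hN] := h _ r2.
  exists (u N); exists N => // n /= Nn; rewrite -ball_normE /= nrE ltcR.
  by apply: le_lt_trans (hN _ _ (leqnn N) Nn) _; lra.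
by move=> /cvg_ex[l] /cvg_seqlim; exists l.
Qed.

Section Lim.
Variable V W : normedModType C.
Lemma seqlimD (u v : nat -> V) l l' : seqlim u l -> seqlim v l' ->
  seqlim (fun n => u n + v n) (l + l').
Proof.
move=> hu hv e e0; have e2 : 0 < e / 2 by lra.
have [N hN] := hu _ e2; have [M hM] := hv _ e2.
exists (maxn N M) => n; rewrite geq_max => /andP[/hN h1 /hM h2].
rewrite opprD addrACA (le_trans (nrD _ _))//; lra.
Qed.
Lemma seqlim_cst (l : V) : seqlim (fun=> l) l.
Proof. by move=> e e0; exists 0%N => n _; rewrite subrr nr0 ltW. Qed.
Lemma seqlim_bnd (u : nat -> V) (v : nat -> W) l l' (M : R) :
  (forall n, nr (v n - l') <= M * nr (u n - l)) -> seqlim u l -> seqlim v l'.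
Proof.
move=> h hu e e0.
have [N hN] := hu (e / (`|M| + 1)) (divr_gt0 e0 (ltr_wpDl (normr_ge0 _) ltr01)).
exists N => n /hN h1; apply: le_trans (h n) _.
have M0 : 0 < `|M| + 1 by rewrite ltr_wpDl.
have : M * nr (u n - l) <= (`|M| + 1) * nr (u n - l).
  rewrite ler_wpM2r ?nr_ge0//.
  by apply: le_trans (ler_norm _) _; rewrite lerDl.
move=> /le_trans; apply.
by rewrite mulrC -ler_pdivlMr.
Qed.
Lemma seqlim_nr (u : nat -> V) l M : seqlim u l -> (forall n, nr (u n) <= M) ->
  nr l <= M.
Proof.
move=> h hM; apply/ler_addgt0Pl => e e0.
have [N hN] := h e e0.
have := nr_le_sub l (u N); rewrite nrB; have := hN N (leqnn _); have := hM N; lra.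
Qed.
End Lim.

Definition bnd (V W : normedModType C) (f : V -> W) (M : R) :=
  forall x, nr (f x) <= M * nr x.

Lemma bounded_opP (V W : normedModType C) (f : V -> W) :
  bounded_op f <-> linear f /\ exists2 M : R, 0 <= M & bnd f M.
Proof.
split; last first.
  move=> [lf [M _ bf]]; split => //.
  by exists M%:C => x; rewrite !nrE -rmorphM /= lecR.
move=> [lf [M hM]]; split => //.
  exists (cn M) => [|x]; first exact: cn_ge0.
  have h := hM x.
  (* [M] is an arbitrary complex number, but this product dominates a norm, so it equals its own
     modulus and [cn M] may replace [M]. *)
  have h0 : 0 <= M * `|x| by apply: le_trans (normr_ge0 _) h.
  by move: h; rewrite -(ger0_norm h0) normrM normr_id cnE !nrE -rmorphM lecR.
Qed.

Lemma bnd_op (V W : normedModType C) (f : V -> W) M :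
  linear f -> bnd f M -> bounded_op f.
Proof.
move=> lf bf; apply/bounded_opP; split => //.
exists `|M| => // x; apply: le_trans (bf x) _.
by rewrite ler_wpM2r ?nr_ge0// ler_norm.
Qed.

Section Lin.
Variables (V W : lmodType C) (f : V -> W).
Hypothesis lf : linear f.
Lemma lin0 : f 0 = 0.
Proof.
have := lf 1 0 0; rewrite !scale1r addr0 => h.
by apply: (addrI (f 0)); rewrite -h addr0.
Qed.
Lemma linD x y : f (x + y) = f x + f y.
Proof. by have := lf 1 x y; rewrite !scale1r. Qed.
Lemma linZ c x : f (c *: x) = c *: f x.
Proof. by have := lf c x 0; rewrite !addr0 lin0 addr0. Qed.
Lemma linN x : f (- x) = - f x.
Proof. by rewrite -scaleN1r linZ scaleN1r. Qed.
Lemma linB x y : f (x - y) = f x - f y.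
Proof. by rewrite linD linN. Qed.
Lemma lin_sum I (s : seq I) (F : I -> V) :
  f (\sum_(i <- s) F i) = \sum_(i <- s) f (F i).
Proof. by elim: s => [|i s IH]; rewrite ?big_nil ?lin0// !big_cons linD IH. Qed.
End Lin.

Lemma bop_seqlim (V W : normedModType C) (f : V -> W) u l :
  bounded_op f -> seqlim u l -> seqlim (f \o u) (f l).
Proof.
move=> /bounded_opP[lf [M M0 bf]]; apply: (@seqlim_bnd _ _ _ _ _ _ M) => n /=.
by rewrite -(linB lf).
Qed.
Lemma bop_lin (V W : normedModType C) (f : V -> W) : bounded_op f -> linear f.
Proof. by case. Qed.
Lemma bop_bnd (V W : normedModType C) (f : V -> W) : bounded_op f ->
  exists2 M : R, 0 <= M & bnd f M.
Proof. by move=> /bounded_opP[]. Qed.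
Lemma bop_comp (U V W : normedModType C) (f : V -> W) (g : U -> V) :
  bounded_op f -> bounded_op g -> bounded_op (f \o g).
Proof.
move=> /bounded_opP[lf [M M0 bf]] /bounded_opP[lg [N N0 bg]].
apply: (@bnd_op _ _ _ (M * N)) => [c x y /=|x /=].
  by rewrite lg lf.
by rewrite -mulrA (le_trans (bf _))// ler_wpM2l.
Qed.
Lemma bop_id (V : normedModType C) : bounded_op (@id V).
Proof. by apply: (@bnd_op _ _ _ 1) => // x; rewrite mul1r. Qed.
Lemma bop_comb (V W : normedModType C) (c : C) (f g : V -> W) :
  bounded_op f -> bounded_op g -> bounded_op (fun x => c *: f x + g x).
Proof.
move=> /bounded_opP[lf [M M0 bf]] /bounded_opP[lg [N N0 bg]].
apply: (@bnd_op _ _ _ (cn c * M + N)) => [d x y /=|x /=].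
  rewrite lf lg !scalerDr !scalerA mulrC -!addrA; congr (_ + _).
  by rewrite addrCA.
rewrite (le_trans (nrD _ _))// nrZ mulrDl lerD// -mulrA ler_wpM2l//.
exact: cn_ge0.
Qed.
Lemma bop0 (V W : normedModType C) : bounded_op (fun _ : V => 0 : W).
Proof.
apply: (@bnd_op _ _ _ 0) => [c x y|x]; first by rewrite scaler0 addr0.
by rewrite nr0 mul0r.
Qed.
End Norms.

(** * Hilbert spaces *)

Section Hilbert.
Context {R : realType}.
Local Notation C := R[i].

Section One.
Variable H : hilbert R.
Implicit Types (x y z : H) (c : C).

Lemma ipDl x y z : ip (x + y) z = ip x z + ip y z.
Proof. by have := ip_linear 1 x y z; rewrite scale1r mul1r. Qed.
Lemma ip0l z : ip 0 z = 0.
Proof. by apply: (addrI (ip 0 z)); rewrite -ipDl !addr0. Qed.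
Lemma ipZl c x z : ip (c *: x) z = c * ip x z.
Proof. by have := ip_linear c x 0 z; rewrite addr0 ip0l addr0. Qed.
Lemma ipNl x z : ip (- x) z = - ip x z.
Proof. by rewrite -scaleN1r ipZl mulN1r. Qed.
Lemma ipBl x y z : ip (x - y) z = ip x z - ip y z.
Proof. by rewrite ipDl ipNl. Qed.
Lemma ipDr x y z : ip z (x + y) = ip z x + ip z y.
Proof. by rewrite ip_conj ipDl rmorphD /= -!ip_conj. Qed.
Lemma ip0r z : ip z 0 = 0.
Proof. by rewrite ip_conj ip0l rmorph0. Qed.
Lemma ipZr c x z : ip z (c *: x) = Num.conj c * ip z x.
Proof. by rewrite ip_conj ipZl rmorphM /= -ip_conj. Qed.
Lemma ipNr x z : ip z (- x) = - ip z x.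
Proof. by rewrite ip_conj ipNl rmorphN /= -ip_conj. Qed.
Lemma ipBr x y z : ip z (x - y) = ip z x - ip z y.
Proof. by rewrite ipDr ipNr. Qed.
Lemma ip_suml I (s : seq I) (F : I -> H) z :
  ip (\sum_(i <- s) F i) z = \sum_(i <- s) ip (F i) z.
Proof. by elim: s => [|i s IH]; rewrite ?big_nil ?ip0l// !big_cons ipDl IH. Qed.
Lemma ip_sumr I (s : seq I) (F : I -> H) z :
  ip z (\sum_(i <- s) F i) = \sum_(i <- s) ip z (F i).
Proof. by elim: s => [|i s IH]; rewrite ?big_nil ?ip0r// !big_cons ipDr IH. Qed.
Lemma ipxx x : ip x x = (nr x ^+ 2)%:C.
Proof. by rewrite -ip_norm nrE rmorphXn. Qed.
Lemma nr_sqr x : nr x ^+ 2 = complex.Re (ip x x).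
Proof. by rewrite ipxx. Qed.
Lemma ip_ext x y : (forall z, ip x z = ip y z) -> x = y.
Proof.
move=> h; apply/eqP; rewrite -subr_eq0; apply/eqP; apply: nr_eq0.
apply/eqP; rewrite -sqrf_eq0; apply/eqP; apply: complexI.
by rewrite -ipxx ipBl h subrr.
Qed.
Lemma ip_extr x y : (forall z, ip z x = ip z y) -> x = y.
Proof. by move=> h; apply: ip_ext => z; rewrite ip_conj h -ip_conj. Qed.

Lemma Re_ipC x y : complex.Re (ip y x) = complex.Re (ip x y).
Proof. by rewrite ip_conj ReJ. Qed.

Lemma nrD_sqr x y :
  nr (x + y) ^+ 2 = nr x ^+ 2 + nr y ^+ 2 + 2 * complex.Re (ip x y).
Proof.
rewrite !nr_sqr ipDl !ipDr !ReD (Re_ipC x y) mulr_natl mulr2n; ring.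
Qed.
Lemma parallelogram x y :
  nr (x + y) ^+ 2 + nr (x - y) ^+ 2 = 2 * (nr x ^+ 2 + nr y ^+ 2).
Proof. rewrite !nrD_sqr ipNr ReN nrN; ring. Qed.

(** Expand the square of the norm of |y| x - |x| y; the division by |x| |y| is the reason why zero
    vectors are set apart. *)
Lemma Re_CS x y : complex.Re (ip x y) <= nr x * nr y.
Proof.
have [y0|y0] := eqVneq (nr y) 0.
  by rewrite (nr_eq0 y0) ip0r nr0 mulr0.
have yp : 0 < nr y by rewrite lt_neqAle eq_sym y0 nr_ge0.
have := sqr_ge0 (nr ((nr y)%:C *: x - (nr x)%:C *: y)).
rewrite nrD_sqr nrN !nrZ !cn_ge0r ?nr_ge0// ipNr ipZl ipZr conj_real ReN.
rewrite !ReM_real => h.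
have [x0|x0] := eqVneq (nr x) 0.
  by rewrite (nr_eq0 x0) ip0l nr0 mul0r.
have xp : 0 < nr x by rewrite lt_neqAle eq_sym x0 nr_ge0.
rewrite -(ler_pM2l (mulr_gt0 xp yp)); move: h; set t := complex.Re _; nra.
Qed.

Lemma CS x y : cn (ip x y) <= nr x * nr y.
Proof.
have [z0|z0] := eqVneq (cn (ip x y)) 0.
  by rewrite z0 mulr_ge0 ?nr_ge0.
have zp : 0 < cn (ip x y) by rewrite lt_neqAle eq_sym z0 cn_ge0.
(* Multiplying x by the conjugate of <x, y> turns the inner product into the real number |<x,
   y>|^2. *)
have := Re_CS (Num.conj (ip x y) *: x) y.
rewrite ipZl mulrC cn_sqr nrZ cnJ /= -mulrA expr2 ler_pM2l//.
Qed.

Lemma nr_dual x (M : R) : 0 <= M -> (forall z, cn (ip x z) <= M * nr z) ->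
  nr x <= M.
Proof.
move=> M0 h; have [x0|x0] := eqVneq (nr x) 0; first by rewrite x0.
have xp : 0 < nr x by rewrite lt_neqAle eq_sym x0 nr_ge0.
by have := h x; rewrite ipxx cn_ge0r ?sqr_ge0// expr2 ler_pM2r.
Qed.

Lemma pythagoras x y : ip x y = 0 -> nr (x + y) ^+ 2 = nr x ^+ 2 + nr y ^+ 2.
Proof. by move=> h; rewrite nrD_sqr h /= mulr0 addr0. Qed.

Definition closed_sub (D : set H) :=
  [/\ D 0, forall c x y, D x -> D y -> D (c *: x + y)
    & forall u l, (forall n : nat, D (u n)) -> seqlim u l -> D l].

Lemma projection_thm (D : set H) x : closed_sub D ->
  exists2 y, D y & forall z, D z -> ip (x - y) z = 0.
Proof.
move=> [D0 Dl Dc].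
have DD y z : D y -> D z -> D (y + z).
  by move=> hy hz; rewrite -[y]scale1r; exact: Dl.
have DZ c y : D y -> D (c *: y) by move=> hy; rewrite -[_ *: _]addr0; exact: Dl.
pose E := [set nr (x - y) | y in D].
have Elb : lbound E 0 by move=> _ [y _ <-]; exact: nr_ge0.
have hE : has_inf E by split; [exists (nr (x - 0)), 0 | exists 0].
pose d := inf E.
have d0 : 0 <= d by apply: lb_le_inf; [case: hE|].
have dlb y : D y -> d <= nr (x - y).
  by move=> hy; apply: ge_inf; [case: hE|exists y].
have step (e : R) : 0 < e -> exists2 y, D y & nr (x - y) < d + e.
  move=> e0; have [_ [y Dy <-] hy] := inf_adherent e0 hE.
  by exists y.
pose ee (n : nat) : R := n.+1%:R^-1.
have ee0 n : 0 < ee n by rewrite invr_gt0 ltr0Sn.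
pose u n := sval (cid2 (step _ (ee0 n))).
have Du n : D (u n) by rewrite /u; case: cid2.
have hu n : nr (x - u n) < d + ee n by rewrite /u; case: cid2.
(* Parallelogram law: the midpoint of y and z has distance at least d from x, so |y - z|^2 <= 4 (d +
   e)^2 - 4 d^2. *)
have key y z (e : R) : D y -> D z -> 0 <= e -> nr (x - y) <= d + e -> nr (x - z) <= d + e ->
    nr (y - z) ^+ 2 <= 8 * d * e + 4 * e ^+ 2.
  move=> Dy Dz e0 hy hz.
  have := parallelogram (x - y) (x - z).
  rewrite (_ : x - y - (x - z) = z - y); last by rewrite opprB addrC subrKA.
  rewrite (_ : x - y + (x - z) = 2%:R%:C *: (x - 2^-1%:C *: (y + z))); last first.
    rewrite scalerBr scalerA -rmorphM /= divff ?pnatr_eq0// scale1r.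
    rewrite rmorphMn /= scaler_nat mulr2n opprD addrACA //.
  rewrite nrZ cn_ge0r// [nr (z - y)]nrB.
  have : d <= nr (x - 2^-1%:C *: (y + z)) by apply: dlb; apply: DZ; exact: DD.
  move: (nr_ge0 (x - y)) (nr_ge0 (x - z)) hy hz d0.
  set a := nr (x - y); set b := nr (x - z); set m := nr (x - _); set w := nr _.
  move=> a0 b0 ha hb d0' dm; rewrite exprMn => h.
  have h1 : a ^+ 2 <= (d + e) ^+ 2 by rewrite lerXn2r ?nnegrE// addr_ge0.
  have h2 : b ^+ 2 <= (d + e) ^+ 2 by rewrite lerXn2r ?nnegrE// addr_ge0.
  have h3 : d ^+ 2 <= m ^+ 2 by rewrite lerXn2r ?nnegrE// (le_trans d0').
  nra.
have ee_le n m : (n <= m)%N -> ee m <= ee n.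
  by move=> nm; rewrite lef_pV2 ?posrE ?ltr0Sn// ler_nat.
have cu : seqcauchy u.
  move=> e e0.
  pose q := 8 * d + 4.
  have q0 : 0 < q by rewrite /q; lra.
  have [N hN] : exists N : nat, ee N <= e ^+ 2 / q.
    have := archi_boundP (ltW (divr_gt0 q0 (exprn_gt0 2 e0))).
    set N := Num.bound _ => hN; exists N.
    rewrite -[leRHS]invrK lef_pV2 ?posrE ?ltr0Sn// ?invr_gt0 ?divr_gt0 ?exprn_gt0//.
    by rewrite invf_div (le_trans (ltW hN))// ler_nat.
  have eN1 : ee N <= 1 by rewrite invf_le1 ?ltr0Sn// ler1n.
  exists N => m n Nm Nn.
  have := key (u m) (u n) (ee N) (Du m) (Du n) (ltW (ee0 N)).
  move=> /(_ (le_trans (ltW (hu m)) _)) /(_ (le_trans (ltW (hu n)) _)).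
  rewrite !lerD2l !ee_le// => /(_ isT isT) h.
  rewrite -(@ler_pXn2r _ 2)// ?nnegrE ?nr_ge0// ?(ltW e0)//.
  apply: le_trans h _.
  have : ee N * q <= e ^+ 2 by rewrite -ler_pdivlMr.
  have := ee0 N; rewrite /q; nra.
have [y hy] := seqcauchy_lim cu.
have Dy : D y by apply: Dc hy.
have ny : nr (x - y) <= d.
  apply/ler_addgt0Pl => e e0.
  have e2 : 0 < e / 2 by lra.
  have [N hN] := hy _ e2.
  have [M hM] : exists M : nat, ee M <= e / 2.
    have := archi_boundP (ltW (divr_gt0 (@ltr01 R) e2)).
    set M := Num.bound _ => hM; exists M.
    rewrite -[leRHS]invrK lef_pV2 ?posrE ?ltr0Sn ?invr_gt0//.
    by rewrite -div1r (le_trans (ltW hM))// ler_nat.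
  have := nr_triang x (u (maxn N M)) y.
  have := hN (maxn N M) (leq_maxl _ _); have := hu (maxn N M).
  have := ee_le _ _ (leq_maxr N M); lra.
exists y => // z Dz.
have [z0|z0] := eqVneq (nr z) 0; first by rewrite (nr_eq0 z0) ip0r.
have zp : 0 < nr z by rewrite lt_neqAle eq_sym z0 nr_ge0.
(* The best step along z: it lowers |x - y|^2 by k |<x - y, z>|^2, so minimality of y forces <x - y,
   z> = 0. *)
pose k : R := (nr z ^+ 2)^-1; pose c := k%:C * ip (x - y) z.
have : d <= nr (x - (c *: z + y)) by apply: dlb; apply: Dl.
move=> /(le_trans ny).
rewrite -(@ler_pXn2r _ 2)// ?nnegrE ?nr_ge0//.
rewrite opprD addrCA addrC [X in _ <= X -> _]nrD_sqr nrN nrZ ipNr ipZr ReN.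
have k0 : 0 <= k by rewrite invr_ge0 sqr_ge0.
set p := ip (x - y) z.
have -> : Num.conj c * p = (k * cn p ^+ 2)%:C.
  by rewrite /c -/p rmorphM /= conj_real rmorphM /= -cn_sqr; ring.
have -> : cn c = k * cn p by rewrite /c cnM cn_ge0r.
set t := cn p => /=.
have kz : k * nr z ^+ 2 = 1 by rewrite mulVf// sqrf_eq0.
have -> : (k * t * nr z) ^+ 2 = k * t ^+ 2 * (k * nr z ^+ 2) by ring.
rewrite kz mulr1 => h.
have t0 : k * t ^+ 2 = 0.
  have : 0 <= k * t ^+ 2 by rewrite mulr_ge0 ?sqr_ge0.
  by move: h; set q := k * _; lra.
apply: cn_eq0; apply/eqP; move/eqP: t0.
by rewrite mulf_eq0 invr_eq0 !sqrf_eq0 (negPf z0).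
Qed.

Lemma riesz (f : H -> C) (M : R) :
  (forall c x y, f (c *: x + y) = c * f x + f y) ->
  (forall x, cn (f x) <= M * nr x) -> exists z, forall x, f x = ip x z.
Proof.
move=> lf bf.
have f0 : f 0 = 0.
  by have := lf 1 0 0; rewrite scale1r mul1r addr0 => h; apply: (addrI (f 0)); rewrite -h addr0.
have fZ c x : f (c *: x) = c * f x by have := lf c x 0; rewrite !addr0 f0 addr0.
have fB x y : f (x - y) = f x - f y.
  by have := lf (-1) y x; rewrite scaleN1r mulN1r addrC => ->; rewrite addrC.
pose D : set H := [set x | f x = 0].
have cD : closed_sub D.
  split => [//|c x y /= hx hy|u l hu hl]; first by rewrite /D /= lf hx hy mulr0 addr0.
  apply: cn_small => e e0.
  pose M' := `|M| + 1; have M0 : 0 < M' by rewrite ltr_wpDl.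
  have [N hN] := hl _ (divr_gt0 e0 M0).
  have := bf (u N - l); rewrite fB hu sub0r cnN => h; apply: le_trans h _.
  apply: le_trans (_ : M' * nr (u N - l) <= _).
    by rewrite ler_wpM2r ?nr_ge0// (le_trans (ler_norm _))// lerDl.
  by rewrite mulrC -ler_pdivlMr// hN.
have [allD|/existsNP[x nx]] := pselect (forall x, D x).
  by exists 0 => x; rewrite ip0r; exact: allD.
have [y Dy hy] := projection_thm x cD.
pose w := x - y.
have fw : f w = f x by rewrite fB Dy subr0.
have w0 : ip w w != 0.
  apply/eqP; rewrite ipxx => /complexI /eqP; rewrite sqrf_eq0 => /eqP /nr_eq0 h.
  by apply: nx; rewrite /D /= -fw h.
exists (Num.conj (f w / ip w w) *: w) => z.
rewrite ipZr conjCK.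
have fw0 : f w != 0 by rewrite fw; apply/eqP.
have Dz : D (z - (f z / f w) *: w) by rewrite /D /= fB fZ divfK// subrr.
have := hy _ Dz; rewrite -/w ipBr ipZr => /eqP.
rewrite subr_eq0 => /eqP h.
have h2 : ip z w = f z / f w * ip w w.
  by rewrite ip_conj h rmorphM /= conjCK -ip_conj.
by rewrite h2; field; rewrite fw0.
Qed.
End One.

Section Adjoint.
Variables (H K : hilbert R).

(** The formula of [adj] between two different spaces; on a single space both are convertible, so
    that every fact about [gadj] applies to [adj]. *)
Definition gadj (S : H -> K) : K -> H :=
  fun y => xget 0 [set z | forall x, ip (S x) y = ip x z].

Lemma gadjE (S : H -> K) x y : bounded_op S -> ip (S x) y = ip x (gadj S y).
Proof.
move=> /bounded_opP[lS [M M0 bS]].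
have [z hz] : exists z, forall x, ip (S x) y = ip x z.
  apply: (@riesz _ (fun x => ip (S x) y) (M * nr y)) => [c a b|a].
    by rewrite lS ip_linear.
  by rewrite (le_trans (CS _ _))// mulrAC ler_wpM2r ?nr_ge0.
by move: x; rewrite /gadj; case: xgetP => [w _ //|/(_ z)]; case.
Qed.
Lemma gadjEr (S : H -> K) x y : bounded_op S -> ip x (S y) = ip (gadj S x) y.
Proof. by move=> bS; rewrite ip_conj gadjE// -ip_conj. Qed.
Lemma gadj_uniq (S : H -> K) (T : K -> H) : bounded_op S ->
  (forall x y, ip (S x) y = ip x (T y)) -> gadj S = T.
Proof.
by move=> bS h; apply/funext => y; apply: ip_extr => x; rewrite -gadjE.
Qed.
Lemma gadj_bnd (S : H -> K) M : bounded_op S -> 0 <= M -> bnd S M -> bnd (gadj S) M.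
Proof.
move=> bS M0 h y; apply: nr_dual => [|z]; first by rewrite mulr_ge0 ?nr_ge0.
rewrite -gadjEr//; apply: le_trans (CS _ _) _.
by rewrite mulrC -mulrA [nr y * _]mulrC mulrA ler_wpM2r ?nr_ge0.
Qed.
Lemma gadj_bop (S : H -> K) : bounded_op S -> bounded_op (gadj S).
Proof.
move=> bS; have [M M0 hM] := bop_bnd bS.
apply: (@bnd_op _ _ _ _ M) => [c x y|]; last exact: gadj_bnd.
by apply: ip_ext => z; rewrite ip_linear -!gadjEr// ip_linear.
Qed.
End Adjoint.

Lemma adj_gadj (H : hilbert R) : @adj R H = @gadj H H.
Proof. by []. Qed.

Lemma gadjK (H K : hilbert R) (S : H -> K) : bounded_op S -> gadj (gadj S) = S.
Proof.
move=> bS; apply: gadj_uniq => [|x y]; first exact: gadj_bop.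
by rewrite -gadjEr.
Qed.
Lemma gadj_comp (H K L : hilbert R) (S : K -> L) (T : H -> K) :
  bounded_op S -> bounded_op T -> gadj (S \o T) = gadj T \o gadj S.
Proof.
move=> bS bT; apply: gadj_uniq => [|x y /=]; first exact: bop_comp.
by rewrite !gadjE.
Qed.
Lemma adjE (H : hilbert R) (S : H -> H) x y : bounded_op S ->
  ip (S x) y = ip x (adj S y).
Proof. exact: gadjE. Qed.
Lemma adjEr (H : hilbert R) (S : H -> H) x y : bounded_op S ->
  ip x (S y) = ip (adj S x) y.
Proof. exact: gadjEr. Qed.
Lemma adj_bop (H : hilbert R) (S : H -> H) : bounded_op S -> bounded_op (adj S).
Proof. exact: gadj_bop. Qed.
Lemma adjK (H : hilbert R) (S : H -> H) : bounded_op S -> adj (adj S) = S.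
Proof. exact: gadjK. Qed.
Lemma adj_comp (H : hilbert R) (S T : H -> H) : bounded_op S -> bounded_op T ->
  adj (S \o T) = adj T \o adj S.
Proof. exact: gadj_comp. Qed.
Lemma adj_uniq (H : hilbert R) (S T : H -> H) : bounded_op S ->
  (forall x y, ip (S x) y = ip x (T y)) -> adj S = T.
Proof. exact: gadj_uniq. Qed.
Lemma adj_id (H : hilbert R) : adj (@id H) = id.
Proof. by apply: adj_uniq => //; exact: bop_id. Qed.
Lemma adj_comb (H : hilbert R) c (S T : H -> H) : bounded_op S -> bounded_op T ->
  adj (fun x => c *: S x + T x) = (fun x => Num.conj c *: adj S x + adj T x).
Proof.
move=> bS bT; apply: adj_uniq => [|x y]; first exact: bop_comb.
by rewrite ipDl ipZl ipDr ipZr conjCK -!adjE.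
Qed.
Lemma isometry_gadj (H K : hilbert R) (J : H -> K) : bounded_op J ->
  (forall x y, ip (J x) (J y) = ip x y) -> gadj J \o J = id.
Proof.
move=> bJ h; apply/funext => x /=; apply: ip_extr => y.
by rewrite -gadjE.
Qed.
Lemma isometry_nr (H K : hilbert R) (J : H -> K) :
  (forall x y, ip (J x) (J y) = ip x y) -> forall x, nr (J x) = nr x.
Proof.
move=> h x; apply/eqP; rewrite -(@eqrXn2 _ 2) ?nr_ge0//.
by rewrite !nr_sqr h.
Qed.
End Hilbert.

(** * Extension of maps defined on total families *)

Section Extension.
Context {R : realType}.
Local Notation C := R[i].

Lemma inv_small (e : R) : 0 < e -> exists N : nat, forall n, (N <= n)%N -> n.+1%:R^-1 <= e.
Proof.
move=> e0; have := archi_boundP (ltW (divr_gt0 (@ltr01 R) e0)).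
set M := Num.bound _ => hM; exists M => n Mn.
rewrite -[leRHS]invrK lef_pV2 ?posrE ?ltr0Sn ?invr_gt0//.
by rewrite -div1r (le_trans (ltW hM))// ler_nat (leq_trans Mn).
Qed.

Definition lcomb (I : Type) (V : lmodType C) (u : I -> V) (s : seq (C * I)) : V :=
  \sum_(p <- s) p.1 *: u p.2.

Definition total_family (I : Type) (V : normedModType C) (u : I -> V) :=
  forall (x : V) (e : R), 0 < e -> exists s, nr (x - lcomb u s) <= e.

(** The combination [r] is found before the module and the family are given, so one formal
    combination serves in the domain and in the codomain at once. *)
Lemma lcomb_lin (I : Type) (c : C) (s t : seq (C * I)) : exists r,
  forall (V : lmodType C) (u : I -> V), lcomb u r = c *: lcomb u s + lcomb u t.
Proof.
exists ([seq (c * p.1, p.2) | p <- s] ++ t) => V u.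
rewrite /lcomb big_cat /= big_map scaler_sumr; congr (_ + _).
by apply: eq_bigr => p _; rewrite scalerA.
Qed.

(** The bound on formal combinations already contains well-definedness. The map is obtained as the
    closure [G] of the set of pairs ([lcomb u s], [lcomb v s]), which the bound makes a graph. *)
Lemma bounded_extension (I : Type) (V : normedModType C) (W : completeNormedModType C)
    (u : I -> V) (v : I -> W) (M : R) :
  0 <= M -> total_family u -> (forall s, nr (lcomb v s) <= M * nr (lcomb u s)) ->
  exists f : V -> W, [/\ linear f, bnd f M & forall i, f (u i) = v i].
Proof.
move=> M0 tu hb.
pose G x y := forall e : R, 0 < e -> exists s, nr (x - lcomb u s) <= e /\ nr (y - lcomb v s) <= e.
have Glin c x y x' y' : G x y -> G x' y' -> G (c *: x + x') (c *: y + y').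
  move=> h h' e e0; pose k := cn c + 1.
  have k0 : 0 < k by rewrite ltr_wpDl ?cn_ge0.
  have e2 : 0 < e / 2 by lra.
  have [s [h1 h2]] := h _ (divr_gt0 e2 k0).
  have [t [h3 h4]] := h' _ e2.
  have [r hr] := lcomb_lin c s t; exists r; rewrite !hr.
  have tech (U : normedModType C) (a b a' b' : U) : nr (a - b) <= e / 2 / k ->
      nr (a' - b') <= e / 2 -> nr (c *: a + a' - (c *: b + b')) <= e.
    move=> g1 g2; rewrite opprD addrACA -scalerBr (le_trans (nrD _ _))// nrZ.
    have : cn c * nr (a - b) <= e / 2.
      apply: le_trans (_ : k * nr (a - b) <= _).
        by rewrite ler_wpM2r ?nr_ge0// lerDl.
      by rewrite mulrC -ler_pdivlMr.
    lra.
  by split; apply: tech.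
have Gbnd x y : G x y -> nr y <= M * nr x.
  move=> h; apply/ler_addgt0Pl => e e0.
  pose k := M + 1; have k0 : 0 < k by rewrite /k; lra.
  have [s [h1 h2]] := h _ (divr_gt0 e0 k0).
  have := nr_le_sub y (lcomb v s); have := nr_le_sub (lcomb u s) x.
  rewrite nrB => g1 g2; apply: (le_trans g2).
  have g3 : M * nr (lcomb u s) <= M * (e / k + nr x).
    by rewrite ler_wpM2l// (le_trans g1)// lerD2r.
  have : e / k + M * (e / k) = e by rewrite /k; field; rewrite -/k gt_eqF.
  have := hb s; move: h2 g3; set a := e / k; nra.
have Gex x : exists y, G x y.
  have e0 (n : nat) : 0 < n.+1%:R^-1 :> R by rewrite invr_gt0 ltr0Sn.
  pose s n := projT1 (cid (tu x _ (e0 n))).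
  have hs n : nr (x - lcomb u (s n)) <= n.+1%:R^-1 by rewrite /s; case: cid.
  have : seqcauchy (fun n => lcomb v (s n)).
    move=> e ep; pose k := 2 * (M + 1); have k0 : 0 < k by rewrite /k; lra.
    have [N hN] := inv_small (divr_gt0 ep k0).
    exists N => m n Nm Nn.
    have [r hr] := lcomb_lin (-1) (s n) (s m).
    have -> : lcomb v (s m) - lcomb v (s n) = lcomb v r.
      by rewrite hr scaleN1r addrC.
    apply: le_trans (hb _) _; rewrite hr scaleN1r addrC.
    have := nr_triang (lcomb u (s m)) x (lcomb u (s n)).
    rewrite [X in _ <= X + _ -> _]nrB => h.
    have h2 : nr (lcomb u (s m) - lcomb u (s n)) <= 2 * (e / k).
      have := le_trans (hs m) (hN m Nm); have := le_trans (hs n) (hN n Nn).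
      by move: h; set a := e / k; lra.
    have : M * nr (lcomb u (s m) - lcomb u (s n)) <= M * (2 * (e / k)).
      by rewrite ler_wpM2l.
    move=> /le_trans; apply.
    have : 2 * (M + 1) * (e / k) = e by rewrite /k; field; rewrite gt_eqF//; lra.
    have : 0 < e / k by rewrite divr_gt0.
    set a := e / k; nra.
  move=> /seqcauchy_lim[y hy]; exists y => e ep.
  have [N hN] := inv_small ep; have [N' hN'] := hy _ ep.
  exists (s (maxn N N')); split; last by rewrite nrB hN'// leq_maxr.
  by apply: le_trans (hs _) (hN _ (leq_maxl _ _)).
pose f x := projT1 (cid (Gex x)).
have Gf x : G x (f x) by rewrite /f; case: cid.
have Gu x y y' : G x y -> G x y' -> y = y'.
  move=> h h'; have := Gbnd _ _ (Glin (-1) _ _ _ _ h h').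
  rewrite !scaleN1r addNr nr0 mulr0 => g.
  apply/eqP; rewrite eq_sym -subr_eq0 addrC; apply/eqP; apply: nr_eq0.
  by apply/eqP; rewrite eq_le g nr_ge0.
exists f; split => [c x y|x|i].
- by apply: Gu (Gf _) _; apply: Glin.
- exact: Gbnd.
- apply: Gu (Gf _) _ => e e0; exists [:: (1, i)].
  by rewrite /lcomb !big_seq1 /= !scale1r !subrr !nr0 ltW.
Qed.

Lemma nr_lcomb_iso (I : Type) (H K : hilbert R) (u : I -> H) (v : I -> K) :
  (forall i j, ip (v i) (v j) = ip (u i) (u j)) ->
  forall s, nr (lcomb v s) = nr (lcomb u s).
Proof.
move=> h s; apply/eqP; rewrite -(@eqrXn2 _ 2) ?nr_ge0// !nr_sqr; apply/eqP.
congr complex.Re; rewrite /lcomb !ip_suml; apply: eq_bigr => p _.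
rewrite !ip_sumr; apply: eq_bigr => q _.
by rewrite !ipZl !ipZr h.
Qed.

Lemma total_ext (I : Type) (V W : normedModType C) (u : I -> V) (f g : V -> W) :
  total_family u -> bounded_op f -> bounded_op g -> (forall i, f (u i) = g (u i)) ->
  f = g.
Proof.
move=> tu bf bg h; apply/funext => x.
have [M M0 bM] := bop_bnd bf; have [N N0 bN] := bop_bnd bg.
apply/eqP; rewrite -subr_eq0; apply/eqP; apply: nr_small => e e0.
pose k := M + N + 1; have k0 : 0 < k by rewrite /k; lra.
have [s hs] := tu x _ (divr_gt0 e0 k0).
have fg : f (lcomb u s) = g (lcomb u s).
  rewrite /lcomb (lin_sum (bop_lin bf)) (lin_sum (bop_lin bg)).
  by apply: eq_bigr => p _; rewrite (linZ (bop_lin bf)) (linZ (bop_lin bg)) h.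
have -> : f x - g x = f (x - lcomb u s) - g (x - lcomb u s).
  rewrite (linB (bop_lin bf)) (linB (bop_lin bg)).
  by rewrite fg opprB addrA subrK.
apply: le_trans (nrD _ _) _; rewrite nrN.
have := bM (x - lcomb u s); have := bN (x - lcomb u s).
have : (M + N) * nr (x - lcomb u s) <= k * (e / k).
  by apply: ler_pM; rewrite ?nr_ge0 ?addr_ge0// lerDl.
rewrite mulrCA divff ?mulr1 ?gt_eqF//; lra.
Qed.

Lemma total_ip (I : Type) (H : hilbert R) (u : I -> H) (x y : H) :
  total_family u -> (forall i, ip x (u i) = ip y (u i)) -> x = y.
Proof.
move=> tu h; apply: ip_extr => z.
have b w : bounded_op (fun z : H => ip z w : C^o).
  apply: (@bnd_op _ _ _ _ (nr w)) => [c a b|a]; first by rewrite ip_linear.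
  by rewrite mulrC; exact: CS.
have := total_ext tu (b x) (b y) => /(_ (fun i => _)) e.
have {}e : (fun z : H => ip z x : C^o) = (fun z => ip z y).
  by apply: e => i; rewrite ip_conj h -ip_conj.
by have := congr1 (fun f => f z) e.
Qed.
End Extension.

(** * Finite orthonormal systems *)

Section OrthoSeq.
Context {R : realType} (H : hilbert R).
Local Notation C := R[i].

Fixpoint onseq (e : seq H) : Prop :=
  if e is z :: e' then [/\ nr z = 1, forall w, w \in e' -> ip z w = 0 & onseq e'] else True.

Definition oproj (e : seq H) (x : H) : H := \sum_(z <- e) ip x z *: z.

Lemma oproj_ip e x y : ip (oproj e x) y = ip x (oproj e y).
Proof.
rewrite /oproj ip_suml ip_sumr; apply: eq_bigr => z _.
by rewrite ipZl ipZr -ip_conj mulrC.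
Qed.

Lemma oproj_lin e : linear (oproj e).
Proof.
move=> c x y; rewrite /oproj scaler_sumr -big_split /=; apply: eq_bigr => z _.
by rewrite ip_linear scalerDl scalerA.
Qed.

Lemma oproj_orth e x z : (forall w, w \in e -> ip w z = 0) -> ip (oproj e x) z = 0.
Proof.
move=> h; rewrite /oproj ip_suml big_seq big1// => w we.
by rewrite ipZl h// mulr0.
Qed.

Lemma oproj_mem e z : onseq e -> z \in e -> oproj e z = z.
Proof.
elim: e => [//|w e IH] /= [nw ow oe]; rewrite inE => /orP[/eqP ->|ze].
  rewrite /oproj big_cons ipxx nw expr1n scale1r big_seq big1 ?addr0// => v ve.
  by rewrite ow// scale0r.
rewrite /oproj big_cons ip_conj ow// rmorph0 scale0r add0r.
exact: IH.
Qed.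

Lemma oproj_idem e x : onseq e -> oproj e (oproj e x) = oproj e x.
Proof.
move=> oe; rewrite {2 3}/oproj (lin_sum (oproj_lin e)) !big_seq.
by apply: eq_bigr => z ze; rewrite (linZ (oproj_lin e)) oproj_mem.
Qed.

(** Membership in the span of e is expressed as being fixed by [oproj e], so that expanding a vector
    in e is a rewrite. *)
Lemma gram_schmidt (ys : seq H) : exists2 e, onseq e & forall y, y \in ys -> oproj e y = y.
Proof.
elim: ys => [|y ys [e oe he]]; first by exists [::].
pose w := y - oproj e y.
have we z : z \in e -> ip w z = 0.
  by move=> ze; rewrite /w ipBl oproj_ip oproj_mem// subrr.
have [w0|w0] := eqVneq (nr w) 0.
  exists e => // v; rewrite inE => /orP[/eqP ->|]; last exact: he.
  by apply/eqP; rewrite eq_sym -subr_eq0; apply/eqP; exact: nr_eq0.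
have wp : 0 < nr w by rewrite lt_neqAle eq_sym w0 nr_ge0.
pose z := (nr w)^-1%:C *: w.
have ze v : v \in e -> ip z v = 0 by move=> ve; rewrite ipZl we// mulr0.
have ze' x : oproj e x = x -> ip x z = 0.
  by move=> <-; apply: oproj_orth => v ve; rewrite ip_conj ze// rmorph0.
exists (z :: e) => /=.
  by split=> //; rewrite nrZ cn_ge0r ?invr_ge0 ?nr_ge0// mulVf.
move=> v; rewrite inE => /orP[/eqP ->|vy]; rewrite /oproj big_cons -/(oproj e _).
  have -> : y = w + oproj e y by rewrite subrK.
  rewrite ipDl (ze' (oproj e y)) ?oproj_idem// addr0.
  rewrite (linD (oproj_lin e)) oproj_idem// (_ : oproj e w = 0) ?add0r; last first.
    by rewrite /oproj big_seq big1// => v' /we ->; rewrite scale0r.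
  congr (_ + _); rewrite /z ipZr conj_real ipxx scalerA -!rmorphM /=.
  by rewrite (_ : _ * _ = 1) ?scale1r//; field.
by rewrite he// ze' ?he// scale0r add0r.
Qed.
End OrthoSeq.

(** * Tensor products *)

Section TensorBasics.
Context {R : realType}.
Local Notation C := R[i].

(** The residual of the projection of x on the closed span is orthogonal to the whole family, hence
    zero. *)
Lemma total_orth (I : Type) (H : hilbert R) (u : I -> H) :
  (forall x, (forall i, ip x (u i) = 0) -> x = 0) -> total_family u.
Proof.
move=> h.
pose D : set H := [set x | forall e : R, 0 < e -> exists s, nr (x - lcomb u s) <= e].
have D0 : D 0.
  by move=> e e0; exists [::]; rewrite /lcomb big_nil subrr nr0 ltW.
have cD : closed_sub D.
  split=> // [c x y hx hy e e0|v l hv hl e e0].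
    pose k := cn c + 1; have k0 : 0 < k by rewrite ltr_wpDl ?cn_ge0.
    have e2 : 0 < e / 2 by lra.
    have [s hs] := hx _ (divr_gt0 e2 k0); have [t ht] := hy _ e2.
    have [r hr] := lcomb_lin c s t; exists r; rewrite hr.
    rewrite opprD addrACA -scalerBr (le_trans (nrD _ _))// nrZ.
    have : cn c * nr (x - lcomb u s) <= e / 2.
      apply: le_trans (_ : k * nr (x - lcomb u s) <= _).
        by rewrite ler_wpM2r ?nr_ge0// lerDl.
      by rewrite mulrC -ler_pdivlMr.
    lra.
  have e2 : 0 < e / 2 by lra.
  have [N hN] := hl _ e2; have [s hs] := hv N _ e2.
  exists s; have := nr_triang l (v N) (lcomb u s).
  have := hN N (leqnn _); rewrite nrB; lra.
move=> x; have [y Dy hy] := projection_thm x cD.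
have x0 : x - y = 0.
  apply: h => i; apply: hy => e e0; exists [:: (1, i)].
  by rewrite /lcomb big_seq1 /= scale1r subrr nr0 ltW.
by move/eqP: x0; rewrite subr_eq0 => /eqP ->.
Qed.

Section One.
Variables (H K : hilbert R) (T : htensor H K).

Lemma tensDl x x' y : tens T (x + x') y = tens T x y + tens T x' y.
Proof. by have := tens_linl T 1 x x' y; rewrite !scale1r. Qed.
Lemma tensDr x y y' : tens T x (y + y') = tens T x y + tens T x y'.
Proof. by have := tens_linr T 1 x y y'; rewrite !scale1r. Qed.
Lemma tens0l y : tens T 0 y = 0.
Proof. by apply: (addrI (tens T 0 y)); rewrite -tensDl !addr0. Qed.
Lemma tens0r x : tens T x 0 = 0.
Proof. by apply: (addrI (tens T x 0)); rewrite -tensDr !addr0. Qed.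
Lemma tensZl c x y : tens T (c *: x) y = c *: tens T x y.
Proof. by have := tens_linl T c x 0 y; rewrite !addr0 tens0l addr0. Qed.
Lemma tensZr c x y : tens T x (c *: y) = c *: tens T x y.
Proof. by have := tens_linr T c x y 0; rewrite !addr0 tens0r addr0. Qed.
Lemma tens_suml I (s : seq I) (F : I -> H) y :
  tens T (\sum_(i <- s) F i) y = \sum_(i <- s) tens T (F i) y.
Proof. by elim: s => [|i s IH]; rewrite ?big_nil ?tens0l// !big_cons tensDl IH. Qed.
Lemma tens_sumr I (s : seq I) (F : I -> K) x :
  tens T x (\sum_(i <- s) F i) = \sum_(i <- s) tens T x (F i).
Proof. by elim: s => [|i s IH]; rewrite ?big_nil ?tens0r// !big_cons tensDr IH. Qed.
Lemma nr_tens x y : nr (tens T x y) = nr x * nr y.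
Proof.
apply/eqP; rewrite -(@eqrXn2 _ 2) ?nr_ge0 ?mulr_ge0 ?nr_ge0// exprMn !nr_sqr.
by rewrite tens_ip !ipxx -rmorphM.
Qed.

Definition tfam (p : H * K) : T := tens T p.1 p.2.
Lemma tens_total : total_family tfam.
Proof.
move=> x e e0; have [|n [a [b hab]]] := tens_dense x (e := e%:C); first by rewrite ltcR.
exists [seq (1, (a k, b k)) | k <- index_enum 'I_n].
rewrite /lcomb big_map /=; under eq_bigr do rewrite scale1r.
by rewrite -lecR -nrE.
Qed.

Definition tensr (y : K) (x : H) : T := tens T x y.
Definition tensl (x : H) (y : K) : T := tens T x y.
Lemma tensr_bnd y : bnd (tensr y) (nr y).
Proof. by move=> x; rewrite nr_tens mulrC. Qed.
Lemma tensl_bnd x : bnd (tensl x) (nr x).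
Proof. by move=> y; rewrite nr_tens. Qed.
Lemma tensr_bop y : bounded_op (tensr y).
Proof. by apply: (bnd_op _ (@tensr_bnd y)) => c a b; rewrite /tensr tens_linl. Qed.
Lemma tensl_bop x : bounded_op (tensl x).
Proof. by apply: (bnd_op _ (@tensl_bnd x)) => c a b; rewrite /tensl tens_linr. Qed.

Lemma tens_ext (W : normedModType C) (f g : T -> W) : bounded_op f -> bounded_op g ->
  (forall x y, f (tens T x y) = g (tens T x y)) -> f = g.
Proof. by move=> bf bg h; apply: (total_ext tens_total) => // -[x y]; exact: h. Qed.
Lemma tens_ipext (u v : T) : (forall x y, ip u (tens T x y) = ip v (tens T x y)) -> u = v.
Proof. by move=> h; apply: (total_ip tens_total) => -[x y]; exact: h. Qed.
Lemma tens_opext (X Y : T -> T) : bounded_op X -> bounded_op Y ->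
  (forall x y x' y', ip (X (tens T x y)) (tens T x' y') = ip (Y (tens T x y)) (tens T x' y')) ->
  X = Y.
Proof. by move=> bX bY h; apply: tens_ext => // x y; apply: tens_ipext. Qed.

Lemma nr_onsum (e : seq K) (a : K -> H) : onseq e ->
  nr (\sum_(z <- e) tens T (a z) z) ^+ 2 = \sum_(z <- e) nr (a z) ^+ 2.
Proof.
elim: e => [|z e IH] /=; first by rewrite !big_nil nr0 expr0n.
move=> [nz oz oe]; rewrite !big_cons pythagoras ?IH// ?nr_tens ?nz ?mulr1//.
by rewrite ip_sumr big_seq big1// => w we; rewrite tens_ip oz// mulr0.
Qed.

Lemma tens_oproj (e : seq K) (s : seq (C * (H * K))) :
  (forall p, p \in s -> oproj e p.2.2 = p.2.2) ->
  lcomb tfam s = \sum_(z <- e) tens T (\sum_(p <- s) (p.1 * ip p.2.2 z) *: p.2.1) z.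
Proof.
move=> he; under eq_bigr do rewrite tens_suml; rewrite exchange_big /=.
rewrite /lcomb !big_seq; apply: eq_bigr => p ps.
rewrite /tfam -{1}(he p ps) /oproj tens_sumr scaler_sumr; apply: eq_bigr => z _.
by rewrite tensZl tensZr scalerA.
Qed.
End One.

(** The second legs of a finite combination are expanded in an orthonormal system. The terms become
    orthogonal, and Pythagoras reduces the bound for S (x) id to that for S on each coefficient. *)
Lemma tensl_extension (H H' K : hilbert R) (T : htensor H K) (T' : htensor H' K)
    (S : H -> H') M : linear S -> 0 <= M -> bnd S M ->
  exists X : T -> T', [/\ linear X, bnd X M &
    forall x y, X (tens T x y) = tens T' (S x) y].
Proof.
move=> lS M0 bS.
have [||X [lX bX hX]] := @bounded_extension R (H * K)%type T T' (@tfam _ _ T)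
    (fun p => tens T' (S p.1) p.2) M M0.
- exact: tens_total.
- move=> s; have [e oe he] := gram_schmidt [seq p.2.2 | p <- s].
  have he' p : p \in s -> oproj e p.2.2 = p.2.2.
    by move=> ps; apply: he; apply: (map_f (fun p => p.2.2)).
  rewrite (tens_oproj T he').
  have -> : lcomb (fun p => tens T' (S p.1) p.2) s =
      \sum_(z <- e) tens T' (S (\sum_(p <- s) (p.1 * ip p.2.2 z) *: p.2.1)) z.
    have -> : lcomb (fun p => tens T' (S p.1) p.2) s =
        lcomb (@tfam _ _ T') [seq (p.1, (S p.2.1, p.2.2)) | p <- s].
      by rewrite /lcomb big_map.
    rewrite (@tens_oproj _ _ _ e); last first.
      by move=> p /mapP[q /he' hq ->].
    apply: eq_bigr => z _; rewrite big_map (lin_sum lS); congr tens.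
    by apply: eq_bigr => p _; rewrite (linZ lS).
  rewrite -(@ler_pXn2r _ 2)// ?nnegrE ?nr_ge0 ?mulr_ge0 ?nr_ge0//.
  rewrite exprMn !nr_onsum// mulr_sumr; apply: ler_sum => z _.
  rewrite -exprMn lerXn2r ?nnegrE ?nr_ge0 ?mulr_ge0 ?nr_ge0//.
by exists X; split => // x y; rewrite -(hX (x, y)).
Qed.

Lemma iso_extension (I : Type) (H K : hilbert R) (u : I -> H) (v : I -> K) :
  total_family u -> (forall i j, ip (v i) (v j) = ip (u i) (u j)) ->
  exists J : H -> K, [/\ bounded_op J, forall x y, ip (J x) (J y) = ip x y
    & forall i, J (u i) = v i].
Proof.
move=> tu huv.
have [|J [lJ bJ hJ]] := @bounded_extension R I H K u v 1 ler01 tu.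
  by move=> s; rewrite mul1r (nr_lcomb_iso huv).
have bopJ := bnd_op lJ bJ.
exists J; split => // x y.
have -> : ip (J x) (J y) = ip x (gadj J (J y)) by rewrite -gadjE.
congr ip; apply: (total_ip tu) => i; rewrite -gadjEr// hJ.
have -> : ip (J y) (v i) = ip y (gadj J (v i)) by rewrite gadjE.
congr ip; apply: (total_ip tu) => j.
by rewrite -gadjEr// hJ huv.
Qed.

Variable tp : tensor_products R.

(** Maps between different spaces are allowed because compressions by isometries need them; on one
    pair of spaces this is convertible to [op_tens]. *)
Definition gtens (H K H' K' : hilbert R) (S : H -> H') (T : K -> K') :
    tp H K -> tp H' K' :=
  xget (fun=> 0) [set X | bounded_op X /\
    forall x y, X (tens (tp H K) x y) = tens (tp H' K') (S x) (T y)].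

Lemma flip_extension (H K : hilbert R) : exists J : tp H K -> tp K H,
  [/\ bounded_op J, forall v, nr (J v) = nr v & forall x y, J (tens _ x y) = tens _ y x].
Proof.
have [||J [bJ iJ hJ]] := @iso_extension (H * K)%type (tp H K) (tp K H) (@tfam _ _ _)
    (fun p => tens _ p.2 p.1).
- exact: tens_total.
- by move=> i j; rewrite /tfam !tens_ip mulrC.
- by exists J; split => // [|x y]; [exact: isometry_nr|rewrite -(hJ (x, y))].
Qed.

Section Gtens.
Variables (H K H' K' : hilbert R) (S : H -> H') (T : K -> K').
Hypotheses (bS : bounded_op S) (bT : bounded_op T).

(** [tensl_extension] acts on the first leg only, so T is brought there by a flip and the legs are
    flipped back afterwards. *)
Lemma gtens_ex M N : 0 <= M -> 0 <= N -> bnd S M -> bnd T N ->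
  exists X : tp H K -> tp H' K', [/\ bounded_op X, bnd X (N * M) &
    forall x y, X (tens (tp H K) x y) = tens (tp H' K') (S x) (T y)].
Proof.
move=> M0 N0 hM hN.
have [X [lX bX hX]] := tensl_extension (tp H K) (tp H' K) (bop_lin bS) M0 hM.
have [Y [lY bY hY]] := tensl_extension (tp K H') (tp K' H') (bop_lin bT) N0 hN.
have [F [bF nF hF]] := flip_extension H' K; have [F' [bF' nF' hF']] := flip_extension K' H'.
exists (F' \o Y \o F \o X); split => [|v|x y /=].
- do 2!(apply: bop_comp; last by [apply: bnd_op bX|]); apply: bop_comp => //.
  exact: bnd_op bY.
- rewrite /= nF'; apply: le_trans (bY _) _; rewrite nF -mulrA.
  by rewrite ler_wpM2l.
- by rewrite hX hF hY hF'.
Qed.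

Lemma gtens_spec : bounded_op (gtens S T) /\
    forall x y, gtens S T (tens (tp H K) x y) = tens (tp H' K') (S x) (T y).
Proof.
have [M M0 hM] := bop_bnd bS; have [N N0 hN] := bop_bnd bT.
have [X [h1 _ h2]] := gtens_ex M0 N0 hM hN.
by rewrite /gtens; case: xgetP => [Y _ //|/(_ X)]; case.
Qed.
Lemma gtens_bop : bounded_op (gtens S T). Proof. by have [] := gtens_spec. Qed.
Lemma gtensE x y : gtens S T (tens (tp H K) x y) = tens (tp H' K') (S x) (T y).
Proof. by have [] := gtens_spec. Qed.
Lemma gtens_uniq (X : tp H K -> tp H' K') : bounded_op X ->
  (forall x y, X (tens (tp H K) x y) = tens (tp H' K') (S x) (T y)) -> gtens S T = X.
Proof.
move=> bX hX; apply: tens_ext => // [|x y]; first exact: gtens_bop.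
by rewrite gtensE hX.
Qed.
Lemma gtens_bnd M N : 0 <= M -> 0 <= N -> bnd S M -> bnd T N -> bnd (gtens S T) (N * M).
Proof.
move=> M0 N0 hM hN; have [X [bX hX eX]] := gtens_ex M0 N0 hM hN.
by rewrite (gtens_uniq bX eX).
Qed.
End Gtens.

Lemma gtens_adj (H K H' K' : hilbert R) (S : H -> H') (T : K -> K') :
  bounded_op S -> bounded_op T -> gadj (gtens S T) = gtens (gadj S) (gadj T).
Proof.
move=> bS bT; symmetry; apply: gtens_uniq; do ?exact: gadj_bop.
  by apply: gadj_bop; exact: gtens_bop.
move=> x y; apply: tens_ipext => x' y'.
by rewrite -(gadjEr _ _ (gtens_bop bS bT)) (gtensE bS bT) !tens_ip -!gadjEr.
Qed.
Lemma gtens_comp (H K H' K' H2 K2 : hilbert R) (S : H -> H') (T : K -> K')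
    (S' : H' -> H2) (T' : K' -> K2) :
  bounded_op S -> bounded_op T -> bounded_op S' -> bounded_op T' ->
  gtens S' T' \o gtens S T = gtens (S' \o S) (T' \o T).
Proof.
move=> bS bT bS' bT'; symmetry; apply: gtens_uniq => [||| x y /=]; do ?exact: bop_comp.
  by apply: bop_comp; exact: gtens_bop.
by rewrite !gtensE.
Qed.
Lemma gtens_id (H K : hilbert R) : gtens (@id H) (@id K) = id.
Proof. by apply: gtens_uniq => //; exact: bop_id. Qed.
Lemma gtens_iso (H K H' K' : hilbert R) (S : H -> H') (T : K -> K') :
  bounded_op S -> bounded_op T -> gadj S \o S = id -> gadj T \o T = id ->
  gadj (gtens S T) \o gtens S T = id.
Proof.
move=> bS bT hS hT; rewrite gtens_adj// gtens_comp//; do ?exact: gadj_bop.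
by rewrite hS hT gtens_id.
Qed.
Lemma op_tens_gtens (H K : hilbert R) (S : H -> H) (T : K -> K) :
  op_tens (tp := tp) S T = gtens S T.
Proof. by []. Qed.

Section Legs.
Variables (H K : hilbert R).
Notation T3 := (tp (tp H H) K).
Notation tri x1 x2 y := (tens T3 (tens (tp H H) x1 x2) y).

Definition trifam (p : H * H * K) : T3 := tri p.1.1 p.1.2 p.2.
Lemma tri_total : total_family trifam.
Proof.
apply: total_orth => z hz; apply: tens_ipext => w y; rewrite ip0l.
rewrite -[tens _ w y]/(tensr T3 y w) gadjEr; last exact: tensr_bop.
rewrite (_ : gadj _ z = 0) ?ip0l//.
apply: tens_ipext => x1 x2; rewrite ip0l -gadjEr; last exact: tensr_bop.
exact: (hz (x1, x2, y)).
Qed.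

Lemma tri_total' : total_family (fun p : H * H * K =>
  tens (tp H (tp H K)) p.1.1 (tens (tp H K) p.1.2 p.2)).
Proof.
apply: total_orth => z hz; apply: tens_ipext => y w; rewrite ip0l.
rewrite -[tens _ y w]/(tensl _ y w) gadjEr; last exact: tensl_bop.
rewrite (_ : gadj _ z = 0) ?ip0l//.
apply: tens_ipext => x1 x2; rewrite ip0l -gadjEr; last exact: tensl_bop.
exact: (hz (y, x1, x2)).
Qed.

(** Reassociates the triple product and, for [sw = true], also moves the second factor to the front;
    then X_13 and X_23 are both conjugates of id (x) X. *)
Lemma leg_unitary (sw : bool) : exists J : T3 -> tp H (tp H K), [/\ bounded_op J,
  gadj J \o J = id, J \o gadj J = id &
  forall x1 x2 y, J (tri x1 x2 y) =
    if sw then tens _ x2 (tens _ x1 y) else tens _ x1 (tens _ x2 y)].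
Proof.
pose v (p : H * H * K) : tp H (tp H K) :=
  if sw then tens _ p.1.2 (tens _ p.1.1 p.2) else tens _ p.1.1 (tens _ p.1.2 p.2).
have [|J [bJ iJ hJ]] := @iso_extension _ _ _ trifam v tri_total.
  by move=> i j; rewrite /v /trifam; case: (sw); rewrite !tens_ip; ring.
have JJ := isometry_gadj bJ iJ.
exists J; split => // [|x1 x2 y]; last exact: (hJ (x1, x2, y)).
apply: (total_ext tri_total') => [||[[x1 x2] y] /=]; last 1 first.
- have [p ->] : exists p, tens (tp H (tp H K)) x1 (tens (tp H K) x2 y) = J (trifam p).
    rewrite /v in hJ; case: (sw) hJ => hJ.
      by exists (x2, x1, y); rewrite hJ.
    by exists (x1, x2, y); rewrite hJ.
  by have /= -> := congr1 (fun f => f (trifam p)) JJ.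
- by apply: bop_comp => //; exact: gadj_bop.
- exact: bop_id.
Qed.

Lemma leg_ex (sw : bool) (X : tp H K -> tp H K) : bounded_op X -> exists Y : T3 -> T3,
  [/\ bounded_op Y, forall x1 x2 y x1' x2' y',
    ip (Y (tri x1 x2 y)) (tri x1' x2' y') =
    (if sw then ip x2 x2' * ip (X (tens _ x1 y)) (tens _ x1' y')
     else ip x1 x1' * ip (X (tens _ x2 y)) (tens _ x2' y'))
    & gadj X \o X = id -> gadj Y \o Y = id].
Proof.
move=> bX; have [J [bJ JJ JJ' hJ]] := leg_unitary sw.
have b1 : bounded_op (gtens (@id H) X) by apply: gtens_bop => //; exact: bop_id.
have bY : bounded_op (gadj J \o (gtens (@id H) X \o J)).
  by apply: bop_comp; [exact: gadj_bop|exact: bop_comp].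
exists (gadj J \o (gtens (@id H) X \o J)); split => //.
  move=> x1 x2 y x1' x2' y' /=; rewrite -gadjEr// !hJ.
  by case: (sw); rewrite gtensE// ?tens_ip//; exact: bop_id.
move=> XX; have X1 : gadj (gtens (@id H) X) \o gtens (@id H) X = id.
  by apply: gtens_iso => //; [exact: bop_id|rewrite -adj_gadj adj_id].
rewrite (gadj_comp (gadj_bop bJ) (bop_comp b1 bJ)) (gadjK bJ) (gadj_comp b1 bJ).
apply/funext => z /=.
have e1 (u : tp H (tp H K)) : J (gadj J u) = u by have := congr1 (fun f => f u) JJ'.
have e2 (u : tp H (tp H K)) : gadj (gtens id X) (gtens id X u) = u.
  by have := congr1 (fun f => f u) X1.
rewrite e1 e2; by have := congr1 (fun f => f z) JJ.
Qed.

Lemma leg13_spec (X : tp H K -> tp H K) : bounded_op X ->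
  [/\ bounded_op (leg13 X), forall x1 x2 y x1' x2' y',
    ip (leg13 X (tri x1 x2 y)) (tri x1' x2' y') =
      ip x2 x2' * ip (X (tens _ x1 y)) (tens _ x1' y')
    & gadj X \o X = id -> gadj (leg13 X) \o leg13 X = id].
Proof.
move=> bX; have [Y [bY hY iY]] := leg_ex true bX.
suff -> : leg13 X = Y by [].
rewrite /leg13; case: xgetP => [Z _ [bZ hZ]|/(_ Y)]; last by case.
by apply: (total_ext tri_total) => // -[[x1 x2] y]; apply: (total_ip tri_total) => -[[x1' x2'] y'];
  rewrite hZ hY.
Qed.
Lemma leg23_spec (X : tp H K -> tp H K) : bounded_op X ->
  [/\ bounded_op (leg23 X), forall x1 x2 y x1' x2' y',
    ip (leg23 X (tri x1 x2 y)) (tri x1' x2' y') =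
      ip x1 x1' * ip (X (tens _ x2 y)) (tens _ x2' y')
    & gadj X \o X = id -> gadj (leg23 X) \o leg23 X = id].
Proof.
move=> bX; have [Y [bY hY iY]] := leg_ex false bX.
suff -> : leg23 X = Y by [].
rewrite /leg23; case: xgetP => [Z _ [bZ hZ]|/(_ Y)]; last by case.
by apply: (total_ext tri_total) => // -[[x1 x2] y]; apply: (total_ip tri_total) => -[[x1' x2'] y'];
  rewrite hZ hY.
Qed.
End Legs.
End TensorBasics.

(** * Building Hilbert spaces *)

Section Packaging.
Context {R : realType}.
Local Notation C := R[i].

(** Subspaces given as data, so that the module structure is built once for its three uses: closed
    subspaces, square-summable sequences, and the image of a representation. *)
Record lsub := LSub {
  lsV : lmodType C;
  lsD : set lsV;
  ls0 : lsD 0;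
  lsl : forall c x y, lsD x -> lsD y -> lsD (c *: x + y)
}.

Section LSub.
Variable d : lsub.
Definition lsp : {pred lsV d} := fun x => `[< lsD x >].
Record lsubT : Type := LSubT { lsval : lsV d; lsvalP : lsval \in lsp }.
HB.instance Definition _ := [isSub of lsubT for lsval].
HB.instance Definition _ := [Choice of lsubT by <:].
Lemma lsp_closed : submod_closed lsp.
Proof.
split; first by apply/asboolP; exact: ls0.
by move=> c x y /asboolP hx /asboolP hy; apply/asboolP; exact: lsl.
Qed.
HB.instance Definition _ := GRing.isSubmodClosed.Build C (lsV d) lsp lsp_closed.
HB.instance Definition _ := [SubChoice_isSubLmodule of lsubT by <:].

Definition lsmk (x : lsV d) (h : lsD x) : lsubT := LSubT (asboolT h).
Lemma lsvalD (x : lsubT) : lsD (lsval x).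
Proof. by have /asboolP := lsvalP x. Qed.
Lemma lsval_inj (x y : lsubT) : lsval x = lsval y -> x = y.
Proof. exact: val_inj. Qed.
End LSub.

Record normdata := NormData {
  ndV : lmodType C;
  ndN : ndV -> R;
  nd_tri : forall x y, ndN (x + y) <= ndN x + ndN y;
  nd_scal : forall c x, ndN (c *: x) = cn c * ndN x;
  nd_eq0 : forall x, ndN x = 0 -> x = 0;
  nd_compl : forall u : nat -> ndV,
    (forall e : R, 0 < e -> exists N, forall m n, (N <= m)%N -> (N <= n)%N -> ndN (u m - u n) <= e) ->
    exists l, forall e : R, 0 < e -> exists N, forall n, (N <= n)%N -> ndN (u n - l) <= e
}.

Definition ndT (d : normdata) : Type := ndV d.
Section ND.
Variable d : normdata.
HB.instance Definition _ := GRing.Lmodule.on (ndT d).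
Definition ndnorm (x : ndT d) : C := (ndN x)%:C.
Lemma ndnorm_tri x y : ndnorm (x + y) <= ndnorm x + ndnorm y.
Proof. by rewrite /ndnorm -rmorphD /= lecR nd_tri. Qed.
Lemma ndnorm_scal (c : C) (x : ndT d) : ndnorm (c *: x) = `|c| * ndnorm x.
Proof. by rewrite /ndnorm nd_scal rmorphM /= cnE. Qed.
Lemma ndnorm_eq0 x : ndnorm x = 0 -> x = 0.
Proof. by move=> /complexI /nd_eq0. Qed.
HB.instance Definition _ := @Lmodule_isNormed.Build C (ndT d) ndnorm
  ndnorm_tri ndnorm_scal ndnorm_eq0.
Lemma nd_nr (x : ndT d) : nr x = ndN x.
Proof. by []. Qed.

(** Pick points whose balls of radius 1/(n+1) belong to the filter. Any two of these balls meet, so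
    the centres form a Cauchy sequence, and its limit is the limit of the filter. *)
Lemma nd_complete (F : set_system (ndT d)) : ProperFilter F -> cauchy F -> cvg F.
Proof.
move=> FF cF.
have e0 (n : nat) : 0 < (n.+1%:R^-1)%:C :> C by rewrite ltcR invr_gt0 ltr0Sn.
have hx (n : nat) : exists x : ndT d, F (ball x (n.+1%:R^-1)%:C).
  exact: ((cauchyP F).1 cF _ (e0 n)).
pose u n := projT1 (cid (hx n)).
have hu n : F (ball (u n) (n.+1%:R^-1)%:C) by rewrite /u; case: cid.
have close m n : nr (u m - u n) <= m.+1%:R^-1 + n.+1%:R^-1.
  have [z [h1 h2]] := filter_ex (filterI (hu m) (hu n)).
  rewrite -!ball_normE /= !nrE !ltcR in h1 h2.
  by rewrite (le_trans (nr_triang _ z _))// [nr (z - _)]nrB ltW// ltrD.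
have : seqcauchy u.
  move=> e ep; have e2 : 0 < e / 2 by lra.
  have [N hN] := inv_small e2; exists N => m n Nm Nn.
  apply: le_trans (close m n) _.
  by rewrite [e]splitr lerD// hN.
move=> /nd_compl[l0 hl0].
pose l : ndT d := l0; have hl : seqlim u l by []; clearbody l.
apply/cvg_ex; exists l; apply/cvg_ballP => _ /epsC[r r0 ->].
have r2 : 0 < r / 2 by lra.
have [N hN] := inv_small r2; have [N' hN'] := hl _ r2.
apply: filterS (hu (maxn N N')) => z; rewrite -!ball_normE /= !nrE !ltcR => h.
have h3 : nr (l - z) <= nr (l - u (maxn N N')) + nr (u (maxn N N') - z) := @nr_triang R (ndT d) l _ z.
apply: (le_lt_trans h3).
rewrite [r]splitr ler_ltD//; first by rewrite nrB hN'// leq_maxr.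
by apply: lt_le_trans h _; rewrite hN// leq_maxl.
Qed.
HB.instance Definition _ := Uniform_isComplete.Build (ndT d) nd_complete.
Definition ndsp : completeNormedModType C := ndT d.
End ND.

(** The triangle inequality is not part of the data: it follows from Cauchy-Schwarz, in [id_tri]. *)
Record ipdata := IpData {
  idV : lmodType C;
  idq : idV -> idV -> C;
  idN : idV -> R;
  id_linear : forall c x y z, idq (c *: x + y) z = c * idq x z + idq y z;
  id_conj : forall x y, idq y x = Num.conj (idq x y);
  id_ge0 : forall x, 0 <= idN x;
  id_xx : forall x, idq x x = (idN x ^+ 2)%:C;
  id_eq0 : forall x, idN x = 0 -> x = 0;
  id_compl : forall u : nat -> idV,
    (forall e : R, 0 < e -> exists N, forall m n, (N <= m)%N -> (N <= n)%N -> idN (u m - u n) <= e) ->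
    exists l, forall e : R, 0 < e -> exists N, forall n, (N <= n)%N -> idN (u n - l) <= e
}.

Section ID.
Variable d : ipdata.
Notation q := (@idq d).
Notation N := (@idN d).
Implicit Types x y z : idV d.

Lemma id_qDl x y z : q (x + y) z = q x z + q y z.
Proof. by have := id_linear 1 x y z; rewrite scale1r mul1r. Qed.
Lemma id_q0l z : q 0 z = 0.
Proof. by apply: (addrI (q 0 z)); rewrite -id_qDl !addr0. Qed.
Lemma id_qZl c x z : q (c *: x) z = c * q x z.
Proof. by have := id_linear c x 0 z; rewrite addr0 id_q0l addr0. Qed.
Lemma id_qDr x y z : q z (x + y) = q z x + q z y.
Proof. by rewrite id_conj id_qDl rmorphD /= -!id_conj. Qed.
Lemma id_qZr c x z : q z (c *: x) = Num.conj c * q z x.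
Proof. by rewrite id_conj id_qZl rmorphM /= -id_conj. Qed.
Lemma id_N2 x : N x ^+ 2 = complex.Re (q x x).
Proof. by rewrite id_xx. Qed.

Lemma id_comb (a b : R) x y :
  N (a%:C *: x + b%:C *: y) ^+ 2 = a ^+ 2 * N x ^+ 2 + b ^+ 2 * N y ^+ 2 + 2 * (a * b) * complex.Re (q x y).
Proof.
rewrite !id_N2 id_qDl !id_qDr !id_qZl !id_qZr !conj_real.
by rewrite !ReD !ReM_real (id_conj x y) ReJ; ring.
Qed.
Lemma id_scal c x : N (c *: x) = cn c * N x.
Proof.
apply/eqP; rewrite -(@eqrXn2 _ 2) ?mulr_ge0 ?id_ge0 ?cn_ge0//; apply/eqP.
apply: complexI; rewrite -id_xx id_qZl id_qZr mulrA cn_sqr id_xx -rmorphM.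
by rewrite exprMn.
Qed.
Lemma id_CS x y : complex.Re (q x y) <= N x * N y.
Proof.
have h : 0 <= N ((N y)%:C *: x + (- N x)%:C *: y) ^+ 2 by exact: sqr_ge0.
rewrite id_comb in h.
have [x0|x0] := eqVneq (N x) 0; first by rewrite (id_eq0 x0) id_q0l mulr_ge0 ?id_ge0.
have [y0|y0] := eqVneq (N y) 0.
  by rewrite (id_eq0 y0) id_conj id_q0l rmorph0 mulr_ge0 ?id_ge0.
have xp : 0 < N x by rewrite lt_neqAle eq_sym x0 id_ge0.
have yp : 0 < N y by rewrite lt_neqAle eq_sym y0 id_ge0.
rewrite -(ler_pM2l (mulr_gt0 xp yp)); move: h; set t := complex.Re _; nra.
Qed.
Lemma id_tri x y : N (x + y) <= N x + N y.
Proof.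
rewrite -(@ler_pXn2r _ 2)// ?nnegrE ?addr_ge0 ?id_ge0//.
have := id_comb 1 1 x y; rewrite !scale1r => ->.
have := id_CS x y; nra.
Qed.
Definition id_nd : normdata := NormData id_tri id_scal (@id_eq0 d) (@id_compl d).
Lemma id_norm (x : ndsp id_nd) : `|x| ^+ 2 = q x x.
Proof. by rewrite id_xx nrE rmorphXn. Qed.
Definition id_hilbert : hilbert R :=
  @Hilbert R (ndsp id_nd) q (@id_linear d) (@id_conj d) id_norm.
End ID.

End Packaging.

Section SubHilbert.
Context {R : realType}.
Local Notation C := R[i].
Variables (H : hilbert R) (D : set H) (cD : closed_sub D).

Lemma csub0 : D 0. Proof. by case: cD. Qed.
Lemma csubl c x y : D x -> D y -> D (c *: x + y).
Proof. by case: cD => _ + _; exact. Qed.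
Definition csub_ls : @lsub R := @LSub R H D csub0 csubl.

Lemma csub_compl (u : nat -> lsubT csub_ls) :
  (forall e : R, 0 < e -> exists N, forall m n, (N <= m)%N -> (N <= n)%N ->
    nr (lsval (u m - u n) : H) <= e) ->
  exists l, forall e : R, 0 < e -> exists N, forall n, (N <= n)%N ->
    nr (lsval (u n - l) : H) <= e.
Proof.
move=> h; have : seqcauchy (fun n => lsval (u n) : H).
  move=> e e0; have [N hN] := h e e0; exists N => m n Nm Nn; exact: (hN m n).
move=> /seqcauchy_lim[l hl].
have Dl : D l by case: cD => _ _ /(_ _ _ (fun n => lsvalD (u n)) hl).
by exists (@lsmk _ csub_ls l Dl).
Qed.

Definition csub_id : @ipdata R := @IpData R (lsubT csub_ls)
  (fun x y => ip (lsval x : H) (lsval y)) (fun x => nr (lsval x : H))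
  (fun c x y z => ip_linear c _ _ _) (fun x y => ip_conj _ _) (fun x => nr_ge0 _)
  (fun x => ipxx _) (fun x h => lsval_inj (nr_eq0 h : lsval x = lsval 0)) csub_compl.

Definition subh : hilbert R := id_hilbert csub_id.
Definition sinc (x : subh) : H := lsval (x : lsubT csub_ls).
Definition smk (x : H) (h : D x) : subh := (@lsmk _ csub_ls x h : idV csub_id).

Lemma sincD x : D (sinc x). Proof. exact: (lsvalD (x : lsubT csub_ls)). Qed.
Lemma smkK x (h : D x) : sinc (smk h) = x. Proof. by []. Qed.
Lemma sinc_ip x y : ip (sinc x) (sinc y) = ip x y. Proof. by []. Qed.
Lemma sinc_inj : injective sinc.
Proof. by move=> x y h; exact: (@lsval_inj _ csub_ls x y h). Qed.
Lemma sinc_bnd : bnd sinc 1.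
Proof. by move=> x; rewrite mul1r (isometry_nr sinc_ip). Qed.
Lemma sinc_bop : bounded_op sinc.
Proof. by apply: (bnd_op _ sinc_bnd) => c x y. Qed.
Lemma sincK : gadj sinc \o sinc = id.
Proof. exact: (isometry_gadj sinc_bop sinc_ip). Qed.
Lemma sinc_gadj x : D x -> sinc (gadj sinc x) = x.
Proof.
move=> h; rewrite -{1}(smkK h).
by have /= -> := congr1 (fun f => f (smk h)) sincK.
Qed.
End SubHilbert.

Section RealComplete.
Context {R : realType}.
Local Notation C := R[i].

Lemma nr_cn (z : C^o) : nr z = cn z. Proof. by []. Qed.

Lemma real_cauchy (u : nat -> R) :
  (forall e : R, 0 < e -> exists N, forall m n, (N <= m)%N -> (N <= n)%N -> `|u m - u n| <= e) ->
  exists l : R, forall e : R, 0 < e -> exists N, forall n, (N <= n)%N -> `|u n - l| <= e.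
Proof.
move=> h; have : cvg (u @ \oo).
  apply/cauchy_cvgP; apply/cauchyP => r r0.
  have r2 : 0 < r / 2 by lra.
  have [N hN] := h _ r2.
  exists (u N); exists N => // n /= Nn; rewrite /ball /=.
  by apply: le_lt_trans (hN _ _ (leqnn N) Nn) _; lra.
move=> /cvg_ex[l] /cvgrPdist_le hl; exists l => e e0.
have [N _ hN] := hl e e0.
by exists N => n Nn; rewrite distrC; exact: hN.
Qed.

Lemma complex_cauchy (u : nat -> C) :
  (forall e : R, 0 < e -> exists N, forall m n, (N <= m)%N -> (N <= n)%N -> cn (u m - u n) <= e) ->
  exists l : C^o, seqlim (u : nat -> C^o) l.
Proof.
move=> h.
have ReB (z t : C) : complex.Re (z - t) = complex.Re z - complex.Re t.
  by rewrite ReD ReN.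
have ImB (z t : C) : complex.Im (z - t) = complex.Im z - complex.Im t.
  by case: z; case: t.
have [a ha] : exists l : R, forall e : R, 0 < e -> exists N, forall n, (N <= n)%N ->
    `|complex.Re (u n) - l| <= e.
  apply: real_cauchy => e e0; have [N hN] := h e e0; exists N => m n Nm Nn.
  by rewrite -ReB (le_trans (Re_le_cn _))// hN.
have [b hb] : exists l : R, forall e : R, 0 < e -> exists N, forall n, (N <= n)%N ->
    `|complex.Im (u n) - l| <= e.
  apply: real_cauchy => e e0; have [N hN] := h e e0; exists N => m n Nm Nn.
  by rewrite -ImB (le_trans (Im_le_cn _))// hN.
exists (a +i* b) => e e0; have e2 : 0 < e / 2 by lra.
have [N hN] := ha _ e2; have [M hM] := hb _ e2.
exists (maxn N M) => n; rewrite geq_max => /andP[/hN h1 /hM h2].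
apply: le_trans (cn_ReIm _) _; rewrite ReB ImB /=; lra.
Qed.

Lemma nneg_series (a : nat -> R) (M : R) : (forall k, 0 <= a k) ->
  (forall n, \sum_(k < n) a k <= M) ->
  exists2 s : R, (forall n, \sum_(k < n) a k <= s) &
    (forall e : R, 0 < e -> exists N, forall n, (N <= n)%N -> s - e <= \sum_(k < n) a k).
Proof.
move=> a0 aM; pose E := range (fun n : nat => \sum_(k < n) a k).
have hE : has_sup E.
  by split; [exists (\sum_(k < 0) a k), 0%N | exists M => _ [n _ <-]].
exists (sup E) => [n|e e0].
  by apply: ub_le_sup; [case: hE|exists n].
have [_ [N _ <-] hN] := sup_adherent e0 hE.
exists N => n Nn; apply: le_trans (ltW hN) _.
rewrite -!(big_mkord xpredT a) (big_cat_nat (leq0n N) Nn) /= lerDl.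
by apply: sumr_ge0.
Qed.
End RealComplete.

(** * The Hilbert space of square-summable sequences *)

Section L2.
Context {R : realType}.
Local Notation C := R[i].
Variable H : hilbert R.
Implicit Types x y : nat -> H.

Lemma sqsumP x : sqsum x <-> exists M : R, forall n, \sum_(k < n) nr (x k) ^+ 2 <= M.
Proof.
have e n : \sum_(k < n) `|x k| ^+ 2 = (\sum_(k < n) nr (x k) ^+ 2)%:C :> C.
  by rewrite rmorph_sum; apply: eq_bigr => k _; rewrite nrE rmorphXn.
split=> [[M hM]|[M hM]]; last by exists M%:C => n; rewrite e lecR.
exists (complex.Re M) => n.
by have := hM n; rewrite e => /Re_le.
Qed.

Lemma sqsum0 : sqsum (0 : nat -> H).
Proof. by apply/sqsumP; exists 0 => n; rewrite big1// => k _; rewrite nr0 expr0n. Qed.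

Lemma sqsum_lin c x y : sqsum x -> sqsum y -> sqsum (c *: x + y).
Proof.
move=> /sqsumP[M hM] /sqsumP[N hN]; apply/sqsumP.
exists (2 * (cn c ^+ 2 * M + N)) => n.
apply: (@le_trans _ _ (\sum_(k < n) 2 * (cn c ^+ 2 * nr (x k) ^+ 2 + nr (y k) ^+ 2))).
  apply: ler_sum => k _ /=.
  have := parallelogram (c *: x k) (y k); rewrite nrZ exprMn => <-.
  by rewrite -[leLHS]addr0 lerD2l sqr_ge0.
rewrite -mulr_sumr ler_wpM2l// big_split /= -mulr_sumr.
apply: lerD; last exact: hN.
by rewrite ler_wpM2l ?sqr_ge0 ?hM.
Qed.

Definition l2_ls : @lsub R := @LSub R (nat -> H) (@sqsum R H) sqsum0 sqsum_lin.
Notation L := (lsubT l2_ls).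
(** Written with the same limit of a series as [eval_form], so that normal functionals become inner
    products of this space. *)
Definition l2q (x y : nat -> H) : C := limn (series (fun n => ip (x n) (y n) : C^o)).

Lemma seriesE (u : nat -> C^o) n : series u n = \sum_(k < n) u k.
Proof. by rewrite /series /= big_mkord. Qed.

Lemma l2q_cvg x y : sqsum x -> sqsum y ->
  seqlim (series (fun n => ip (x n) (y n) : C^o)) (l2q x y).
Proof.
move=> /sqsumP[M hM] /sqsumP[N hN].
pose a k : R := nr (x k) ^+ 2 + nr (y k) ^+ 2.
have a0 k : 0 <= a k by rewrite addr_ge0 ?sqr_ge0.
have aM n : \sum_(k < n) a k <= M + N by rewrite big_split lerD.
have [s s1 s2] := nneg_series a0 aM.
have [|l hl] := @complex_cauchy R (series (fun n => ip (x n) (y n) : C^o)).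
  move=> e e0; have [P hP] := s2 e e0; exists P.
  have key m n : (P <= n)%N -> (n <= m)%N ->
      cn (series (fun n => ip (x n) (y n) : C^o) m - series (fun n => ip (x n) (y n) : C^o) n) <= e.
    move=> Pn nm; rewrite /series /= (big_cat_nat (leq0n n) nm) /= addrAC subrr add0r.
    apply: le_trans (cn_sum _ _) _.
    apply: (@le_trans _ _ (\sum_(n <= k < m) a k)).
      apply: ler_sum => k _; apply: le_trans (CS _ _) _.
      have := nr_ge0 (x k); have := nr_ge0 (y k); rewrite /a; nra.
    have := s1 m; have := hP n Pn; rewrite -!(big_mkord xpredT a).
    rewrite (big_cat_nat (leq0n n) nm) /=; lra.
  move=> m n Pm Pn; have [mn|nm] := leqP m n; last exact: key (ltnW nm).
  by rewrite cnB key.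
by rewrite /l2q (seqlim_lim hl).
Qed.

Lemma l2q_uniq x y (l : C^o) : seqlim (series (fun n => ip (x n) (y n) : C^o)) l -> l2q x y = l.
Proof. exact: seqlim_lim. Qed.

Definition l2s (x : nat -> H) : R := complex.Re (l2q x x).

Lemma l2s_spec x : sqsum x ->
  [/\ l2q x x = (l2s x)%:C, forall n, \sum_(k < n) nr (x k) ^+ 2 <= l2s x &
   forall M : R, (forall n, \sum_(k < n) nr (x k) ^+ 2 <= M) -> l2s x <= M].
Proof.
move=> /sqsumP[M hM].
have [s s1 s2] := nneg_series (fun k => sqr_ge0 (nr (x k))) hM.
have qs : l2q x x = s%:C.
  apply: l2q_uniq => e e0; have [N hN] := s2 e e0; exists N => n Nn.
  have -> : series (fun n => ip (x n) (x n) : C^o) n = (\sum_(k < n) nr (x k) ^+ 2)%:C.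
    by rewrite seriesE rmorph_sum; apply: eq_bigr => k _; rewrite ipxx.
  rewrite nr_cn -rmorphB cn_real distrC ger0_norm ?subr_ge0//.
  have := hN n Nn; lra.
rewrite /l2s qs /=; split=> // M' hM'.
apply/ler_addgt0Pl => e e0; have [N hN] := s2 e e0.
have := hN N (leqnn _); have := hM' N; lra.
Qed.

Lemma l2s_ge0 x : sqsum x -> 0 <= l2s x.
Proof. by case/l2s_spec => _ /(_ 0%N) + _; rewrite big_ord0. Qed.

Definition l2N (x : nat -> H) : R := Num.sqrt (l2s x).
Lemma l2N_sqr x : sqsum x -> l2N x ^+ 2 = l2s x.
Proof. by move=> h; rewrite sqr_sqrtr// l2s_ge0. Qed.

Lemma l2N_coord x k : sqsum x -> nr (x k) <= l2N x.
Proof.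
move=> h; rewrite -(@ler_pXn2r _ 2)// ?nnegrE ?nr_ge0 ?sqrtr_ge0// l2N_sqr//.
have [_ /(_ k.+1) + _] := l2s_spec h; rewrite big_ord_recr /=; apply: le_trans.
by rewrite lerDr; apply: sumr_ge0 => i _; exact: sqr_ge0.
Qed.

Lemma l2N_le x (M : R) : sqsum x -> 0 <= M -> (forall n, \sum_(k < n) nr (x k) ^+ 2 <= M ^+ 2) ->
  l2N x <= M.
Proof.
move=> h M0 hM; rewrite -(@ler_pXn2r _ 2)// ?nnegrE ?sqrtr_ge0// l2N_sqr//.
by have [_ _ ] := l2s_spec h; exact.
Qed.

Lemma l2_qlin c (x y z : L) :
  l2q (lsval (c *: x + y)) (lsval z) = c * l2q (lsval x) (lsval z) + l2q (lsval y) (lsval z).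
Proof.
have := l2q_cvg (lsvalD x) (lsvalD z); have := l2q_cvg (lsvalD y) (lsvalD z).
set a := l2q _ _; set b := l2q _ _ => ha hb; apply: l2q_uniq.
have hcb : seqlim (fun n => c * series (fun n => ip (lsval x n : H) (lsval z n) : C^o) n : C^o) (c * b : C^o).
  apply: (seqlim_bnd (M := cn c)) hb => n.
  by rewrite -mulrBr nr_cn cnM.
have := seqlimD hcb ha.
congr (seqlim _ _); apply/funext => n; rewrite !seriesE mulr_sumr -big_split /=.
by apply: eq_bigr => k _; rewrite ip_linear.
Qed.

Lemma l2_qconj (x y : L) : l2q (lsval y) (lsval x) = Num.conj (l2q (lsval x) (lsval y)).
Proof.
apply: l2q_uniq => e e0; have [N hN] := l2q_cvg (lsvalD x) (lsvalD y) e0.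
exists N => n /hN; rewrite !nr_cn -cnJ rmorphB /=.
congr (cn (_ - _) <= _); rewrite !seriesE rmorph_sum.
by apply: eq_bigr => k _; symmetry; exact: ip_conj.
Qed.

Lemma l2_qxx (x : L) : l2q (lsval x) (lsval x) = (l2N (lsval x) ^+ 2)%:C.
Proof.
rewrite l2N_sqr; last exact: (lsvalD x).
by have [-> _ _] := l2s_spec (lsvalD x).
Qed.

Lemma l2_Neq0 (x : L) : l2N (lsval x) = 0 -> x = 0.
Proof.
move=> h; apply: lsval_inj; apply/funext => k; apply: nr_eq0.
apply/eqP; rewrite eq_le nr_ge0 andbT -h.
exact: (l2N_coord k (lsvalD x)).
Qed.

Lemma l2_compl (u : nat -> L) :
  (forall e : R, 0 < e -> exists N, forall m n, (N <= m)%N -> (N <= n)%N ->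
    l2N (lsval (u m - u n)) <= e) ->
  exists l : L, forall e : R, 0 < e -> exists N, forall n, (N <= n)%N -> l2N (lsval (u n - l)) <= e.
Proof.
move=> h.
have hk k : exists l, seqlim (fun n => lsval (u n) k : H) l.
  apply: seqcauchy_lim => e e0; have [N hN] := h e e0; exists N => m n Nm Nn.
  exact: le_trans (l2N_coord k (lsvalD (u m - u n))) (hN _ _ Nm Nn).
pose l k := projT1 (cid (hk k)).
have hl k : seqlim (fun n => lsval (u n) k : H) (l k) by rewrite /l; case: cid.
have key (e : R) : 0 < e -> exists N, forall n, (N <= n)%N ->
    forall K, \sum_(k < K) nr (lsval (u n) k - l k) ^+ 2 <= e ^+ 2.
  move=> e0; have e2 : 0 < e / 2 by lra.
  have [N hN] := h _ e2; exists N => n Nn K.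
  (* Only K coordinates matter, each within d of its limit: their part 2 K d^2 is at most 2 ((K+1)
     d)^2 = e^2 / 2, and the Cauchy part contributes the other e^2 / 2. *)
  pose d : R := e / 2 / K.+1%:R.
  have K0 : 0 < K.+1%:R :> R by rewrite ltr0Sn.
  have d0 : 0 < d by rewrite divr_gt0.
  have [P hP] : exists P, forall m, (P <= m)%N -> forall k, (k < K)%N ->
      nr (lsval (u m) k - l k) <= d.
    elim: (K) => [|K' [P hP]]; first by exists 0%N.
    have [Q hQ] := hl K' _ d0; exists (maxn P Q) => m; rewrite geq_max => /andP[Pm Qm] k.
    by rewrite ltnS leq_eqVlt => /orP[/eqP ->|]; [exact: hQ|exact: hP].
  pose m := maxn N P.
  have h1 k : (k < K)%N -> nr (lsval (u n) k - l k) ^+ 2 <= 2 * nr (lsval (u n - u m) k) ^+ 2 + 2 * d ^+ 2.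
    move=> kK; have g := parallelogram (lsval (u n - u m) k) (lsval (u m) k - l k).
    have g1 : nr (lsval (u m) k - l k) ^+ 2 <= d ^+ 2.
      by rewrite lerXn2r ?nnegrE ?nr_ge0 ?(ltW d0)// hP// leq_maxr.
    have -> : lsval (u n) k - l k = lsval (u n - u m) k + (lsval (u m) k - l k).
      by rewrite [lsval (u n - u m) k](_ : _ = lsval (u n) k - lsval (u m) k)// addrA subrK.
    have := sqr_ge0 (nr (lsval (u n - u m) k - (lsval (u m) k - l k))).
    move: g g1; set a := nr _ ^+ 2; set b := nr _ ^+ 2; set c := nr _ ^+ 2; lra.
  apply: (@le_trans _ _ (\sum_(k < K) (2 * nr (lsval (u n - u m) k) ^+ 2 + 2 * d ^+ 2))).
    by apply: ler_sum => k _; exact: h1.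
  rewrite big_split /= -mulr_sumr sumr_const card_ord.
  have [_ /(_ K) g _] := l2s_spec (lsvalD (u n - u m)).
  have g2 : l2s (lsval (u n - u m)) <= (e / 2) ^+ 2.
    rewrite -l2N_sqr; last exact: (lsvalD (u n - u m)).
    rewrite lerXn2r ?nnegrE ?sqrtr_ge0 ?(ltW e2)//.
    by apply: hN => //; rewrite leq_maxl.
  have g3 : (2 * d ^+ 2) *+ K <= e ^+ 2 / 2.
    rewrite -mulr_natr.
    have dK : d * K.+1%:R = e / 2 by rewrite divfK// gt_eqF.
    have KK : K%:R * 1 <= K.+1%:R * K.+1%:R :> R.
      by rewrite ler_pM ?ler_nat// ler1n.
    have -> : e ^+ 2 / 2 = 2 * (e / 2) ^+ 2 by field.
    have := ler_wpM2l (sqr_ge0 d) KK; rewrite -dK mulr1.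
    set a := K%:R; set b := K.+1%:R; nra.
  have := le_trans g g2; set a := (\sum_(i < K) _); nra.
have l_sq : sqsum l.
  have [N hN] := key 1 ltr01; have {hN}hN := hN N (leqnn _).
  have : sqsum ((lsval (u N) : nat -> H) - l).
    by apply/sqsumP; exists (1 ^+ 2).
  move=> /(sqsum_lin (-1)) /(_ (lsvalD (u N))).
  by rewrite scaleN1r opprB subrK.
pose l1 : L := @lsmk _ l2_ls l l_sq; exists l1 => e e0; have [N hN] := key e e0; exists N => n Nn.
apply: l2N_le (ltW e0) _; first exact: (lsvalD (u n - l1)).
exact: hN.
Qed.

Definition l2_id : @ipdata R := @IpData R L (fun x y : L => l2q (lsval x) (lsval y))
  (fun x : L => l2N (lsval x)) l2_qlin l2_qconj (fun x : L => sqrtr_ge0 _) l2_qxx l2_Neq0 l2_compl.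
Definition l2 : hilbert R := id_hilbert l2_id.
Definition l2c (x : l2) : nat -> H := lsval (x : L).
Definition mkl2 (x : nat -> H) (h : sqsum x) : l2 := (@lsmk _ l2_ls x h : L).

Lemma l2cK (x : nat -> H) (h : sqsum x) : l2c (mkl2 h) = x. Proof. by []. Qed.
Lemma l2cP (x : l2) : sqsum (l2c x). Proof. exact: (lsvalD (x : L)). Qed.
Lemma l2_ip (x y : l2) : ip x y = limn (series (fun n => ip (l2c x n) (l2c y n) : C^o)).
Proof. by []. Qed.
Lemma l2c_lin c (x y : l2) n : l2c (c *: x + y) n = c *: l2c x n + l2c y n.
Proof. by []. Qed.
Lemma l2c_inj (x y : l2) : (forall n, l2c x n = l2c y n) -> x = y.
Proof. by move=> h; apply: (@lsval_inj _ l2_ls); apply/funext. Qed.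
Lemma l2c_le (x : l2) k : nr (l2c x k) <= nr x.
Proof. exact: (l2N_coord k (l2cP x)). Qed.
Lemma l2_le (x : l2) (M : R) : 0 <= M -> (forall n, \sum_(k < n) nr (l2c x k) ^+ 2 <= M ^+ 2) -> nr x <= M.
Proof. exact: (l2N_le (l2cP x)). Qed.
Lemma l2_ge (x : l2) n : \sum_(k < n) nr (l2c x k) ^+ 2 <= nr x ^+ 2.
Proof.
rewrite [nr x](_ : _ = l2N (l2c x))// l2N_sqr; last exact: l2cP.
by have [_ + _] := l2s_spec (l2cP x); apply.
Qed.
End L2.

(** * Normal functionals and slices *)

Section L2Ops.
Context {R : realType}.
Local Notation C := R[i].

(** This is T (x) 1 on H (x) l2. By [pair_opE] every normal functional has the form <(T (x) 1) x,
    y>, and this is how normal functionals are handled from here on. *)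
Definition l2map (H K : hilbert R) (T : H -> K) (x : l2 H) : l2 K :=
  xget 0 [set z | forall n, l2c z n = T (l2c x n)].

Section Map.
Variables (H K : hilbert R) (T : H -> K).
Hypothesis bT : bounded_op T.

Lemma l2mapE x n : l2c (l2map T x) n = T (l2c x n).
Proof.
have [M M0 hM] := bop_bnd bT.
have sq : sqsum (fun n => T (l2c x n)).
  have /sqsumP[N hN] := l2cP x; apply/sqsumP; exists (M ^+ 2 * N) => k.
  apply: (@le_trans _ _ (\sum_(i < k) M ^+ 2 * nr (l2c x i) ^+ 2)).
    apply: ler_sum => i _; rewrite -exprMn lerXn2r ?nnegrE ?nr_ge0 ?mulr_ge0 ?nr_ge0//.
  by rewrite -mulr_sumr ler_wpM2l ?sqr_ge0.
move: n; rewrite /l2map; case: xgetP => [z _ //|/(_ (mkl2 sq))]; case.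
by move=> n; rewrite l2cK.
Qed.

Lemma l2map_lin : linear (l2map T).
Proof.
by move=> c x y; apply: l2c_inj => n; rewrite l2c_lin !l2mapE l2c_lin (bop_lin bT).
Qed.

Lemma l2map_bnd M : 0 <= M -> bnd T M -> bnd (l2map T) M.
Proof.
move=> M0 hM x; apply: l2_le => [|n]; first by rewrite mulr_ge0 ?nr_ge0.
apply: (@le_trans _ _ (\sum_(i < n) M ^+ 2 * nr (l2c x i) ^+ 2)).
  by apply: ler_sum => i _; rewrite l2mapE -exprMn lerXn2r ?nnegrE ?nr_ge0 ?mulr_ge0 ?nr_ge0.
by rewrite -mulr_sumr exprMn ler_wpM2l ?sqr_ge0 ?l2_ge.
Qed.

Lemma l2map_bop : bounded_op (l2map T).
Proof.
have [M M0 hM] := bop_bnd bT.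
exact: bnd_op l2map_lin (l2map_bnd M0 hM).
Qed.
End Map.

Lemma l2_ip_ext (H K : hilbert R) (x y : l2 H) (x' y' : l2 K) :
  (forall n, ip (l2c x n) (l2c y n) = ip (l2c x' n) (l2c y' n)) -> ip x y = ip x' y'.
Proof.
move=> h; rewrite !l2_ip.
suff -> : (fun n => ip (l2c x n) (l2c y n) : C^o) = (fun n => ip (l2c x' n) (l2c y' n)) by [].
exact/funext.
Qed.

Lemma l2map_adj (H K : hilbert R) (T : H -> K) x y : bounded_op T ->
  ip (l2map T x) y = ip x (l2map (gadj T) y).
Proof.
by move=> bT; apply: l2_ip_ext => n; rewrite (l2mapE bT) (l2mapE (gadj_bop bT)) -gadjE.
Qed.
Lemma l2map_comp (H K L : hilbert R) (S : K -> L) (T : H -> K) x :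
  bounded_op S -> bounded_op T -> l2map (S \o T) x = l2map S (l2map T x).
Proof. by move=> bS bT; apply: l2c_inj => n; rewrite !l2mapE//; exact: bop_comp. Qed.
Lemma l2map_comb (H K : hilbert R) c (S T : H -> K) x :
  bounded_op S -> bounded_op T ->
  l2map (fun x => c *: S x + T x) x = c *: l2map S x + l2map T x.
Proof.
by move=> bS bT; apply: l2c_inj => n; rewrite l2c_lin !l2mapE//; exact: bop_comb.
Qed.
Lemma l2map0 (H K : hilbert R) (x : l2 H) : l2map (fun=> 0 : K) x = 0.
Proof. by apply: l2c_inj => n; rewrite l2mapE//; exact: bop0. Qed.

Section Single.
Variable H : hilbert R.

Lemma single_sq n (y : H) : sqsum (fun k => if k == n then y else 0).
Proof.
apply/sqsumP; exists (nr y ^+ 2) => N.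
have [nN|nN] := ltnP n N.
  rewrite (bigD1 (Ordinal nN)) //= eqxx big1 ?addr0// => i.
  by rewrite -val_eqE /= => /negPf ->; rewrite nr0 expr0n.
rewrite big1 ?sqr_ge0// => i _; have [e|] := eqVneq; last by rewrite nr0 expr0n.
by have := ltn_ord i; rewrite e ltnNge nN.
Qed.
Definition single n (y : H) : l2 H := mkl2 (single_sq n y).
Lemma singleE n y k : l2c (single n y) k = if k == n then y else 0.
Proof. by []. Qed.
Lemma single_lin n : linear (single n).
Proof.
move=> c x y; apply: l2c_inj => k; rewrite l2c_lin !singleE.
by case: eqP => // _; rewrite scaler0 addr0.
Qed.
Lemma ip_single (x : l2 H) n y : ip x (single n y) = ip (l2c x n) y.
Proof.
apply: (l2q_uniq (x := l2c x) (y := l2c (single n y))) => e e0; exists n.+1 => N nN.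
rewrite seriesE (bigD1 (Ordinal nN)) //= eqxx big1 ?addr0 ?subrr ?nr0 ?ltW//.
by move=> i; rewrite -val_eqE /= => /negPf ->; rewrite ip0r.
Qed.
Lemma nr_single n y : nr (single n y) = nr y.
Proof.
by apply/eqP; rewrite -(@eqrXn2 _ 2) ?nr_ge0// !nr_sqr ip_single singleE eqxx.
Qed.
Lemma single_bop n : bounded_op (single n).
Proof.
by apply: (@bnd_op _ _ _ _ 1); [exact: single_lin|move=> y; rewrite nr_single mul1r].
Qed.
Lemma l2c_bop n : bounded_op (fun x : l2 H => l2c x n).
Proof. by apply: (@bnd_op _ _ _ _ 1) => // x; rewrite mul1r l2c_le. Qed.
Lemma single_total : total_family (fun p : nat * H => single p.1 p.2).
Proof.
apply: total_orth => x hx; apply: l2c_inj => n; apply: ip_ext => z.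
by rewrite -ip_single (hx (n, z)) ip0l.
Qed.
End Single.

Lemma l2map_single (H K : hilbert R) (T : H -> K) n y : bounded_op T ->
  l2map T (single n y) = single n (T y).
Proof.
move=> bT; apply: l2c_inj => k; rewrite l2mapE// !singleE.
by case: eqP => // _; rewrite (lin0 (bop_lin bT)).
Qed.

Definition pw (H : hilbert R) (x y : l2 H) : (nat -> H) * (nat -> H) := (l2c x, l2c y).

Lemma pw_predual (H : hilbert R) (x y : l2 H) : predual (pw x y).
Proof. by split; exact: l2cP. Qed.
Lemma predualP (H : hilbert R) (w : (nat -> H) * (nat -> H)) : predual w ->
  exists x y : l2 H, w = pw x y.
Proof. by case: w => a b [ha hb]; exists (mkl2 ha), (mkl2 hb). Qed.
Lemma pair_opE (H : hilbert R) (x y : l2 H) (T : H -> H) : bounded_op T ->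
  pair_op (pw x y) T = ip (l2map T x) y.
Proof.
move=> bT; rewrite /pair_op /eval_form l2_ip.
suff -> : (fun n => ip (T (l2c x n)) (l2c y n) : C^o) =
  (fun n => ip (l2c (l2map T x) n) (l2c y n)) by [].
by apply/funext => n; rewrite l2mapE.
Qed.
Lemma vec_pw (H : hilbert R) (x y : H) : vec_fun x y = pw (single 0 x) (single 0 y).
Proof. by []. Qed.
Lemma pair_vec (H : hilbert R) (x y : H) (T : H -> H) : bounded_op T ->
  pair_op (vec_fun x y) T = ip (T x) y.
Proof. by move=> bT; rewrite vec_pw pair_opE// ip_single l2mapE. Qed.
Lemma pair_op_comb (H : hilbert R) w c (S T : H -> H) : predual w ->
  bounded_op S -> bounded_op T ->
  pair_op w (fun x => c *: S x + T x) = c * pair_op w S + pair_op w T.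
Proof.
move=> /predualP[x [y ->]] bS bT; rewrite !pair_opE//; last exact: bop_comb.
by rewrite l2map_comb// ip_linear.
Qed.
Lemma pair_op_bnd (H : hilbert R) w : predual w -> exists2 k : R, 0 <= k &
  forall (T : H -> H) M, bounded_op T -> 0 <= M -> bnd T M -> cn (pair_op w T) <= k * M.
Proof.
move=> /predualP[x [y ->]]; exists (nr x * nr y) => [|T M bT M0 hM].
  by rewrite mulr_ge0 ?nr_ge0.
rewrite pair_opE//; apply: le_trans (CS _ _) _.
rewrite mulrAC ler_wpM2r ?nr_ge0// mulrC.
exact: (l2map_bnd bT M0 hM).
Qed.
End L2Ops.

Section Slices.
Context {R : realType}.
Local Notation C := R[i].

Section Generic.
Variables (H K T : hilbert R) (t : H -> K -> T).
Hypotheses (tl : forall y, linear (t^~ y)) (tr : forall x, linear (t x))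
  (tn : forall x y, nr (t x y) = nr x * nr y).

(** One treatment for both legs: [rslice] is the case where [t] is the tensor map, [lslice] the case
    where its two arguments are exchanged, both by conversion. *)
Definition gslice (w : (nat -> K) * (nat -> K)) (X : T -> T) : H -> H :=
  fun x => xget 0 [set z | forall x', ip z x' =
    eval_form w (fun y y' => ip (X (t x y)) (t x' y'))].

Lemma t_bop x : bounded_op (t x).
Proof. by apply: (@bnd_op _ _ _ _ (nr x)) => // y; rewrite tn. Qed.

(** A slice is the amplified operator X (x) 1 preceded by [tamp xi] and followed by the adjoint of
    [tamp eta]; boundedness and norm estimates can be read off without any series. *)
Definition tamp (xi : l2 K) (x : H) : l2 T := l2map (t x) xi.

Lemma tamp_bop xi : bounded_op (tamp xi).
Proof.
apply: (@bnd_op _ _ _ _ (nr xi)) => [c x y|x].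
  apply: l2c_inj => n; rewrite l2c_lin !l2mapE; do ?exact: t_bop.
  exact: tl.
rewrite mulrC; apply: l2map_bnd (nr_ge0 _) _ _; first exact: t_bop.
by move=> y; rewrite tn.
Qed.
Lemma tamp_bnd xi : bnd (tamp xi) (nr xi).
Proof.
move=> x; rewrite mulrC; apply: l2map_bnd (nr_ge0 _) _ _; first exact: t_bop.
by move=> y; rewrite tn.
Qed.

Section X.
Variable X : T -> T.
Hypothesis bX : bounded_op X.

Lemma gslice_ip xi eta x x' :
  ip (gslice (pw xi eta) X x) x' = ip (l2map X (tamp xi x)) (tamp eta x').
Proof.
have e x1 : eval_form (pw xi eta) (fun y y' => ip (X (t x y)) (t x1 y')) =
    ip (l2map X (tamp xi x)) (tamp eta x1).
  rewrite /eval_form l2_ip.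
  suff -> : (fun n => ip (X (t x (l2c xi n))) (t x1 (l2c eta n)) : C^o) =
    (fun n => ip (l2c (l2map X (tamp xi x)) n) (l2c (tamp eta x1) n)) by [].
  by apply/funext => n; rewrite l2mapE// !l2mapE//; exact: t_bop.
move: x'; rewrite /gslice; case: xgetP => [z _ h x'|]; first by rewrite h e.
move=> /(_ (gadj (tamp eta) (l2map X (tamp xi x)))); case=> x'.
by rewrite e -gadjEr//; exact: tamp_bop.
Qed.
Lemma gsliceE xi eta :
  gslice (pw xi eta) X = gadj (tamp eta) \o l2map X \o tamp xi.
Proof.
apply/funext => x; apply: ip_ext => z; rewrite gslice_ip /= -gadjEr//.
exact: tamp_bop.
Qed.
Lemma gslice_bop w : predual w -> bounded_op (gslice w X).
Proof.
move=> /predualP[xi [eta ->]]; rewrite gsliceE.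
apply: bop_comp; last exact: tamp_bop.
apply: bop_comp; last exact: l2map_bop.
by apply: gadj_bop; exact: tamp_bop.
Qed.
Lemma gslice_bnd xi eta M : 0 <= M -> bnd X M ->
  bnd (gslice (pw xi eta) X) (nr eta * M * nr xi).
Proof.
move=> M0 hM x; rewrite gsliceE /=.
apply: le_trans (gadj_bnd (tamp_bop eta) (nr_ge0 _) (@tamp_bnd eta) _) _.
rewrite -!mulrA ler_wpM2l ?nr_ge0//.
apply: le_trans (l2map_bnd bX M0 hM _) _.
by rewrite ler_wpM2l//; exact: tamp_bnd.
Qed.
Lemma gslice_vec y y' x x' :
  ip (gslice (vec_fun y y') X x) x' = ip (X (t x y)) (t x' y').
Proof.
rewrite vec_pw gslice_ip /tamp !l2map_single//; do ?exact: t_bop.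
by rewrite ip_single singleE eqxx.
Qed.
Lemma gslice_single xi n y' :
  gslice (pw xi (single n y')) X = gslice (vec_fun (l2c xi n) y') X.
Proof.
apply/funext => x; apply: ip_ext => z; rewrite gslice_vec gslice_ip.
rewrite /tamp [X in ip _ X]l2map_single; last exact: t_bop.
rewrite ip_single l2mapE// l2mapE//; exact: t_bop.
Qed.
End X.

Lemma gslice_adj w X : bounded_op X -> predual w ->
  adj (gslice w X) = gslice (w.2, w.1) (adj X).
Proof.
move=> bX pw_; have [xi [eta e]] := predualP pw_; rewrite e.
apply: adj_uniq => [|x y]; first by apply: gslice_bop => //; exact: pw_predual.
rewrite gslice_ip// l2map_adj// ip_conj.
rewrite [in RHS]ip_conj -[(_, _)]/(pw eta xi) gslice_ip//.
exact: adj_bop.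
Qed.

Lemma gslice_comb w c X Y : bounded_op X -> bounded_op Y -> predual w ->
  gslice w (fun z => c *: X z + Y z) = fun x => c *: gslice w X x + gslice w Y x.
Proof.
move=> bX bY /predualP[xi [eta ->]]; apply/funext => x; apply: ip_ext => z.
by rewrite ip_linear !gslice_ip//; [rewrite l2map_comb// ip_linear|exact: bop_comb].
Qed.
End Generic.

Variable tp : tensor_products R.
Variables (H K : hilbert R).
Notation T := (tp H K).

Lemma tens_ln (y : K) : linear (fun x : H => tens T x y).
Proof. by move=> c a b; rewrite tens_linl. Qed.
Lemma tens_rn (x : H) : linear (tens T x).
Proof. by move=> c a b; rewrite tens_linr. Qed.

Section X.
Variable X : T -> T.
Hypothesis bX : bounded_op X.
Let tl := tens_ln.
Let tr := tens_rn.
Let tn := @nr_tens R H K T.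
Let tn' (y : K) (x : H) : nr (tens T x y) = nr y * nr x. Proof. by rewrite nr_tens mulrC. Qed.

Lemma rslice_bop w : predual w -> bounded_op (rslice w X).
Proof. exact: (gslice_bop tl tr tn bX). Qed.
Lemma lslice_bop w : predual w -> bounded_op (lslice w X).
Proof. exact: (gslice_bop tr tl tn' bX). Qed.
Lemma rslice_ip xi eta x x' : ip (rslice (pw xi eta) X x) x' =
  ip (l2map X (l2map (tens T x) xi)) (l2map (tens T x') eta).
Proof. exact: (gslice_ip tl tr tn bX). Qed.
Lemma lslice_ip xi eta y y' : ip (lslice (pw xi eta) X y) y' =
  ip (l2map X (l2map (tensr T y) xi)) (l2map (tensr T y') eta).
Proof. exact: (gslice_ip tr tl tn' bX). Qed.
Lemma rslice_vec y y' x x' : ip (rslice (vec_fun y y') X x) x' =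
  ip (X (tens T x y)) (tens T x' y').
Proof. exact: (gslice_vec tl tr tn bX). Qed.
Lemma lslice_vec x x' y y' : ip (lslice (vec_fun x x') X y) y' =
  ip (X (tens T x y)) (tens T x' y').
Proof. exact: (gslice_vec tr tl tn' bX). Qed.
Lemma rslice_adj w : predual w -> adj (rslice w X) = rslice (w.2, w.1) (adj X).
Proof. exact: (gslice_adj tl tr tn bX). Qed.
Lemma rslice_bnd xi eta M : 0 <= M -> bnd X M ->
  bnd (rslice (pw xi eta) X) (nr eta * M * nr xi).
Proof. exact: (gslice_bnd tl tr tn bX). Qed.
Lemma lslice_bnd xi eta M : 0 <= M -> bnd X M ->
  bnd (lslice (pw xi eta) X) (nr eta * M * nr xi).
Proof. exact: (gslice_bnd tr tl tn' bX). Qed.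

Lemma lslice_rslice v y y' : predual v ->
  ip (lslice v X y) y' = pair_op v (rslice (vec_fun y y') X).
Proof.
move=> /predualP[xi [eta ->]].
rewrite pair_opE; last by apply: rslice_bop; rewrite vec_pw; exact: pw_predual.
rewrite lslice_ip; apply: l2_ip_ext => n; rewrite !l2mapE//; do ?exact: tensr_bop.
  by rewrite rslice_vec.
by apply: rslice_bop; rewrite vec_pw; exact: pw_predual.
Qed.
Lemma rslice_lslice v x x' : predual v ->
  ip (rslice v X x) x' = pair_op v (lslice (vec_fun x x') X).
Proof.
move=> /predualP[xi [eta ->]].
rewrite pair_opE; last by apply: lslice_bop; rewrite vec_pw; exact: pw_predual.
rewrite rslice_ip; apply: l2_ip_ext => n; rewrite !l2mapE//; do ?exact: tensl_bop.
  by rewrite lslice_vec.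
by apply: lslice_bop; rewrite vec_pw; exact: pw_predual.
Qed.

(** No double series is exchanged: both sides are bounded and conjugate-linear in the second vector
    of w, and on sequences with a single entry they agree by [lslice_rslice]. *)
Lemma slice_fubini v w : predual v -> predual w ->
  pair_op v (rslice w X) = pair_op w (lslice v X).
Proof.
move=> pv /predualP[al [be ->]]; have [xi [eta ev]] := predualP pv.
have bL := lslice_bop pv.
have bR b : bounded_op (rslice (pw al b) X) by apply: rslice_bop; exact: pw_predual.
rewrite [RHS]pair_opE//.
(* The conjugation makes the dependence on [b] linear, as [total_ext] requires. *)
pose f (b : l2 K) : C^o := Num.conj (pair_op v (rslice (pw al b) X)).
pose g (b : l2 K) : C^o := Num.conj (ip (l2map (lslice v X) al) b).
have [M M0 hM] := bop_bnd bX.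
suff : f = g by move=> /(congr1 (fun h => h be)) /(can_inj (@conjCK _)).
have fE b : f b = Num.conj (ip (l2map (rslice (pw al b) X) xi) eta).
  by rewrite /f ev pair_opE.
apply: (total_ext (single_total (H := K))).
- apply: (@bnd_op _ _ _ _ (nr xi * nr eta * (M * nr al))) => [c a b|b].
    rewrite !fE; set q := fun b => ip (l2map (rslice (pw al b) X) xi) eta.
    suff -> : ip (l2map (rslice (pw al (c *: a + b)) X) xi) eta = Num.conj c * q a + q b.
      by rewrite rmorphD rmorphM /= conjCK.
    rewrite /q -ipZl -ipDl; congr ip.
    apply: l2c_inj => n; rewrite l2c_lin !l2mapE//.
    apply: ip_ext => z; rewrite ip_linear !rslice_ip.
    have -> : l2map (tens T z) (c *: a + b) = c *: l2map (tens T z) a + l2map (tens T z) b.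
      exact: (l2map_lin (tensl_bop T z)).
    by rewrite ipDr ipZr.
  rewrite fE nr_cn cnJ; apply: le_trans (CS _ _) _.
  have h : 0 <= nr b * M * nr al by rewrite !mulr_ge0 ?nr_ge0.
  have := l2map_bnd (bR b) h (rslice_bnd al b M0 hM) xi.
  have := nr_ge0 eta; set p := nr (l2map _ _) => e0 hp.
  have := ler_wpM2r e0 hp; move/le_trans; apply.
  by rewrite le_eqVlt; apply/orP; left; apply/eqP; ring.
- apply: (@bnd_op _ _ _ _ (nr (l2map (lslice v X) al))) => [c a b|b].
    by rewrite /g ipDr ipZr rmorphD rmorphM /= conjCK.
  by rewrite nr_cn cnJ; exact: CS.
- move=> [n y] /=; rewrite /f /g; congr Num.conj.
  rewrite ip_single l2mapE// lslice_rslice//; congr pair_op.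
  exact: (gslice_single tl tr tn bX).
Qed.
End X.

Lemma rslice_comb w c (X Y : T -> T) : bounded_op X -> bounded_op Y -> predual w ->
  rslice w (fun z => c *: X z + Y z) = fun x => c *: rslice w X x + rslice w Y x.
Proof. exact: (gslice_comb tens_ln tens_rn (@nr_tens R H K T)). Qed.

Lemma rslice_inj (X Y : T -> T) : bounded_op X -> bounded_op Y ->
  (forall w, predual w -> rslice w X = rslice w Y) -> X = Y.
Proof.
move=> bX bY h; apply: tens_opext => // x y x' y'.
by rewrite -!rslice_vec// h// vec_pw; exact: pw_predual.
Qed.
End Slices.

(** * Commutants *)

Section Halves.
Context {R : realType}.
Lemma halves (e a b : R) : a <= e / 2 -> b <= e / 2 -> a + b <= e.
Proof. by move=> ha hb; rewrite [e]splitr lerD. Qed.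
Lemma nr_tri_half (V : normedModType R[i]) (x y z : V) e :
  nr (x - y) <= e / 2 -> nr (y - z) <= e / 2 -> nr (x - z) <= e.
Proof. by move=> h h'; apply: le_trans (nr_triang _ y _) (halves h h'). Qed.
Lemma divr2_gt0 (e : R) : 0 < e -> 0 < e / 2.
Proof. by move=> e0; rewrite divr_gt0. Qed.
Lemma compx (T1 T2 T3 : Type) (f : T2 -> T3) (g : T1 -> T2) x : (f \o g) x = f (g x).
Proof. by []. Qed.
End Halves.

Section Density.
Context {R : realType}.
Local Notation C := R[i].
Variables (H : hilbert R).

Definition is_salg (D : set (H -> H)) : Prop :=
  [/\ D `<=` bounded_op (V:=H) (W:=H), forall S, D S -> D (adj S),
    forall S T, D S -> D T -> D (S \o T), D (fun=> 0)
    & forall c S T, D S -> D T -> D (fun x => c *: S x + T x)].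

Section D.
Variable D : set (H -> H).
Hypothesis sD : is_salg D.

(** The closed cyclic subspace of xi under D (x) 1. *)
Definition cyc (xi : l2 H) : set (l2 H) :=
  [set z | forall e : R, 0 < e -> exists2 d, D d & nr (z - l2map d xi) <= e].

Lemma cyc_mem xi d : D d -> cyc xi (l2map d xi).
Proof. by move=> Dd e e0; exists d => //; rewrite subrr nr0 ltW. Qed.

Lemma cyc_closed xi : closed_sub (cyc xi).
Proof.
have [Db Da Dm D0 Dl] := sD.
split.
- by move=> e e0; exists (fun=> 0) => //; rewrite l2map0 subrr nr0 ltW.
- move=> c x y hx hy e e0; pose k := cn c + 1.
  have k0 : 0 < k by rewrite ltr_wpDl ?cn_ge0.
  have e2 := divr2_gt0 e0.
  have [s Ds hs] := hx _ (divr_gt0 e2 k0); have [t Dt ht] := hy _ e2.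
  exists (fun x => c *: s x + t x); first exact: Dl.
  rewrite l2map_comb; [|exact: Db|exact: Db].
  rewrite opprD addrACA -scalerBr (le_trans (nrD _ _))// nrZ.
  apply: halves ht.
  apply: le_trans (_ : k * nr (x - l2map s xi) <= _).
    by rewrite ler_wpM2r ?nr_ge0// lerDl.
  by rewrite mulrC -ler_pdivlMr.
- move=> v l hv hl e e0.
  have e2 := divr2_gt0 e0.
  have [N hN] := hl _ e2; have [s Ds hs] := hv N _ e2.
  exists s => //; apply: nr_tri_half hs.
  by rewrite nrB hN.
Qed.

Lemma cyc_inv xi z d : D d -> cyc xi z -> cyc xi (l2map d z).
Proof.
have [Db Da Dm D0 Dl] := sD.
move=> Dd hz e e0; have [M M0 hM] := bop_bnd (Db _ Dd).
have M1 : 0 < M + 1 by rewrite ltr_wpDl.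
have [s Ds hs] := hz _ (divr_gt0 e0 M1).
exists (d \o s); first exact: Dm.
rewrite l2map_comp; [|exact: Db|exact: Db].
rewrite -(linB (l2map_lin (Db _ Dd))).
apply: le_trans (l2map_bnd (Db _ Dd) M0 hM _) _.
apply: le_trans (_ : (M + 1) * nr (z - l2map s xi) <= _).
  by rewrite ler_wpM2r ?nr_ge0// lerDl.
by rewrite mulrC -ler_pdivlMr.
Qed.

Lemma cyc_orth xi eta : (forall d, D d -> ip (l2map d xi) eta = 0) ->
  forall z, cyc xi z -> ip z eta = 0.
Proof.
move=> h z hz; apply: cn_small => e e0.
have k0 : 0 < nr eta + 1 by rewrite ltr_wpDl ?nr_ge0.
have [s Ds hs] := hz _ (divr_gt0 e0 k0).
rewrite -[ip z eta]subr0 -(h s Ds) -ipBl; apply: le_trans (CS _ _) _.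
apply: le_trans (_ : nr (z - l2map s xi) * (nr eta + 1) <= _).
  by rewrite ler_wpM2l ?nr_ge0// lerDl.
by rewrite -ler_pdivlMr.
Qed.

(** Let z be the projection of xi on the cyclic subspace. Since d^* d (xi - z) lies in that
    subspace, |d (xi - z)|^2 = 0 for every d in D; so the entries of xi - z are killed by D, hence
    orthogonal to those of xi. In this local form the lemma also applies to ker g, which acts
    degenerately. *)
Lemma cyc_in xi : (forall x, (forall d, D d -> d x = 0) -> forall n, ip (l2c xi n) x = 0) ->
  cyc xi xi.
Proof.
have [Db Da Dm D0 Dl] := sD.
move=> h; have [z hz ho] := projection_thm xi (cyc_closed xi).
have h1 d : D d -> l2map d (xi - z) = 0.
  move=> Dd; have bd := Db _ Dd.
  apply: nr_eq0; apply/eqP; rewrite -sqrf_eq0; apply/eqP; apply: complexI.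
  rewrite -ipxx l2map_adj// -l2map_comp//; last exact: adj_bop.
  have Dad : D (adj d \o d) by apply: Dm => //; exact: Da.
  rewrite (linB (l2map_lin (Db _ Dad))).
  apply: ho.
  have [c0 c1 c2] := cyc_closed xi.
  have := c1 (-1) (l2map (adj d \o d) z) (l2map (adj d \o d) xi).
  rewrite scaleN1r addrC; apply; first exact: cyc_inv.
  exact: cyc_mem.
suff xz : xi - z = 0 by move/eqP: xz; rewrite subr_eq0 => /eqP xz; move: hz; rewrite -xz.
apply: nr_eq0; apply/eqP; rewrite -sqrf_eq0; apply/eqP; apply: complexI.
rewrite -ipxx ipBl [X in _ - X]ip_conj ho// rmorph0 subr0.
have -> : ip xi (xi - z) = ip xi (0 : l2 H).
  apply: l2_ip_ext => n; rewrite [RHS]ip0r; apply: h => d Dd.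
  by have := h1 d Dd => /(congr1 (fun x => l2c x n)); rewrite l2mapE//; exact: Db.
by rewrite ip0r.
Qed.

Hypothesis nD : forall x, (forall d, D d -> d x = 0) -> x = 0.

Lemma cyc_self xi : cyc xi xi.
Proof. by apply: cyc_in => x /nD -> n; rewrite ip0r. Qed.

(** Von Neumann's bicommutant argument on the amplified space: the projection P on the cyclic
    subspace commutes with D (x) 1, so its matrix entries [Pmn] lie in the commutant of D. They
    commute with T, hence P commutes with T (x) 1, which therefore preserves the subspace. *)
Lemma density xi eta : (forall d, D d -> ip (l2map d xi) eta = 0) ->
  forall T, bicommutant D T -> ip (l2map T xi) eta = 0.
Proof.
have [Db Da Dm D0 Dl] := sD.
move=> h T [bT hT]; apply: cyc_orth h _ _.
pose cM := cyc_closed xi; pose inc := @sinc R _ _ cM.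
have binc : bounded_op inc by exact: sinc_bop.
pose P := inc \o gadj inc.
have bP : bounded_op P by apply: bop_comp => //; exact: gadj_bop.
have PM z : cyc xi (P z) by exact: (sincD (cD := cM)).
have Pid z : cyc xi z -> P z = z by exact: (@sinc_gadj _ _ _ cM).
have Pad x y : ip (P x) y = ip x (P y).
  exact: etrans (gadjE _ _ binc) (esym (gadjEr _ _ binc)).
have comm d z : D d -> P (l2map d z) = l2map d (P z).
  move=> Dd; apply: ip_ext => y.
  rewrite Pad l2map_adj; last exact: Db.
  rewrite -[l2map (gadj d) _]Pid; last first.
    by apply: cyc_inv; [exact: Da|exact: PM].
  rewrite -Pad -l2map_adj; last exact: Db.
  rewrite -Pad Pid//.
  by apply: cyc_inv.
pose Pmn m n y := l2c (P (single n y)) m.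
have Pc m n : commutant D (Pmn m n).
  split; first exact: (bop_comp (l2c_bop _ m) (bop_comp bP (single_bop _ n))).
  move=> d Dd; have bd := Db _ Dd; apply/funext => y /=.
  by rewrite /Pmn -l2map_single// comm// l2mapE.
have TP : l2map T \o P = P \o l2map T.
  apply: (total_ext (single_total (H := H))).
  - by apply: bop_comp => //; exact: l2map_bop.
  - by apply: bop_comp => //; exact: l2map_bop.
  - move=> [n y] /=; apply: l2c_inj => m; rewrite l2mapE// l2map_single//.
    by have /(congr1 (fun f => f y)) := hT _ (Pc m n).
rewrite -[xi in l2map T xi]Pid; last exact: cyc_self.
by have /= -> := congr1 (fun f => f xi) TP; exact: PM.
Qed.
End D.

Lemma reindex_iso (s : nat -> nat) : injective s -> exists E : l2 H -> l2 H,
  [/\ bounded_op E, forall x y, ip (E x) (E y) = ip x y,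
    forall n y, E (single n y) = single (s n) y &
    forall (T : H -> H) x, bounded_op T -> l2map T (E x) = E (l2map T x)].
Proof.
move=> is_; have [|E [bE iE hE]] := @iso_extension _ _ (l2 H) (l2 H) _
    (fun p : nat * H => single (s p.1) p.2) (single_total (H := H)).
  move=> [i x] [j y]; cbv beta; rewrite !ip_single !singleE (inj_eq is_).
  by rewrite eq_sym; case: eqP; rewrite ?ip0l.
have hE' n y : E (single n y) = single (s n) y by exact: (hE (n, y)).
exists E; split => // T x bT.
have := total_ext (single_total (H := H)) (bop_comp (l2map_bop bT) bE)
  (bop_comp bE (l2map_bop bT)).
have hh p : (l2map T \o E) (single p.1 p.2) = (E \o l2map T) (single p.1 p.2).
  by rewrite /= hE' !l2map_single// hE'.
by move=> /(_ hh) /(congr1 (fun f => f x)).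
Qed.

(** A difference of two normal functionals is again a single vector functional: put the sequences of
    v at the even places and those of w at the odd places, with a sign on one vector. Then [density]
    applies to it. *)
Lemma pair_density (D : set (H -> H)) v w : is_salg D ->
  (forall x, (forall d, D d -> d x = 0) -> x = 0) -> predual v -> predual w ->
  (forall d, D d -> pair_op v d = pair_op w d) ->
  forall T, bicommutant D T -> pair_op v T = pair_op w T.
Proof.
move=> sD nD /predualP[x [y ->]] /predualP[x' [y' ->]] h T hT.
have [Db _ _ _ _] := sD; have bT : bounded_op T by case: hT.
have [E [bE iE hE cE]] := reindex_iso double_inj.
have oinj : injective (fun n => n.*2.+1) by move=> a b [/double_inj].
have [F [bO iO hO cO]] := reindex_iso oinj.
have EO a b : ip (E a) (F b) = 0.
  rewrite gadjE// (_ : gadj E (F b) = 0) ?ip0r//.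
  suff h0 : gadj E \o F = (fun=> 0) by have := congr1 (fun f => f b) h0.
  apply: (total_ext (single_total (H := H))); [|exact: bop0|].
    by apply: bop_comp => //; exact: gadj_bop.
  move=> [n z]; apply: (total_ip (single_total (H := H))) => -[m t].
  rewrite compx ip0l -gadjEr// hE hO ip_single singleE.
  case: eqP; last by rewrite ip0l.
  by move=> /(congr1 odd); rewrite /= !odd_double.
have key S : bounded_op S ->
    ip (l2map S (E x + F x')) (E y - F y') = pair_op (pw x y) S - pair_op (pw x' y') S.
  move=> bS; rewrite !pair_opE// (linD (l2map_lin bS)) cE// cO//.
  rewrite ipDl !ipBr !iE !iO EO ip_conj [ip (F _) (E _)]ip_conj !EO !rmorph0.
  by rewrite -ip_conj subr0 add0r.
apply/eqP; rewrite -subr_eq0 -key//; apply/eqP.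
apply: (density sD nD) hT => d Dd; rewrite key; last exact: Db.
by rewrite h// subrr.
Qed.
End Density.

Section VonNeumann.
Context {R : realType} (tp : tensor_products R).
Local Notation C := R[i].
Variables (H K : hilbert R) (D : set (H -> H)) (E : set (K -> K)).
Hypotheses (bD : D `<=` bounded_op (V:=H) (W:=H)) (bE : E `<=` bounded_op (V:=K) (W:=K)).

Lemma vN_tens_bop (X : tp H K -> tp H K) : vN_tens D E X -> bounded_op X.
Proof. by case. Qed.

Lemma vN_commute_l S (X : tp H K -> tp H K) : commutant D S -> vN_tens D E X ->
  X \o gtens S id = gtens S id \o X.
Proof.
move=> [bS hS] [bX hX]; apply: hX; split; first by apply: gtens_bop => //; exact: bop_id.
move=> _ [A DA [B EB ->]].
have bA := bD DA; have bB := bE EB.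
rewrite op_tens_gtens !gtens_comp//; do ?exact: bop_id.
by rewrite hS.
Qed.
Lemma vN_commute_r S (X : tp H K -> tp H K) : commutant E S -> vN_tens D E X ->
  X \o gtens id S = gtens id S \o X.
Proof.
move=> [bS hS] [bX hX]; apply: hX; split; first by apply: gtens_bop => //; exact: bop_id.
move=> _ [A DA [B EB ->]].
have bA := bD DA; have bB := bE EB.
rewrite op_tens_gtens !gtens_comp//; do ?exact: bop_id.
by rewrite hS.
Qed.

(** For S in the commutant of D, S (x) 1 commutes with X; slicing this identity in the second leg
    shows that S commutes with the slice. *)
Lemma rslice_commutant w (X : tp H K -> tp H K) : predual w -> vN_tens D E X ->
  commutant (commutant D) (rslice w X).
Proof.
move=> pw_ vX; have bX := vN_tens_bop vX; split; first exact: rslice_bop.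
move=> S hS; have [bS _] := hS; have [xi [eta e]] := predualP pw_; rewrite e.
have XS := vN_commute_l hS vX.
have bg : bounded_op (gtens S (@id K) : tp H K -> _) by apply: gtens_bop => //; exact: bop_id.
apply/funext => x; apply: ip_ext => z; rewrite !compx.
have tS x1 (S1 : H -> H) (zeta : l2 K) : bounded_op S1 ->
    l2map (tens (tp H K) (S1 x1)) zeta = l2map (gtens S1 id) (l2map (tens (tp H K) x1) zeta).
  move=> bS1; rewrite -l2map_comp; [|by apply: gtens_bop => //; exact: bop_id|exact: tensl_bop].
  congr l2map; apply/funext => y /=.
  by rewrite gtensE//; exact: bop_id.
rewrite rslice_ip// tS// [in RHS](gadjE _ _ bS) rslice_ip// tS; last exact: gadj_bop.
rewrite -l2map_comp// XS l2map_comp// l2map_adj// gtens_adj//; last exact: bop_id.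
by rewrite -[gadj id]/(adj id) adj_id.
Qed.

Lemma lslice_commutant w (X : tp H K -> tp H K) : predual w -> vN_tens D E X ->
  commutant (commutant E) (lslice w X).
Proof.
move=> pw_ vX; have bX := vN_tens_bop vX; split; first exact: lslice_bop.
move=> S hS; have [bS _] := hS; have [xi [eta e]] := predualP pw_; rewrite e.
have XS := vN_commute_r hS vX.
have bg : bounded_op (gtens (@id H) S : tp H K -> _) by apply: gtens_bop => //; exact: bop_id.
apply/funext => x; apply: ip_ext => z; rewrite !compx.
have tS x1 (S1 : K -> K) (zeta : l2 H) : bounded_op S1 ->
    l2map (tensr (tp H K) (S1 x1)) zeta = l2map (gtens id S1) (l2map (tensr (tp H K) x1) zeta).
  move=> bS1; rewrite -l2map_comp; [|by apply: gtens_bop => //; exact: bop_id|exact: tensr_bop].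
  congr l2map; apply/funext => y /=.
  by rewrite /tensr gtensE//; exact: bop_id.
rewrite lslice_ip// tS// [in RHS](gadjE _ _ bS) lslice_ip// tS; last exact: gadj_bop.
rewrite -l2map_comp// XS l2map_comp// l2map_adj// gtens_adj//; last exact: bop_id.
by rewrite -[gadj id]/(adj id) adj_id.
Qed.
End VonNeumann.

(** * C*-algebras: square roots and lifting *)

Section CStarBasics.
Context {R : realType}.
Local Notation C := R[i].
Variable A : cstar R.
Implicit Types a b c x y t : A.
Local Notation "a ** b" := (cmul a b) (at level 40, left associativity).

Lemma cmulDl a b c : (a + b) ** c = a ** c + b ** c.
Proof. by have := cmul_linl 1 a b c; rewrite !scale1r. Qed.
Lemma cmulDr a b c : a ** (b + c) = a ** b + a ** c.
Proof. by have := cmul_linr 1 a b c; rewrite !scale1r. Qed.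
Lemma cmul0l c : 0 ** c = 0.
Proof. by apply: (addrI (0 ** c)); rewrite -cmulDl !addr0. Qed.
Lemma cmul0r c : c ** 0 = 0.
Proof. by apply: (addrI (c ** 0)); rewrite -cmulDr !addr0. Qed.
Lemma cmulZl k a c : (k *: a) ** c = k *: (a ** c).
Proof. by have := cmul_linl k a 0 c; rewrite !addr0 cmul0l addr0. Qed.
Lemma cmulZr k a c : c ** (k *: a) = k *: (c ** a).
Proof. by have := cmul_linr k c a 0; rewrite !addr0 cmul0r addr0. Qed.
Lemma cmulNl a c : (- a) ** c = - (a ** c).
Proof. by rewrite -scaleN1r cmulZl scaleN1r. Qed.
Lemma cmulNr a c : c ** (- a) = - (c ** a).
Proof. by rewrite -scaleN1r cmulZr scaleN1r. Qed.
Lemma cmulBl a b c : (a - b) ** c = a ** c - b ** c.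
Proof. by rewrite cmulDl cmulNl. Qed.
Lemma cmulBr a b c : a ** (b - c) = a ** b - a ** c.
Proof. by rewrite cmulDr cmulNr. Qed.
Lemma cinvD a b : cinv (a + b) = cinv a + cinv b.
Proof. by have := cinv_lin 1 a b; rewrite rmorph1 !scale1r. Qed.
Lemma cinv0 : cinv (0 : A) = 0.
Proof. by apply: (addrI (cinv 0)); rewrite -cinvD !addr0. Qed.
Lemma cinvZ k a : cinv (k *: a) = Num.conj k *: cinv a.
Proof. by have := cinv_lin k a 0; rewrite !addr0 cinv0 addr0. Qed.
Lemma cinvN a : cinv (- a) = - cinv a.
Proof. by rewrite -scaleN1r cinvZ rmorphN1 scaleN1r. Qed.
Lemma cinvB a b : cinv (a - b) = cinv a - cinv b.
Proof. by rewrite cinvD cinvN. Qed.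

Lemma cnr_mul a b : nr (a ** b) <= nr a * nr b.
Proof. by have := cmul_norm a b; rewrite !nrE -rmorphM lecR. Qed.
Lemma cnr_star a : nr (cinv a ** a) = nr a ^+ 2.
Proof. by have := cstar_norm a; rewrite !nrE -rmorphXn => /complexI. Qed.
Lemma cnr_inv a : nr (cinv a) = nr a.
Proof.
have h b : nr b <= nr (cinv b).
  have [b0|b0] := eqVneq (nr b) 0; first by rewrite b0 nr_ge0.
  have bp : 0 < nr b by rewrite lt_neqAle eq_sym b0 nr_ge0.
  by have := cnr_mul (cinv b) b; rewrite cnr_star expr2 ler_pM2r.
by apply/eqP; rewrite eq_le h andbT; have := h (cinv a); rewrite cinvK.
Qed.

Lemma cmul_lim_l x (u : nat -> A) l : seqlim u l -> seqlim (fun n => x ** u n) (x ** l).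
Proof. by apply: (seqlim_bnd (M := nr x)) => n; rewrite -cmulBr cnr_mul. Qed.
Lemma cmul_lim_r x (u : nat -> A) l : seqlim u l -> seqlim (fun n => u n ** x) (l ** x).
Proof.
by apply: (seqlim_bnd (M := nr x)) => n; rewrite -cmulBl mulrC; exact: cnr_mul.
Qed.
Lemma cinv_lim (u : nat -> A) l : seqlim u l -> seqlim (fun n => cinv (u n)) (cinv l).
Proof. by apply: (seqlim_bnd (M := 1)) => n; rewrite -cinvB cnr_inv mul1r. Qed.

Lemma seqlim_shift (u : nat -> A) l : seqlim u l -> seqlim (fun n => u n.+1) l.
Proof.
by move=> h e /h[N hN]; exists N => n Nn; apply: hN; exact: leqW.
Qed.

(** Majorant principle: [r] will be the same iteration run on real numbers, or a geometric bound,
    whose telescoping increments dominate those of [u]. *)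
Lemma dominated_lim (u : nat -> A) (r : nat -> R) (M : R) :
  (forall n, nr (u n.+1 - u n) <= r n.+1 - r n) -> (forall n, r n <= M) ->
  exists l, seqlim u l.
Proof.
move=> ur rM; apply: seqcauchy_lim.
have r_mono n : 0 <= r n.+1 - r n by exact: le_trans (nr_ge0 _) (ur n).
have [|s s1 s2] := @nneg_series _ (fun k => r k.+1 - r k) (M - r 0%N) r_mono.
  by move=> n; rewrite -(big_mkord xpredT (fun k => r k.+1 - r k)) telescope_sumr// lerD2r.
have tele n : \sum_(k < n) (r k.+1 - r k) = r n - r 0%N.
  by rewrite -(big_mkord xpredT (fun k => r k.+1 - r k)) telescope_sumr.
have key n k : nr (u (n + k)%N - u n) <= r (n + k)%N - r n.
  elim: k => [|k IH]; first by rewrite addn0 !subrr nr0.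
  rewrite addnS; apply: le_trans (nr_triang _ (u (n + k)%N) _) _.
  apply: le_trans (lerD (ur _) IH) _; lra.
move=> e e0; have [N hN] := s2 e e0; exists N.
have half m n : (N <= n)%N -> (n <= m)%N -> nr (u m - u n) <= e.
  move=> Nn nm; rewrite -(subnKC nm); apply: le_trans (key _ _) _.
  rewrite subnKC//; have := hN n Nn; have := s1 m; rewrite !tele; lra.
move=> m n Nm Nn; have [mn|nm] := leqP m n; last exact: half (ltnW nm).
by rewrite nrB half.
Qed.

(* The fixed point [y] of [y |-> (t + y y) / 2]; the iterates from 0 are dominated
   by those for the scalar [t = 1].  In a unital algebra [1 - y] is a square root
   of [1 - t]. *)
Lemma csqrt t : nr t <= 1 -> exists y, [/\ nr y <= 1, y + y = t + y ** y,
  cinv t = t -> cinv y = y & forall x, x ** t = t ** x -> x ** y = y ** x].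
Proof.
move=> t1; pose h : C := (2^-1 : R)%:C.
pose u n := iter n (fun y => h *: (t + y ** y)) 0.
pose r n : R := iter n (fun s => 2^-1 * (1 + s ^+ 2)) 0.
have uS n : u n.+1 = h *: (t + u n ** u n) by [].
have rS n : r n.+1 = 2^-1 * (1 + r n ^+ 2) by [].
have r01 n : 0 <= r n <= 1.
  elim: n => [|n /andP[r0 r1]]; first by rewrite lexx ler01.
  by rewrite rS; apply/andP; split; nra.
have nh : cn h = 2^-1 by rewrite cn_ge0r// invr_ge0.
have ur n : nr (u n) <= r n.
  elim: n => [|n IH]; first by rewrite nr0.
  rewrite uS nrZ nh rS ler_wpM2l ?invr_ge0//.
  apply: le_trans (nrD _ _) _; apply: lerD => //.
  by apply: le_trans (cnr_mul _ _) _; rewrite expr2 ler_pM ?nr_ge0.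
have du n : nr (u n.+1 - u n) <= r n.+1 - r n.
  elim: n => [|n IH].
    rewrite uS /u /r /= cmul0l addr0 subr0 nrZ nh expr0n /= addr0 mulr1 subr0.
    by rewrite ler_piMr ?invr_ge0.
  (* A factorisation of the difference of two squares that does not use commutativity. *)
  have -> : u n.+2 - u n.+1 = h *: (u n.+1 ** (u n.+1 - u n) + (u n.+1 - u n) ** u n).
    rewrite [u n.+2]uS {3}uS -scalerBr cmulBr cmulBl; congr (_ *: _).
    by rewrite addrA subrK opprD addrACA subrr add0r.
  rewrite nrZ nh [r n.+2]rS [X in _ <= _ - X]rS -mulrBr ler_wpM2l ?invr_ge0//.
  apply: le_trans (nrD _ _) _.
  have h1 := le_trans (cnr_mul (u n.+1) (u n.+1 - u n)) (ler_pM (nr_ge0 _) (nr_ge0 _) (ur _) IH).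
  have h2 := le_trans (cnr_mul (u n.+1 - u n) (u n)) (ler_pM (nr_ge0 _) (nr_ge0 _) IH (ur _)).
  by apply: le_trans (lerD h1 h2) _; nra.
have [y hy] := dominated_lim du (fun n => (andP (r01 n)).2).
exists y; split.
- by apply: seqlim_nr hy _ => n; apply: le_trans (ur n) _; case/andP: (r01 n).
- have h1 : seqlim (fun n => u n.+1) y by exact: seqlim_shift.
  have hyy : seqlim (fun n => u n ** u n) (y ** y).
    move=> e e0; have e2 : 0 < e / 2 by lra.
    have [N hN] := hy _ e2; exists N => n /hN hn.
    have -> : u n ** u n - y ** y = u n ** (u n - y) + (u n - y) ** y.
      by rewrite cmulBr cmulBl addrA subrK.
    have ny : nr y <= 1.
      by apply: seqlim_nr hy _ => k; apply: le_trans (ur k) _; case/andP: (r01 k).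
    have nu : nr (u n) <= 1 by apply: le_trans (ur n) _; case/andP: (r01 n).
    apply: le_trans (nrD _ _) _.
    have g1 := le_trans (cnr_mul (u n) (u n - y)) (ler_pM (nr_ge0 _) (nr_ge0 _) nu hn).
    have g2 := le_trans (cnr_mul (u n - y) y) (ler_pM (nr_ge0 _) (nr_ge0 _) hn ny).
    by apply: le_trans (lerD g1 g2) _; lra.
  have h2 : seqlim (fun n => h *: (t + u n ** u n)) (h *: (t + y ** y)).
    have := seqlimD (seqlim_cst t) hyy.
    by apply: (seqlim_bnd (M := cn h)) => n; rewrite -scalerBr nrZ.
  have e := seqlim_uniq h1 h2; rewrite {1 2}e -scalerDl -rmorphD /=.
  by rewrite (_ : 2^-1 + 2^-1 = 1) ?scale1r//; field.
- move=> tt; have h1 := cinv_lim hy; apply: seqlim_uniq h1 _.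
  have -> // : (fun n => cinv (u n)) = u.
  apply/funext; elim=> [|n IH]; first exact: cinv0.
  by rewrite uS cinvZ conj_real cinvD cinvM IH tt.
- move=> x xt; apply: seqlim_uniq (cmul_lim_l x hy) _.
  have -> : (fun n => x ** u n) = (fun n => u n ** x); last exact: cmul_lim_r.
  apply/funext; elim=> [|n IH]; first by rewrite cmul0l cmul0r.
  by rewrite uS cmulZl cmulZr cmulDl cmulDr xt cmulA IH -cmulA IH cmulA.
Qed.
End CStarBasics.

Section StarHom.
Context {R : realType}.
Local Notation C := R[i].
Variables (A : cstar R) (H : hilbert R) (f : A -> H -> H).
Hypothesis hf : star_hom f.

Lemma sh_bop a : bounded_op (f a). Proof. by case: hf. Qed.
Lemma sh_lin c a b : f (c *: a + b) = fun x => c *: f a x + f b x.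
Proof. by case: hf. Qed.
Lemma sh_mul a b x : f (cmul a b) x = f a (f b x).
Proof. by case: hf => _ _ h _; rewrite h. Qed.
Lemma sh_inv a : f (cinv a) = adj (f a). Proof. by case: hf. Qed.
Lemma shD a b x : f (a + b) x = f a x + f b x.
Proof. by have := sh_lin 1 a b; rewrite scale1r => ->; rewrite scale1r. Qed.
Lemma sh0 x : f 0 x = 0.
Proof. by apply: (addrI (f 0 x)); rewrite -shD !addr0. Qed.
Lemma shZ c a x : f (c *: a) x = c *: f a x.
Proof. by have := sh_lin c a 0; rewrite addr0 => ->; rewrite sh0 addr0. Qed.
Lemma shN a x : f (- a) x = - f a x.
Proof. by rewrite -scaleN1r shZ scaleN1r. Qed.
Lemma shB a b x : f (a - b) x = f a x - f b x.
Proof. by rewrite shD shN. Qed.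
Lemma sh_ip a x y : ip (f a x) y = ip x (f (cinv a) y).
Proof. by rewrite sh_inv adjE//; exact: sh_bop. Qed.
Lemma sh_linear a : linear (f a). Proof. exact: bop_lin (sh_bop a). Qed.

(** With y from [csqrt], a^* a = y + y - y y, so |x|^2 - |f(a) x|^2 = |x - f(y) x|^2. Formally 1 -
    a^* a = (1 - y)^2, but the identity is phrased inside the algebra, which may have no unit. *)
Lemma sh_contr1 a x : nr a <= 1 -> nr (f a x) <= nr x.
Proof.
move=> a1; have [|y [_ hy sy _]] := @csqrt _ _ (cmul (cinv a) a).
  by rewrite cnr_star expr_le1// nr_ge0.
have yy : cinv y = y by apply: sy; rewrite cinvM cinvK.
rewrite -(@ler_pXn2r _ 2)// ?nnegrE ?nr_ge0//.
have h : nr x ^+ 2 - nr (f a x) ^+ 2 = nr (x - f y x) ^+ 2.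
  have e : f (cmul (cinv a) a) x = f y x + f y x - f y (f y x).
    by rewrite -shD hy shD [f (cmul y y) _]sh_mul addrK.
  have fy v w : ip (f y v) w = ip v (f y w) by rewrite sh_ip yy.
  rewrite !nr_sqr [ip (f a x) _]sh_ip -sh_mul e.
  by rewrite [in RHS]ipBl !ipBr !ipDr ![ip (f y x) _]fy !(ReD, ReN); ring.
by rewrite -subr_ge0 h sqr_ge0.
Qed.

Lemma sh_contr a : bnd (f a) (nr a).
Proof.
move=> x; have [a0|a0] := eqVneq (nr a) 0.
  by rewrite (nr_eq0 a0) sh0 !nr0 mul0r.
have ap : 0 < nr a by rewrite lt_neqAle eq_sym a0 nr_ge0.
have := @sh_contr1 ((nr a)^-1%:C *: a) x.
rewrite shZ !nrZ cn_ge0r ?invr_ge0 ?nr_ge0// mulVf// => /(_ (lexx _)).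
by rewrite ler_pdivrMl.
Qed.

Lemma sh_salg : is_salg (range f).
Proof.
split.
- by move=> _ [a _ <-]; exact: sh_bop.
- by move=> _ [a _ <-]; exists (cinv a) => //; rewrite sh_inv.
- by move=> _ _ [a _ <-] [b _ <-]; exists (cmul a b) => //; apply/funext => x; rewrite sh_mul.
- by exists 0 => //; apply/funext => x; rewrite sh0.
- by move=> c _ _ [a _ <-] [b _ <-]; exists (c *: a + b) => //; rewrite sh_lin.
Qed.
End StarHom.

(** * Lifting along a *-homomorphism with control of the norm *)

Section Lift.
Context {R : realType}.
Local Notation C := R[i].
Variables (A : cstar R) (e : A).
Hypothesis ue : forall a : A, cmul e a = a /\ cmul a e = a.
Implicit Types a b c x y t u h : A.
Local Notation "a ** b" := (cmul a b) (at level 40, left associativity).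

Lemma conji : Num.conj 'i%C = - 'i%C :> C.
Proof. by apply/eqP; rewrite eq_complex /= oppr0 !eqxx. Qed.

Lemma ul a : e ** a = a. Proof. by case: (ue a). Qed.
Lemma ur a : a ** e = a. Proof. by case: (ue a). Qed.
Lemma cinv_unit : cinv e = e.
Proof. by rewrite -[LHS]ul -{1}(cinvK e) -cinvM ul cinvK. Qed.
Lemma nr_unit : nr e <= 1.
Proof.
have h : nr e ^+ 2 = nr e by rewrite -cnr_star cinv_unit ul.
have [->|e0] := eqVneq (nr e) 0; first exact: ler01.
by have := congr1 (fun z => z / nr e) h; rewrite expr2 mulfK// divff// => ->.
Qed.

Lemma csqrt1 k : cinv k = k -> nr (e - k) <= 1 -> exists d, [/\ cinv d = d, d ** d = k,
  nr (e - d) <= 1 & forall x, x ** k = k ** x -> x ** d = d ** x].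
Proof.
move=> sk hk; have [y [y1 yy sy cy]] := csqrt hk.
exists (e - y); split.
- by rewrite cinvB cinv_unit sy// cinvB cinv_unit sk.
- have -> : (e - y) ** (e - y) = e - (y + y - y ** y).
    by rewrite cmulBl !cmulBr !ul ur -addrA -opprD addrA.
  by rewrite yy addrK subKr.
- by rewrite subKr.
- move=> x xk; rewrite cmulBl cmulBr ul ur (cy x)//.
  by rewrite cmulBl cmulBr ul ur xk.
Qed.

(* For [d d = 1 - u u], [d + i u] is unitary, so its real part [d] is a contraction. *)
Lemma one_sub_sqr u : cinv u = u -> nr u <= 1 -> nr (e - u ** u) <= 1.
Proof.
move=> su u1; have nuu : nr (u ** u) <= 1.
  by rewrite -{1}su cnr_star expr_le1// nr_ge0.
have [|| d [sd dd _ cd]] := @csqrt1 (e - u ** u).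
- by rewrite cinvB cinv_unit cinvM su.
- by rewrite subKr.
have du : u ** d = d ** u by apply: cd; rewrite cmulBl cmulBr ul ur cmulA.
pose z := d + 'i%C *: u.
have zz : cinv z ** z = e.
  rewrite /z cinvD cinvZ sd su cmulDl !cmulDr !cmulZl !cmulZr dd du scalerA.
  rewrite conji.
  rewrite mulNr -expr2 sqr_i opprK scale1r scaleNr.
  by rewrite addrACA addrA !subrK.
have z1 : nr z <= 1.
  rewrite -(@ler_pXn2r _ 2)// ?nnegrE ?nr_ge0// -cnr_star zz expr1n.
  exact: nr_unit.
have d1 : nr d <= 1.
  have -> : d = (2^-1 : R)%:C *: (z + cinv z).
    rewrite /z cinvD cinvZ sd su.
    rewrite conji.
    rewrite scaleNr addrACA subrr addr0 scalerDr -scalerDl -rmorphD /=.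
    by rewrite (_ : 2^-1 + 2^-1 = 1) ?scale1r//; field.
  rewrite nrZ cn_ge0r ?invr_ge0//; apply: le_trans (ler_wpM2l _ (nrD _ _)) _.
    by rewrite invr_ge0.
  rewrite cnr_inv; move: z1; set q := nr z; lra.
by rewrite -dd -{1}sd cnr_star expr_le1// nr_ge0.
Qed.

(** w is the absolute value of u; [one_sub_sqr] is what allows [csqrt1] to be applied to the square
    of u. *)
Lemma cabs u : cinv u = u -> nr u <= 1 -> exists w, [/\ cinv w = w, w ** w = u ** u,
  nr (e - w) <= 1 & forall x, x ** u = u ** x -> x ** w = w ** x].
Proof.
move=> su u1.
have suu : cinv (u ** u) = u ** u by rewrite cinvM su.
have [w [sw ww w1 cw]] := csqrt1 suu (one_sub_sqr su u1).
exists w; split => // x xu; apply: cw.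
by rewrite cmulA xu -cmulA xu cmulA.
Qed.

Lemma cneumann q : nr q < 1 -> exists g, [/\ (e - q) ** g = e, g ** (e - q) = e &
  forall x, x ** q = q ** x -> x ** g = g ** x].
Proof.
move=> q1; pose v n := iter n (fun g => e + q ** g) 0.
pose r n : R := iter n (fun s => 1 + nr q * s) 0.
have vS n : v n.+1 = e + q ** v n by [].
have rS n : r n.+1 = 1 + nr q * r n by [].
have q0 := nr_ge0 q.
have rM n : r n <= (1 - nr q)^-1.
  elim: n => [|n IH]; first by rewrite /r /= invr_ge0 subr_ge0 ltW.
  rewrite rS; apply: le_trans (lerD (lexx 1) (ler_wpM2l q0 IH)) _.
  by rewrite le_eqVlt; apply/orP; left; apply/eqP; field; rewrite subr_eq0 gt_eqF.
have dv n : nr (v n.+1 - v n) <= r n.+1 - r n.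
  elim: n => [|n IH].
    by rewrite vS /v /r /= cmul0r mulr0 !subr0 !addr0 nr_unit.
  rewrite [v n.+2]vS {2}vS [r n.+2]rS {2}rS.
  have -> : e + q ** v n.+1 - (e + q ** v n) = q ** (v n.+1 - v n).
    by rewrite cmulBr opprD addrACA subrr add0r.
  have -> : 1 + nr q * r n.+1 - (1 + nr q * r n) = nr q * (r n.+1 - r n) by ring.
  by apply: le_trans (cnr_mul _ _) _; rewrite ler_wpM2l.
have [g hg] := dominated_lim dv rM.
have fg : g = e + q ** g.
  apply: (seqlim_uniq (seqlim_shift hg)).
  by have := seqlimD (seqlim_cst e) (cmul_lim_l q hg).
have cg x : x ** q = q ** x -> x ** g = g ** x.
  move=> xq; apply: seqlim_uniq (cmul_lim_l x hg) _.
  have -> : (fun n => x ** v n) = (fun n => v n ** x); last exact: cmul_lim_r.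
  apply/funext; elim=> [|n IH]; first by rewrite cmul0l cmul0r.
  by rewrite vS cmulDl cmulDr ul ur cmulA xq -cmulA IH cmulA.
have h1 : (e - q) ** g = e by rewrite cmulBl ul {1}fg addrK.
exists g; split => //.
by rewrite cmulBr ur -cg// -[X in X - _]ul -cmulBl.
Qed.
End Lift.

Section Commute.
Context {R : realType}.
Variable A : cstar R.
Implicit Types a b c : A.
Definition ccomm a b := cmul a b = cmul b a.
Lemma ccommM a b c : ccomm a b -> ccomm a c -> ccomm a (cmul b c).
Proof. by rewrite /ccomm => ab ac; rewrite cmulA ab -cmulA ac cmulA. Qed.
Lemma ccommD a b c : ccomm a b -> ccomm a c -> ccomm a (b + c).
Proof. by rewrite /ccomm => ab ac; rewrite cmulDl cmulDr ab ac. Qed.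
Lemma ccommZ a k b : ccomm a b -> ccomm a (k *: b).
Proof. by rewrite /ccomm => ab; rewrite cmulZl cmulZr ab. Qed.
Lemma ccommB a b c : ccomm a b -> ccomm a c -> ccomm a (b - c).
Proof. by rewrite /ccomm => ab ac; rewrite cmulBl cmulBr ab ac. Qed.
End Commute.

Section Cayley.
Context {R : realType}.
Local Notation C := R[i].
Variables (A : cstar R) (e : A).
Hypothesis ue : forall a : A, cmul e a = a /\ cmul a e = a.
Implicit Types a b c x y t u h : A.
Local Notation "a ** b" := (cmul a b) (at level 40, left associativity).

(** N = h + i X is normal with N^* N = h h + X X, the inverse of G. Hence z = N N G is unitary, and
    z - z^* = 4 i h X G has norm at most 2. *)
Lemma cayley h X G : cinv h = h -> cinv X = X -> h ** X = X ** h ->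
  G ** h = h ** G -> G ** X = X ** G ->
  (h ** h + X ** X) ** G = e -> nr (h ** X ** G) <= 2^-1.
Proof.
move=> sh sX hX Gh GX; set P := h ** h + X ** X => PG.
have hP : ccomm h P by apply: ccommD; apply: ccommM.
have Ph : P ** h = h ** P by rewrite hP.
have XP : ccomm X P by apply: ccommD; apply: ccommM.
have PX : P ** X = X ** P by rewrite XP.
have GP : G ** P = e by rewrite -PG; apply: ccommD; apply: ccommM.
have sP : cinv P = P by rewrite /P cinvD !cinvM sh sX.
have sG : cinv G = G.
  have h1 : cinv G ** P = e by rewrite -{1}sP -cinvM PG (cinv_unit ue).
  by rewrite -[LHS](ur ue) -PG cmulA h1 (ul ue).
pose N := h + 'i%C *: X; pose N' := h - 'i%C *: X.
have sN : cinv N = N' by rewrite /N cinvD cinvZ sh sX conji scaleNr.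
have sN' : cinv N' = N by rewrite -sN cinvK.
have N'N : N' ** N = P.
  rewrite /N /N' cmulBl !cmulDr !cmulZl !cmulZr hX scalerA -expr2 sqr_i.
  by rewrite scaleN1r opprD opprK addrA addrK.
have PN : P ** N = N ** P by rewrite /N cmulDl cmulDr cmulZl cmulZr Ph PX.
have NN : N ** N = (h ** h - X ** X) + ('i%C *: (h ** X) + 'i%C *: (h ** X)).
  rewrite /N cmulDl !cmulDr !cmulZl !cmulZr -hX scalerA -expr2 sqr_i scaleN1r.
  by rewrite addrACA [in LHS]addrC [in LHS]addrC addrACA [LHS]addrACA [X in _ + X]addrC [LHS]addrACA.
have NN' : N' ** N' = (h ** h - X ** X) - ('i%C *: (h ** X) + 'i%C *: (h ** X)).
  rewrite -sN -cinvM NN cinvD cinvB !cinvM sh sX !cinvD !cinvZ cinvM sh sX conji.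
  by rewrite -hX !scaleNr -opprD.
pose z := N ** N ** G.
have sz : cinv z = N' ** N' ** G.
  rewrite /z !cinvM sG sN NN'; set h2 := h ** h; set X2 := X ** X; set hX1 := h ** X.
  suff h3 : ccomm G (h2 - X2 - ('i%C *: hX1 + 'i%C *: hX1)) by [].
  by apply: ccommB; [apply: ccommB|apply: ccommD; apply: ccommZ]; apply: ccommM.
have zz : cinv z ** z = e.
  have -> : cinv z = G ** (N' ** N') by rewrite /z !cinvM sG sN.
  rewrite /z; have -> : G ** (N' ** N') ** (N ** N ** G) = G ** (N' ** (N' ** N) ** N) ** G.
    by rewrite !cmulA.
  by rewrite N'N -(cmulA N') PN (cmulA N' N) N'N (cmulA G P) GP (ul ue) PG.
have z1 : nr z <= 1.
  rewrite -(@ler_pXn2r _ 2)// ?nnegrE ?nr_ge0// -cnr_star zz expr1n.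
  exact: nr_unit ue.
have d : z - cinv z = (4%:R * 'i%C) *: (h ** X ** G).
  rewrite sz /z -cmulBl NN NN' opprB addrC addrA subrK.
  rewrite -!scalerDl cmulZl; congr (_ *: _).
  by ring.
have : nr (z - cinv z) <= 2.
  apply: le_trans (nrD _ _) _; rewrite nrN cnr_inv.
  by move: z1; set q := nr z; lra.
rewrite d nrZ cnM cni mulr1.
rewrite -[4%:R](rmorph_nat (real_complex R)) cn_ge0r//.
by set q := nr _; lra.
Qed.
End Cayley.

Section PosUniq.
Context {R : realType}.
Variables (H : hilbert R) (P Q D : H -> H).
(** Put y = P x - Q x; then P y + Q y = 0. Since P = D D and Q are positive, both <P y, y> and <Q y,
    y> vanish, so D y = 0, P y = 0 and Q y = 0, which makes y orthogonal to P x - Q x = y. *)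
Lemma pos_sqrt_uniq : linear P -> linear Q ->
  (forall x y, ip (P x) y = ip x (P y)) -> (forall x y, ip (Q x) y = ip x (Q y)) ->
  (forall x y, ip (D x) y = ip x (D y)) -> D 0 = 0 -> (forall x, P x = D (D x)) ->
  (forall x, 0 <= complex.Re (ip (Q x) x)) ->
  (forall x, P (Q x) = Q (P x)) -> (forall x, P (P x) = Q (Q x)) ->
  forall x, P x = Q x.
Proof.
move=> lP lQ sP sQ sD D0 PD Qp PQ PP x.
pose y := P x - Q x.
have y1 : P y + Q y = 0.
  by rewrite /y (linB lP) (linB lQ) PP PQ addrA subrK subrr.
have py : complex.Re (ip (P y) y) = nr (D y) ^+ 2 by rewrite PD sD nr_sqr.
have : complex.Re (ip (P y) y) + complex.Re (ip (Q y) y) = 0.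
  by rewrite -ReD -ipDl y1 ip0l.
rewrite py => h.
have Dy : D y = 0.
  apply: nr_eq0; apply/eqP; rewrite -sqrf_eq0; apply/eqP.
  by have := Qp y; have := sqr_ge0 (nr (D y)); lra.
have Py : P y = 0 by rewrite PD Dy.
have Qy : Q y = 0 by move: y1; rewrite Py add0r.
suff : y = 0 by move/eqP; rewrite subr_eq0 => /eqP.
apply: nr_eq0; apply/eqP; rewrite -sqrf_eq0; apply/eqP.
by rewrite nr_sqr {2}/y ipBr -sP -sQ Py Qy !ip0l subrr.
Qed.
End PosUniq.

Section LiftThm.
Context {R : realType}.
Local Notation C := R[i].
Variables (A : cstar R) (e : A) (H : hilbert R) (f : A -> H -> H).
Hypothesis ue : forall a : A, cmul e a = a /\ cmul a e = a.
Hypotheses (hf : star_hom f) (fe : f e = id).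
Implicit Types a b c x y t u h : A.
Local Notation "a ** b" := (cmul a b) (at level 40, left associativity).

(* The lift is [2 r h X (h h + X X)^-1] with [X = r + |r^2 - h^2|^(1/2)]; its norm
   is at most [r] because the Cayley transform [(h + i X) (h - i X)^-1] is unitary,
   and under [f] the square root becomes that of a positive operator. *)
Lemma lift_small h (r : R) : cinv h = h -> nr h <= 2^-1 -> 0 < r -> r <= 2^-1 ->
  bnd (f h) r -> exists2 c, f c = f h & nr c <= r.
Proof.
move=> sh h1 r0 r1 fr; pose u := (r ^+ 2)%:C *: e - h ** h.
have se := cinv_unit ue.
have su : cinv u = u by rewrite /u cinvB cinvZ conj_real se cinvM sh.
have r2 : 0 <= r ^+ 2 by rewrite sqr_ge0.
have u1 : nr u <= 1.
  apply: le_trans (nrD _ _) _; rewrite nrN nrZ cn_ge0r// -{1}sh cnr_star.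
  have : r ^+ 2 * nr e <= r ^+ 2 * 1 by rewrite ler_wpM2l// (nr_unit ue).
  by move: (nr_ge0 h) h1; set q := nr h; set p := nr e; nra.
have [w [sw ww w1 cw]] := cabs ue su u1.
have [d [sd dd d1 cd]] := csqrt1 ue sw w1.
have hu : h ** u = u ** h.
  by rewrite /u cmulBl cmulBr cmulZl cmulZr (ul ue) (ur ue) cmulA.
have hd : h ** d = d ** h by apply: cd; exact: cw.
pose X := r%:C *: e + d; pose P := h ** h + X ** X.
have sX : cinv X = X by rewrite /X cinvD cinvZ conj_real se sd.
have hX : h ** X = X ** h.
  by rewrite /X cmulDl cmulDr cmulZl cmulZr (ul ue) (ur ue) hd.
have XX : X ** X = (r ^+ 2)%:C *: e + (r *+ 2)%:C *: d + w.
  rewrite /X cmulDl !cmulDr !cmulZl !cmulZr (ul ue) !(ur ue) (ul ue) dd scalerA -rmorphM -expr2.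
  by rewrite mulr2n rmorphD scalerDl !addrA.
(* From X X = r^2 + 2 r d + w, the element (lam + r^2) e - P is (e - h h) + 2 r (e - d) + (e - w),
   of norm at most 1 + 2 r + 1 = lam. The additional r^2 gives the strict inequality needed to
   invert P. *)
pose lam := 2 + 2 * r; pose k := (lam + r ^+ 2)^-1.
have lam0 : 0 < lam + r ^+ 2 by rewrite /lam; nra.
have k0 : 0 < k by rewrite invr_gt0.
pose q := e - k%:C *: P.
have eq : q = k%:C *: ((e - h ** h) + ((r *+ 2)%:C *: (e - d) + (e - w))).
  rewrite /q /P XX; have {1}-> : e = k%:C *: ((lam + r ^+ 2)%:C *: e).
    by rewrite scalerA -rmorphM /= mulVf ?scale1r// gt_eqF.
  rewrite -scalerBr; congr (_ *: _).
  have -> : (lam + r ^+ 2)%:C = 1 + (r *+ 2)%:C + 1 + (r ^+ 2)%:C :> C.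
    have -> : lam + r ^+ 2 = 1 + r *+ 2 + 1 + r ^+ 2 by rewrite /lam; ring.
    by rewrite !(rmorphD (real_complex R)) rmorph1.
  rewrite !scalerDl !scale1r scalerBr.
  by rewrite !opprD !addrA [LHS](ACl (1*5*2*7*3*8*4*6))%AC /= addrK.
have q1 : nr q < 1.
  rewrite eq nrZ cn_ge0r ?(ltW k0)// mulrC ltr_pdivrMr// mul1r.
  have g1 : nr (e - h ** h) <= 1.
    apply: one_sub_sqr => //; apply: le_trans h1 _; lra.
  have g2 : nr ((r *+ 2)%:C *: (e - d)) <= 2 * r.
    rewrite nrZ cn_ge0r ?mulrn_wge0 ?(ltW r0)//.
    by have := ler_wpM2l (mulrn_wge0 2 (ltW r0)) d1; rewrite mulr1 mulr_natl.
  apply: le_lt_trans (nrD _ _) _; apply: le_lt_trans (lerD (lexx _) (nrD _ _)) _.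
  have r20 : 0 < r ^+ 2 by rewrite exprn_gt0.
  apply: le_lt_trans (lerD g1 (lerD g2 w1)) _; rewrite /lam; lra.
have [g [g1 g2 cg]] := cneumann ue q1.
pose G := k%:C *: g.
have PG : P ** G = e.
  by rewrite /G cmulZr -cmulZl -[_ *: P](subKr e) -/q.
have hP : h ** P = P ** h by apply: ccommD; apply: ccommM.
have XP : X ** P = P ** X by apply: ccommD; apply: ccommM.
have cG x : x ** P = P ** x -> G ** x = x ** G.
  move=> xP; rewrite /G cmulZl cmulZr cg// /q cmulBl cmulBr cmulZl cmulZr xP.
  by rewrite (ul ue) (ur ue).
have cay := cayley ue sh sX hX (cG _ hP) (cG _ XP) PG.
exists ((r *+ 2)%:C *: (h ** X ** G)); last first.
  rewrite nrZ cn_ge0r ?mulrn_wge0 ?(ltW r0)//.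
  apply: le_trans (ler_wpM2l _ cay) _; first by rewrite mulrn_wge0 ?(ltW r0).
  by rewrite mulr2n; lra.
have fsa a : cinv a = a -> forall v v' : H, ip (f a v) v' = ip v (f a v').
  by move=> sa v v'; rewrite sh_ip// sa.
(* Under f the element u becomes r^2 - f(h)^2, positive since f(h) is bounded by r. So f(w) and f(u)
   are two positive square roots of the same operator. *)
have fw (v : H) : f w v = f u v.
  apply: (@pos_sqrt_uniq _ _ (f w) (f u) (f d)); try exact: (sh_linear hf).
  - exact: fsa.
  - exact: fsa.
  - exact: fsa.
  - exact: lin0 (sh_linear hf d).
  - by move=> y; rewrite -sh_mul// dd.
  - move=> y; rewrite /u shB// shZ// fe sh_mul// ipBl ipZl fsa// ReD ReN ReM_real -!nr_sqr.
    rewrite subr_ge0 -exprMn lerXn2r ?nnegrE ?mulr_ge0 ?nr_ge0 ?(ltW r0)//.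
  - move=> y; rewrite -!sh_mul//; congr (f _ y); symmetry; apply: cw; reflexivity.
  - by move=> y; rewrite -!sh_mul// ww.
apply/funext => x; rewrite shZ// -cmulA sh_mul// -(linZ (sh_linear hf h)); congr (f h _).
rewrite sh_mul// -shZ//.
(* As f(w) = r^2 - f(h)^2, the terms in h cancel in f(P), leaving 2 r^2 + 2 r f(d) = 2 r f(X);
   multiplying by f(G) turns this into the identity. *)
suff fP (y : H) : f ((r *+ 2)%:C *: X) y = f P y by rewrite fP -sh_mul// PG fe.
rewrite /P XX !shD// fw /u shB// /X !shZ// shD// shZ// fe sh_mul//.
rewrite scalerDr scalerA -rmorphM /=.
have -> : (r *+ 2 * r)%:C = (r ^+ 2)%:C + (r ^+ 2)%:C :> C.
  by rewrite -(rmorphD (real_complex R)) /=; congr (_%:C); ring.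
rewrite scalerDl; set p := _ *: y; set m := _ *: f d y; set n := f h (f h y).
by rewrite !addrA [RHS](ACl (2*4*3*1*5))%AC /= addrK.
Qed.

Lemma lift_sa h (M : R) : cinv h = h -> 0 <= M -> bnd (f h) M ->
  exists2 c, f c = f h & nr c <= M.
Proof.
move=> sh; rewrite le_eqVlt => /orP[/eqP <-|M0] fh.
  exists 0; last by rewrite nr0.
  apply/funext => x; rewrite sh0//; symmetry; apply: nr_eq0.
  by apply/eqP; rewrite eq_le nr_ge0 andbT; have := fh x; rewrite mul0r.
(* Dividing by s brings both the norm of h and the bound M below 1/2, as [lift_small] wants. *)
pose s := 2 * (nr h + M); have s0 : 0 < s.
  by rewrite /s mulr_gt0// ltr_wpDl ?nr_ge0.
have [|||||c fc nc] := @lift_small (s^-1%:C *: h) (s^-1 * M).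
- by rewrite cinvZ conj_real sh.
- rewrite nrZ cn_ge0r ?invr_ge0 ?(ltW s0)// ler_pdivrMl// /s.
  by have := nr_ge0 h; move: (ltW M0); set p := nr h; lra.
- by rewrite mulr_gt0 ?invr_gt0.
- rewrite ler_pdivrMl// /s.
  by have := nr_ge0 h; set p := nr h; lra.
- move=> x; rewrite shZ// nrZ cn_ge0r ?invr_ge0 ?(ltW s0)// -mulrA ler_wpM2l ?fh//.
  by rewrite invr_ge0 ltW.
exists (s%:C *: c).
  apply/funext => x; rewrite shZ// fc shZ// scalerA -rmorphM /= mulfV ?gt_eqF//.
  by rewrite scale1r.
by rewrite nrZ cn_ge0r ?(ltW s0)// -ler_pdivlMl.
Qed.

(** The factor 2 comes from lifting the real and the imaginary part separately. *)
Lemma star_lift a (M : R) : 0 <= M -> bnd (f a) M -> exists2 c, f c = f a & nr c <= 2 * M.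
Proof.
move=> M0 fa; have bi : bnd (f (cinv a)) M.
  by rewrite sh_inv//; apply: gadj_bnd => //; exact: sh_bop.
pose h : C := (2^-1 : R)%:C.
have nh : cn h = 2^-1 by rewrite cn_ge0r// invr_ge0.
have hh : h + h = 1 by rewrite -rmorphD /= (_ : 2^-1 + 2^-1 = 1)//; field.
have hb (k : C) (b : A) : cn k = 1 -> f b = (fun x : H => h *: (f a x + k *: f (cinv a) x)) -> bnd (f b) M.
  move=> k1 -> x; rewrite nrZ nh; apply: le_trans (ler_wpM2l _ (nrD _ _)) _.
    by rewrite invr_ge0.
  rewrite nrZ k1 mul1r; have := fa x; have := bi x; lra.
have [||c fc nc] := @lift_sa (h *: (a + cinv a)) M _ M0.
- by rewrite cinvZ conj_real cinvD cinvK addrC.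
- apply: (hb 1); first exact: cn1.
  by apply/funext => x; rewrite shZ// shD// scale1r.
have [||d fd nd] := @lift_sa ((- 'i%C * h) *: (a - cinv a)) M _ M0.
- rewrite cinvZ; have -> : Num.conj (- 'i%C * h) = 'i%C * h.
    by rewrite /h; apply/eqP; rewrite eq_complex /=; apply/andP; split; apply/eqP; ring.
  rewrite cinvB cinvK.
  by rewrite -opprB scalerN -scaleNr mulNr.
- move=> x; rewrite -scalerA shZ// nrZ cnN cni mul1r.
  apply: (hb (-1)); first by rewrite cnN cn1.
  by apply/funext => z; rewrite shZ// shB// scaleN1r.
exists (c + 'i%C *: d).
  apply/funext => x; rewrite shD// shZ// fc fd !shZ// shD// shB// scalerA mulrA mulrN.
  rewrite -expr2 sqr_i opprK mul1r -scalerDr addrACA subrr addr0.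
  by rewrite scalerDr -scalerDl hh scale1r.
apply: le_trans (nrD _ _) _; rewrite nrZ cni mul1r.
by rewrite mulr_natl mulr2n lerD.
Qed.
End LiftThm.

(** * Universal representations *)

Section UnivRep.
Context {R : realType}.
Local Notation C := R[i].

Definition nondegenerate (A : cstar R) (H : hilbert R) (f : A -> H -> H) :=
  forall x, (forall a, f a x = 0) -> x = 0.

Lemma nondeg_unit (A : cstar R) (H : hilbert R) (f : A -> H -> H) e :
  star_hom f -> nondegenerate f -> (forall a : A, cmul e a = a /\ cmul a e = a) -> f e = id.
Proof.
move=> hf nf ue; apply/funext => x; apply/eqP; rewrite -subr_eq0; apply/eqP.
apply: nf => a; rewrite (linB (sh_linear hf a)) -sh_mul//.
by case: (ue a) => _ ->; rewrite subrr.
Qed.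

Lemma dual_bnd (V : normedModType C) (f : V -> C^o) : dual f ->
  (forall c x y, f (c *: x + y) = c * f x + f y) /\ exists2 M : R, 0 <= M & forall x, cn (f x) <= M * nr x.
Proof. by move=> /bounded_opP[lf [M M0 hM]]; split=> //; exists M. Qed.

Lemma dual_intro (V : normedModType C) (f : V -> C^o) (M : R) :
  (forall c x y, f (c *: x + y) = c * f x + f y) -> (forall x, cn (f x) <= M * nr x) -> dual f.
Proof. by move=> lf hM; exact: (bnd_op lf hM). Qed.

Lemma dual_pair (A : cstar R) (H : hilbert R) (f : A -> H -> H) w :
  star_hom f -> predual w -> dual (fun a => pair_op w (f a)).
Proof.
move=> hf pw_; have [k k0 hk] := pair_op_bnd pw_.
apply: (dual_intro (M := k)) => [c x y|a].
  by rewrite (sh_lin hf) pair_op_comb//; exact: sh_bop.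
by apply: hk; [exact: sh_bop|exact: nr_ge0|exact: sh_contr].
Qed.

Lemma dual_vec (A : cstar R) (H : hilbert R) (f : A -> H -> H) x y :
  star_hom f -> dual (fun a => ip (f a x) y : C^o).
Proof.
move=> hf; have -> : (fun a => ip (f a x) y : C^o) = (fun a => pair_op (vec_fun x y) (f a)).
  by apply/funext => a; rewrite pair_vec//; exact: sh_bop.
by apply: dual_pair => //; rewrite vec_pw; exact: pw_predual.
Qed.

Section One.
Variables (A : cstar R) (u : univ_rep A).
Notation f := (urep u).
Lemma urep_sh : star_hom f. Proof. exact: urep_hom. Qed.
Lemma urep_bop a : bounded_op (f a). Proof. exact: (sh_bop urep_sh). Qed.

Lemma urep_nd : nondegenerate f.
Proof.
move=> x hx; apply: (@total_ip _ (A * usp u)%type _ (fun p => f p.1 p.2)) => [|[a y]].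
  move=> z r r0; have [|n [a [y h]]] := @urep_nondeg _ _ u z r%:C; first by rewrite ltcR.
  exists [seq (1, (a k, y k)) | k <- index_enum 'I_n].
  rewrite /lcomb big_map /=; under eq_bigr do rewrite scale1r.
  by rewrite -lecR -nrE.
rewrite ip0l -[a]cinvK -(sh_ip urep_sh) hx ip0l //.
Qed.

Lemma urep_salg : is_salg (range f). Proof. exact: (sh_salg urep_sh). Qed.
Lemma urep_ann x : (forall d, range f d -> d x = 0) -> x = 0.
Proof. by move=> h; apply: urep_nd => a; apply: h; exists a. Qed.

Lemma bicommutant_sub (H : hilbert R) (D : set (H -> H)) :
  D `<=` bounded_op (V:=H) (W:=H) -> D `<=` bicommutant D.
Proof. by move=> bD S DS; split; [exact: bD|move=> T [bT hT]; rewrite hT]. Qed.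

Lemma urep_bidual a : bidual u (f a).
Proof. by apply: bicommutant_sub => [_ [b _ <-]|]; [exact: urep_bop|exists a]. Qed.
Lemma bidual_bop T : bidual u T -> bounded_op T. Proof. by case. Qed.

Lemma bidual_ext v w : predual v -> predual w ->
  (forall a, pair_op v (f a) = pair_op w (f a)) ->
  forall T, bidual u T -> pair_op v T = pair_op w T.
Proof.
move=> pv pw_ h T hT; apply: (pair_density urep_salg urep_ann) hT => //.
by move=> _ [a _ <-].
Qed.

Lemma normal_funP (m : A -> C^o) : dual m -> predual (Defs.normal_fun u m) /\
  forall a, m a = pair_op (Defs.normal_fun u m) (f a).
Proof.
move=> dm; have [w pw_ hw] := urep_univ u dm; rewrite /Defs.normal_fun.
by case: xgetP => [w' _ //|/(_ w)]; case.
Qed.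
Lemma nf_predual (m : A -> C^o) : dual m -> predual (Defs.normal_fun u m).
Proof. by case/normal_funP. Qed.
Lemma nfE (m : A -> C^o) a : dual m -> pair_op (Defs.normal_fun u m) (f a) = m a.
Proof. by case/normal_funP. Qed.
(** [normal_fun] is a choice; on A** its values do not depend on it, and any representing pair may
    be substituted. *)
Lemma nf_bidual (m : A -> C^o) w T : dual m -> predual w -> (forall a, pair_op w (f a) = m a) ->
  bidual u T -> pair_op (Defs.normal_fun u m) T = pair_op w T.
Proof.
move=> dm pw_ h; apply: bidual_ext => //; first exact: nf_predual.
by move=> a; rewrite nfE.
Qed.
Lemma nf_vec x y T : bidual u T ->
  pair_op (Defs.normal_fun u (fun a => ip (f a x) y)) T = ip (T x) y.
Proof.
move=> hT; rewrite (nf_bidual (w := vec_fun x y))//.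
- by rewrite pair_vec//; exact: bidual_bop.
- exact: dual_vec urep_sh.
- by rewrite vec_pw; exact: pw_predual.
- by move=> a; rewrite pair_vec//; exact: urep_bop.
Qed.

(** The matrix coefficients of g are functionals on A, and each of these factors through the
    universal representation. *)
Lemma urep_ker (H : hilbert R) (g : A -> H -> H) a b : star_hom g ->
  f a = f b -> g a = g b.
Proof.
move=> hg ab; apply/funext => x; apply: ip_ext => z.
have d := dual_vec x z hg.
by have := nfE a d; have := nfE b d; rewrite ab => -> .
Qed.

Lemma normal_ext_urep (H : hilbert R) (g : A -> H -> H) a : star_hom g ->
  normal_ext u g (f a) = g a.
Proof.
move=> hg; apply/funext => x; rewrite /normal_ext.
have d z := dual_vec x z hg.
case: xgetP => [t _ ht|/(_ (g a x))]; last first.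
  by case=> z; rewrite nfE.
by apply: ip_ext => z; rewrite ht nfE.
Qed.
End One.

Section Unital.
Variables (A : cstar R) (e : A) (H : hilbert R) (g : A -> H -> H).
Hypotheses (ue : forall a : A, cmul e a = a /\ cmul a e = a)
  (hg : star_hom g) (ge : g e = id).

(** Approximants at distance 2^-n have differences of image norm at most 2 * 2^-n; [star_lift]
    replaces these differences by elements of norm at most 4 * 2^-n, whose series converges in A. *)
Lemma range_closed T : op_closure (range g) T -> range g T.
Proof.
move=> [bT hT].
have h2 n : (0 : R) < 2^-1 ^+ n by rewrite exprn_gt0 ?invr_gt0.
have step (n : nat) : exists a, bnd (fun x => T x - g a x) (2^-1 ^+ n).
  have [|_ [a _ <-] ha] := hT (2^-1 ^+ n)%:C; first by rewrite ltcR.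
  by exists a => x; have := ha x; rewrite !nrE -rmorphM lecR.
pose a n := projT1 (cid (step n)).
have ha n : bnd (fun x => T x - g (a n) x) (2^-1 ^+ n) by rewrite /a; case: cid.
have step2 n : exists c, g c = g (a n.+1 - a n) /\ nr c <= 4 * 2^-1 ^+ n.
  have [||c gc nc] := @star_lift _ _ _ _ _ ue hg ge (a n.+1 - a n) (2 * 2^-1 ^+ n).
  - by rewrite mulr_ge0 ?(ltW (h2 n)).
  - move=> x; rewrite shB//.
    have -> : g (a n.+1) x - g (a n) x = (T x - g (a n) x) - (T x - g (a n.+1) x).
      by rewrite opprB [RHS]addrC addrA subrK.
    apply: le_trans (nrD _ _) _; rewrite nrN mulrDl mul1r mulrDl.
    apply: lerD; first exact: ha.
    apply: le_trans (ha _ _) _; rewrite ler_wpM2r ?nr_ge0// exprS.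
    by rewrite ler_piMl ?(ltW (h2 n))// invf_le1 ?ler1n.
  - by exists c; split => //; apply: le_trans nc _; rewrite mulrA -natrM.
pose c n := projT1 (cid (step2 n)).
have hc n : g (c n) = g (a n.+1 - a n) /\ nr (c n) <= 4 * 2^-1 ^+ n.
  by rewrite /c; case: cid.
pose s n := a 0%N + \sum_(k < n) c k.
have sS n : s n.+1 = s n + c n by rewrite /s big_ord_recr addrA.
have gs n : g (s n) = g (a n).
  elim: n => [|n IH]; first by rewrite /s big_ord0 addr0.
  apply/funext => x; rewrite sS shD// IH (hc n).1 shB//.
  by rewrite addrC subrK.
(* The real sequence -8 * 2^-n increases by exactly 4 * 2^-n at each step. *)
have [||l hl] := @dominated_lim _ _ s (fun n => - (8 * 2^-1 ^+ n)) 0.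
- move=> n; rewrite sS addrC addKr; apply: le_trans (hc n).2 _.
  by rewrite exprS; set q := _ ^+ n; lra.
- by move=> n; rewrite oppr_le0 mulr_ge0 ?(ltW (h2 n)).
exists l => //; apply/funext => x.
have l1 : seqlim (fun n => g (s n) x) (g l x).
  by apply: (seqlim_bnd (M := nr x)) hl => n; rewrite -shB// mulrC; exact: sh_contr.
apply: (seqlim_uniq l1).
move=> r r0; have x1 : 0 < nr x + 1 by rewrite ltr_wpDl ?nr_ge0.
have [N hN] := inv_small (divr_gt0 r0 x1).
exists N => n Nn; rewrite nrB gs; apply: le_trans (ha n x) _.
have h3 : 2^-1 ^+ n <= n.+1%:R^-1 :> R.
  rewrite exprVn lef_pV2 ?posrE ?exprn_gt0 ?ltr0Sn//.
  by rewrite -natrX ler_nat ltn_expl.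
apply: le_trans (_ : r / (nr x + 1) * (nr x + 1) <= _); last by rewrite divfK// gt_eqF.
apply: ler_pM; rewrite ?nr_ge0 ?(ltW (h2 n))//; last by rewrite lerDl.
exact: le_trans h3 (hN n Nn).
Qed.
End Unital.

Lemma op_closure_bnd (H : hilbert R) (D : set (H -> H)) T : op_closure D T <->
  bounded_op T /\ forall r : R, 0 < r -> exists2 S, D S & bnd (fun x => T x - S x) r.
Proof.
split=> -[bT h]; split => //.
  move=> r r0; have [|S DS hS] := h r%:C; first by rewrite ltcR.
  by exists S => // x; have := hS x; rewrite !nrE -rmorphM lecR.
move=> _ /epsC[r r0 ->]; have [S DS hS] := h r r0.
by exists S => // x; rewrite !nrE -rmorphM lecR; exact: hS.
Qed.
End UnivRep.

(** * Amplification *)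

Section Forms.
Context {R : realType}.
Local Notation C := R[i].

Lemma cn_compl (u : nat -> C^o) :
  (forall e : R, 0 < e -> exists N, forall m n, (N <= m)%N -> (N <= n)%N -> cn (u m - u n) <= e) ->
  exists l : C^o, forall e : R, 0 < e -> exists N, forall n, (N <= n)%N -> cn (u n - l) <= e.
Proof. by move=> /complex_cauchy. Qed.
Definition scalar_nd : @normdata R := @NormData R C^o (@cn R) (@cnD R) (@cnM R) (@cn_eq0 R) cn_compl.

(** Riesz in the second variable for each vector of u, followed by [bounded_extension] in the first.
    The families are merely total, so the bound has to be stated on formal combinations. *)
Lemma form_op (I J : Type) (H K : hilbert R) (u : I -> H) (v : J -> K) (g : I -> J -> C) (M : R) :
  total_family u -> total_family v -> 0 <= M ->
  (forall s t, cn (\sum_(p <- s) \sum_(q <- t) p.1 * Num.conj q.1 * g p.2 q.2)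
     <= M * nr (lcomb u s) * nr (lcomb v t)) ->
  exists Y : H -> K, bounded_op Y /\ forall i j, ip (Y (u i)) (v j) = g i j.
Proof.
move=> tu tv M0 hg.
have step i : exists y : K, forall j, ip y (v j) = g i j.
  have [||f [lf bf fv]] := @bounded_extension R J K (ndsp scalar_nd) v
    (fun j => Num.conj (g i j)) (M * nr (u i)) _ tv.
  - by rewrite mulr_ge0 ?nr_ge0.
  - move=> t; have := hg [:: (1, i)] t.
    rewrite big_seq1 /lcomb big_seq1 scale1r /= nd_nr /=; apply: le_trans.
    rewrite -[X in _ <= X]cnJ rmorph_sum /= le_eqVlt; apply/orP; left; apply/eqP.
    congr cn; apply: eq_bigr => q _.
    by rewrite !rmorphM /= conjCK rmorph1 mul1r.
  have [z hz] := @riesz R K f (M * nr (u i)) lf bf.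
  by exists z => j; rewrite ip_conj -hz fv conjCK.
pose y i := projT1 (cid (step i)).
have hy i j : ip (y i) (v j) = g i j by rewrite /y; case: cid.
have [|Y [lY bY hY]] := @bounded_extension R I H K u y M M0 tu; last first.
  exists Y; split; first exact: bnd_op lY bY.
  by move=> i j; rewrite hY hy.
move=> s; set X := lcomb y s; set N := M * nr (lcomb u s).
have N0 : 0 <= N by rewrite mulr_ge0 ?nr_ge0.
have ht t : cn (ip X (lcomb v t)) <= N * nr (lcomb v t).
  apply: le_trans (hg s t); rewrite /X /lcomb ip_suml le_eqVlt; apply/orP; left; apply/eqP.
  congr cn; apply: eq_bigr => p _; rewrite ip_sumr; apply: eq_bigr => q _.
  by rewrite ipZl ipZr hy mulrA.
apply: (nr_dual N0) => z; apply/ler_addgt0Pl => e e0.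
pose k := N + nr X + 1; have k0 : 0 < k := ltr_wpDl (addr_ge0 N0 (nr_ge0 X)) ltr01.
have [t hz] := tv z _ (divr_gt0 e0 k0).
have h1 : cn (ip X z) <= cn (ip X (lcomb v t)) + nr X * (e / k).
  have -> : ip X z = ip X (lcomb v t) + ip X (z - lcomb v t) by rewrite -ipDr subrKC.
  apply: le_trans (cnD _ _) _; rewrite lerD2l; apply: le_trans (CS _ _) _.
  by rewrite ler_wpM2l ?nr_ge0.
have h2 : N * nr (lcomb v t) <= N * (e / k + nr z).
  rewrite ler_wpM2l//; apply: le_trans (nr_le_sub _ z) _.
  by rewrite nrB lerD2r.
have h3 := le_trans h1 (lerD (le_trans (ht t) h2) (lexx _)).
apply: le_trans h3 _.
have h4 : (N + nr X) * (e / k) <= e.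
  rewrite -[leRHS](divfK (lt0r_neq0 k0)) [leRHS]mulrC ler_wpM2r ?(ltW (divr_gt0 e0 k0))//.
  by rewrite /k lerDl.
move: h4; set a := e / k; set b := nr z; set c := nr X; lra.
Qed.
End Forms.

(** * Matrices over a C*-algebra indexed by an orthonormal system *)

Section SeqMatrix.
Context {R : realType} (tp : tensor_products R).
Local Notation C := R[i].
Variables (S : cstar R) (K : hilbert R) (ee : seq K).
Hypothesis oe : onseq ee.

(** The first index is the input and the second one the output, as in [sop]; this explains the order
    of the indices in the product. *)
Definition smul (W Z : K -> K -> S) : K -> K -> S :=
  fun z z2 => \sum_(z1 <- ee) cmul (W z1 z2) (Z z z1).
Definition sstar (Z : K -> K -> S) : K -> K -> S := fun z z' => cinv (Z z' z).

Lemma onseq_uniq (e : seq K) : onseq e -> uniq e.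
Proof.
elim: e => [//|z e IH] /= [nz oz /IH ->]; rewrite andbT; apply/negP => ze.
have := oz z ze; rewrite ipxx nz expr1n => /complexI /eqP.
by rewrite oner_eq0.
Qed.

Section Op.
Variables (L : hilbert R) (g : S -> L -> L).
Hypothesis hg : star_hom g.
Definition svec (a : K -> L) : tp L K := \sum_(z <- ee) tens _ (a z) z.
Definition sop (Z : K -> K -> S) (a : K -> L) : K -> L :=
  fun z' => \sum_(z <- ee) g (Z z z') (a z).

Lemma svec_ip a b : ip (svec a) (svec b) = \sum_(z <- ee) ip (a z) (b z).
Proof.
rewrite /svec; elim: ee oe => [|z e IH] /=; first by rewrite !big_nil ip0l.
move=> [nz oz oe']; rewrite !big_cons ipDl !ipDr (IH oe') tens_ip ipxx nz expr1n mulr1.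
rewrite ip_sumr big_seq big1 ?addr0; last first.
  by move=> w we; rewrite tens_ip oz// mulr0.
rewrite ip_suml big_seq big1 ?add0r// => w we.
by rewrite tens_ip [ip w z]ip_conj oz// rmorph0 mulr0.
Qed.

Lemma sop_mul W Z a z : sop (smul W Z) a z = sop W (sop Z a) z.
Proof.
rewrite /sop /smul.
have gs I (s : seq I) (F : I -> S) x : g (\sum_(i <- s) F i) x = \sum_(i <- s) g (F i) x.
  by elim: s => [|i s IH]; rewrite ?big_nil ?sh0// !big_cons shD// IH.
under eq_bigr do rewrite gs.
rewrite exchange_big /=; apply: eq_bigr => z1 _.
rewrite (lin_sum (sh_linear hg _)); apply: eq_bigr => z2 _.
by rewrite sh_mul.
Qed.

Lemma sop_adj Z a b : ip (svec (sop Z a)) (svec b) = ip (svec a) (svec (sop (sstar Z) b)).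
Proof.
rewrite !svec_ip /sop.
under eq_bigr do rewrite ip_suml.
rewrite exchange_big /=; apply: eq_bigr => z _.
rewrite ip_sumr; apply: eq_bigr => z' _.
by rewrite (sh_ip hg).
Qed.

Definition scontr Z := forall a, nr (svec (sop Z a)) <= nr (svec a).
Lemma sop_mulv W Z a : svec (sop (smul W Z) a) = svec (sop W (sop Z a)).
Proof. by apply: eq_bigr => z _; rewrite sop_mul. Qed.
Lemma scontr_mul W Z : scontr W -> scontr Z -> scontr (smul W Z).
Proof. by move=> hW hZ a; rewrite sop_mulv; exact: le_trans (hW _) (hZ _). Qed.
Lemma sstarK Z : sstar (sstar Z) = Z.
Proof. by apply/funext => z; apply/funext => z'; rewrite /sstar cinvK. Qed.
Lemma scontr_star Z : scontr Z -> scontr (sstar Z).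
Proof.
move=> hZ a; set b := sop (sstar Z) a.
have h : nr (svec b) ^+ 2 <= nr (svec a) * nr (svec b).
  rewrite nr_sqr {1}/b -[Z]sstarK sop_adj !sstarK.
  apply: le_trans (Re_CS _ _) _.
  by rewrite ler_wpM2l ?nr_ge0// hZ.
have [b0|b0] := eqVneq (nr (svec b)) 0; first by rewrite b0 nr_ge0.
have bp : 0 < nr (svec b) by rewrite lt_neqAle eq_sym b0 nr_ge0.
by move: h; rewrite expr2 ler_pM2r.
Qed.

Lemma svec_coord a z : z \in ee -> nr (a z) <= nr (svec a).
Proof.
move=> ze; rewrite -(@ler_pXn2r _ 2)// ?nnegrE ?nr_ge0// nr_onsum//.
rewrite (big_rem z ze) /= lerDl.
by apply: sumr_ge0 => w _; exact: sqr_ge0.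
Qed.
Lemma svec_le a : nr (svec a) <= \sum_(z <- ee) nr (a z).
Proof.
apply: le_trans (nr_sum _ _) _; rewrite !big_seq; apply: ler_sum => z ze.
rewrite nr_tens; suff -> : nr z = 1 by rewrite mulr1.
elim: ee oe ze => [//|w e IH] /= [nw ow oe']; rewrite inE => /orP[/eqP ->//|].
exact: IH.
Qed.
Lemma scontr_entry Z z z' : scontr Z -> z \in ee -> z' \in ee -> bnd (g (Z z z')) 1.
Proof.
move=> hZ ze z'e x; pose a w : L := if w == z then x else 0.
have e1 : sop Z a z' = g (Z z z') x.
  rewrite /sop (big_rem z ze) /= {1}/a eqxx big_seq big1 ?addr0// => w.
  rewrite mem_rem_uniq ?onseq_uniq// inE => /andP[/negPf wz _].
  by rewrite /a wz (lin0 (sh_linear hg _)).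
rewrite -e1 mul1r; apply: le_trans (svec_coord _ z'e) _; apply: le_trans (hZ a) _.
apply: le_trans (svec_le a) _; rewrite (big_rem z ze) /= {1}/a eqxx big_seq big1 ?addr0// => w.
rewrite mem_rem_uniq ?onseq_uniq// inE => /andP[/negPf wz _].
by rewrite /a wz nr0.
Qed.
End Op.

(** For y_k = x_k / al one has y_k^2 <= y_(k+1). If y_0 = 1 + ep with ep > 0, then y_k >= 1 + k ep,
    which eventually exceeds K0. *)
Lemma power_trick (x : nat -> R) (al K0 : R) : 0 <= al -> (forall k, 0 <= x k) ->
  (forall k, x k ^+ 2 <= x k.+1 * al) -> (forall k, x k <= K0 * al) -> x 0%N <= al.
Proof.
move=> al0 x0 xx xK.
have [a0|a0] := eqVneq al 0.
  by have := xK 0%N; rewrite a0 mulr0.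
have ap : 0 < al by rewrite lt_neqAle eq_sym a0 al0.
rewrite leNgt; apply/negP => lx.
pose y k := x k / al.
have y1 k : y k ^+ 2 <= y k.+1.
  rewrite /y ler_pdivlMr// (_ : (x k / al) ^+ 2 * al = x k ^+ 2 / al); last by field.
  by rewrite ler_pdivrMr.
have y0 : 1 < y 0%N by rewrite /y ltr_pdivlMr// mul1r.
pose ep := y 0%N - 1; have ep0 : 0 < ep by rewrite subr_gt0.
have yk k : 1 + ep * k%:R <= y k.
  elim: k => [|k IH]; first by rewrite mulr0 addr0 ltW.
  have k0 : 0 <= ep * k%:R by rewrite mulr_ge0// ltW.
  have e1 : 1 + ep <= y k.
    case: k IH k0 => [|k] IH k0; first by rewrite /ep subrKC.
    apply: le_trans IH; rewrite lerD2l ler_peMr ?(ltW ep0)// ler1n//.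
  apply: le_trans (y1 k); rewrite -natr1 mulrDr mulr1 addrA.
  move: IH e1 k0; set q := ep * _; set r := y k; nra.
have yK k : y k <= K0 by rewrite /y ler_pdivrMr.
have := archi_boundP (ltW (divr_gt0 (lt_le_trans (lt_trans ltr01 y0) (yK 0%N)) ep0)).
set n := Num.bound _; rewrite ltr_pdivrMr// => h.
have := le_trans (yk n) (yK n); rewrite mulrC; lra.
Qed.

Variables (L L' : hilbert R) (g : S -> L -> L) (g' : S -> L' -> L').
Hypotheses (hg : star_hom g) (hg' : star_hom g').
Hypothesis gg' : forall a, bnd (g a) 1 -> bnd (g' a) 2.

(* [Z] is viewed as a matrix over [S].  The powers of [Z^* Z] stay contractive, so
   under [g'] their entries are bounded uniformly in the exponent; taking roots
   removes the constant. *)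
Lemma scontr_transfer Z : scontr g Z -> scontr g' Z.
Proof.
move=> hZ a.
pose Y k := iter k (fun W => smul W W) (smul (sstar Z) Z).
have YS k : Y k.+1 = smul (Y k) (Y k) by [].
have cY k : scontr g (Y k).
  elim: k => [|k IH]; last by rewrite YS; apply: scontr_mul.
  by apply: scontr_mul => //; exact: scontr_star.
have sY k z z' : sstar (Y k) z z' = Y k z z'.
  have sm W1 W2 z1 z2 : sstar (smul W1 W2) z1 z2 = smul (sstar W2) (sstar W1) z1 z2.
    rewrite /sstar /smul.
    have cs I (s : seq I) (F : I -> S) : cinv (\sum_(i <- s) F i) = \sum_(i <- s) cinv (F i).
      by elim: s => [|i s IH]; rewrite ?big_nil ?cinv0// !big_cons cinvD IH.
    by rewrite cs; apply: eq_bigr => w _; rewrite cinvM.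
  elim: k z z' => [|k IH] z z'; first by rewrite sm sstarK.
  rewrite YS sm /smul; apply: eq_bigr => w _.
  by rewrite !IH.
have sopY k b : sop g' (sstar (Y k)) b = sop g' (Y k) b.
  by apply/funext => z; apply: eq_bigr => w _; rewrite sY.
pose al := nr (svec a); pose x k := nr (svec (sop g' (Y k) a)).
pose n : R := (size ee)%:R.
have sz : \sum_(z <- ee) (1 : R) = n by rewrite big_const_seq count_predT iter_addr_0.
have h0 : x 0%N <= al.
  (* The matrix has n rows of n entries, and each entry is bounded by 2 under [g']. *)
  apply: (@power_trick x al (2 * n ^+ 2)); [exact: nr_ge0|by move=> k; exact: nr_ge0| |].
    move=> k; rewrite /x nr_sqr sop_adj// sopY -sop_mulv// -YS mulrC.
    exact: Re_CS.
  move=> k; apply: le_trans (svec_le _) _.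
  have h z' : z' \in ee -> nr (sop g' (Y k) a z') <= 2 * n * al.
    move=> z'e; apply: le_trans (nr_sum _ _) _.
    apply: (@le_trans _ _ (\sum_(z <- ee) 2 * al)).
      rewrite !big_seq; apply: ler_sum => z ze.
      apply: le_trans (gg' (scontr_entry hg (cY k) ze z'e) _) _.
      by rewrite ler_wpM2l// svec_coord.
    by rewrite -sz mulr_sumr mulr_suml; apply: ler_sum => w _; rewrite mulr1.
  apply: (@le_trans _ _ (\sum_(z <- ee) 2 * n * al)).
    by rewrite !big_seq; apply: ler_sum => z ze; exact: h.
  rewrite expr2 mulrA -{3}sz !mulr_sumr mulr_suml.
  by apply: ler_sum => w _; rewrite mulr1.
have h1 : nr (svec (sop g' Z a)) ^+ 2 <= al * al.
  rewrite nr_sqr sop_adj// -sop_mulv//.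
  apply: le_trans (Re_CS _ _) _; rewrite ler_wpM2l ?nr_ge0//.
by move: h1; rewrite -expr2 ler_pXn2r// ?nnegrE ?nr_ge0.
Qed.
End SeqMatrix.

Section Amplification.
Context {R : realType} (tp : tensor_products R).
Local Notation C := R[i].
Variables (S : cstar R) (e : S) (us : univ_rep S) (L K : hilbert R).
Variables (g : S -> L -> L) (V : tp (usp us) K -> tp (usp us) K).
Hypotheses (ue : forall a : S, cmul e a = a /\ cmul a e = a) (hg : star_hom g).
Hypotheses (bV : bounded_op V) (V1 : bnd V 1).
Hypothesis (hV : forall w, predual w -> range (urep us) (rslice w V)).

Lemma urep_unit : urep us e = id.
Proof. exact: nondeg_unit (urep_sh us) (@urep_nd _ _ us) ue. Qed.

(** A lift c with the same image in the universal representation also has the same image under g,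
    and g is contractive on c. *)
Lemma urep_bnd_transfer a (M : R) : 0 <= M -> bnd (urep us a) M -> bnd (g a) (2 * M).
Proof.
move=> M0 h x; have [c uc nc] := star_lift ue (urep_sh us) urep_unit M0 h.
rewrite -(urep_ker hg uc); apply: le_trans (sh_contr hg _ _) _.
by rewrite ler_wpM2r ?nr_ge0.
Qed.

Lemma vec_predual (k k' : K) : predual (vec_fun k k').
Proof. by rewrite vec_pw; exact: pw_predual. Qed.

Lemma slice_elt_ex k k' : exists a, urep us a = rslice (vec_fun k k') V.
Proof. by have [a _ ha] := hV (vec_predual k k'); exists a. Qed.
Definition slice_elt (k k' : K) : S := projT1 (cid (slice_elt_ex k k')).
Lemma slice_eltE k k' : urep us (slice_elt k k') = rslice (vec_fun k k') V.
Proof. by rewrite /slice_elt; case: cid. Qed.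

Definition gfun (h h' : L) := Defs.normal_fun us (fun a => ip (g a h) h').
Lemma gfun_predual h h' : predual (gfun h h').
Proof. exact: (nf_predual us (dual_vec h h' hg)). Qed.
Lemma gfunE h h' a : pair_op (gfun h h') (urep us a) = ip (g a h) h'.
Proof. exact: (nfE us a (dual_vec h h' hg)). Qed.
(** [slice_elt] is a choice, so it is not visibly sesquilinear in k and k'. Under g it is a matrix
    coefficient of a single operator, and sesquilinearity follows. *)
Lemma slice_elt_lslice h h' k k' :
  ip (g (slice_elt k k') h) h' = ip (lslice (gfun h h') V k) k'.
Proof.
by rewrite lslice_rslice//; [rewrite -slice_eltE gfunE|exact: gfun_predual].
Qed.

Lemma slice_elt_expand (ee : seq K) h h' k k' : oproj ee k = k -> oproj ee k' = k' ->
  ip (g (slice_elt k k') h) h' =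
  \sum_(z <- ee) \sum_(z' <- ee) ip k z * Num.conj (ip k' z') * ip (g (slice_elt z z') h) h'.
Proof.
move=> ek ek'; rewrite slice_elt_lslice -{1}ek -{1}ek' /oproj.
have bl := lslice_bop bV (gfun_predual h h').
rewrite (lin_sum (bop_lin bl)) ip_suml; apply: eq_bigr => z _.
rewrite ip_sumr; apply: eq_bigr => z' _.
by rewrite (linZ (bop_lin bl)) ipZl ipZr slice_elt_lslice mulrA.
Qed.

Lemma slice_elt_contr (ee : seq K) : onseq ee -> scontr tp ee (urep us) slice_elt.
Proof.
move=> oe a; set b := sop ee (urep us) slice_elt a.
have h : nr (svec tp ee b) ^+ 2 <= nr (svec tp ee a) * nr (svec tp ee b).
  rewrite nr_sqr; have -> : ip (svec tp ee b) (svec tp ee b) = ip (V (svec tp ee a)) (svec tp ee b).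
    rewrite svec_ip// {1}/b /sop {2}/svec ip_sumr; apply: eq_bigr => z' _.
    rewrite ip_suml /svec (lin_sum (bop_lin bV)) ip_suml; apply: eq_bigr => z _.
    by rewrite slice_eltE rslice_vec.
  apply: le_trans (Re_CS _ _) _; rewrite ler_wpM2r ?nr_ge0//.
  by have := V1 (svec tp ee a); rewrite mul1r.
have [b0|b0] := eqVneq (nr (svec tp ee b)) 0; first by rewrite b0 nr_ge0.
have bp : 0 < nr (svec tp ee b) by rewrite lt_neqAle eq_sym b0 nr_ge0.
by move: h; rewrite expr2 ler_pM2r.
Qed.

(** Y is defined by its sesquilinear form on elementary tensors. On finite combinations the second
    legs lie in the span of some orthonormal [ee], where the form is that of the matrix [slice_elt]:
    it is a contraction in the universal representation because V is, hence also under g by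
    [scontr_transfer]. *)
Lemma amplify_ex : exists Y : tp L K -> tp L K, bounded_op Y /\
  forall w a, predual w -> rslice w V = urep us a -> rslice w Y = g a.
Proof.
pose G (p q : L * K) := ip (g (slice_elt p.2 q.2) p.1) q.1.
have [|Y [bY hY]] := @form_op R _ _ _ _ (@tfam _ _ _ (tp L K)) (@tfam _ _ _ (tp L K)) G 1
    (tens_total (T := tp L K)) (tens_total (T := tp L K)) ler01.
  move=> s t.
  have [ee oe he] := gram_schmidt ([seq p.2.2 | p <- s] ++ [seq p.2.2 | p <- t]).
  have hs p : p \in s -> oproj ee p.2.2 = p.2.2.
    by move=> ps; apply: he; rewrite mem_cat (map_f (fun p => p.2.2)).
  have ht p : p \in t -> oproj ee p.2.2 = p.2.2.
    by move=> ps; apply: he; rewrite mem_cat orbC (map_f (fun p => p.2.2)).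
  rewrite (tens_oproj _ hs) (tens_oproj _ ht).
  pose a z : L := \sum_(p <- s) (p.1 * ip p.2.2 z) *: p.2.1.
  pose b z : L := \sum_(p <- t) (p.1 * ip p.2.2 z) *: p.2.1.
  rewrite -[X in _ * nr X * _]/(svec tp ee a) -[X in _ * nr X]/(svec tp ee b) mul1r.
  have -> : \sum_(p <- s) \sum_(q <- t) p.1 * Num.conj q.1 * G p.2 q.2 =
      ip (svec tp ee (sop ee g slice_elt a)) (svec tp ee b).
    rewrite svec_ip// /sop.
    under [RHS]eq_bigr do rewrite ip_suml.
    have e1 z' z : ip (g (slice_elt z z') (a z)) (b z') =
        \sum_(p <- s) \sum_(q <- t) p.1 * Num.conj q.1 *
          (ip p.2.2 z * Num.conj (ip q.2.2 z') * ip (g (slice_elt z z') p.2.1) q.2.1).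
      rewrite /a /b (lin_sum (sh_linear hg _)) ip_suml; apply: eq_bigr => p _.
      rewrite ip_sumr; apply: eq_bigr => q _.
      by rewrite (linZ (sh_linear hg _)) ipZl ipZr rmorphM /=; ring.
    under [RHS]eq_bigr do under eq_bigr do rewrite e1.
    under [RHS]eq_bigr do rewrite exchange_big /=.
    rewrite [RHS]exchange_big /= !big_seq; apply: eq_bigr => p ps.
    under [RHS]eq_bigr do rewrite exchange_big /=.
    rewrite [RHS]exchange_big /= !big_seq; apply: eq_bigr => q qt.
    rewrite /G (slice_elt_expand _ _ (hs p ps) (ht q qt)).
    rewrite exchange_big /= mulr_sumr; apply: eq_bigr => z _.
    by rewrite mulr_sumr.
  apply: le_trans (CS _ _) _; rewrite ler_wpM2r ?nr_ge0//.
  apply: (@scontr_transfer _ _ _ _ _ oe _ _ (urep us) g (urep_sh us) hg).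
    by move=> c hc; have := urep_bnd_transfer ler01 hc; rewrite mulr1.
  exact: slice_elt_contr.
exists Y; split => // w a pw_ wa.
apply/funext => h; apply: ip_ext => h'.
rewrite rslice_lslice//.
have -> : lslice (vec_fun h h') Y = lslice (gfun h h') V.
  apply/funext => k; apply: ip_ext => k'.
  rewrite lslice_vec// -slice_elt_lslice.
  exact: (hY (h, k) (h', k')).
by rewrite -slice_fubini// ?wa ?gfunE//; exact: gfun_predual.
Qed.

Lemma amplifyE f : (forall a, f (urep us a) = g a) ->
  bounded_op (amplify f V) /\ forall w, predual w -> rslice w (amplify f V) = f (rslice w V).
Proof.
move=> fg; have [Y [bY hY]] := amplify_ex.
have hY' w : predual w -> rslice w Y = f (rslice w V).
  move=> pw_; have [a _ ha] := hV pw_.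
  by rewrite -ha fg; apply: hY.
by rewrite /amplify; case: xgetP => [Z _ [bZ hZ]|/(_ Y)]; last by case.
Qed.
End Amplification.

(** * Eberlein algebras *)

Section Biweak.
Context {R : realType}.
Local Notation C := R[i].
Variable A : cstar R.

(* In each variable separately F is evaluation at an element of A, so its vanishing
   passes from D to the annihilator of N, the weak-* closure of the span of D. *)
Lemma biweak (F : (A -> C^o) -> (A -> C^o) -> C) (D : set (A -> C^o)) (N : set A) :
  (forall n, dual n -> exists a, forall m, dual m -> F m n = m a) ->
  (forall m, dual m -> exists a, forall n, dual n -> F m n = n a) ->
  D `<=` dual (V := A) -> (forall a, (forall d, D d -> d a = 0) -> N a) ->
  (forall m n, D m -> D n -> F m n = 0) ->
  forall m n, dual m -> dual n -> (forall a, N a -> m a = 0) -> (forall a, N a -> n a = 0) ->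
  F m n = 0.
Proof.
move=> hr hl Dd DN FD.
have h1 m n : dual m -> D n -> (forall a, N a -> m a = 0) -> F m n = 0.
  move=> dm Dn mN; have [a ha] := hr n (Dd _ Dn); rewrite ha//; apply: mN.
  by apply: DN => d Dd'; rewrite -ha ?FD//; exact: Dd.
move=> m n dm dn mN nN; have [a ha] := hl m dm; rewrite ha//; apply: nN.
by apply: DN => d Dd'; rewrite -ha ?h1//; exact: Dd.
Qed.
End Biweak.

Section Eberlein.
Context {R : realType} (tp : tensor_products R).
Local Notation C := R[i].

Section Conv.
Variables (A : cstar R) (u : univ_rep A).
Variable Phi : A -> tp (usp u) (usp u) -> tp (usp u) (usp u).
Hypotheses (hPhi : star_hom Phi)
  (vPhi : forall a, vN_tens (bidual u) (bidual u) (Phi a)).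

Lemma bidual_sub : bidual u `<=` bounded_op (V := usp u) (W := usp u).
Proof. by move=> T; exact: bidual_bop. Qed.
Lemma bidual_bic : commutant (commutant (bidual u)) `<=` bidual u.
Proof.
move=> T [bT hT]; split => // S hS; apply: hT; split; first by case: hS.
by move=> X [bX hX]; symmetry; apply: hX.
Qed.
Lemma rslice_bidual w (X : tp (usp u) (usp u) -> tp (usp u) (usp u)) : predual w -> vN_tens (bidual u) (bidual u) X -> bidual u (rslice w X).
Proof. by move=> pw_ vX; apply: bidual_bic; exact: (rslice_commutant (@bidual_sub) (@bidual_sub) pw_ vX). Qed.
Lemma lslice_bidual w (X : tp (usp u) (usp u) -> tp (usp u) (usp u)) : predual w -> vN_tens (bidual u) (bidual u) X -> bidual u (lslice w X).
Proof. by move=> pw_ vX; apply: bidual_bic; exact: (lslice_commutant (@bidual_sub) (@bidual_sub) pw_ vX). Qed.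

Lemma rslice_ext w w' (X : tp (usp u) (usp u) -> tp (usp u) (usp u)) : predual w -> predual w' ->
  (forall a, pair_op w (urep u a) = pair_op w' (urep u a)) ->
  vN_tens (bidual u) (bidual u) X -> rslice w X = rslice w' X.
Proof.
move=> pw_ pw' h vX; have bX := vN_tens_bop vX.
apply/funext => x; apply: ip_ext => x'; rewrite !rslice_lslice//.
by apply: (bidual_ext (u := u)) => //; apply: lslice_bidual vX; exact: vec_predual.
Qed.

(** Any representing pairs may be used in place of the chosen ones in [conv]; the first and second
    legs are exchanged one at a time, each slice staying in A**. *)
Lemma convE (m n : A -> C^o) v w a : dual m -> dual n -> predual v -> predual w ->
  (forall b, pair_op v (urep u b) = m b) -> (forall b, pair_op w (urep u b) = n b) ->
  Defs.conv Phi m n a = pair_op v (rslice w (Phi a)).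
Proof.
move=> dm dn pv pw_ hv hw; rewrite /Defs.conv /pair_tens.
have -> : rslice (Defs.normal_fun u n) (Phi a) = rslice w (Phi a).
  by apply: rslice_ext => //; [exact: nf_predual|move=> b; rewrite nfE// hw].
by apply: nf_bidual => //; apply: rslice_bidual.
Qed.

Lemma conv_dual m n : dual m -> dual n -> dual (Defs.conv Phi m n : A -> C^o).
Proof.
move=> dm dn; have pm := nf_predual u dm; have pn := nf_predual u dn.
have [k k0 hk] := pair_op_bnd pm; have [xi [eta en]] := predualP pn.
have bP a : bounded_op (Phi a) by exact: sh_bop.
apply: (dual_intro (M := k * (nr eta * nr xi))) => [c x y|a]; rewrite /Defs.conv /pair_tens.
  by rewrite (sh_lin hPhi) rslice_comb// pair_op_comb//; exact: rslice_bop.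
apply: le_trans (hk _ (nr eta * nr a * nr xi) _ _ _) _.
- exact: rslice_bop.
- by rewrite !mulr_ge0 ?nr_ge0.
- by rewrite en; apply: rslice_bnd => //; [exact: nr_ge0|exact: sh_contr].
- by rewrite -[leRHS]mulrA ler_wpM2l// mulrAC.
Qed.
End Conv.

Section Module.
Variables (E : eberlein tp) (e : ealg E).
Hypothesis ue : forall a : ealg E, cmul e a = a /\ cmul a e = a.
Notation u := (euniv E).
Notation Phi := (ePhi E).
Notation V := (eV E).
Notation nf := (Defs.normal_fun u).

Lemma eV_bop : bounded_op V. Proof. exact: vN_tens_bop (eV_vN E). Qed.
Lemma eV_bnd : bnd V 1.
Proof. by move=> x; rewrite mul1r -nr_le; exact: eV_contr. Qed.
Lemma ePhi_bop a : bounded_op (Phi a). Proof. exact: sh_bop (ePhi_hom E) a. Qed.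

Notation Mop m := (lslice (nf m) V).
Lemma Mop_bop m : dual m -> bounded_op (Mop m).
Proof. by move=> dm; apply: (lslice_bop eV_bop); exact: nf_predual. Qed.

Lemma slice_eval (m : ealg E -> C^o) w a : dual m -> predual w -> rslice w V = urep u a ->
  m a = pair_op w (Mop m).
Proof.
move=> dm pw_ ha; rewrite -slice_fubini ?ha ?nfE//; first exact: eV_bop.
exact: nf_predual.
Qed.

Lemma conv_slice (m n : ealg E -> C^o) w a : dual m -> dual n -> predual w ->
  rslice w V = urep u a -> Defs.conv Phi m n a = pair_op w (Mop m \o Mop n).
Proof.
move=> dm dn pw_ ha; rewrite (slice_eval _ pw_ ha) ?eV_mult//.
by apply: conv_dual => //; exact: ePhi_hom.
Qed.

(** The value is w(M_m M_n). Absorbing M_n into the first vector of w produces a new normal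
    functional, independent of m, and a' is the corresponding slice of V. For the left version the
    adjoint of M_m goes into the second vector. *)
Lemma right_slice (n : ealg E -> C^o) w a : dual n -> predual w -> rslice w V = urep u a ->
  exists a', forall m : ealg E -> C^o, dual m -> Defs.conv Phi m n a = m a'.
Proof.
move=> dn pw_ ha; have [xi [eta ew]] := predualP pw_.
have bn := Mop_bop dn.
have pw' := pw_predual (l2map (Mop n) xi) eta.
have [a' _ ha'] := eV_slice pw'; exists a' => m dm; have bm := Mop_bop dm.
rewrite (conv_slice dm dn pw_ ha) (slice_eval dm pw' (esym ha')) ew.
by rewrite (pair_opE _ _ (bop_comp bm bn)) (pair_opE _ _ bm) (l2map_comp _ bm bn).
Qed.

Lemma left_slice (m : ealg E -> C^o) w a : dual m -> predual w -> rslice w V = urep u a ->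
  exists a', forall n : ealg E -> C^o, dual n -> Defs.conv Phi m n a = n a'.
Proof.
move=> dm pw_ ha; have [xi [eta ew]] := predualP pw_.
have bm := Mop_bop dm.
have pw' := pw_predual xi (l2map (adj (Mop m)) eta).
have [a' _ ha'] := eV_slice pw'; exists a' => n dn; have bn := Mop_bop dn.
rewrite (conv_slice dm dn pw_ ha) (slice_eval dn pw' (esym ha')) ew.
by rewrite (pair_opE _ _ (bop_comp bm bn)) (pair_opE _ _ bn) (l2map_comp _ bm bn) l2map_adj.
Qed.

(** Slices of V are dense in the algebra, f is Lipschitz, and the image of a unital algebra in its
    universal representation is closed. *)
Lemma closure_slices (f : ealg E -> usp u -> usp u) (k : R) : 0 <= k ->
  (forall a, bounded_op (f a)) -> (forall a b, f (a - b) = fun x => f a x - f b x) ->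
  (forall a, bnd (f a) (k * nr a)) ->
  (forall w a, predual w -> rslice w V = urep u a -> range (urep u) (f a)) ->
  forall a, range (urep u) (f a).
Proof.
move=> k0 bf fB kf h a.
apply: (range_closed ue (urep_sh u) (urep_unit u ue)).
apply/op_closure_bnd; split => // r r0.
have k1 : 0 < k + 1 by rewrite ltr_wpDl.
have rk : 0 < (r / (k + 1))%:C :> C by rewrite ltcR divr_gt0.
have [w pw_ [b hb ab]] := eV_dense a rk.
exists (f b); first exact: h hb.
have {}ab : nr (a - b) <= r / (k + 1) by rewrite -lecR -nrE.
have -> : (fun x => f a x - f b x) = f (a - b) by rewrite fB.
move=> x; apply: le_trans (kf _ _) _; rewrite ler_wpM2r ?nr_ge0//.
apply: le_trans (_ : (k + 1) * nr (a - b) <= _).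
  by rewrite ler_wpM2r ?nr_ge0// lerDl.
by rewrite mulrC -ler_pdivlMr.
Qed.

Lemma right_urep n a : dual n -> range (urep u) (rslice (nf n) (Phi a)).
Proof.
move=> dn; have pn := nf_predual u dn; have [xi [eta en]] := predualP pn.
apply: (@closure_slices (fun a => rslice (nf n) (Phi a)) (nr eta * nr xi)).
- by rewrite mulr_ge0 ?nr_ge0.
- by move=> b; apply: rslice_bop pn; exact: ePhi_bop.
- move=> b c; have -> : b - c = (-1) *: c + b by rewrite scaleN1r addrC.
  rewrite (sh_lin (ePhi_hom E)) rslice_comb//; try exact: ePhi_bop.
  by apply/funext => x; rewrite scaleN1r addrC.
- move=> b; rewrite en mulrAC; apply: rslice_bnd; [exact: ePhi_bop|exact: nr_ge0|].
  exact: sh_contr (ePhi_hom E) b.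
- move=> w b pw_ hb; have [b' hb'] := right_slice dn pw_ hb; exists b' => //.
  apply/funext => x; apply: ip_ext => x'.
  have dv := dual_vec x x' (urep_sh u).
  rewrite -[LHS](hb' _ dv) /Defs.conv /pair_tens nf_vec//.
  by apply: rslice_bidual => //; exact: ePhi_vN.
Qed.

Lemma left_urep m a : dual m -> range (urep u) (lslice (nf m) (Phi a)).
Proof.
move=> dm; have pm := nf_predual u dm; have [xi [eta em]] := predualP pm.
have lslice_comb c (X Y : tp (usp u) (usp u) -> tp (usp u) (usp u)) :
    bounded_op X -> bounded_op Y ->
    lslice (nf m) (fun z => c *: X z + Y z) = fun x => c *: lslice (nf m) X x + lslice (nf m) Y x.
  move=> bX bY; apply/funext => x; apply: ip_ext => z.
  have bXY := bop_comb c bX bY.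
  rewrite ip_linear !lslice_rslice// rslice_comb//; last exact: vec_predual.
  by rewrite pair_op_comb//; apply: rslice_bop => //; exact: vec_predual.
apply: (@closure_slices (fun a => lslice (nf m) (Phi a)) (nr eta * nr xi)).
- by rewrite mulr_ge0 ?nr_ge0.
- by move=> b; apply: lslice_bop pm; exact: ePhi_bop.
- move=> b c; have -> : b - c = (-1) *: c + b by rewrite scaleN1r addrC.
  rewrite (sh_lin (ePhi_hom E)) lslice_comb//; try exact: ePhi_bop.
  by apply/funext => x; rewrite scaleN1r addrC.
- move=> b; rewrite em mulrAC; apply: lslice_bnd; [exact: ePhi_bop|exact: nr_ge0|].
  exact: sh_contr (ePhi_hom E) b.
- move=> w b pw_ hb; have [b' hb'] := left_slice dm pw_ hb; exists b' => //.
  apply/funext => x; apply: ip_ext => x'.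
  have dv := dual_vec x x' (urep_sh u).
  rewrite -[LHS](hb' _ dv) lslice_rslice//; last exact: ePhi_bop.
  apply: convE => //; do ?exact: ePhi_vN; do ?exact: vec_predual.
    by move=> c; rewrite nfE.
  by move=> c; rewrite pair_vec//; exact: urep_bop.
Qed.

Lemma right_module (n : ealg E -> C^o) a : dual n ->
  exists a', forall m : ealg E -> C^o, dual m -> Defs.conv Phi m n a = m a'.
Proof.
move=> dn; have [a' _ ha'] := right_urep a dn; exists a' => m dm.
by rewrite /Defs.conv /pair_tens -ha' nfE.
Qed.
Lemma left_module (m : ealg E -> C^o) a : dual m ->
  exists a', forall n : ealg E -> C^o, dual n -> Defs.conv Phi m n a = n a'.
Proof.
move=> dm; have [a' _ ha'] := left_urep a dm; exists a' => n dn.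
rewrite /Defs.conv /pair_tens slice_fubini; [|exact: ePhi_bop|exact: nf_predual|exact: nf_predual].
by rewrite -ha' nfE.
Qed.
End Module.
End Eberlein.

(** * The image of a homomorphism as an Eberlein algebra *)

Section OpNorm.
Context {R : realType}.
Local Notation C := R[i].
Variable L : hilbert R.
Implicit Types S T : L -> L.

Definition opn T : R := inf [set M : R | 0 <= M /\ bnd T M].

Lemma opn_inf T : bounded_op T -> has_inf [set M : R | 0 <= M /\ bnd T M].
Proof. by move=> /bop_bnd[M M0 hM]; split; [exists M|exists 0 => N []]. Qed.
Lemma opn_ge0 T : bounded_op T -> 0 <= opn T.
Proof. by move=> /opn_inf[h _]; apply: lb_le_inf => // N []. Qed.
Lemma opn_le T (M : R) : bounded_op T -> 0 <= M -> bnd T M -> opn T <= M.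
Proof. by move=> /opn_inf[_ h] M0 hM; apply: ge_inf. Qed.
Lemma opn_bnd T : bounded_op T -> bnd T (opn T).
Proof.
move=> bT x; have [h _] := opn_inf bT.
have [x0|x0] := eqVneq (nr x) 0.
  by rewrite (nr_eq0 x0) (lin0 (bop_lin bT)) !nr0 mulr0.
have xp : 0 < nr x by rewrite lt_neqAle eq_sym x0 nr_ge0.
rewrite -ler_pdivrMr//; apply: lb_le_inf => // N [_ hN].
by rewrite ler_pdivrMr.
Qed.
Lemma opn_comp S T : bounded_op S -> bounded_op T -> opn (S \o T) <= opn S * opn T.
Proof.
move=> bS bT; apply: opn_le; first exact: bop_comp.
  by rewrite mulr_ge0 ?opn_ge0.
move=> x /=; apply: le_trans (opn_bnd bS _) _.
by rewrite -mulrA ler_wpM2l ?opn_ge0//; exact: opn_bnd.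
Qed.
Lemma opn_adj T : bounded_op T -> opn (adj T) <= opn T.
Proof.
move=> bT; apply: opn_le; [exact: adj_bop|exact: opn_ge0|].
by apply: gadj_bnd => //; [exact: opn_ge0|exact: opn_bnd].
Qed.
Lemma opn_star T : bounded_op T -> opn (adj T \o T) = opn T ^+ 2.
Proof.
move=> bT; have bA := adj_bop bT; have bc := bop_comp bA bT.
apply/eqP; rewrite eq_le; apply/andP; split.
  apply: le_trans (opn_comp bA bT) _; rewrite expr2 ler_wpM2r ?opn_ge0//.
  exact: opn_adj.
rewrite -[leRHS]sqr_sqrtr ?opn_ge0// lerXn2r ?nnegrE ?sqrtr_ge0 ?opn_ge0//.
apply: opn_le => // x.
rewrite -(@ler_pXn2r _ 2)// ?nnegrE ?mulr_ge0 ?sqrtr_ge0 ?nr_ge0//.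
rewrite exprMn sqr_sqrtr ?opn_ge0// nr_sqr adjE//.
apply: le_trans (_ : complex.Re (ip x (adj T (T x))) <= _) => //.
apply: le_trans (Re_CS _ _) _; rewrite mulrC expr2 mulrA ler_wpM2r ?nr_ge0//.
exact: (opn_bnd bc).
Qed.
Lemma opnD S T : bounded_op S -> bounded_op T -> opn (fun x => S x + T x) <= opn S + opn T.
Proof.
move=> bS bT; apply: opn_le.
- have := bop_comb 1 bS bT; congr bounded_op; apply/funext => x; by rewrite scale1r.
- by rewrite addr_ge0 ?opn_ge0.
- move=> x; apply: le_trans (nrD _ _) _; rewrite mulrDl.
  by apply: lerD; exact: opn_bnd.
Qed.
Lemma opnZ_le c T : bounded_op T -> opn (fun x => c *: T x) <= cn c * opn T.
Proof.
move=> bT; apply: opn_le.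
- have := bop_comb c bT (bop0 L L); congr bounded_op; apply/funext => x; by rewrite addr0.
- by rewrite mulr_ge0 ?opn_ge0 ?cn_ge0.
- move=> x; rewrite nrZ -mulrA ler_wpM2l ?cn_ge0//; exact: opn_bnd.
Qed.
End OpNorm.

Section ImageAlgebra.
Context {R : realType}.
Local Notation C := R[i].
Variables (S : cstar R) (e : S) (L : hilbert R) (g : S -> L -> L).
Hypotheses (ue : forall a : S, cmul e a = a /\ cmul a e = a)
  (hg : star_hom g) (ge : g e = id).

Lemma im0 : range g (0 : L -> L).
Proof. by exists 0 => //; apply/funext => x; rewrite sh0. Qed.
Lemma iml (c : C) (x y : L -> L) : range g x -> range g y -> range g (c *: x + y).
Proof. by move=> [a _ <-] [b _ <-]; exists (c *: a + b) => //; rewrite sh_lin. Qed.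
(** B is the image itself, with the operator norm, and not a quotient by ker g; embedded algebras
    are of this concrete form. *)
Definition im_ls : @lsub R := @LSub R (L -> L) (range g) im0 iml.
Notation B := (lsubT im_ls).
Notation bv := (@lsval R im_ls).

Lemma im_bop (b : B) : bounded_op (bv b : L -> L).
Proof. by have [a _ <-] := lsvalD b; exact: sh_bop. Qed.

Definition imN (b : B) : R := opn (bv b : L -> L).
Lemma im_tri (x y : B) : imN (x + y) <= imN x + imN y.
Proof. exact: (opnD (im_bop x) (im_bop y)). Qed.
Lemma im_scal (c : C) (x : B) : imN (c *: x) = cn c * imN x.
Proof.
have h (k : C) (z : B) : imN (k *: z) <= cn k * imN z by exact: (opnZ_le k (im_bop z)).
have [->|c0] := eqVneq c 0.
  rewrite cn0 mul0r; apply/eqP; rewrite eq_le; apply/andP; split.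
    by have := h 0 x; rewrite cn0 mul0r.
  exact: opn_ge0 (im_bop _).
apply/eqP; rewrite eq_le h /=.
have := h c^-1 (c *: x); rewrite scalerA mulVf// scale1r => h1.
have cp : 0 < cn c.
  by rewrite lt_neqAle cn_ge0 andbT eq_sym; apply: contra_neq c0 => /cn_eq0.
have := ler_wpM2l (ltW cp) h1; rewrite mulrA -cnM mulfV// cn1 mul1r//.
Qed.
Lemma im_eq0 (x : B) : imN x = 0 -> x = 0.
Proof.
move=> h; apply: lsval_inj; apply/funext => z; apply: nr_eq0; apply/eqP.
rewrite eq_le nr_ge0 andbT.
by have := opn_bnd (im_bop x) z; rewrite -/(imN x) h mul0r.
Qed.

Definition imq (s : S) : B := @lsmk R im_ls (g s) (ex_intro2 _ _ s I erefl).
Lemma imqE s : bv (imq s) = g s. Proof. by []. Qed.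
Lemma imlft_ex (b : B) : exists s, g s = bv b.
Proof. by have [s _ h] := lsvalD b; exists s. Qed.
Definition imlft (b : B) : S := projT1 (cid (imlft_ex b)).
Lemma imlftE b : g (imlft b) = bv b.
Proof. by rewrite /imlft; case: cid. Qed.
Lemma imlftK b : imq (imlft b) = b.
Proof. by apply: lsval_inj; rewrite imqE imlftE. Qed.

(** A norm Cauchy sequence of operators converges in norm to its pointwise limit, and this limit
    stays in the image by [range_closed]. *)
Lemma im_compl (u : nat -> B) :
  (forall r : R, 0 < r -> exists N, forall m n, (N <= m)%N -> (N <= n)%N -> imN (u m - u n) <= r) ->
  exists l, forall r : R, 0 < r -> exists N, forall n, (N <= n)%N -> imN (u n - l) <= r.
Proof.
move=> h.
have hb m n r : imN (u m - u n) <= r -> forall x, nr (bv (u m) x - bv (u n) x) <= r * nr x.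
  move=> hr x; apply: le_trans (opn_bnd (im_bop (u m - u n)) x) _.
  by rewrite ler_wpM2r ?nr_ge0.
have hx x : exists y, seqlim (fun n => bv (u n) x : L) y.
  apply: seqcauchy_lim => r r0; have x1 : 0 < nr x + 1 by rewrite ltr_wpDl ?nr_ge0.
  have [N hN] := h _ (divr_gt0 r0 x1); exists N => m n Nm Nn.
  apply: le_trans (hb _ _ _ (hN _ _ Nm Nn) x) _.
  rewrite -[leRHS](divfK (lt0r_neq0 x1)) ler_wpM2l ?(ltW (divr_gt0 r0 x1))//.
  by rewrite lerDl.
pose T x := projT1 (cid (hx x)).
have hT x : seqlim (fun n => bv (u n) x : L) (T x) by rewrite /T; case: cid.
have key r : 0 < r -> exists N, forall n, (N <= n)%N -> bnd (fun x => bv (u n) x - T x) r.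
  move=> r0; have [N hN] := h r r0; exists N => n Nn x.
  have : seqlim (fun m => bv (u n) x - bv (u m) x : L) (bv (u n) x - T x).
    apply: (seqlim_bnd (M := 1)) (hT x) => m; rewrite mul1r.
    by rewrite opprB addrC addrA subrK nrB.
  (* [seqlim_nr] wants the bound for all terms, so the index is pushed beyond N by [maxn]. *)
  move=> hs; have := @seqlim_nr R L (fun m => bv (u n) x - bv (u (maxn N m)) x) _ (r * nr x).
  apply; last by move=> m; apply: hb; apply: hN; rewrite ?leq_maxl.
  move=> r' /hs[M hM]; exists M => m Mm; apply: hM.
  by rewrite (leq_trans Mm)// leq_maxr.
have lT : linear T.
  move=> c x y; apply: seqlim_uniq (hT _) _.
  have h1 : seqlim (fun n => c *: bv (u n) x : L) (c *: T x).
    by apply: (seqlim_bnd (M := cn c)) (hT x) => n; rewrite -scalerBr nrZ.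
  have := seqlimD h1 (hT y).
  by congr seqlim; apply/funext => n; rewrite (bop_lin (im_bop (u n))).
have bT : bounded_op T.
  have [N hN] := key 1 ltr01.
  have [M M0 hM] := bop_bnd (im_bop (u N)).
  apply: (@bnd_op _ _ _ _ (1 + M)) => // x.
  have := nr_le_sub (T x) (bv (u N) x); rewrite nrB => h1.
  apply: le_trans h1 _; rewrite mulrDl; apply: lerD; [exact: hN|exact: hM].
have cT : range g T.
  apply: (range_closed ue hg ge); apply/op_closure_bnd; split => // r r0.
  have [N hN] := key r r0; exists (bv (u N)); first exact: (lsvalD (u N)).
  by move=> x; rewrite nrB; exact: hN.
pose l : B := @lsmk R im_ls T cT.
exists l => r r0; have [N hN] := key r r0; exists N => n Nn.
exact: (opn_le (im_bop (u n - l)) (ltW r0) (hN n Nn)).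
Qed.

Definition im_nd : @normdata R := @NormData R B imN im_tri im_scal im_eq0 im_compl.
Definition im_csp : completeNormedModType C := ndsp im_nd.

Lemma imM_range (a b : B) : range g (bv a \o bv b).
Proof.
have [x _ <-] := lsvalD a; have [y _ <-] := lsvalD b.
by exists (cmul x y) => //; apply/funext => z; rewrite sh_mul.
Qed.
Lemma imV_range (a : B) : range g (adj (bv a)).
Proof. by have [x _ <-] := lsvalD a; exists (cinv x) => //; rewrite sh_inv. Qed.
Definition im_mul (a b : im_csp) : im_csp := @lsmk R im_ls _ (imM_range a b).
Definition im_inv (a : im_csp) : im_csp := @lsmk R im_ls _ (imV_range a).

Lemma im_mulA a b c : im_mul a (im_mul b c) = im_mul (im_mul a b) c.
Proof. exact: (@lsval_inj R im_ls). Qed.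
Lemma im_mul_linl (t : C) a b c :
  im_mul (t *: a + b) c = t *: im_mul a c + im_mul b c.
Proof. exact: (@lsval_inj R im_ls). Qed.
Lemma im_mul_linr (t : C) a b c :
  im_mul a (t *: b + c) = t *: im_mul a b + im_mul a c.
Proof.
apply: (@lsval_inj R im_ls); apply/funext => x.
exact: (bop_lin (im_bop a)).
Qed.
Lemma im_inv_lin (t : C) a b :
  im_inv (t *: a + b) = Num.conj t *: im_inv a + im_inv b.
Proof.
apply: (@lsval_inj R im_ls).
exact: (adj_comb t (im_bop a) (im_bop b)).
Qed.
Lemma im_invK a : im_inv (im_inv a) = a.
Proof. by apply: (@lsval_inj R im_ls); exact: (adjK (im_bop a)). Qed.
Lemma im_invM a b : im_inv (im_mul a b) = im_mul (im_inv b) (im_inv a).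
Proof. by apply: (@lsval_inj R im_ls); exact: (adj_comp (im_bop a) (im_bop b)). Qed.
Lemma im_mul_norm (a b : im_csp) : `|im_mul a b| <= `|a| * `|b|.
Proof.
rewrite !nrE -rmorphM lecR.
exact: (opn_comp (im_bop a) (im_bop b)).
Qed.
Lemma im_star_norm (a : im_csp) : `|im_mul (im_inv a) a| = `|a| ^+ 2.
Proof.
rewrite !nrE -rmorphXn; congr (_%:C).
exact: (opn_star (im_bop a)).
Qed.

Definition im_cstar : cstar R := @CStar R im_csp im_mul im_inv im_mulA im_mul_linl
  im_mul_linr im_inv_lin im_invK im_invM im_mul_norm im_star_norm.
Definition imv (b : im_cstar) : L -> L := bv (b : B).
Definition imk (s : S) : im_cstar := imq s.
Definition imf (b : im_cstar) : S := imlft b.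
Lemma imkE s : imv (imk s) = g s. Proof. by []. Qed.
Lemma imfE b : g (imf b) = imv b. Proof. exact: imlftE. Qed.
Lemma imfK b : imk (imf b) = b. Proof. exact: imlftK. Qed.
Lemma imv_inj : injective imv. Proof. by move=> a b h; exact: (@lsval_inj R im_ls a b h). Qed.
Lemma imv_sh : star_hom imv.
Proof. by split => //; exact: im_bop. Qed.
Lemma imk_lin (c : C) s t : imk (c *: s + t) = c *: imk s + imk t.
Proof. by apply: imv_inj; rewrite imkE sh_lin. Qed.
Lemma imk_le s : nr (imk s) <= nr s.
Proof. exact: (opn_le (sh_bop hg s) (nr_ge0 _) (sh_contr hg s)). Qed.
Lemma imk_dual (f : im_cstar -> C^o) : dual f -> dual (fun s => f (imk s) : C^o).
Proof.
move=> /dual_bnd[lf [M M0 hM]]; apply: (dual_intro (M := M)) => [c x y|x].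
  by rewrite imk_lin lf.
by apply: le_trans (hM _) _; rewrite ler_wpM2l// imk_le.
Qed.
End ImageAlgebra.

Section Compression.
Context {R : realType} (tp : tensor_products R).
Local Notation C := R[i].
Variables (H K H' K' : hilbert R) (i : H' -> H) (j : K' -> K).
Hypotheses (bi : bounded_op i) (bj : bounded_op j).
Notation J := (gtens (tp := tp) i j).
Variable X : tp H K -> tp H K.
Hypothesis bX : bounded_op X.

Definition compress : tp H' K' -> tp H' K' := gadj J \o X \o J.
Lemma compress_bop : bounded_op compress.
Proof.
have bJ : bounded_op J by exact: gtens_bop.
by apply: bop_comp => //; apply: bop_comp => //; exact: gadj_bop.
Qed.
Lemma compress_ip x y x' y' : ip (compress (tens _ x y)) (tens _ x' y') =
  ip (X (tens _ (i x) (j y))) (tens _ (i x') (j y')).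
Proof.
have bJ : bounded_op J by exact: gtens_bop.
by rewrite /compress !compx -gadjEr// !gtensE.
Qed.
Lemma compress_rslice xi eta : rslice (pw xi eta) compress =
  gadj i \o rslice (pw (l2map j xi) (l2map j eta)) X \o i.
Proof.
have bJ : bounded_op J by exact: gtens_bop.
apply/funext => x; apply: ip_ext => x'; rewrite !compx -gadjEr//.
rewrite (rslice_ip compress_bop) (rslice_ip bX); apply: l2_ip_ext => n.
rewrite (l2mapE compress_bop) (l2mapE (tensl_bop _ x)) (l2mapE (tensl_bop _ x')).
rewrite (l2mapE bX) (l2mapE (tensl_bop _ (i x))) (l2mapE (tensl_bop _ (i x'))).
by rewrite !(l2mapE bj) compress_ip.
Qed.
End Compression.

Lemma compress_vec (R : realType) (H H' : hilbert R) (i : H' -> H) x y : bounded_op i ->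
  pw (l2map i (single 0 x)) (l2map i (single 0 y)) = vec_fun (i x) (i y).
Proof. by move=> bi; rewrite !l2map_single// vec_pw. Qed.

(** * The universal representation of the image *)

Section SubRep.
Context {R : realType}.
Local Notation C := R[i].
Variables (S : cstar R) (e : S) (L : hilbert R) (g : S -> L -> L) (u : univ_rep S).
Hypotheses (ue : forall a : S, cmul e a = a /\ cmul a e = a)
  (hg : star_hom g) (ge : g e = id).
Notation f := (urep u).
Notation uf := (urep_sh u).

(* The range of 1 - z, where z in A** is the support projection of ker g. *)
Definition kerset : set (usp u) := [set x | forall s, g s = (fun=> 0) -> f s x = 0].

Lemma kerset_closed : closed_sub kerset.
Proof.
split=> [s _|c x y hx hy s gs|v l hv hl s gs].
- by rewrite (lin0 (sh_linear uf s)).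
- by rewrite (sh_linear uf s) hx// hy// scaler0 addr0.
- apply: (seqlim_uniq (bop_seqlim (urep_bop u s) hl)).
  have -> : f s \o v = fun=> 0 by apply/funext => n /=; rewrite hv.
  exact: seqlim_cst.
Qed.

Lemma ker_mull s t : g s = (fun=> 0) -> g (cmul s t) = (fun=> 0).
Proof. by move=> gs; apply/funext => x; rewrite sh_mul// gs. Qed.
Lemma ker_mulr s t : g s = (fun=> 0) -> g (cmul t s) = (fun=> 0).
Proof. by move=> gs; apply/funext => x; rewrite sh_mul// gs (lin0 (sh_linear hg t)). Qed.
Lemma ker_inv s : g s = (fun=> 0) -> g (cinv s) = (fun=> 0).
Proof.
by move=> gs; apply/funext => x; apply: ip_extr => y; rewrite -(sh_ip hg) gs ip0l ip0r.
Qed.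
Lemma ker_lin c s t : g s = (fun=> 0) -> g t = (fun=> 0) -> g (c *: s + t) = (fun=> 0).
Proof. by move=> gs gt; apply/funext => x; rewrite sh_lin// gs gt scaler0 addr0. Qed.
Lemma ker_sub s t : g s = g t -> g (s - t) = (fun=> 0).
Proof. by move=> gst; apply/funext => x; rewrite shB// gst subrr. Qed.

Lemma kerset_inv s x : kerset x -> kerset (f s x).
Proof. by move=> hx t gt; rewrite -(sh_mul uf); apply: hx; exact: ker_mull. Qed.

Definition kH : hilbert R := subh kerset_closed.
Definition kinc : kH -> usp u := @sinc R _ _ kerset_closed.
Lemma kinc_bop : bounded_op kinc. Proof. exact: sinc_bop. Qed.
Lemma kinc_ip x y : ip (kinc x) (kinc y) = ip x y. Proof. exact: sinc_ip. Qed.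
Lemma kincP x : kerset (kinc x). Proof. exact: (sincD (cD := kerset_closed)). Qed.
Lemma kincK x : gadj kinc (kinc x) = x.
Proof. by have := congr1 (fun h => h x) (sincK kerset_closed). Qed.
Lemma kinc_gadj x : kerset x -> kinc (gadj kinc x) = x.
Proof. exact: sinc_gadj. Qed.

Definition kproj : usp u -> usp u := kinc \o gadj kinc.
Lemma kproj_bop : bounded_op kproj.
Proof. by apply: bop_comp; [exact: kinc_bop|apply: gadj_bop; exact: kinc_bop]. Qed.
Lemma kproj_ip x y : ip (kproj x) y = ip x (kproj y).
Proof. exact: etrans (gadjE _ _ kinc_bop) (esym (gadjEr _ _ kinc_bop)). Qed.
Lemma kprojP x : kerset (kproj x). Proof. exact: kincP. Qed.
Lemma kproj_id x : kerset x -> kproj x = x. Proof. exact: kinc_gadj. Qed.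

(** [kerset] is invariant under f(s) and under its adjoint, because ker g is an ideal. *)
Lemma kproj_comm s x : f s (kproj x) = kproj (f s x).
Proof.
have key t z : kproj (f t (kproj z)) = f t (kproj z).
  by rewrite kproj_id//; apply: kerset_inv; exact: kprojP.
apply: ip_ext => y; rewrite -key.
by rewrite !kproj_ip !(sh_ip uf) kproj_ip key.
Qed.

Definition krep (s : S) : kH -> kH := gadj kinc \o f s \o kinc.
Lemma krepE s x : kinc (krep s x) = f s (kinc x).
Proof. by rewrite /krep !compx kinc_gadj//; apply: kerset_inv; exact: kincP. Qed.
Lemma kinc_inj : injective kinc. Proof. exact: sinc_inj. Qed.
Lemma krep_bop s : bounded_op (krep s).
Proof.
apply: bop_comp; last exact: kinc_bop.
by apply: bop_comp; [apply: gadj_bop; exact: kinc_bop|exact: urep_bop].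
Qed.
Lemma krep_sh : star_hom krep.
Proof.
split; first exact: krep_bop.
- move=> c a b; apply/funext => x; apply: kinc_inj.
  rewrite krepE (sh_lin uf) (linD (bop_lin kinc_bop)) (linZ (bop_lin kinc_bop)).
  by rewrite !krepE.
- by move=> a b; apply/funext => x; apply: kinc_inj; rewrite compx !krepE (sh_mul uf).
- move=> a; symmetry; apply: adj_uniq; first exact: krep_bop.
  by move=> x y; rewrite -!kinc_ip !krepE (sh_ip uf).
Qed.
Lemma krep_ext s t : g s = g t -> krep s = krep t.
Proof.
move=> h; apply/funext => x; apply: kinc_inj; rewrite !krepE.
apply/eqP; rewrite -subr_eq0 -(shB uf); apply/eqP; apply: kincP.
exact: ker_sub.
Qed.

Definition iI : set (usp u -> usp u) := [set T | exists2 s, g s = (fun=> 0) & f s = T].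
Lemma iI_salg : is_salg iI.
Proof.
split.
- by move=> _ [s _ <-]; exact: urep_bop.
- by move=> _ [s gs <-]; exists (cinv s); [exact: ker_inv|rewrite (sh_inv uf)].
- move=> _ _ [s gs <-] [t gt <-]; exists (cmul s t); first exact: ker_mull.
  by apply/funext => x; rewrite (sh_mul uf).
- by exists 0; apply/funext => x; rewrite ?(sh0 hg) ?(sh0 uf).
- by move=> c _ _ [s gs <-] [t gt <-]; exists (c *: s + t); [exact: ker_lin|rewrite (sh_lin uf)].
Qed.

(** Let rho be the part of xi orthogonal to [kerset]. The ideal ker g acts nondegenerately there, so
    rho is a limit of vectors f(t) rho with t in ker g. Since s t is in ker g, f(s t) kills the
    vectors of [kerset] and the functional vanishes on s t; hence rho contributes nothing. *)
Lemma ker_functional xi eta : (forall s, g s = (fun=> 0) -> ip (l2map (f s) xi) eta = 0) ->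
  forall s, ip (l2map (f s) xi) eta = ip (l2map (krep s) (l2map (gadj kinc) xi)) (l2map (gadj kinc) eta).
Proof.
move=> hI s; have bk := kinc_bop; have bk' := gadj_bop bk.
have bs t := urep_bop u t.
pose rho := xi - l2map kproj xi.
have hrho n : l2c rho n = l2c xi n - kproj (l2c xi n).
  by rewrite -(l2mapE kproj_bop).
have cr : cyc iI rho rho.
  apply: (cyc_in iI_salg) => x hx n; rewrite hrho ipBl kproj_ip kproj_id ?subrr// => t gt.
  by apply: hx; exists t.
have rho0 : ip (l2map (f s) rho) eta = 0.
  rewrite l2map_adj//; apply: (cyc_orth _ cr) => _ [t gt <-].
  rewrite -l2map_adj// -l2map_comp//.
  have -> : f s \o f t = f (cmul s t) by apply/funext => x; rewrite (sh_mul uf).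
  have gst : g (cmul s t) = (fun=> 0) by exact: ker_mulr.
  rewrite /rho (linB (l2map_lin (bs _))) ipBl hI// sub0r -l2map_comp//; last exact: kproj_bop.
  have -> : f (cmul s t) \o kproj = (fun=> 0).
    by apply/funext => x; exact: kprojP.
  by rewrite l2map0 ip0l oppr0.
have -> : xi = rho + l2map kproj xi by rewrite subrK.
rewrite (linD (l2map_lin (bs _))) ipDl rho0 add0r (linD (l2map_lin bk')).
have -> : l2map (gadj kinc) rho = 0.
  apply: l2c_inj => n; rewrite l2mapE// hrho (linB (bop_lin bk')) /kproj compx kincK subrr //.
rewrite add0r -!l2map_comp//; do ?exact: kproj_bop; do ?exact: krep_bop.
  apply: l2_ip_ext => n; rewrite !l2mapE//; do ?(apply: bop_comp => //; try exact: krep_bop; exact: kproj_bop).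
  rewrite !compx -gadjEr// -![kinc (gadj kinc _)]/(kproj _) (kproj_id (kprojP _)) -kproj_ip.
  by rewrite (kproj_id (kerset_inv s (kprojP _))).
apply: bop_comp; last exact: kproj_bop.
  by apply: bop_comp => //; exact: krep_bop.
by apply: bop_comp => //; exact: krep_bop.
Qed.

Notation B := (im_cstar ue hg ge).
Definition im_rep (b : B) : kH -> kH := krep (imf b).
Lemma im_repE b s : g s = imv b -> im_rep b = krep s.
Proof. by move=> h; apply: krep_ext; rewrite imfE h. Qed.
Lemma im_rep_k s : im_rep (imk ue hg ge s) = krep s.
Proof. exact: im_repE. Qed.
Lemma im_rep_sh : star_hom im_rep.
Proof.
have [h1 h2 h3 h4] := krep_sh; split => [b|c a b|a b|a].
- exact: h1.
- rewrite (@im_repE _ (c *: imf a + imf b)) ?h2//.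
  by rewrite (sh_lin hg) !imfE.
- rewrite (@im_repE _ (cmul (imf a) (imf b))) ?h3//.
  by apply/funext => x; rewrite sh_mul// !imfE.
- rewrite (@im_repE _ (cinv (imf a))) ?h4//.
  by rewrite sh_inv// imfE.
Qed.
Lemma im_unit b : cmul (imk ue hg ge e) b = b /\ cmul b (imk ue hg ge e) = b.
Proof. by split; apply: imv_inj; apply/funext => x; rewrite /imv /= ge. Qed.
Lemma krep_unit : krep e = id.
Proof.
by apply/funext => x; apply: kinc_inj; rewrite krepE (urep_unit u ue).
Qed.
Lemma im_rep_nondeg (x : kH) (r : C) : 0 < r ->
    exists n (a : 'I_n -> B) (y : 'I_n -> kH),
      `|x - \sum_(k < n) im_rep (a k) (y k)| <= r.
Proof.
move=> r0; exists 1%N, (fun=> imk ue hg ge e), (fun=> x).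
by rewrite big_ord1 im_rep_k krep_unit subrr normr0 ltW.
Qed.
Lemma im_rep_univ (h : B -> C^o) : dual h ->
    exists2 w, predual w & forall a, h a = pair_op w (im_rep a).
Proof.
move=> dh; have dk := imk_dual dh.
have [xi [eta ew]] := predualP (nf_predual u dk).
have hF s : ip (l2map (f s) xi) eta = h (imk ue hg ge s).
  by rewrite -(pair_opE _ _ (urep_bop u s)) -ew (nfE u s dk).
exists (pw (l2map (gadj kinc) xi) (l2map (gadj kinc) eta)); first exact: pw_predual.
move=> b; rewrite -(imfK b) im_rep_k (pair_opE _ _ (krep_bop _)) -ker_functional// => s gs.
rewrite hF (_ : imk ue hg ge s = 0).
  have [lh _] := dual_bnd dh; have := lh (-1) 0 0.
  by rewrite scaleN1r addNr mulN1r addNr.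
by apply: imv_inj; rewrite imkE gs.
Qed.
Definition im_univ : univ_rep B := @UnivRep R B kH im_rep im_rep_sh im_rep_nondeg im_rep_univ.
End SubRep.

Section BidualAdj.
Context {R : realType}.
Variables (A : cstar R) (u : univ_rep A).
Lemma bidual_adj T : bidual u T -> bidual u (adj T).
Proof.
move=> hT; have bT := bidual_bop hT.
split; first exact: adj_bop.
move=> X [bX hX]; have bX' := adj_bop bX.
have : commutant (range (urep u)) (adj X).
  split => // _ [s _ <-].
  have h := hX (urep u (cinv s)) (ex_intro2 _ _ _ I erefl).
  have bs := urep_bop u (cinv s).
  rewrite -[s]cinvK (sh_inv (urep_sh u)) -(adj_comp bs bX) -(adj_comp bX bs).
  by rewrite h.
case: hT => _ /[apply] h1.
rewrite -[X](adjK bX) -(adj_comp bX' bT) -(adj_comp bT bX').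
by rewrite h1.
Qed.
End BidualAdj.

Section SliceVN.
Context {R : realType} (tp : tensor_products R).
Variables (H K : hilbert R) (D : set (H -> H)).
Hypotheses (bD : D `<=` bounded_op (V:=H) (W:=H)) (iD : D id).

(** An operator Y commuting with all id (x) T has the form Y0 (x) id, as rank-one T show; commuting
    with D puts Y0 in the commutant of D. It then commutes with every slice of X, so Y commutes with
    X. *)
Lemma slice_vN (X : tp H K -> tp H K) : bounded_op X ->
  (forall y y', commutant (commutant D) (rslice (vec_fun y y') X)) ->
  vN_tens D [set T : K -> K | bounded_op T] X.
Proof.
move=> bX hX; split => // Y [bY hY].
(* Without a unit vector in K the tensor product is trivial and rank-one operators are of no
   help. *)
have [[k nk]|nok] := pselect (exists k : K, nr k = 1); last first.
  have K0 (y : K) : y = 0.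
    apply: contrapT => y0; apply: nok; exists ((nr y)^-1%:C *: y).
    have yp : nr y != 0 by apply/eqP => /nr_eq0.
    by rewrite nrZ cn_ge0r ?invr_ge0 ?nr_ge0// mulVf.
  apply: tens_ext; [exact: bop_comp|exact: bop_comp|] => x y.
  by rewrite (K0 y) tens0r !compx (lin0 (bop_lin bX)) (lin0 (bop_lin bY)) (lin0 (bop_lin bX)).
have bi := bop_id H; have biK := bop_id K.
pose th (y : K) : K -> K := fun z => ip z k *: y.
have bth y : bounded_op (th y).
  apply: (@bnd_op _ _ _ _ (nr y)) => [c a b|z]; rewrite /th.
    by rewrite ip_linear scalerDl scalerA.
  rewrite nrZ mulrC ler_wpM2l ?nr_ge0//; apply: le_trans (CS _ _) _.
  by rewrite nk mulr1.
pose Y0 := gadj (tensr (tp H K) k) \o Y \o tensr (tp H K) k.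
have bk := tensr_bop (tp H K) k.
have bY0 : bounded_op Y0 by apply: bop_comp => //; apply: bop_comp => //; exact: gadj_bop.
have YE x y : Y (tens _ x y) = tens _ (Y0 x) y.
  have h : Y \o gtens id (th y) = gtens id (th y) \o Y.
    by apply: hY; exists id => //; exists (th y); first exact: bth.
  have e1 : tens (tp H K) x y = gtens id (th y) (tens _ x k).
    by rewrite gtensE// /th ipxx nk expr1n scale1r.
  rewrite e1; have := congr1 (fun f => f (tens (tp H K) x k)) h; rewrite !compx => ->.
  apply: tens_ipext => x' y'.
  rewrite (gadjE _ _ (gtens_bop _ bi (bth y))) gtens_adj// gtensE//; do ?exact: gadj_bop.
  have -> : gadj (th y) y' = ip y' y *: k.
    apply: ip_extr => z; rewrite -(gadjE _ _ (bth y)) /th ipZl ipZr mulrC.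
    by rewrite [ip y y']ip_conj.
  have -> : gadj id x' = x' by rewrite -[gadj id]/(adj id) adj_id.
  rewrite tensZr ipZr -ip_conj tens_ip mulrC; congr (_ * _).
  by rewrite /Y0 !compx -(gadjEr _ _ bk).
have cY0 : commutant D Y0.
  split => // A DA; have bA := bD DA; apply/funext => x; rewrite !compx.
  have h : Y \o gtens A (@id K) = gtens A id \o Y by apply: hY; exists A => //; exists id.
  have := congr1 (fun f => f (tens (tp H K) x k)) h.
  rewrite !compx gtensE// YE YE gtensE// => h2.
  apply: ip_ext => z; have := congr1 (fun v => ip v (tens (tp H K) z k)) h2.
  by rewrite !tens_ip ipxx nk expr1n !mulr1.
apply: tens_ext; [exact: bop_comp|exact: bop_comp|] => x y.
rewrite !compx YE; apply: tens_ipext => x' y'.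
have YG : Y = gtens Y0 id.
  by apply: tens_ext => //; [exact: gtens_bop|move=> a b; rewrite YE gtensE].
rewrite -rslice_vec// [RHS](gadjE _ _ bY) YG gtens_adj// gtensE//; do ?exact: gadj_bop.
rewrite -[gadj id]/(adj id) adj_id -rslice_vec// -(gadjE _ _ bY0).
have [_ h] := hX y y'.
by have := congr1 (fun f => ip (f x) x') (h _ cY0); rewrite !compx.
Qed.
End SliceVN.

(** * The Eberlein structure on the image *)

Section SubEberlein.
Context {R : realType} (tp : tensor_products R).
Local Notation C := R[i].
Variables (S : eberlein tp) (e : ealg S) (L : hilbert R) (g : ealg S -> L -> L).
Variable p : eH S -> eH S.
Hypotheses (ue : forall a : ealg S, cmul e a = a /\ cmul a e = a)
  (hg : star_hom g) (ge : g e = id) (pp : projection_op p).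
Notation u := (euniv S).
Notation f := (urep u).
Notation uf := (urep_sh u).
Notation Phi := (ePhi S).
Notation V := (eV S).
(** What is retained of a morphism theta: [DS] will be the functionals m o theta, which separate
    points modulo ker g and whose products vanish on ker g. The assumption [hp] says that cutting
    both vectors by p does not change the image of a slice of V under g. *)
Variable DS : set (ealg S -> C^o).
Hypotheses (DSd : DS `<=` dual (V := ealg S))
  (DSs : forall s, (forall d, DS d -> d s = 0) -> g s = (fun=> 0))
  (DSc : forall m n s, DS m -> DS n -> g s = (fun=> 0) -> Defs.conv Phi m n s = 0)
  (hp : forall xi eta s t, rslice (pw xi eta) V = f s ->
    rslice (pw (l2map p xi) (l2map p eta)) V = f t -> g s = g t).

Lemma p_closed : closed_sub [set y : eH S | p y = y].
Proof.
case: pp => bp _ _; split => [|c x y /= hx hy|v l hv hl].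
- exact: lin0 (bop_lin bp).
- by rewrite /= (bop_lin bp) hx hy.
- apply: (seqlim_uniq (bop_seqlim bp hl)).
  by have -> : p \o v = v by apply/funext => n; exact: hv.
Qed.
Definition pK : hilbert R := subh p_closed.
Definition pinc : pK -> eH S := @sinc R _ _ p_closed.
Lemma pinc_bop : bounded_op pinc. Proof. exact: sinc_bop. Qed.
Lemma pincP x : p (pinc x) = pinc x. Proof. exact: (sincD (cD := p_closed)). Qed.
Lemma pincK : gadj pinc \o pinc = id. Proof. exact: sincK. Qed.
Lemma pinc_gadj y : pinc (gadj pinc y) = p y.
Proof.
have [bp p2 pa] := pp.
have ppy : p (p y) = p y by have := congr1 (fun h => h y) p2.
rewrite -[RHS](@sinc_gadj R _ _ p_closed (p y) ppy); congr sinc.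
apply: ip_extr => x; rewrite -!(gadjE _ _ pinc_bop).
by rewrite -{1}pincP (adjE _ _ bp) pa.
Qed.
Lemma l2_pinc xi : l2map pinc (l2map (gadj pinc) xi) = l2map p xi.
Proof.
have [bp _ _] := pp.
rewrite -l2map_comp; [|exact: pinc_bop|by apply: gadj_bop; exact: pinc_bop].
by congr l2map; apply/funext => y; exact: pinc_gadj.
Qed.

Notation kH := (@kH R _ L g u).
Notation kinc := (@kinc R _ L g u).
Notation kproj := (@kproj R _ L g u).
Notation krep := (@krep R _ L g u).
Notation bk := (@kinc_bop R _ L g u).
Notation B := (im_cstar ue hg ge).
Notation uB := (im_univ u ue hg ge).
Notation q := (imk ue hg ge).

Definition cPhi (s : ealg S) : tp kH kH -> tp kH kH := compress kinc kinc (Phi s).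
Lemma Phi_bop s : bounded_op (Phi s). Proof. exact: ePhi_bop. Qed.
Lemma cPhi_bop s : bounded_op (cPhi s).
Proof. by apply: compress_bop; [exact: bk|exact: bk|exact: Phi_bop]. Qed.
Lemma cPhi_ip s x y x' y' : ip (cPhi s (tens _ x y)) (tens _ x' y') =
  ip (Phi s (tens _ (kinc x) (kinc y))) (tens _ (kinc x') (kinc y')).
Proof. by apply: compress_ip; [exact: bk|exact: bk]. Qed.

Lemma conv_vec x y x' y' s :
  Defs.conv Phi (fun a => ip (f a x) x') (fun a => ip (f a y) y') s =
  ip (Phi s (tens _ x y)) (tens _ x' y').
Proof.
have d1 := dual_vec x x' uf; have d2 := dual_vec y y' uf.
rewrite (@convE _ _ _ u _ (@ePhi_vN _ _ S) _ _ (vec_fun x x') (vec_fun y y') _ d1 d2).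
- rewrite pair_vec; last by apply: (rslice_bop (Phi_bop s)); exact: vec_predual.
  by rewrite rslice_vec//; exact: Phi_bop.
- exact: vec_predual.
- exact: vec_predual.
- by move=> b; rewrite pair_vec//; exact: urep_bop.
- by move=> b; rewrite pair_vec//; exact: urep_bop.
Qed.

(** A matrix coefficient of [Phi s] is a product of two vector functionals, by [conv_vec]. At
    vectors in the range of [kinc] these functionals vanish on ker g, so [biweak] transports the
    vanishing from [DS] to them. *)
Lemma cPhi_ker s : g s = (fun=> 0) -> cPhi s = (fun=> 0).
Proof.
move=> gs; apply: tens_opext; [exact: cPhi_bop|exact: bop0|] => x y x' y'.
rewrite cPhi_ip ip0l -conv_vec.
apply: (@biweak _ _ (fun m n => Defs.conv Phi m n s) DS [set a | g a = (fun=> 0)]).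
- by move=> n dn; exact: (right_module ue s dn).
- by move=> m dm; exact: (left_module ue s dm).
- exact: DSd.
- by move=> a ha; exact: DSs.
- by move=> m n Dm Dn; exact: DSc.
- exact: dual_vec uf.
- exact: dual_vec uf.
- by move=> a ga; rewrite (kincP x) ?ip0l.
- by move=> a ga; rewrite (kincP y) ?ip0l.
Qed.

Lemma cPhi_lin c s t : cPhi (c *: s + t) = fun x => c *: cPhi s x + cPhi t x.
Proof.
rewrite /cPhi /compress (sh_lin (ePhi_hom S)); apply/funext => x; rewrite !compx.
have bJ : bounded_op (gadj (gtens (tp := tp) kinc kinc)).
  by apply: gadj_bop; apply: gtens_bop; exact: bk.
by rewrite (linD (bop_lin bJ)) (linZ (bop_lin bJ)).
Qed.
Lemma cPhi_ext s t : g s = g t -> cPhi s = cPhi t.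
Proof.
move=> h; have := cPhi_lin (-1) t s; rewrite addrC scaleN1r cPhi_ker; last exact: ker_sub.
move=> h2; apply/funext => x; apply/eqP; rewrite -subr_eq0.
have := congr1 (fun k => k x) h2; rewrite /= scaleN1r addrC => <- //.
Qed.

Lemma kproj_bidual : commutant (bidual u) kproj.
Proof.
split; first exact: kproj_bop.
move=> T [bT hT]; symmetry; apply: hT; split; first exact: kproj_bop.
by move=> _ [s _ <-]; apply/funext => x; rewrite !compx (kproj_comm hg).
Qed.

Notation J2 := (gtens (tp := tp) kinc kinc).
Lemma J2_bop : bounded_op J2. Proof. by apply: gtens_bop; exact: bk. Qed.
Lemma J2K : gadj J2 \o J2 = id.
Proof.
have h : gadj kinc \o kinc = id by apply/funext => x; exact: kincK.
by apply: gtens_iso => //; exact: bk.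
Qed.
Lemma J2proj : J2 \o gadj J2 = gtens kproj id \o gtens id kproj.
Proof.
have bk' := gadj_bop bk; have bi := bop_id (usp u).
rewrite gtens_adj ?gtens_comp//; do ?exact: bk; do ?exact: bk'; exact: kproj_bop.
Qed.
Lemma J2_comm X : vN_tens (bidual u) (bidual u) X -> J2 \o gadj J2 \o X = X \o (J2 \o gadj J2).
Proof.
move=> vX; rewrite J2proj.
have h1 := vN_commute_l (@bidual_sub _ _ _) (@bidual_sub _ _ _) kproj_bidual vX.
have h2 := vN_commute_r (@bidual_sub _ _ _) (@bidual_sub _ _ _) kproj_bidual vX.
apply/funext => x; rewrite !compx.
have := congr1 (fun h => h x) h2; rewrite !compx => <-.
by have := congr1 (fun h => h (gtens id kproj x)) h1; rewrite !compx => <-.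
Qed.
(** The range projection of [J2] commutes with A** (x) A**, so the compressed coproduct is a
    restriction to an invariant subspace; this is why it is multiplicative. *)
Lemma J2_Phi s x : Phi s (J2 x) = J2 (cPhi s x).
Proof.
have := congr1 (fun h => h (J2 x)) (J2_comm (ePhi_vN s)); rewrite !compx.
have -> : gadj J2 (J2 x) = x by have := congr1 (fun h => h x) J2K.
by move=> <-; rewrite /cPhi /compress !compx.
Qed.
Lemma J2_inj : injective J2.
Proof.
move=> x y h; have := congr1 (gadj J2) h.
by have /= h1 x1 : gadj J2 (J2 x1) = x1 := congr1 (fun h => h x1) J2K; rewrite !h1.
Qed.

Lemma cPhi_sh : star_hom cPhi.
Proof.
split; [exact: cPhi_bop|exact: cPhi_lin| |].
- move=> a b; apply/funext => x; apply: J2_inj; rewrite compx -!J2_Phi.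
  exact: (sh_mul (ePhi_hom S)).
- move=> a; symmetry; apply: adj_uniq; first exact: cPhi_bop.
  move=> x y; have J2ip z t : ip (J2 z) (J2 t) = ip z t.
    rewrite (gadjE _ _ J2_bop).
    by have -> : gadj J2 (J2 t) = t by have := congr1 (fun h => h t) J2K.
  by rewrite -!J2ip -!J2_Phi (sh_ip (ePhi_hom S)).
Qed.

Definition bPhi (b : B) : tp kH kH -> tp kH kH := cPhi (imf b).
Lemma bPhiE (b : B) s : g s = imv b -> bPhi b = cPhi s.
Proof. by move=> h; apply: cPhi_ext; rewrite imfE h. Qed.
Lemma bPhi_k s : bPhi (q s) = cPhi s. Proof. exact: bPhiE. Qed.
Lemma bPhi_sh : star_hom bPhi.
Proof.
have [h1 h2 h3 h4] := cPhi_sh; split => [b|c a b|a b|a].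
- exact: h1.
- rewrite (@bPhiE _ (c *: imf a + imf b)) ?h2//.
  by rewrite (sh_lin hg) !imfE.
- rewrite (@bPhiE _ (cmul (imf a) (imf b))) ?h3//.
  by apply/funext => x; rewrite sh_mul// !imfE.
- rewrite (@bPhiE _ (cinv (imf a))) ?h4//.
  by rewrite sh_inv// imfE.
Qed.

(** An operator commuting with B on [kH], extended by 0, commutes with the whole of S, hence with
    T. *)
Lemma bidual_kcomp T : bidual u T -> bidual uB (gadj kinc \o T \o kinc).
Proof.
move=> [bT hT]; have bk' := gadj_bop bk.
have bS : bounded_op (gadj kinc \o T \o kinc).
  by apply: bop_comp; [exact: bop_comp|exact: bk].
split => // X [bX hX].
have bX' : bounded_op (kinc \o X \o gadj kinc).
  by apply: bop_comp => //; apply: bop_comp => //; exact: bk.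
have cX : commutant (range f) (kinc \o X \o gadj kinc).
  split => // _ [s _ <-].
  have hs : X \o krep s = krep s \o X.
    by have := hX (krep s); apply; exists (q s) => //; exact: im_rep_k.
  have gk x : gadj kinc (f s x) = krep s (gadj kinc x).
    apply: ip_ext => z; rewrite -(gadjEr _ _ bk) (sh_ip uf).
    by rewrite (sh_ip (krep_sh u hg)) -(gadjEr _ _ bk) (krepE hg).
  apply/funext => x; rewrite !compx gk.
  have -> : X (krep s (gadj kinc x)) = krep s (X (gadj kinc x)).
    by have := congr1 (fun h => h (gadj kinc x)) hs.
  by rewrite (krepE hg).
have TX := hT _ cX.
apply/funext => x; rewrite !compx.
have h := congr1 (fun h => gadj kinc (h (kinc x))) TX; move: h; rewrite !compx !kincK.
by move=> <-.
Qed.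

Lemma kinc_bidual T x : bidual u T -> kinc (gadj kinc (T (kinc x))) = T (kinc x).
Proof.
move=> bT; have [_ h] := kproj_bidual.
have := congr1 (fun h => h (kinc x)) (h T bT); rewrite !compx /kproj !compx.
by rewrite kincK.
Qed.

(** If Y commutes with the compressed generators, then J Y J^* commutes with the original ones,
    whose legs and their adjoints leave the range of J invariant. Hence X commutes with J Y J^* and
    its compression with Y. *)
Lemma uB_tens_compress (K K' : hilbert R) (j : K' -> K) (N : set (K -> K)) (N' : set (K' -> K'))
    (X : tp (usp u) K -> tp (usp u) K) :
  bounded_op j -> (forall y, gadj j (j y) = y) ->
  N `<=` bounded_op (V := K) (W := K) ->
  (forall T, N T -> N' (gadj j \o T \o j)) ->
  (forall T y, N T -> j (gadj j (T (j y))) = T (j y)) ->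
  (forall T, N T -> N (adj T)) ->
  vN_tens (bidual u) N X -> vN_tens (bidual uB) N' (compress kinc j X).
Proof.
move=> bj jK bN NN' jN Na vX; have bX := vN_tens_bop vX.
have bJ : bounded_op (gtens (tp := tp) kinc j) by apply: gtens_bop => //; exact: bk.
have bJ' := gadj_bop bJ.
pose J := gtens (tp := tp) kinc j.
split; first by apply: compress_bop => //; exact: bk.
move=> Y [bY hY].
have bY' : bounded_op (J \o Y \o gadj J).
  by apply: bop_comp => //; exact: bop_comp.
have JJ : gadj J \o J = id.
  apply: gtens_iso => //; first exact: bk.
    by apply/funext => x; exact: kincK.
  by apply/funext => x; exact: jK.
have JK x : gadj J (J x) = x by have := congr1 (fun h => h x) JJ.
have cY : commutant (tens_ops (bidual u) N) (J \o Y \o gadj J).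
  split => // _ [A hA [T hT ->]]; rewrite op_tens_gtens.
  have bA := bidual_bop hA; have bT := bN _ hT.
  pose A' := gadj kinc \o A \o kinc; pose T' := gadj j \o T \o j.
  have bA' : bounded_op A' by exact: bidual_bop (bidual_kcomp hA).
  have bT' : bounded_op T' by apply: bop_comp => //; apply: bop_comp => //; exact: gadj_bop.
  have bg := gtens_bop tp bA bT; have bg' := gtens_bop tp bA' bT'.
  have gJ : gtens A T \o J = J \o gtens A' T'.
    rewrite /J !gtens_comp//; try exact: bk.
    congr gtens; apply/funext => x; rewrite !compx; first by rewrite kinc_bidual.
    by rewrite jN.
  have Jg : gadj J \o gtens A T = gtens A' T' \o gadj J.
    have ha := bidual_adj hA.
    have ha2 := Na _ hT.
    pose A2 := gadj kinc \o adj A \o kinc; pose T2 := gadj j \o adj T \o j.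
    have bA2 : bounded_op A2 by exact: bidual_bop (bidual_kcomp ha).
    have bT2 : bounded_op T2.
      by apply: bop_comp => //; apply: bop_comp; [exact: gadj_bop|exact: adj_bop].
    have gJ2 : gtens (adj A) (adj T) \o J = J \o gtens A2 T2.
      rewrite /J !gtens_comp//; try exact: bk; try exact: adj_bop.
      congr gtens; apply/funext => x; rewrite !compx; first by rewrite kinc_bidual.
      by rewrite jN.
    apply/funext => x; apply: ip_ext => z; rewrite !compx.
    rewrite -(gadjEr _ _ bJ).
    have -> : ip (gtens A T x) (J z) = ip x (gtens (adj A) (adj T) (J z)).
      by rewrite (gadjE _ _ bg) gtens_adj.
    have -> : gtens (adj A) (adj T) (J z) = J (gtens A2 T2 z).
      by have := congr1 (fun h => h z) gJ2.
    have eA : gadj A' = A2.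
      apply: gadj_uniq => // y t; rewrite /A2 /A' !compx -(gadjEr _ _ bk) -(gadjE _ _ bk).
      exact: (adjE _ _ bA).
    have eT : gadj T' = T2.
      apply: gadj_uniq => // y t; rewrite /T2 /T' !compx -(gadjEr _ _ bj) -(gadjE _ _ bj).
      exact: (adjE _ _ bT).
    by rewrite (gadjEr _ _ bJ) [RHS](gadjE _ _ bg') (gtens_adj tp bA' bT') eA eT.
  have Yg : Y \o gtens A' T' = gtens A' T' \o Y.
    apply: hY; exists A'; first exact: bidual_kcomp.
    by exists T' => //; exact: NN'.
  apply/funext => x; rewrite !compx.
  have := congr1 (fun h => h x) Jg; rewrite !compx => ->.
  have := congr1 (fun h => h (gadj J x)) Yg; rewrite !compx => ->.
  by have := congr1 (fun h => h (Y (gadj J x))) gJ; rewrite !compx => ->.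
have [_ h] := vX; have XY := h _ cY.
apply/funext => x; have := congr1 (fun h => gadj J (h (J x))) XY.
by rewrite !compx !JK => hh; rewrite /compress !compx -/J hh.
Qed.

Lemma bPhi_vN b : vN_tens (bidual uB) (bidual uB) (bPhi b).
Proof.
apply: uB_tens_compress (ePhi_vN _).
- exact: bk.
- exact: kincK.
- exact: bidual_sub.
- exact: bidual_kcomp.
- exact: kinc_bidual.
- exact: bidual_adj.
Qed.

Definition bV : tp kH pK -> tp kH pK := compress kinc pinc V.
Lemma V_bop : bounded_op V. Proof. exact: eV_bop. Qed.
Lemma bV_bop : bounded_op bV.
Proof. by apply: compress_bop; [exact: bk|exact: pinc_bop|exact: V_bop]. Qed.
Lemma bV_rslice xi eta : rslice (pw xi eta) bV =
  gadj kinc \o rslice (pw (l2map pinc xi) (l2map pinc eta)) V \o kinc.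
Proof. by apply: compress_rslice; [exact: bk|exact: pinc_bop|exact: V_bop]. Qed.
Lemma bV_slice_ex xi eta : exists2 s, rslice (pw (l2map pinc xi) (l2map pinc eta)) V = f s
  & rslice (pw xi eta) bV = krep s.
Proof.
have [s _ hs] := eV_slice (pw_predual (l2map pinc xi) (l2map pinc eta)).
by exists s => //; rewrite bV_rslice -hs.
Qed.

Lemma bV_vN : vN_tens (bidual uB) [set T : pK -> pK | bounded_op T] bV.
Proof.
apply: slice_vN; [exact: bidual_sub| |exact: bV_bop|].
  by have := urep_bidual uB (q e); rewrite [urep uB _]im_rep_k krep_unit.
move=> y y'; have [s _] := bV_slice_ex (single 0 y) (single 0 y').
rewrite -vec_pw => ->; rewrite -(im_rep_k u ue hg ge).
by apply: bicommutant_sub; [exact: bidual_sub|exact: (urep_bidual uB)].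
Qed.

Lemma bV_contr x : `|bV x| <= `|x|.
Proof.
rewrite nr_le; pose J := gtens (tp := tp) kinc pinc.
have bJ : bounded_op J by apply: gtens_bop; [exact: bk|exact: pinc_bop].
have JJ : gadj J \o J = id.
  apply: gtens_iso; [exact: bk|exact: pinc_bop| |exact: pincK].
  by apply/funext => z; exact: kincK.
have nJ z : nr (J z) = nr z.
  apply: isometry_nr => a b; rewrite (gadjE _ _ bJ).
  by have -> : gadj J (J b) = b by have := congr1 (fun h => h b) JJ.
have J1 : bnd (gadj J) 1 by apply: gadj_bnd => // z; rewrite nJ mul1r.
rewrite /bV /compress !compx; apply: le_trans (J1 _) _; rewrite mul1r.
by apply: le_trans (@eV_bnd _ _ S _) _; rewrite mul1r nJ.
Qed.

Lemma bV_slice w : predual w -> range (urep uB) (rslice w bV).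
Proof.
move=> /predualP[xi [eta ->]]; have [s _ ->] := bV_slice_ex xi eta.
by exists (q s) => //; exact: im_rep_k.
Qed.

(** A slice of V close to a lift of b is cut down by p. The element of S changes, but by [hp] its
    image in B does not. *)
Lemma bV_dense (b : B) (r : C) : 0 < r -> exists2 w, predual w &
  exists2 b', rslice w bV = urep uB b' & `|b - b'| <= r.
Proof.
move=> r0; have [w pw_ [s hs sr]] := eV_dense (imf b) r0.
have [xi [eta ew]] := predualP pw_.
have bp' := gadj_bop pinc_bop.
exists (pw (l2map (gadj pinc) xi) (l2map (gadj pinc) eta)); first exact: pw_predual.
have [t ht ->] := bV_slice_ex (l2map (gadj pinc) xi) (l2map (gadj pinc) eta).
exists (q t); first by rewrite [urep uB _]im_rep_k.
have gst : g s = g t.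
  by apply: (hp (xi := xi) (eta := eta)); rewrite -?ew// -!l2_pinc.
have -> : q t = q s by apply: imv_inj; rewrite !imkE.
rewrite -(imfK b); apply: le_trans sr; rewrite !nrE lecR.
have -> : q (imf b) - q s = q (imf b - s).
  have := imk_lin ue hg ge (-1) s (imf b).
  by rewrite !scaleN1r ![- _ + _]addrC => ->.
exact: imk_le.
Qed.

Lemma kinc_pair x a b :
  pair_op (pw (l2map kinc a) (l2map kinc b)) (f x) = pair_op (pw a b) (krep x).
Proof.
rewrite (pair_opE _ _ (krep_bop g u x)) (pair_opE _ _ (urep_bop u _)).
apply: l2_ip_ext => k; rewrite !l2mapE; do ?exact: bk; do ?exact: urep_bop.
- by rewrite -(krepE hg) kinc_ip.
- exact: krep_bop.
Qed.

Notation bconv := (@Defs.conv R B uB tp bPhi).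
(** Pulled back to S, the product of functionals on B is the product of the pullbacks; associativity
    and the homomorphism property of [bV] are then inherited from S. *)
Lemma bconvE (m n : B -> C^o) s : dual m -> dual n ->
  bconv m n (q s) = Defs.conv Phi (fun a => m (q a)) (fun a => n (q a)) s.
Proof.
move=> dm dn; have dm' := imk_dual dm; have dn' := imk_dual dn.
have [a [b ev]] := predualP (nf_predual uB dm).
have [c [d ew]] := predualP (nf_predual uB dn).
have hm x : pair_op (pw (l2map kinc a) (l2map kinc b)) (f x) = m (q x).
  by rewrite kinc_pair -(nfE uB (q x) dm) ev -(im_rep_k u ue hg ge).
have hn x : pair_op (pw (l2map kinc c) (l2map kinc d)) (f x) = n (q x).
  by rewrite kinc_pair -(nfE uB (q x) dn) ew -(im_rep_k u ue hg ge).
rewrite (convE (@ePhi_vN _ _ S) s dm' dn' (pw_predual _ _) (pw_predual _ _) hm hn).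
rewrite /Defs.conv /pair_tens ev ew bPhi_k /cPhi.
rewrite (compress_rslice bk bk (Phi_bop s)).
have br : bounded_op (rslice (pw (l2map kinc c) (l2map kinc d)) (Phi s)).
  by apply: (rslice_bop (Phi_bop s)); exact: pw_predual.
rewrite (pair_opE _ _ br) pair_opE; last first.
  by apply: bop_comp; [apply: bop_comp => //; apply: gadj_bop|]; exact: bk.
apply: l2_ip_ext => k; rewrite !l2mapE; do ?exact: bk; do ?exact: br; last first.
  by apply: bop_comp; [apply: bop_comp => //; apply: gadj_bop|]; exact: bk.
by rewrite !compx -(gadjEr _ _ bk).
Qed.

Lemma bconv_fun (m n : B -> C^o) : dual m -> dual n ->
  (fun s => bconv m n (q s)) = Defs.conv Phi (fun a => m (q a)) (fun a => n (q a)).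
Proof. by move=> dm dn; apply/funext => s; exact: bconvE. Qed.

Lemma bPhi_assoc (l m n : B -> C^o) : dual l -> dual m -> dual n ->
  bconv (bconv l m) n = bconv l (bconv m n).
Proof.
move=> dl dm dn; apply/funext => b; rewrite -(imfK b).
have dlm : dual (bconv l m : B -> C^o) := @conv_dual R tp B uB bPhi bPhi_sh _ _ dl dm.
have dmn : dual (bconv m n : B -> C^o) := @conv_dual R tp B uB bPhi bPhi_sh _ _ dm dn.
apply: (etrans (bconvE _ dlm dn)); apply: esym; apply: (etrans (bconvE _ dl dmn)).
apply: (etrans (congr1 (fun x => Defs.conv Phi _ x _) (bconv_fun dm dn))).
apply: esym; apply: (etrans (congr1 (fun x => Defs.conv Phi x _ _) (bconv_fun dl dm))).
by rewrite (ePhi_assoc (imk_dual dl) (imk_dual dm) (imk_dual dn)).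
Qed.

Lemma bV_lslice (m : B -> C^o) : dual m ->
  lslice (Defs.normal_fun uB m) bV =
  gadj pinc \o lslice (Defs.normal_fun u (fun s => m (q s))) V \o pinc.
Proof.
move=> dm; have dm' := imk_dual dm.
apply/funext => y; apply: ip_ext => y'; rewrite !compx -(gadjEr _ _ pinc_bop).
rewrite (lslice_rslice bV_bop _ _ (nf_predual uB dm)).
rewrite (lslice_rslice V_bop _ _ (nf_predual u dm')).
have [s hs hs'] := bV_slice_ex (single 0 y) (single 0 y').
rewrite vec_pw hs' -(im_rep_k u ue hg ge) [LHS](nfE uB (q s) dm).
by rewrite -(compress_vec _ _ pinc_bop) hs (nfE u s dm').
Qed.

(** Compression to the range of p is multiplicative only if the operators leave that range
    invariant. For functionals coming from B they do, by [hp] with p applied to both vectors, the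
    first of which p already fixes. *)
Lemma M_range (m : B -> C^o) y : dual m -> let M := lslice (Defs.normal_fun u (fun s => m (q s))) V in
  p (M (pinc y)) = M (pinc y).
Proof.
move=> dm M; have dm' := imk_dual dm; have [bp p2 pa] := pp.
apply: ip_ext => y'; rewrite (adjE _ _ bp) pa /M.
rewrite !(lslice_rslice V_bop _ _ (nf_predual u dm')).
have [s _ hs] := eV_slice (vec_predual (pinc y) y').
have [t _ ht] := eV_slice (vec_predual (pinc y) (p y')).
have gst : g s = g t.
  apply: (hp (xi := single 0 (pinc y)) (eta := single 0 y')); first by rewrite -vec_pw hs.
  by rewrite (compress_vec _ _ bp) pincP -ht.
rewrite -hs -ht (nfE u s dm') (nfE u t dm').
by congr m; apply: imv_inj; rewrite !imkE.
Qed.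

Lemma bV_mult (m n : B -> C^o) : dual m -> dual n ->
  lslice (Defs.normal_fun uB (bconv m n)) bV =
  lslice (Defs.normal_fun uB m) bV \o lslice (Defs.normal_fun uB n) bV.
Proof.
move=> dm dn; have dmn : dual (bconv m n : B -> C^o) := @conv_dual R tp B uB bPhi bPhi_sh _ _ dm dn.
rewrite (bV_lslice dmn) (bV_lslice dm) (bV_lslice dn) (bconv_fun dm dn).
rewrite (eV_mult (imk_dual dm) (imk_dual dn)).
apply/funext => y; rewrite !compx pinc_gadj.
by rewrite [p _](M_range _ dn).
Qed.

Lemma bPhi_unital : normal_ext uB bPhi id = id.
Proof.
have e1 : urep uB (q e) = id by rewrite [urep uB _]im_rep_k krep_unit.
have e2 : Phi e = id.
  rewrite -(normal_ext_urep u e (ePhi_hom S)) (urep_unit u ue); exact: ePhi_unital.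
rewrite -{1}e1 (normal_ext_urep uB (q e) bPhi_sh) bPhi_k /cPhi /compress e2.
exact: J2K.
Qed.

Definition sub_eberlein : eberlein tp := @Eberlein R tp B uB pK bPhi bV bPhi_sh bPhi_vN
  bPhi_unital bV_vN bV_contr bV_slice bV_dense bPhi_assoc bV_mult.
End SubEberlein.

(** * Multipliers of the minimal tensor product *)

Section Ultralimit.
Context {R : realType}.
Local Notation C := R[i].
Variables (I : Type) (U : set_system I).
Hypothesis UU : UltraFilter U.

Lemma ultra_ex A : U A -> exists i, A i.
Proof. by move=> UA; have [i Ai] := filter_ex UA; exists i. Qed.

(** The limit is the supremum of the t with t <= r(i) along U; the ultrafilter property decides what
    happens just above it. *)
Lemma ulim_real (r : I -> R) M : (forall i, `|r i| <= M) ->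
  exists l, forall e : R, 0 < e -> U [set i | `|r i - l| <= e].
Proof.
move=> hM; pose T := [set t | U [set i | t <= r i]].
have Tn : T (- M).
  apply: filterS filterT => i _ /=; have := hM i; by rewrite ler_norml => /andP[].
have Tu : ubound T M.
  move=> t /ultra_ex[i /= ti]; apply: le_trans ti _; apply: le_trans (hM i); exact: ler_norm.
have hs : has_sup T by split; [exists (- M)|exists M].
exists (sup T) => e e0.
have [t Tt te] := sup_adherent e0 hs.
have nT : ~ T (sup T + e).
  move=> /(ub_le_sup hs.2); rewrite leNgt => /negP; apply; by rewrite ltrDl.
have [//|U2] := in_ultra_setVsetC [set i | sup T + e <= r i] UU.
apply: filterS (filterI Tt U2) => i /= [ti /negP]; rewrite -ltNge => ri.
by rewrite ler_norml; apply/andP; split; lra.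
Qed.

Lemma ulim_complex (z : I -> C) M : (forall i, cn (z i) <= M) ->
  exists l, forall e : R, 0 < e -> U [set i | cn (z i - l) <= e].
Proof.
move=> hM.
have [|a ha] := @ulim_real (fun i => complex.Re (z i)) M.
  by move=> i; apply: le_trans (hM i); exact: Re_le_cn.
have [|b hb] := @ulim_real (fun i => complex.Im (z i)) M.
  by move=> i; apply: le_trans (hM i); exact: Im_le_cn.
exists (Complex a b) => e e0; have e2 := divr2_gt0 e0.
apply: filterS (filterI (ha _ e2) (hb _ e2)) => i /= [h1 h2].
apply: le_trans (cn_ReIm _) _.
by case: (z i) h1 h2 => x y /= h1 h2; exact: halves.
Qed.

Lemma ulim_uniq (z : I -> C) k l : (forall e : R, 0 < e -> U [set i | cn (z i - k) <= e]) ->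
  (forall e : R, 0 < e -> U [set i | cn (z i - l) <= e]) -> k = l.
Proof.
move=> hk hl; apply/eqP; rewrite -subr_eq0; apply/eqP; apply: cn_small => e e0.
have e2 := divr2_gt0 e0; have [i [/= h1 h2]] := ultra_ex (filterI (hk _ e2) (hl _ e2)).
have := cnD (k - z i) (z i - l); rewrite subrKA => h; apply: le_trans h _.
by rewrite cnB; exact: halves.
Qed.

(** Plays the part of weak-* compactness of balls in the dual. *)
Lemma ulim_functional (V : normedModType C) (phi : I -> V -> C^o) (M : R) :
  (forall i c x y, phi i (c *: x + y) = c * phi i x + phi i y) ->
  (forall i x, cn (phi i x) <= M * nr x) ->
  exists2 f : V -> C^o, dual f &
    forall x (e : R), 0 < e -> U [set i | cn (phi i x - f x) <= e].
Proof.
move=> lphi hM; have [f hf] : exists f : V -> C^o,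
    forall x (e : R), 0 < e -> U [set i | cn (phi i x - f x) <= e].
  have h x := cid (ulim_complex (hM ^~ x)).
  by exists (fun x => projT1 (h x)) => x; exact: (projT2 (h x)).
exists f => //; apply: (dual_intro (M := M)) => [c x y|x]; last first.
  apply/ler_addgt0Pl => e e0; have [i /= hi] := ultra_ex (hf x e e0).
  apply: le_trans (_ : cn (phi i x - f x) + cn (phi i x) <= _); last exact: lerD.
  by rewrite cnB; have := cnD (f x - phi i x) (phi i x); rewrite subrK.
apply: (@ulim_uniq (fun i => phi i (c *: x + y))) => [e e0|e e0]; first exact: hf.
have e2 := divr2_gt0 e0; have k0 : 0 < cn c + 1 by rewrite ltr_wpDl ?cn_ge0.
have e3 : 0 < e / 2 / (cn c + 1) by rewrite divr_gt0.
apply: filterS (filterI (hf x _ e3) (hf y _ e2)) => i /= [h1 h2].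
rewrite lphi (_ : _ - _ = c * (phi i x - f x) + (phi i y - f y)); last by ring.
apply: le_trans (cnD _ _) _; apply: halves => //; rewrite cnM.
apply: le_trans (_ : (cn c + 1) * cn (phi i x - f x) <= _).
  by rewrite ler_wpM2r ?cn_ge0// lerDl.
by rewrite mulrC -ler_pdivlMr.
Qed.
End Ultralimit.

Section FiniteRank.
Context {R : realType}.
Local Notation C := R[i].
Variable K : hilbert R.

Definition fixes (e F : seq K) := forall y, y \in F -> oproj e y = y.

(** Convergence to 0 along the net of finite orthonormal systems, where [fixes e F] says that the
    span of e contains F. The uniform bound M carries it from a total family to all vectors. *)
Lemma net_small (I : Type) (V W : normedModType C) (u : I -> V) (T : seq K -> V -> W) M :
  (forall e, linear (T e)) -> (forall e, onseq e -> bnd (T e) M) -> total_family u ->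
  (forall i r, 0 < r -> exists F, forall e, onseq e -> fixes e F -> nr (T e (u i)) <= r) ->
  forall v r, 0 < r -> exists F, forall e, onseq e -> fixes e F -> nr (T e v) <= r.
Proof.
move=> lT bT tu hu.
have hs (s : seq (C * I)) : forall r, 0 < r ->
    exists F, forall e, onseq e -> fixes e F -> nr (T e (lcomb u s)) <= r.
  elim: s => [|[c i] s IH] r r0.
    by exists [::] => e _ _; rewrite /lcomb big_nil (lin0 (lT e)) nr0 ltW.
  have r2 := divr2_gt0 r0; have k0 : 0 < cn c + 1 by rewrite ltr_wpDl ?cn_ge0.
  have r3 : 0 < r / 2 / (cn c + 1) by rewrite divr_gt0.
  have [F hF] := hu i _ r3; have [F' hF'] := IH _ r2.
  exists (F ++ F') => e oe fe.
  have f1 : fixes e F by move=> y yF; apply: fe; rewrite mem_cat yF.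
  have f2 : fixes e F' by move=> y yF; apply: fe; rewrite mem_cat yF orbT.
  rewrite /lcomb big_cons /= (lT e); apply: le_trans (nrD _ _) _.
  apply: halves; last exact: hF'.
  rewrite nrZ; apply: le_trans (_ : (cn c + 1) * nr (T e (u i)) <= _).
    by rewrite ler_wpM2r ?nr_ge0// lerDl.
  by rewrite mulrC -ler_pdivlMr// hF.
move=> v r r0; have r2 := divr2_gt0 r0.
have k0 : 0 < `|M| + 1 by rewrite ltr_wpDl.
have r3 : 0 < r / 2 / (`|M| + 1) by rewrite divr_gt0.
have [s hsv] := tu v _ r3; have [F hF] := hs s _ r2.
exists F => e oe fe; rewrite -(subrK (lcomb u s) v) (linD (lT e)).
apply: le_trans (nrD _ _) _; apply: halves; last exact: hF.
apply: le_trans (bT e oe _) _.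
apply: le_trans (_ : (`|M| + 1) * nr (v - lcomb u s) <= _).
  by rewrite ler_wpM2r ?nr_ge0//; apply: le_trans (ler_norm _) _; rewrite lerDl.
by rewrite mulrC -ler_pdivlMr.
Qed.

Variables (H : hilbert R) (T : htensor H K).
Implicit Types (e F : seq K) (v : T).

(** This is id (x) [oproj e], written slot by slot so that it is a finite sum of slices on every
    vector. *)
Definition tproj e v : T := \sum_(z <- e) tens T (gadj (tensr T z) v) z.
Definition tres e v : T := v - tproj e v.

Lemma slot_tens z x y : gadj (tensr T z) (tens T x y) = ip y z *: x.
Proof.
apply: ip_ext => x'; rewrite -(gadjEr _ _ (tensr_bop T z)) /tensr tens_ip ipZl.
by rewrite mulrC.
Qed.
Lemma slot_bop z : bounded_op (gadj (tensr T z)).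
Proof. by apply: gadj_bop; exact: tensr_bop. Qed.
Lemma tproj_cons z e v : tproj (z :: e) v = tens T (gadj (tensr T z) v) z + tproj e v.
Proof. by rewrite /tproj big_cons. Qed.
Lemma tproj_bop e : bounded_op (tproj e).
Proof.
elim: e => [|z e IH].
  have -> : tproj [::] = fun=> 0 by apply/funext => v; rewrite /tproj big_nil.
  exact: bop0.
have := bop_comb 1 (bop_comp (tensr_bop T z) (slot_bop z)) IH.
congr bounded_op; apply/funext => v; by rewrite tproj_cons scale1r.
Qed.
Lemma tproj_tens e x y : tproj e (tens T x y) = tens T x (oproj e y).
Proof.
rewrite /tproj /oproj tens_sumr; apply: eq_bigr => z _.
by rewrite slot_tens tensZl tensZr.
Qed.
Lemma tproj_ip e v w : ip (tproj e v) w = ip v (tproj e w).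
Proof.
rewrite /tproj ip_suml ip_sumr; apply: eq_bigr => z _.
rewrite -[tens T _ z]/(tensr T z _) (gadjE _ _ (tensr_bop T z)).
by rewrite -[tens T _ z]/(tensr T z _) (gadjEr _ _ (tensr_bop T z)).
Qed.
Lemma tproj_fix e e' v : fixes e' e -> tproj e' (tproj e v) = tproj e v.
Proof.
move=> h; rewrite {2 3}/tproj (lin_sum (bop_lin (tproj_bop e'))) !big_seq.
by apply: eq_bigr => z ze; rewrite tproj_tens h.
Qed.
Lemma onseq_fix e : onseq e -> fixes e e.
Proof. by move=> oe y; exact: oproj_mem. Qed.
Lemma tres_bop e : bounded_op (tres e).
Proof.
have := bop_comb (-1) (tproj_bop e) (bop_id T); congr bounded_op; apply/funext => v.
by rewrite scaleN1r addrC.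
Qed.
Lemma tres_ip e v : onseq e -> ip (tres e v) v = (nr (tres e v) ^+ 2)%:C.
Proof.
move=> oe; rewrite -ipxx [X in _ = ip _ X]/tres ipBr.
have -> : ip (tres e v) (tproj e v) = 0; last by rewrite subr0.
by rewrite /tres ipBl (tproj_ip e v (tproj e v)) tproj_fix ?subrr//; exact: onseq_fix.
Qed.
Lemma tres_bnd e : onseq e -> bnd (tres e) 1.
Proof.
move=> oe v; rewrite mul1r.
have [h|h] := eqVneq (nr (tres e v)) 0; first by rewrite h nr_ge0.
have p0 : 0 < nr (tres e v) by rewrite lt_neqAle eq_sym h nr_ge0.
rewrite -(ler_pM2l p0) -expr2; have := Re_CS (tres e v) v.
by rewrite tres_ip.
Qed.
Lemma tres_le e e' v : onseq e' -> fixes e' e -> nr (tres e' v) <= nr (tres e v).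
Proof.
move=> oe' h; have -> : tres e' v = tres e' (tres e v).
  by rewrite /tres (linB (bop_lin (tproj_bop e'))) (tproj_fix _ h) opprB subrKA.
by apply: le_trans (tres_bnd oe' _) _; rewrite mul1r.
Qed.
Lemma tres_small v r : 0 < r ->
  exists F, forall e, onseq e -> fixes e F -> nr (tres e v) <= r.
Proof.
apply: (net_small (M := 1) (fun e => bop_lin (tres_bop e)) tres_bnd (@tens_total _ _ _ T)) => -[x y] {}r r0.
exists [:: y] => e oe h; rewrite /tres /tfam /= tproj_tens h ?mem_head//.
by rewrite subrr nr0 ltW.
Qed.
End FiniteRank.

Section Dini.
Context {R : realType}.
Local Notation C := R[i].
Variables (A : cstar R) (u : univ_rep A) (K : hilbert R) (T : htensor (usp u) K).
Variable Y : usp u -> T.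
Hypotheses (bY : bounded_op Y) (hY : range (urep u) (gadj Y \o Y))
  (hz : forall z, range (urep u) (gadj (tensr T z) \o Y)).

(** Y^* (1 - [tproj e]) Y is Y^* Y minus finitely many c^* c, where each c is a slot of Y and
    therefore lies in A. *)
Lemma tres_elt e : exists a, forall x y, ip (urep u a x) y = ip (tres e (Y x)) (Y y).
Proof.
elim: e => [|z e [b hb]].
  have [a _ ha] := hY; exists a => x y.
  by rewrite ha compx -(gadjEr _ _ bY) /tres /tproj big_nil subr0.
have [c _ hc] := hz z; exists (b - cmul (cinv c) c) => x y.
rewrite (shB (urep_sh u)) ipBl hb (sh_mul (urep_sh u)) (sh_ip (urep_sh u)) cinvK.
rewrite hc !compx -(gadjE _ _ (tensr_bop T z)) /tres tproj_cons !ipBl ipDl /tensr.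
by rewrite opprD addrA addrAC.
Qed.

Let rY e x := tres e (Y x).
Lemma rY_bop e : bounded_op (rY e).
Proof. exact: bop_comp (tres_bop T e) bY. Qed.

(* Otherwise there are unit vectors on which all the residuals stay large; an
   ultralimit of their vector states is a functional on A, hence normal on A**,
   while the residuals decrease strongly to 0. *)
Lemma dini r : 0 < r ->
  exists2 e, onseq e & bnd (fun x => Y x - tproj e (Y x)) r.
Proof.
move=> r0; apply: contrapT => no; have [M M0 hM] := bop_bnd bY.
have rYb e : onseq e -> bnd (rY e) M.
  by move=> oe x; apply: le_trans (tres_bnd oe (Y x)) _; rewrite mul1r.
have bad e : exists x, onseq e -> nr x = 1 /\ r < nr (rY e x).
  have [oe|noe] := pselect (onseq e); last by exists 0.
  have [x hx] : exists x, ~ (nr (rY e x) <= r * nr x).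
    by apply: contrapT => h; apply: no; exists e => // x; apply: contrapT => hx; apply: h; exists x.
  move/negP: hx; rewrite -ltNge => hx.
  have x0 : 0 < nr x.
    rewrite lt_neqAle nr_ge0 andbT eq_sym; apply/eqP => h; move: hx.
    by rewrite (nr_eq0 h) (lin0 (bop_lin (rY_bop e))) !nr0 mulr0 ltxx.
  exists ((nr x)^-1%:C *: x) => _; rewrite (linZ (bop_lin (rY_bop e))) !nrZ.
  have i0 : 0 <= (nr x)^-1 by rewrite invr_ge0 nr_ge0.
  by rewrite (cn_ge0r i0) mulVf ?gt_eqF// mulrC ltr_pdivlMr.
have /choice[g hg] (F : seq K) : exists e, onseq e /\ fixes e F.
  by have [e oe h] := gram_schmidt F; exists e.
have /choice[h hh] := bad.
(* Tails of the finite sets ordered by inclusion; an ultrafilter containing them makes the systems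
   grow. *)
pose B (s : seq K) : set (seq K) := [set F : seq K | {subset s <= F}].
have PF : ProperFilter (filter_from setT B).
  apply: filter_from_proper => [|s _]; last by exists s.
  apply: filter_from_filter => [|s t _ _]; first by exists [::].
  exists (s ++ t) => // F sF; split => y ys; apply: sF; rewrite mem_cat ys ?orbT//.
have [U [UU BU]] := ultraFilterLemma PF.
pose phi (F : seq K) (c : A) : C^o := ip (urep u c (h (g F))) (h (g F)).
have [|i c|f df hf] := @ulim_functional _ _ _ UU A phi 1.
- by move=> i c x y; rewrite /phi (sh_lin (urep_sh u)) ipDl ipZl.
- have [og _] := hg i; have [n1 _] := hh _ og.
  rewrite mul1r /phi; apply: le_trans (CS _ _) _; rewrite n1 mulr1.
  by apply: le_trans (sh_contr (urep_sh u) _ _) _; rewrite n1 mulr1.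
have [w pw_ hw] := urep_univ u df; have [xi [eta ew]] := predualP pw_.
have bl : 0 < M * nr eta + 1 by rewrite ltr_wpDl// mulr_ge0 ?nr_ge0.
have r4 : 0 < r ^+ 2 / 2 by rewrite divr2_gt0// exprn_gt0.
have r5 : 0 < r ^+ 2 / 2 / (M * nr eta + 1) by rewrite divr_gt0.
(* The residuals tend strongly to 0 on the amplified space as well, so they are small at the one
   vector xi that represents the limit functional. *)
have [|||F hF] := @net_small R K _ _ _ _ (fun e => l2map (rY e)) M _ _
    (@single_total _ (usp u)) _ xi _ r5.
- by move=> e; exact: l2map_lin (rY_bop e).
- by move=> e oe; apply: l2map_bnd => //; [exact: rY_bop|exact: rYb].
- move=> [n x] s s0; have [F hF] := tres_small (Y x) s0.
  by exists F => e oe fe; rewrite /= l2map_single ?nr_single; [exact: hF|exact: rY_bop].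
have [oe fe] := hg F; set e := g F in oe fe.
have [a ha] := tres_elt e.
have fa : cn (f a) <= r ^+ 2 / 2.
  rewrite hw ew (pair_opE _ _ (urep_bop u a)).
  have -> : ip (l2map (urep u a) xi) eta = ip (l2map (rY e) xi) (l2map Y eta).
    apply: l2_ip_ext => n; rewrite (l2mapE (urep_bop u a)) (l2mapE (rY_bop e)) (l2mapE bY).
    exact: ha.
  apply: le_trans (CS _ _) _.
  apply: le_trans (_ : nr (l2map (rY e) xi) * (M * nr eta + 1) <= _).
    rewrite ler_wpM2l ?nr_ge0//; apply: le_trans (l2map_bnd bY M0 hM _) _.
    by rewrite lerDl.
  by rewrite -ler_pdivlMr//; exact: hF.
(* For G beyond e in the net, the residual of e dominates that of [g G], so the vector state at G
   takes a value above r^2 on a. But its limit is at most r^2 / 2 there and is approached within r^2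
   / 2. *)
have UB : U (B e) by apply: BU; exists e.
have [G [/= sG hG]] := ultra_ex UU (filterI UB (hf a _ r4)).
have [oG fG] := hg G; have [_ rG] := hh _ oG.
have k1 : nr (rY (g G) (h (g G))) <= nr (rY e (h (g G))).
  by apply: tres_le => // y ye; apply: fG; exact: sG.
have : r ^+ 2 < cn (phi G a).
  rewrite /phi ha tres_ip// cn_ge0r ?sqr_ge0// ltrXn2r ?nnegrE ?nr_ge0 ?(ltW r0)//.
  exact: lt_le_trans rG k1.
rewrite ltNge => /negP; apply.
have := cnD (phi G a - f a) (f a); rewrite subrK => k2; apply: le_trans k2 _.
exact: halves.
Qed.
End Dini.

Section OpClosure.
Context {R : realType}.
Local Notation C := R[i].
Variable H : hilbert R.
Implicit Types (D G : set (H -> H)) (S T : H -> H).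

Lemma lspan_ind G (P : (H -> H) -> Prop) : P (fun=> 0) ->
  (forall c S T, G S -> P T -> P (fun x => c *: S x + T x)) ->
  forall S, op_lspan G S -> P S.
Proof.
move=> P0 Pl _ [n [c [T [GT ->]]]]; elim: n c T GT => [|n IH] c T GT.
  by rewrite (_ : (fun x => _) = fun=> 0)//; apply/funext => x; rewrite big_ord0.
rewrite (_ : (fun x => _) = fun x => c ord0 *: T ord0 x + \sum_(k < n) c (lift ord0 k) *: T (lift ord0 k) x).
  apply: Pl => //; exact: (IH (fun k => c (lift ord0 k)) (fun k => T (lift ord0 k))).
by apply/funext => x; rewrite big_ord_recl.
Qed.
Lemma lspan0 G : op_lspan G (fun=> 0).
Proof.
exists 0%N, (fun=> 0), (fun=> fun=> 0); split => [[]//|].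
by apply/funext => x; rewrite big_ord0.
Qed.
Lemma lspan_cons G c S T : G S -> op_lspan G T -> op_lspan G (fun x => c *: S x + T x).
Proof.
move=> GS [n [d [Z [GZ ->]]]].
exists n.+1, (fun k => if unlift ord0 k is Some k' then d k' else c),
  (fun k => if unlift ord0 k is Some k' then Z k' else S).
split=> [k|]; first by case: unliftP => [k' _|_] //; exact: GZ.
apply/funext => x; rewrite big_ord_recl unlift_none; congr (_ + _).
by apply: eq_bigr => k _; rewrite liftK.
Qed.
Lemma lspan_comb G c S T : op_lspan G S -> op_lspan G T ->
  op_lspan G (fun x => c *: S x + T x).
Proof.
move=> hS hT; move: S hS c; apply: lspan_ind => [c|d Z S' GZ IH c].
  by rewrite (_ : (fun x => _) = T)//; apply/funext => x; rewrite scaler0 add0r.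
rewrite (_ : (fun x => _) = fun x => (c * d) *: Z x + (c *: S' x + T x)).
  by apply: lspan_cons => //; exact: IH.
by apply/funext => x; rewrite scalerDr scalerA addrA.
Qed.
Lemma lspan_in G S : G S -> op_lspan G S.
Proof.
move=> GS; have := lspan_cons 1 GS (lspan0 G); congr op_lspan; apply/funext => x.
by rewrite scale1r addr0.
Qed.
Lemma lspan_bop G S : G `<=` bounded_op (V := H) (W := H) -> op_lspan G S -> bounded_op S.
Proof.
move=> bG; apply: lspan_ind => [|c Z T /bG bZ bT]; first exact: bop0.
exact: bop_comb.
Qed.
Lemma lspan_adj G S : G `<=` bounded_op (V := H) (W := H) ->
  (forall T, G T -> G (adj T)) -> op_lspan G S -> op_lspan G (adj S).
Proof.
move=> bG aG hS; suff [] : bounded_op S /\ op_lspan G (adj S) by [].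
move: S hS; apply: lspan_ind => [|c Z T GZ [bT hT]].
  split; first exact: bop0.
  rewrite (_ : adj _ = fun=> 0); first exact: lspan0.
  by apply: adj_uniq => [|x y]; [exact: bop0|rewrite ip0l ip0r].
split; first by apply: bop_comb => //; exact: bG.
by rewrite adj_comb//; [apply: lspan_cons => //; exact: aG|exact: bG].
Qed.

Lemma clos_in D S : bounded_op S -> D S -> op_closure D S.
Proof.
move=> bS DS; apply/op_closure_bnd; split => // r r0; exists S => // x.
by rewrite subrr nr0 mulr_ge0 ?nr_ge0 ?ltW.
Qed.
Lemma clos_comb D c S T : (forall c S T, D S -> D T -> D (fun x => c *: S x + T x)) ->
  op_closure D S -> op_closure D T -> op_closure D (fun x => c *: S x + T x).
Proof.
move=> Dl /op_closure_bnd[bS hS] /op_closure_bnd[bT hT].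
apply/op_closure_bnd; split; first exact: bop_comb.
move=> r r0; have r2 := divr2_gt0 r0.
have k0 : 0 < cn c + 1 by rewrite ltr_wpDl ?cn_ge0.
have r3 : 0 < r / 2 / (cn c + 1) by rewrite divr_gt0.
have [S' DS' h1] := hS _ r3; have [T' DT' h2] := hT _ r2.
exists (fun x => c *: S' x + T' x); first exact: Dl.
move=> x; rewrite opprD addrACA -scalerBr; apply: le_trans (nrD _ _) _.
rewrite (splitr r) mulrDl; apply: lerD => //; rewrite nrZ.
apply: le_trans (_ : (cn c + 1) * (r / 2 / (cn c + 1) * nr x) <= _); last first.
  by rewrite mulrA mulrCA divff ?mulr1// gt_eqF.
apply: le_trans (_ : (cn c + 1) * nr (S x - S' x) <= _).
  by rewrite ler_wpM2r ?nr_ge0// lerDl.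
by rewrite ler_wpM2l// ltW.
Qed.
Lemma clos_clos D S : op_closure (op_closure D) S -> op_closure D S.
Proof.
move=> /op_closure_bnd[bS hS]; apply/op_closure_bnd; split => // r r0.
have r2 := divr2_gt0 r0; have [T /op_closure_bnd[_ hT] h1] := hS _ r2.
have [Z DZ h2] := hT _ r2; exists Z => // x.
apply: le_trans (nr_triang _ (T x) _) _.
by rewrite (splitr r) mulrDl; exact: lerD.
Qed.
Lemma clos_adj D S : D `<=` bounded_op (V := H) (W := H) ->
  (forall T, D T -> D (adj T)) -> op_closure D S -> op_closure D (adj S).
Proof.
move=> bD aD /op_closure_bnd[bS hS]; apply/op_closure_bnd; split; first exact: adj_bop.
move=> r r0; have [T DT h] := hS _ r0; exists (adj T); first exact: aD.
have bT := bD _ DT; have bTS := bop_comb (-1) bT bS.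
have := @gadj_bnd _ _ _ _ r bTS (ltW r0); rewrite -adj_gadj (adj_comb _ bT bS).
move=> h2 x; have := h2 _ x; rewrite conjCN1 scaleN1r addrC; apply=> y.
by rewrite scaleN1r addrC.
Qed.
End OpClosure.

Section MinTens.
Context {R : realType} (tp : tensor_products R).
Local Notation C := R[i].
Variables (A : cstar R) (u : univ_rep A) (K : hilbert R).
Notation H := (usp u).
Notation T := (tp H K).
Notation gens := (tens_ops (tp := tp) (range (urep u)) (@compact_op R K)).
Notation Min := (min_tens (tp := tp) (range (urep u)) (@compact_op R K)).

Definition rank1 (x y : K) : K -> K := fun k => ip k x *: y.
Lemma rank1_bop x y : bounded_op (rank1 x y).
Proof.
apply: (@bnd_op _ _ _ _ (nr x * nr y)) => [c a b|z]; rewrite /rank1.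
  by rewrite ip_linear scalerDl scalerA.
by rewrite nrZ mulrAC ler_wpM2r ?nr_ge0// mulrC CS.
Qed.
Lemma rank1_adj x y : adj (rank1 x y) = rank1 y x.
Proof.
apply: adj_uniq => [|a b]; first exact: rank1_bop.
by rewrite /rank1 ipZl ipZr -ip_conj mulrC.
Qed.

Lemma compact_bop : @compact_op R K `<=` bounded_op (V := K) (W := K).
Proof. by move=> S []. Qed.
Lemma rank1_compact x y : compact_op (rank1 x y).
Proof.
apply: clos_in; first exact: rank1_bop.
by apply: lspan_in; exists x, y.
Qed.
Lemma compact_adj S : @compact_op R K S -> compact_op (adj S).
Proof.
have b1 : [set S | exists a b : K, S = fun x => ip x a *: b] `<=` bounded_op (V := K) (W := K).
  by move=> _ [a [b ->]]; exact: rank1_bop.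
apply: clos_adj => Z; first exact: lspan_bop.
by apply: lspan_adj => // _ [a [b ->]]; exists b, a; exact: rank1_adj.
Qed.

Lemma gens_bop : gens `<=` bounded_op (V := T) (W := T).
Proof.
move=> _ [_ [a _ <-] [k /compact_bop bk ->]].
by apply: gtens_bop => //; exact: urep_bop.
Qed.
Lemma min_bop : Min `<=` bounded_op (V := T) (W := T).
Proof. by move=> S []. Qed.
Lemma min_comb c S Z : Min S -> Min Z -> Min (fun x => c *: S x + Z x).
Proof. by apply: clos_comb => {}c {}S {}Z; exact: lspan_comb. Qed.
Lemma min0 : Min (fun=> 0).
Proof. by apply: clos_in; [exact: bop0|exact: lspan0]. Qed.
Lemma min_adj S : Min S -> Min (adj S).
Proof.
apply: clos_adj => Z; first by apply: lspan_bop; exact: gens_bop.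
apply: lspan_adj; first exact: gens_bop.
move=> _ [_ [a _ <-] [k ck ->]]; have bk := compact_bop ck.
exists (urep u (cinv a)); first by exists (cinv a).
exists (adj k); first exact: compact_adj.
rewrite (sh_inv (urep_sh u)); exact: (gtens_adj tp (urep_bop u a) bk).
Qed.

Variable X : T -> T.
Hypotheses (bX : bounded_op X) (iX : forall v w, ip (X v) (X w) = ip v w)
  (hX : forall y z a, range (urep u) (rslice (vec_fun y z) X \o urep u a)).

(** The operator factors through Y = X (. (x) y) a. As X is isometric, Y^* Y is a multiple of a^* a,
    and the slots of Y are slices of X times a; so [dini] approximates Y uniformly by [tproj e] Y,
    which yields finite sums of b (x) rank one. *)
Lemma slice_rank1 a x y : Min (X \o gtens (tp := tp) (urep u a) (rank1 x y)).
Proof.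
have ba := urep_bop u a; have b1 := rank1_bop x y.
pose Y := X \o tensr T y \o urep u a.
have bY : bounded_op Y by apply: bop_comp => //; apply: bop_comp => //; exact: tensr_bop.
have bs := slot_bop T.
have e1 : X \o gtens (tp := tp) (urep u a) (rank1 x y) = Y \o gadj (tensr T x).
  apply: tens_ext => [||xi k]; first by apply: bop_comp => //; exact: gtens_bop.
    by apply: bop_comp.
  rewrite !compx (gtensE tp ba b1) slot_tens /rank1 /Y !compx tensZr.
  by rewrite (linZ (bop_lin bX)) (linZ (bop_lin ba)) /tensr tensZl (linZ (bop_lin bX)).
have hz z : gadj (tensr T z) \o Y = rslice (vec_fun y z) X \o urep u a.
  apply/funext => xi; apply: ip_ext => t; rewrite /Y !compx (rslice_vec bX).
  by rewrite -(gadjEr _ _ (tensr_bop T z)).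
have hzr z : range (urep u) (gadj (tensr T z) \o Y) by rewrite hz.
have hY : range (urep u) (gadj Y \o Y).
  exists ((nr y ^+ 2)%:C *: cmul (cinv a) a) => //; apply/funext => xi.
  apply: ip_ext => t; rewrite compx -(gadjEr _ _ bY) /Y !compx iX /tensr tens_ip ipxx.
  rewrite (shZ (urep_sh u)) ipZl (sh_mul (urep_sh u)) (sh_ip (urep_sh u)) cinvK.
  by rewrite mulrC.
apply/op_closure_bnd; split; first by apply: bop_comp => //; exact: gtens_bop.
move=> r r0; have k0 : 0 < nr x + 1 by rewrite ltr_wpDl ?nr_ge0.
have r2 : 0 < r / (nr x + 1) by rewrite divr_gt0.
have [e _ he] := dini bY hY hzr r2.
exists (tproj e \o Y \o gadj (tensr T x)); last first.
  move=> v; rewrite e1 !compx; apply: le_trans (he _) _.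
  have hs : bnd (gadj (tensr T x)) (nr x).
    by apply: gadj_bnd; [exact: tensr_bop|exact: nr_ge0|exact: tensr_bnd].
  rewrite -mulrA ler_wpM2l ?(ltW r0)// mulrC ler_pdivrMr//.
  apply: le_trans (hs _) _; rewrite mulrC ler_wpM2l ?nr_ge0// lerDl//.
elim: e {he} => [|z e IH].
  rewrite (_ : _ \o _ = fun=> 0); first exact: lspan0.
  by apply/funext => v; rewrite !compx /tproj big_nil.
have [b _ hb] := hzr z.
have G1 : gens (gtens (urep u b) (rank1 x z)).
  exists (urep u b); first by exists b.
  by exists (rank1 x z); first exact: rank1_compact.
have := lspan_cons 1 G1 IH; congr op_lspan; apply/funext => v.
rewrite !compx tproj_cons scale1r; congr (_ + _).
have bb := urep_bop u b; have b2 := rank1_bop x z.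
have : gtens (urep u b) (rank1 x z) = tensr T z \o urep u b \o gadj (tensr T x).
  apply: tens_ext => [||xi k]; first exact: gtens_bop.
    by apply: bop_comp => //; apply: bop_comp => //; exact: tensr_bop.
  rewrite !compx (gtensE tp bb b2) slot_tens /rank1 tensZr.
  by rewrite (linZ (bop_lin bb)) /tensr tensZl.
by move=> ->; rewrite !compx hb.
Qed.

Lemma min_mull S : Min S -> Min (X \o S).
Proof.
have [M M0 hM] := bop_bnd bX.
have clos S' : bounded_op S' -> (forall r : R, 0 < r -> exists2 Z, Min (X \o Z) & bnd (fun x => S' x - Z x) r) ->
    Min (X \o S').
  move=> bS' h; apply: clos_clos; apply/op_closure_bnd; split; first exact: bop_comp.
  move=> r r0; have k0 : 0 < M + 1 by rewrite ltr_wpDl.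
  have r2 : 0 < r / (M + 1) by rewrite divr_gt0.
  have [Z mZ hZ] := h _ r2; exists (X \o Z) => // v.
  rewrite !compx -(linB (bop_lin bX)); apply: le_trans (hM _) _.
  apply: le_trans (_ : (M + 1) * (r / (M + 1) * nr v) <= _); last first.
    by rewrite mulrA mulrCA divff ?mulr1// gt_eqF.
  apply: ler_pM => //; [exact: nr_ge0|by rewrite lerDl].
have comb c S1 S2 : Min (X \o S1) -> Min (X \o S2) -> Min (X \o (fun x => c *: S1 x + S2 x)).
  move=> h1 h2; have := min_comb c h1 h2; congr min_tens; apply/funext => x.
  by rewrite !compx (bop_lin bX).
have zero : Min (X \o (fun=> 0)).
  rewrite (_ : _ \o _ = fun=> 0); first exact: min0.
  by apply/funext => x; rewrite compx (lin0 (bop_lin bX)).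
have gen a k : compact_op k -> Min (X \o gtens (tp := tp) (urep u a) k).
  have ba := urep_bop u a.
  move=> /op_closure_bnd[bk hk].
  have lin (k' : K -> K) : op_lspan [set S | exists a b : K, S = fun x => ip x a *: b] k' ->
      bounded_op k' /\ Min (X \o gtens (tp := tp) (urep u a) k').
    move: k'; apply: lspan_ind => [|c Z k' [x [y ->]] [bk' hk']].
      split; first exact: bop0.
      rewrite (_ : gtens _ _ = fun=> 0)//; apply: (gtens_uniq ba (bop0 _ _) (bop0 _ _)) => x y.
      by rewrite tens0r.
    have b1 := rank1_bop x y; split; first exact: bop_comb.
    have := comb c _ _ (slice_rank1 a x y) hk'; congr min_tens; congr (_ \o _).
    symmetry; apply: (gtens_uniq ba (bop_comb c b1 bk') (bop_comb c (gtens_bop tp ba b1)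
      (gtens_bop tp ba bk'))) => v w.
    by rewrite (gtensE tp ba b1) (gtensE tp ba bk') tens_linr.
  apply: clos => [|r r0]; first exact: gtens_bop.
  have [N N0 hN] := bop_bnd ba; have k0 : 0 < N + 1 by rewrite ltr_wpDl.
  have r2 : 0 < r / (N + 1) by rewrite divr_gt0.
  have [k' sk' hk'] := hk _ r2; have [bk' mk] := lin _ sk'.
  exists (gtens (urep u a) k') => // v.
  have -> : gtens (tp := tp) (urep u a) k v - gtens (urep u a) k' v =
      gtens (tp := tp) (urep u a) (fun x => k x - k' x) v.
    have b3 := bop_comb (-1) bk' bk.
    have -> : (fun x => k x - k' x) = (fun x => -1 *: k' x + k x).
      by apply/funext => x; rewrite scaleN1r addrC.
    have -> : gtens (tp := tp) (urep u a) (fun x => -1 *: k' x + k x) =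
        (fun v => -1 *: gtens (urep u a) k' v + gtens (urep u a) k v).
      apply: (gtens_uniq ba b3 (bop_comb (-1) (gtens_bop tp ba bk') (gtens_bop tp ba bk))) => x y.
      by rewrite (gtensE tp ba bk) (gtensE tp ba bk') tens_linr.
    by rewrite scaleN1r addrC.
  have bd : bounded_op (fun x => k x - k' x).
    by have := bop_comb (-1) bk' bk; congr bounded_op; apply/funext => x; rewrite scaleN1r addrC.
  apply: le_trans (gtens_bnd ba bd N0 (ltW r2) hN hk' v) _.
  rewrite ler_wpM2r ?nr_ge0// mulrAC ler_pdivrMr// ler_wpM2l ?(ltW r0)// lerDl//.
move=> /op_closure_bnd[bS hS]; apply: clos => // r r0.
have [Z sZ hZ] := hS _ r0; exists Z => //; move: Z sZ {hZ}; apply: lspan_ind => // c Z W.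
by move=> [_ [a _ <-] [k ck ->]] mW; apply: comb => //; exact: gen.
Qed.
End MinTens.

Section MinIdeal.
Context {R : realType} (tp : tensor_products R).
Variables (A : cstar R) (u : univ_rep A) (K : hilbert R).
Notation T := (tp (usp u) K).

(** Multiplication from the right is reduced to multiplication from the left by taking adjoints: the
    adjoint of X satisfies the same assumptions. *)
Lemma unitary_idealizer (X : T -> T) : unitary_op X ->
  (forall y z a, range (urep u) (rslice (vec_fun y z) X \o urep u a)) ->
  (forall y z a, range (urep u) (urep u a \o rslice (vec_fun y z) X)) ->
  idealizer (min_tens (tp := tp) (range (urep u)) (@compact_op R K)) X.
Proof.
move=> [bX X1 X2] h1 h2; have bX' := adj_bop bX; split => // S mS; have bS := min_bop mS.
have iX v w : ip (X v) (X w) = ip v w.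
  by rewrite (adjE _ _ bX); have := congr1 (fun f => f w) X1; rewrite compx => ->.
have iX' v w : ip (adj X v) (adj X w) = ip v w.
  by rewrite -(adjE _ _ bX); have := congr1 (fun f => f v) X2; rewrite compx => ->.
split; first exact: min_mull.
have h3 y z a : range (urep u) (rslice (vec_fun y z) (adj X) \o urep u a).
  have [b _ hb] := h2 z y (cinv a); exists (cinv b) => //.
  have br : bounded_op (rslice (vec_fun z y) X) by apply: rslice_bop => //; exact: vec_predual.
  rewrite (sh_inv (urep_sh u)) hb (adj_comp (urep_bop u _) br) -(sh_inv (urep_sh u)) cinvK.
  by rewrite (rslice_adj bX (vec_predual z y)).
have := min_adj (min_mull bX' iX' h3 (min_adj mS)).
by rewrite (adj_comp bX' (adj_bop bS)) (adjK bS) (adjK bX).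
Qed.
End MinIdeal.

(** * Corepresentations and embedded algebras *)

Section AmplifySpec.
Context {R : realType} (tp : tensor_products R) (H L K : hilbert R).
Variables (f : (H -> H) -> L -> L) (X : tp H K -> tp H K).

(** The condition under the choice in [amplify], isolated because [amplify] returns 0 when no
    solution exists: an equation such as [corep_eq] does not by itself provide one. *)
Definition amplifies (Y : tp L K -> tp L K) : Prop :=
  bounded_op Y /\ forall w, predual w -> rslice w Y = f (rslice w X).

Lemma amplify_ok Y : amplifies Y -> amplify f X = Y.
Proof.
move=> hY; rewrite /amplify; case: xgetP => [Z _ hZ|/(_ _ hY)//].
case: hY hZ => bY hY [bZ hZ]; apply: (rslice_inj bZ bY) => w pw_.
by rewrite (hZ _ pw_) (hY _ pw_).
Qed.
Lemma amplify_none : (forall Y, ~ amplifies Y) -> amplify f X = (fun=> 0) :> (tp L K -> tp L K).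
Proof. by move=> no; rewrite /amplify; case: xgetP => [Z _ hZ|//]; case: (no Z). Qed.
End AmplifySpec.

Section TriExt.
Context {R : realType} (tp : tensor_products R) (H K : hilbert R).
Notation T3 := (tp (tp H H) K).
Lemma tri_opext (X Y : T3 -> T3) : bounded_op X -> bounded_op Y ->
  (forall x1 x2 y x1' x2' y',
    ip (X (tens T3 (tens (tp H H) x1 x2) y)) (tens T3 (tens (tp H H) x1' x2') y') =
    ip (Y (tens T3 (tens (tp H H) x1 x2) y)) (tens T3 (tens (tp H H) x1' x2') y')) -> X = Y.
Proof.
move=> bX bY h; apply: (total_ext (@tri_total _ tp H K) bX bY) => -[[x1 x2] y].
by apply: (total_ip (@tri_total _ tp H K)) => -[[x1' x2'] y']; exact: h.
Qed.
End TriExt.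

Section CorepCompress.
Context {R : realType} (tp : tensor_products R) (G : lcqg tp) (X : universal G).
Notation L := (usp (uuniv X)).
Notation N := (normal_ext (uuniv X) (uDelta X)).
Variables (K K' : hilbert R) (j : K' -> K) (U : tp L K -> tp L K).
Hypotheses (bj : bounded_op j) (bU : bounded_op U).
Notation q := (j \o gadj j).
Hypothesis qU : forall v, gtens (tp := tp) (@id L) q (U v) = U v.
Notation J3 := (gtens (tp := tp) (@id (tp L L)) j).
Notation Up := (compress (tp := tp) (@id L) j U).

Lemma q_bop : bounded_op q. Proof. exact: bop_comp bj (gadj_bop bj). Qed.
Lemma compress_id_slice (H : hilbert R) (Z : tp H K -> tp H K) xi eta : bounded_op Z ->
  rslice (pw xi eta) (compress (tp := tp) (@id H) j Z) = rslice (pw (l2map j xi) (l2map j eta)) Z.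
Proof.
move=> bZ; rewrite (compress_rslice (bop_id H) bj bZ).
by rewrite -[gadj id]/(adj id) adj_id; apply/funext.
Qed.
Lemma compress_id_bop : bounded_op Up.
Proof. by apply: compress_bop; first exact: bop_id. Qed.
Lemma compress_leg13 : leg13 Up = compress (tp := tp) id j (leg13 U).
Proof.
have [b1 f1 _] := leg13_spec compress_id_bop; have [b2 f2 _] := leg13_spec bU.
have h : bounded_op (compress (tp := tp) (@id (tp L L)) j (leg13 U)).
  by apply: compress_bop; first exact: bop_id.
apply: (tri_opext b1 h).
move=> x1 x2 y x1' x2' y'.
by rewrite f1 (compress_ip (bop_id L) bj) (compress_ip (bop_id _) bj) f2.
Qed.
Lemma compress_leg23 : leg23 Up = compress (tp := tp) id j (leg23 U).
Proof.
have [b1 f1 _] := leg23_spec compress_id_bop; have [b2 f2 _] := leg23_spec bU.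
have h : bounded_op (compress (tp := tp) (@id (tp L L)) j (leg23 U)).
  by apply: compress_bop; first exact: bop_id.
apply: (tri_opext b1 h).
move=> x1 x2 y x1' x2' y'.
by rewrite f1 (compress_ip (bop_id L) bj) (compress_ip (bop_id _) bj) f2.
Qed.
(** The range of U is fixed by 1 (x) q, so q may be inserted between the two legs; this makes the
    product of the compressed legs the compression of the product. *)
Lemma absorb_leg23 : gtens (tp := tp) id q \o leg23 U = leg23 U.
Proof.
have [b2 f2 _] := leg23_spec bU; have bq := q_bop.
have bg (H : hilbert R) := gtens_bop tp (bop_id H) bq.
have ag (H : hilbert R) : gadj (gtens (tp := tp) (@id H) q) = gtens id q.
  rewrite (gtens_adj tp (bop_id H) bq); congr gtens; first exact: adj_id.
  by rewrite (gadj_comp bj (gadj_bop bj)) (gadjK bj).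
apply: (tri_opext (bop_comp (bg _) b2) b2) => x1 x2 y x1' x2' y'.
rewrite compx (gadjE _ _ (bg _)) ag (gtensE tp (bop_id _) bq) !f2.
by rewrite -(gtensE tp (bop_id L) bq) -{1}[gtens id q]ag -(gadjE _ _ (bg _)) qU.
Qed.

(* If U has no amplification, [amplify] returns 0, so the legs of the compression are
   isometries with product 0 and the space they act on is trivial. *)
Lemma corep_compress : gadj Up \o Up = id -> corep_eq U -> corep_eq Up.
Proof.
move=> isoU cU; have [b13 _ i13] := leg13_spec compress_id_bop; have [b23 _ i23] := leg23_spec compress_id_bop.
have [c13 _ _] := leg13_spec bU; have [c23 _ _] := leg23_spec bU.
have legs : leg13 Up \o leg23 Up = compress (tp := tp) id j (leg13 U \o leg23 U).
  rewrite compress_leg13 compress_leg23 /compress; apply/funext => v; rewrite !compx.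
  have bJ : bounded_op J3 := gtens_bop tp (bop_id _) bj.
  have -> (w : tp (tp L L) K) : J3 (gadj J3 w) = gtens (tp := tp) id q w.
    rewrite (gtens_adj tp (bop_id _) bj).
    have := congr1 (fun f => f w) (gtens_comp tp (gadj_bop (bop_id (tp L L))) (gadj_bop bj) (bop_id _) bj).
    by rewrite compx => ->; congr (gtens _ _ w); exact: adj_id.
  by have := congr1 (fun f => f (J3 v)) absorb_leg23; rewrite compx => ->.
rewrite /corep_eq.
have [[W hW]|no] := pselect (exists W : tp (tp L L) K -> tp (tp L L) K, amplifies N U W).
  have [bW sW] := hW; rewrite legs -cU (amplify_ok hW); apply: amplify_ok; split.
    by apply: compress_bop; first exact: bop_id.
  move=> _ /predualP[xi [eta ->]]; rewrite (compress_id_slice _ _ bW) (compress_id_slice _ _ bU).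
  exact: sW (pw_predual _ _).
have A0 : amplify N U = (fun=> 0) :> (tp (tp L L) K -> tp (tp L L) K).
  by apply: amplify_none => W hW; apply: no; exists W.
have z v : v = 0 :> tp (tp L L) K'.
  have e1 := congr1 (fun f => f (leg23 Up v)) (i13 isoU).
  have e2 := congr1 (fun f => f v) (i23 isoU).
  rewrite -[LHS]e2 compx -[leg23 Up v]e1 compx.
  have := congr1 (fun f => f v) legs; rewrite compx => ->.
  rewrite -cU A0 /compress !compx.
  have lg (H1 H2 : hilbert R) (T : H1 -> H2) : bounded_op T -> gadj T 0 = 0.
    by move=> bT; exact: lin0 (bop_lin (gadj_bop bT)).
  rewrite (lg _ _ _ (gtens_bop tp (bop_id _) bj)) (lg _ _ _ b13).
  exact: lg b23.
by apply/funext => v; rewrite [LHS]z [RHS]z.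
Qed.
End CorepCompress.

(** * The embedded algebra attached to a morphism *)

Section Morphism.
Context {R : realType} (tp : tensor_products R) (G : lcqg tp) (X : universal G).
Local Notation C := R[i].
Notation uA := (uuniv X).
Notation L := (usp uA).
Variables (S : eberlein tp) (e : ealg S) (theta : ealg S -> L -> L).
Hypotheses (ue : forall a : ealg S, cmul e a = a /\ cmul a e = a)
  (qm : qg_morphism theta).
Notation u := (euniv S).
Notation V := (eV S).

Lemma theta_sh : star_hom theta. Proof. by case: qm => -[]. Qed.
Lemma theta_mult b : multiplier uA (theta b). Proof. by case: qm => -[]. Qed.
Lemma theta_bidual b : bidual uA (theta b). Proof. by case: (theta_mult b). Qed.

(** By nondegeneracy each a is a norm limit of combinations of theta(b) a'. A vector killed by all
    theta(b) is therefore orthogonal to all a y, hence zero. *)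
Lemma theta_unit : theta e = id.
Proof.
apply: (nondeg_unit theta_sh _ ue) => x hx; apply: (@urep_nd _ _ uA) => a.
have [[_ _ nd] _ _] := qm; have /op_closure_bnd[_ h] := nd (cinv a).
apply: ip_ext => y; rewrite ip0l; apply: cn_small => r r0.
have k0 : 0 < nr x * nr y + 1 by rewrite ltr_wpDl ?mulr_ge0 ?nr_ge0.
have r2 : 0 < r / (nr x * nr y + 1) by rewrite divr_gt0.
have [Z hZ bZ] := h _ r2.
have xZ : ip x (Z y) = 0.
  move: Z hZ {bZ}; apply: lspan_ind => [|c Z1 Z2 [b [a' ->]] IH]; first by rewrite ip0r.
  by rewrite ipDr ipZr IH compx -[b]cinvK -(sh_ip theta_sh) hx ip0l mulr0 addr0.
rewrite (sh_ip (urep_sh uA)) -[urep uA _ y](subrK (Z y)) ipDr xZ addr0.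
apply: le_trans (CS _ _) _; apply: le_trans (_ : nr x * (r / (nr x * nr y + 1) * nr y) <= _).
  by rewrite ler_wpM2l ?nr_ge0.
rewrite (_ : nr x * _ = nr x * nr y * r / (nr x * nr y + 1)); last by ring.
by rewrite ler_pdivrMr// mulrC ler_wpM2l ?(ltW r0)// lerDl.
Qed.

Definition tset : set (ealg S -> C^o) := [set f | exists2 m, dual m & f = transpose theta m].
Lemma transpose_dual (m : uC0 X -> C^o) : dual m -> dual (transpose theta m : ealg S -> C^o).
Proof. by move=> dm; exact: dual_pair theta_sh (nf_predual uA dm). Qed.
Lemma tset_dual : tset `<=` dual (V := ealg S).
Proof. by move=> _ [m dm ->]; exact: transpose_dual. Qed.
Lemma tset_sep s : (forall d, tset d -> d s = 0) -> theta s = (fun=> 0).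
Proof.
move=> h; apply/funext => x; apply: ip_ext => y; rewrite ip0l.
rewrite -(nf_vec _ _ (theta_bidual s)).
apply: (h (transpose theta (fun a => ip (urep uA a x) y : C^o))).
by exists (fun a => ip (urep uA a x) y : C^o) => //; exact: dual_vec (urep_sh uA).
Qed.
Lemma tset_conv m n s : tset m -> tset n -> theta s = (fun=> 0) ->
  Defs.conv (ePhi S) m n s = 0.
Proof.
move=> [m' dm ->] [n' dn ->] h; have [_ hc _] := qm.
have := congr1 (fun f => f s) (hc _ _ dm dn) => <-; rewrite /transpose h.
have dmn : dual (Defs.conv (uDelta X) m' n' : uC0 X -> C^o) :=
  conv_dual (@uDelta_hom _ _ _ X) dm dn.
have [xi [eta ->]] := predualP (nf_predual uA dmn).
by rewrite pair_opE ?l2map0 ?ip0l//; exact: bop0.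
Qed.

Definition ampU : tp L (eH S) -> tp L (eH S) := amplify (normal_ext u theta) V.
Lemma ampU_spec : bounded_op ampU /\ forall w, predual w ->
  rslice w ampU = normal_ext u theta (rslice w V).
Proof.
apply: (amplifyE ue theta_sh (@eV_bop _ _ S) (@eV_bnd _ _ S)).
  by move=> w; exact: eV_slice.
by move=> a; exact: normal_ext_urep theta_sh.
Qed.
Lemma ampU_bop : bounded_op ampU. Proof. by case: ampU_spec. Qed.
Lemma ampU_slice w s : predual w -> rslice w V = urep u s -> rslice w ampU = theta s.
Proof.
case: ampU_spec => _ h pw_ hs; rewrite h// hs; exact: normal_ext_urep theta_sh.
Qed.

Variable p : eH S -> eH S.
Hypotheses (pp : projection_op p)
  (U1 : adj ampU \o ampU = op_tens id p) (U2 : ampU \o adj ampU = op_tens id p).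
Notation U := ampU.
Notation bU := ampU_bop.
Let P := gtens (tp := tp) (@id L) p.
Lemma p_bop : bounded_op p. Proof. by case: pp. Qed.
Lemma P_bop : bounded_op P.
Proof. by apply: gtens_bop; [exact: bop_id|exact: p_bop]. Qed.
Lemma P_adj : adj P = P.
Proof.
have [bp p2 pa] := pp; rewrite [LHS](gtens_adj tp (bop_id L) bp).
by congr gtens; [exact: adj_id|exact: pa].
Qed.
Lemma P_idem v : P (P v) = P v.
Proof.
have [bp p2 pa] := pp.
have := congr1 (fun f => f v) (gtens_comp tp (bop_id L) bp (bop_id L) bp).
by rewrite p2 compx.
Qed.
(** |Z (P v - v)|^2 = <P v - v, P (P v - v)>, and P is idempotent. *)
Lemma absorbP (Z : tp L (eH S) -> tp L (eH S)) v : bounded_op Z -> adj Z \o Z = P -> Z (P v) = Z v.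
Proof.
move=> bZ hZ; apply/eqP; rewrite -subr_eq0 -(linB (bop_lin bZ)); apply/eqP; apply: nr_eq0.
apply/eqP; rewrite -(@sqrf_eq0 R); apply/eqP; apply: complexI; rewrite -ipxx.
rewrite (adjE _ _ bZ); have := congr1 (fun f => f (P v - v)) hZ; rewrite compx => ->.
by rewrite (linB (bop_lin P_bop)) P_idem subrr ip0r.
Qed.
Lemma UP v : U (P v) = U v. Proof. by apply: absorbP; [exact: bU|exact: U1]. Qed.
Lemma PU v : P (U v) = U v.
Proof.
apply: ip_ext => w; rewrite (adjE _ _ P_bop) P_adj !(adjE _ _ bU) absorbP//.
  exact: adj_bop bU.
by rewrite (adjK bU) U2.
Qed.
Lemma U_compress : compress id p U = U.
Proof.
rewrite /compress -/P -[gadj P]/(adj P) P_adj; apply/funext => v.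
by rewrite !compx UP PU.
Qed.
(** The slices of U = (1 (x) p) U (1 (x) p); this is where the assumption [hp] of the construction
    comes from. *)
Lemma U_cut xi eta : rslice (pw xi eta) U = rslice (pw (l2map p xi) (l2map p eta)) U.
Proof.
rewrite -{1}U_compress (compress_rslice (bop_id L) p_bop bU).
by rewrite -[gadj id]/(adj id) adj_id; apply/funext.
Qed.
Lemma theta_hp xi eta s t : rslice (pw xi eta) V = urep u s ->
  rslice (pw (l2map p xi) (l2map p eta)) V = urep u t -> theta s = theta t.
Proof.
move=> hs ht; rewrite -(ampU_slice (pw_predual _ _) hs) U_cut.
exact: ampU_slice (pw_predual _ _) ht.
Qed.

Definition sub_E : eberlein tp := sub_eberlein ue theta_sh theta_unit pp tset_dual
  tset_sep tset_conv theta_hp.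
Definition sub_j : ealg sub_E -> L -> L := @imv _ _ _ _ _ ue theta_sh theta_unit.

Notation pK := (pK pp).
Notation pinc := (@pinc R tp S p pp).
Notation bpi := (pinc_bop pp).
Definition Up : tp L pK -> tp L pK := compress (tp := tp) (@id L) pinc U.

Lemma Up_bop : bounded_op Up.
Proof. by apply: compress_bop; [exact: bop_id|exact: bpi|exact: bU]. Qed.
Lemma Up_slice xi eta : rslice (pw xi eta) Up = rslice (pw (l2map pinc xi) (l2map pinc eta)) U.
Proof. exact: (compress_id_slice bpi _ _ bU). Qed.
Lemma Up_slice_ex xi eta : exists2 s,
  rslice (pw (l2map pinc xi) (l2map pinc eta)) V = urep u s & rslice (pw xi eta) Up = theta s.
Proof.
have [s _ hs] := eV_slice (pw_predual (l2map pinc xi) (l2map pinc eta)).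
exists s; first by rewrite hs.
by rewrite Up_slice; apply: ampU_slice; [exact: pw_predual|rewrite hs].
Qed.

Lemma pinc_q : pinc \o gadj pinc = p.
Proof. by apply/funext => y; exact: pinc_gadj. Qed.
Notation J := (gtens (tp := tp) (@id L) pinc).
Lemma bJ : bounded_op J. Proof. by apply: gtens_bop; [exact: bop_id|exact: bpi]. Qed.
Lemma J_proj v : J (gadj J v) = P v.
Proof.
rewrite (gtens_adj tp (bop_id L) bpi).
have := congr1 (fun f => f v) (gtens_comp tp (gadj_bop (bop_id L)) (gadj_bop bpi) (bop_id L) bpi).
by rewrite pinc_q compx => ->; congr (gtens _ _ v); exact: adj_id.
Qed.
Lemma J_iso v : gadj J (J v) = v.
Proof.
have := congr1 (fun f => f v) (gtens_iso tp (bop_id L) bpi (adj_id L) (pincK pp)).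
by rewrite compx.
Qed.
Lemma Up_adj : adj Up = gadj J \o adj U \o J.
Proof.
apply: (adj_uniq Up_bop) => x y; rewrite /Up /compress !compx -(gadjEr _ _ bJ).
by rewrite -(gadjE _ _ bJ) (adjE _ _ bU).
Qed.
(** U and its adjoint have their ranges in that of 1 (x) p, and on this subspace both of their
    products are the identity. *)
Lemma Up_unitary : unitary_op Up.
Proof.
have aU v : P (adj U v) = adj U v.
  apply: ip_ext => w; rewrite (adjE _ _ P_bop) P_adj -!(adjEr _ _ bU).
  by rewrite UP.
split; first exact: Up_bop.
- apply/funext => v; rewrite Up_adj /Up /compress !compx J_proj PU.
  have := congr1 (fun f => f (J v)) U1; rewrite compx => ->.
  by rewrite -[op_tens id p _]J_proj !J_iso.
- apply/funext => v; rewrite Up_adj /Up /compress !compx J_proj aU.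
  have := congr1 (fun f => f (J v)) U2; rewrite compx => ->.
  by rewrite -[op_tens id p _]J_proj !J_iso.
Qed.

Definition sub_q (s : ealg S) : ealg sub_E := imk ue theta_sh theta_unit s.
Lemma sub_jE s : sub_j (sub_q s) = theta s. Proof. exact: imkE. Qed.
Lemma sub_surj b : exists s, sub_q s = b.
Proof. by exists (imf b); exact: imfK. Qed.
Lemma sub_unit b : cmul (sub_q e) b = b /\ cmul b (sub_q e) = b.
Proof. exact: im_unit. Qed.
Lemma sub_jinj : injective sub_j. Proof. exact: imv_inj. Qed.
Lemma sub_jsh : star_hom sub_j. Proof. exact: imv_sh. Qed.
Lemma sub_slice xi eta : exists2 s,
  rslice (pw xi eta) (eV sub_E) = urep (euniv sub_E) (sub_q s) & rslice (pw xi eta) Up = theta s.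
Proof.
have [s h1 h2] := bV_slice_ex theta (pp := pp) xi eta; exists s.
  by apply: (etrans h2); symmetry; exact: im_rep_k.
by rewrite Up_slice; apply: ampU_slice; [exact: pw_predual|].
Qed.
Lemma sub_conv (m n : ealg sub_E -> C^o) s : dual m -> dual n ->
  Defs.conv (ePhi sub_E) m n (sub_q s) =
  Defs.conv (ePhi S) (fun a => m (sub_q a)) (fun a => n (sub_q a)) s.
Proof. exact: (bconvE tset_dual tset_sep tset_conv). Qed.
Lemma sub_range : range sub_j = range theta.
Proof.
apply/seteqP; split=> _ [b _ <-].
  by have [s <-] := sub_surj b; rewrite sub_jE; exists s.
by exists (sub_q b) => //; exact: sub_jE.
Qed.

Lemma Up_mult : idealizer (min_tens (range (urep uA)) (@compact_op R pK)) Up.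
Proof.
have h y z : exists s, rslice (vec_fun y z) Up = theta s.
  by have [s _ hs] := Up_slice_ex (single 0 y) (single 0 z); exists s; rewrite vec_pw.
apply: unitary_idealizer; first exact: Up_unitary.
- by move=> y z a; have [s ->] := h y z; have [_ /(_ a)[]] := theta_mult s.
- by move=> y z a; have [s ->] := h y z; have [_ /(_ a)[]] := theta_mult s.
Qed.

Lemma Up_corep : corep_eq U -> corep_eq Up.
Proof.
apply: (corep_compress bpi bU) => [v|]; first by rewrite pinc_q; exact: PU.
by have [_ h _] := Up_unitary.
Qed.

(** One inclusion is [range_closed]. For the other, slices of V are dense in S, and cutting their
    functionals by p turns the corresponding slices of U into slices of [Up]. *)
Lemma Up_closure : slice_closure Up = range theta.
Proof.
apply/seteqP; split=> T.
  move=> hT; apply: (range_closed ue theta_sh theta_unit).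
  move/op_closure_bnd: hT => [bT hT]; apply/op_closure_bnd; split => // r r0.
  have [Z [w pw_ ->] hZ] := hT _ r0; have [xi [eta ew]] := predualP pw_.
  exists (rslice w Up) => //; rewrite ew; have [s _ ->] := Up_slice_ex xi eta.
  by exists s.
move=> [s _ <-]; apply/op_closure_bnd; split; first exact: sh_bop theta_sh s.
move=> r r0; have rC : 0 < r%:C by rewrite ltcR.
have [w pw_ [b hb sb]] := eV_dense s rC; have [xi [eta ew]] := predualP pw_.
exists (theta b).
  exists (pw (l2map (gadj pinc) xi) (l2map (gadj pinc) eta)); first exact: pw_predual.
  rewrite Up_slice !l2_pinc -U_cut; symmetry; apply: ampU_slice; first exact: pw_predual.
  by rewrite -ew.
move=> x; rewrite -(shB theta_sh); apply: le_trans (sh_contr theta_sh _ _) _.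
by rewrite ler_wpM2r ?nr_ge0//; move: sb; rewrite nrE lecR.
Qed.

Lemma sub_nondeg : nondeg_hom sub_j.
Proof.
split=> [|b|a]; first exact: sub_jsh.
  by have [s <-] := sub_surj b; rewrite sub_jE; exact: theta_mult.
apply: clos_in; first exact: urep_bop.
apply: lspan_in; exists (sub_q e), a; rewrite sub_jE theta_unit.
by apply/funext.
Qed.

Lemma sub_transpose (m : uC0 X -> C^o) s : transpose sub_j m (sub_q s) = transpose theta m s.
Proof. by rewrite /transpose sub_jE. Qed.

(** Compared slice by slice. As [Up] is unitary, the projection required of the inclusion as a
    morphism is the identity. *)
Lemma sub_amplify : amplify (normal_ext (euniv sub_E) sub_j) (eV sub_E) = Up.
Proof.
apply: amplify_ok; split; first exact: Up_bop.
move=> _ /predualP[xi [eta ->]]; have [s h1 ->] := sub_slice xi eta.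
by rewrite h1 (normal_ext_urep _ _ sub_jsh) sub_jE.
Qed.

Lemma sub_qg : corep_eq U -> qg_morphism sub_j.
Proof.
move=> cU; split; first exact: sub_nondeg.
  move=> m n dm dn; have [_ hc _] := qm.
  have tm (m' : uC0 X -> C^o) : dual m' -> dual (transpose sub_j m' : ealg sub_E -> C^o).
    by move=> dm'; exact: dual_pair sub_jsh (nf_predual uA dm').
  apply/funext => b; have [s <-] := sub_surj b.
  by rewrite sub_transpose (sub_conv _ (tm _ dm) (tm _ dn)) hc.
rewrite sub_amplify; split; first exact: Up_corep.
have [bU' h1 h2] := Up_unitary.
exists id; split; first by split; [exact: bop_id|by []|exact: adj_id].
  by rewrite h1 op_tens_gtens gtens_id.
by rewrite h2 op_tens_gtens gtens_id.
Qed.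

Lemma sub_embedded : corep_eq U -> embedded sub_j.
Proof.
move=> cU; exists Up; split.
- by split; [exact: Up_mult|exact: Up_unitary|exact: Up_corep].
- rewrite Up_closure; split=> [_ [s _ <-]|_ _ [s _ <-] [t _ <-]|_ [s _ <-]].
  + exact: theta_mult.
  + exists (cmul s t) => //; apply/funext => x; exact: (sh_mul theta_sh).
  + by exists (cinv s) => //; exact: (sh_inv theta_sh).
- by split; [exact: sub_jsh|exact: sub_jinj].
- by rewrite Up_closure sub_range.
- split; last exact: sub_qg.
  move=> _ /predualP[xi [eta ->]]; have [s h1 h2] := sub_slice xi eta.
  by exists (sub_q s); rewrite ?h1// sub_jE h2.
Qed.
End Morphism.

Lemma morphism_range (R : realType) (tp : tensor_products R) (G : lcqg tp) (X : universal G)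
    (E S : eberlein tp) (j : ealg E -> usp (uuniv X) -> usp (uuniv X))
    (theta : ealg S -> usp (uuniv X) -> usp (uuniv X)) :
  maximal_embedded j -> unital (ealg S) -> qg_morphism theta -> range theta `<=` range j.
Proof.
move=> [_ _ max] [e ue] qm; have [_ _ [cU [p [pp U1 U2]]]] := qm.
rewrite -(sub_range ue qm pp U1 U2); apply: max.
  exact: (sub_embedded ue qm pp U1 U2 cU).
by exists (sub_q ue qm pp U1 U2 e); exact: sub_unit.
Qed.

(** * The universal property *)

Section Factor.
Context {R : realType} (tp : tensor_products R) (G : lcqg tp) (X : universal G).
Local Notation C := R[i].
Variables (E S : eberlein tp) (eE : ealg E) (e : ealg S).
Variables (j : ealg E -> usp (uuniv X) -> usp (uuniv X))
  (theta : ealg S -> usp (uuniv X) -> usp (uuniv X)) (theta0 : ealg S -> ealg E).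
Hypotheses (uE : forall a : ealg E, cmul eE a = a /\ cmul a eE = a)
  (ue : forall a : ealg S, cmul e a = a /\ cmul a e = a)
  (qj : qg_morphism j) (ij : injective j) (qm : qg_morphism theta)
  (jt : forall b, j (theta0 b) = theta b).
Notation u := (euniv E).
Notation f := (fun b => urep u (theta0 b)).

Lemma factor_sh : star_hom f.
Proof.
have hj := theta_sh qj; have ht := theta_sh qm; split=> [b|c a b|a b|a].
- exact: urep_bop.
- have -> : theta0 (c *: a + b) = c *: theta0 a + theta0 b.
    by apply: ij; rewrite jt (sh_lin ht) (sh_lin hj) !jt.
  exact: sh_lin (urep_sh u) _ _ _.
- have -> : theta0 (cmul a b) = cmul (theta0 a) (theta0 b).
    by apply: ij; apply/funext => x; rewrite jt (sh_mul ht) (sh_mul hj) !jt.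
  by apply/funext => x; exact: (sh_mul (urep_sh u)).
- have -> : theta0 (cinv a) = cinv (theta0 a).
    by apply: ij; rewrite jt (sh_inv ht) (sh_inv hj) jt.
  exact: sh_inv (urep_sh u) _.
Qed.

Lemma factor_unit : theta0 e = eE.
Proof. by apply: ij; rewrite jt (theta_unit ue qm) (theta_unit uE qj). Qed.

Lemma factor_nondeg : nondeg_hom f.
Proof.
split=> [|b|a]; first exact: factor_sh.
  split=> [|a]; first exact: urep_bidual.
  split; [exists (cmul (theta0 b) a)|exists (cmul a (theta0 b))] => //.
    by apply/funext => x; exact: (sh_mul (urep_sh u)).
  by apply/funext => x; exact: (sh_mul (urep_sh u)).
apply: clos_in; first exact: urep_bop.
apply: lspan_in; exists e, a; rewrite factor_unit (urep_unit u uE).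
by apply/funext.
Qed.

Lemma factor_dual (m : ealg E -> C^o) : dual m -> dual (fun b => m (theta0 b) : C^o).
Proof.
move=> dm; have := dual_pair factor_sh (nf_predual u dm); congr dual.
by apply/funext => b; exact: nfE.
Qed.

(** The defect [F] vanishes on functionals of the form m o j, since both j and theta transport the
    product of functionals. They separate the points of E because j is injective, so [biweak]
    applies with N reduced to 0. *)
Lemma factor_conv (m n : ealg E -> C^o) b : dual m -> dual n ->
  Defs.conv (ePhi E) m n (theta0 b) =
  Defs.conv (ePhi S) (fun a => m (theta0 a)) (fun a => n (theta0 a)) b.
Proof.
move=> dm dn; apply/eqP; rewrite -subr_eq0; apply/eqP; move: m n dm dn.
pose F (m n : ealg E -> C^o) : C := Defs.conv (ePhi E) m n (theta0 b) -
  Defs.conv (ePhi S) (fun a => m (theta0 a)) (fun a => n (theta0 a)) b.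
have th m : transpose theta m = fun b => transpose j m (theta0 b).
  by apply/funext => a; rewrite /transpose jt.
move=> m n dm dn; apply: (@biweak _ (ealg E) F (tset j) [set 0]) => //.
- move=> n' dn'; have [a1 h1] := right_module uE (theta0 b) dn'.
  have [a2 h2] := right_module ue b (factor_dual dn').
  exists (a1 - theta0 a2) => m' dm'; rewrite /F h1// h2; last exact: factor_dual.
  by rewrite (linB (bop_lin dm')).
- move=> m' dm'; have [a1 h1] := left_module uE (theta0 b) dm'.
  have [a2 h2] := left_module ue b (factor_dual dm').
  exists (a1 - theta0 a2) => n' dn'; rewrite /F h1// h2; last exact: factor_dual.
  by rewrite (linB (bop_lin dn')).
- exact: tset_dual.
- move=> a /(tset_sep qj) h; apply: ij; rewrite h.
  by apply/funext => x; rewrite (sh0 (theta_sh qj)).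
- move=> _ _ [m' dm' ->] [n' dn' ->]; rewrite /F.
  have [_ hj _] := qj; have [_ ht _] := qm.
  rewrite -(congr1 (fun g => g (theta0 b)) (hj _ _ dm' dn')).
  rewrite -!th -(congr1 (fun g => g b) (ht _ _ dm' dn')) th subrr//.
- by move=> a ->; rewrite (lin0 (bop_lin dm)).
- by move=> a ->; rewrite (lin0 (bop_lin dn)).
Qed.

Lemma factor_morphism : eberlein_morphism f.
Proof.
split; first exact: factor_nondeg.
move=> m n dm dn; apply/funext => b.
have tr (m' : ealg E -> C^o) : dual m' -> transpose f m' = fun a => m' (theta0 a).
  by move=> dm'; apply/funext => a; exact: nfE.
rewrite !tr//; first exact: factor_conv.
exact: (@conv_dual _ _ _ _ _ (@ePhi_hom _ _ E) m n dm dn).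
Qed.
End Factor.

Theorem theorem5p2 (R : realType) (tp : tensor_products R) (G : lcqg tp)
    (X : universal G) (E : eberlein tp)
    (j : ealg E -> usp (uuniv X) -> usp (uuniv X)) :
  maximal_embedded j ->
  forall (S : eberlein tp), unital (ealg S) ->
  forall theta : ealg S -> usp (uuniv X) -> usp (uuniv X),
  qg_morphism theta ->
  exists! theta0 : ealg S -> ealg E,
    eberlein_morphism (fun b => urep (euniv E) (theta0 b)) /\
    forall b, j (theta0 b) = theta b.
Proof.
move=> mj S uS theta qm; have rt := morphism_range mj uS qm.
have [[U [_ _ [_ ij] _ [_ qj]]] [eE uE] _] := mj; have [e ue] := uS.
have /choice[theta0 jt] (b : ealg S) : exists a, j a = theta b.
  by have [|a _ ha] := rt (theta b); [exists b|exists a].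
exists theta0; split; first by split=> //; exact: (factor_morphism uE ue qj ij qm jt).
by move=> t [_ ht]; apply/funext => b; apply: ij; rewrite jt ht.
Qed.
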